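(* Let $k \geq 2$ be an integer. Then there exists a weight $k$ newform with complex multiplication $$f_k(z) = \sum_{n=1}^\infty \gamma_k(n) q^n \in \begin{cases} S_k(\Gamma_0(32)), & k \text{ even},\\ S_k(\Gamma_0(4), (\tfrac{-4}{\cdot})), & k \equiv 1 \pmod 4,\\ S_k(\Gamma_0(16), (\tfrac{-4}{\cdot})), & k \equiv 3 \pmod 4,\end{cases}$$ such that for every odd prime $p$, $$\gamma_k(p) = \begin{cases} (-1)^{\frac{(x+y-1)(k-1)}{2}}\left[(x+iy)^{k-1} + (x-iy)^{k-1}\right], & p \equiv 1 \pmod 4,\ p = x^2+y^2,\ x \text{ odd},\\ 0, & p \equiv 3 \pmod 4.\end{cases}$$
   Context: $q = e^{2\pi i z}$. $(\tfrac{-4}{\cdot})$ is the Kronecker symbol (the nontrivial character modulo $4$). A newform $f = \sum \gamma(n)q^n$ has complex multiplication (CM) by a nontrivial real Dirichlet character $\psi$ (or its quadratic field) if $\gamma(p) = \psi(p)\gamma(p)$ for all primes $p$ in a set of density one. *)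

(* Defs.v *)
From Stdlib Require Import Reals ZArith Znumtheory ClassicalEpsilon.
From Coquelicot Require Import Coquelicot.
Open Scope R_scope.

Definition ZtoC (n : Z) : C := RtoC (IZR n).

Definition qe (z : C) : C :=
  Cmult (RtoC (exp (- 2 * PI * Im z)))
        (cos (2 * PI * Re z), sin (2 * PI * Re z)).

Definition inH (z : C) : Prop := 0 < Im z.

Definition mob (a b c d : Z) (z : C) : C :=
  Cdiv (Cplus (Cmult (ZtoC a) z) (ZtoC b)) (Cplus (Cmult (ZtoC c) z) (ZtoC d)).

Definition dirichlet_char (N : Z) (chi : Z -> C) : Prop :=
  (0 < N)%Z /\
  (forall n, chi (n + N)%Z = chi n) /\
  (forall m n, chi (m * n)%Z = Cmult (chi m) (chi n)) /\
  chi 1%Z = RtoC 1 /\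
  (forall n, chi n = RtoC 0 <-> Z.gcd n N <> 1%Z).

Definition triv_char (N : Z) (n : Z) : C :=
  if Z.eqb (Z.gcd n N) 1 then RtoC 1 else RtoC 0.

Definition chi_m4 (n : Z) : C :=
  if Z.odd n then (if Z.eqb (Z.modulo n 4) 1 then RtoC 1 else RtoC (-1))
  else RtoC 0.

Definition has_qexp (f : C -> C) (a : nat -> C) : Prop :=
  forall z, inH z -> is_series (fun n => Cmult (a n) (Cpow (qe z) n)) (f z).

(** Cusp form of weight k on Gamma_0(N) with character chi, with q-expansion a:
    - f is given on H by a q-expansion convergent on H (hence holomorphic on H);
    - modularity: f(gamma z) = chi(d) (cz+d)^k f(z) for gamma in Gamma_0(N);
    - cuspidality: for every gamma in SL_2(Z), (f|_k gamma)(x+iy) -> 0 as y -> oo,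
      uniformly in x (vanishing at every cusp). *)
Definition cuspform (N : Z) (k : nat) (chi : Z -> C) (f : C -> C) (a : nat -> C)
  : Prop :=
  dirichlet_char N chi /\
  has_qexp f a /\
  (forall a0 b0 c0 d0 : Z, (a0 * d0 - b0 * c0 = 1)%Z -> (N | c0)%Z ->
     forall z, inH z ->
       f (mob a0 b0 c0 d0 z) =
       Cmult (chi d0) (Cmult (Cpow (Cplus (Cmult (ZtoC c0) z) (ZtoC d0)) k) (f z))) /\
  (forall a0 b0 c0 d0 : Z, (a0 * d0 - b0 * c0 = 1)%Z ->
     forall eps, 0 < eps -> exists Y, forall x y, Y < y ->
       Cmod (Cmult (Cinv (Cpow (Cplus (Cmult (ZtoC c0) (x, y)) (ZtoC d0)) k))
                   (f (mob a0 b0 c0 d0 (x, y)))) < eps).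

(** Integral over the standard fundamental domain
    F = { x+iy : |x| <= 1/2, x^2+y^2 >= 1 } of SL_2(Z), w.r.t. dx dy / y^2,
    of a complex-valued function (computed componentwise, as iterated integrals). *)
Definition intF_R (g : R -> R -> R) : R :=
  RInt (fun x => RInt_gen (fun y => g x y / (y * y))
                          (at_point (sqrt (1 - x * x))) (Rbar_locally p_infty))
       (- / 2) (/ 2).

(** A list of right coset representatives of Gamma_0(N) in SL_2(Z):
    each sigma in SL_2(Z) lies in Gamma_0(N) gamma_i for exactly one i
    (sigma gamma_i^{-1} in Gamma_0(N) iff N | r d_i - s c_i for sigma = (p q; r s)). *)
Definition coset_reps (N : Z) (L : list (Z * Z * Z * Z)) : Prop :=
  (forall g, List.In g L -> let '(a0, b0, c0, d0) := g in (a0 * d0 - b0 * c0 = 1)%Z) /\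
  forall p q r s : Z, (p * s - q * r = 1)%Z ->
    exists i, (i < length L)%nat /\
      (forall j, (j < length L)%nat ->
         (let '(_, _, c0, d0) := List.nth j L (0, 0, 0, 0)%Z in (N | r * d0 - s * c0)%Z)
         <-> j = i).

(** Petersson inner product <f, h> vanishes (up to the positive normalising
    constant 1/[SL_2(Z):Gamma_0(N)]):
    <f,h> = sum_i int_F f(g_i z) conj(h(g_i z)) Im(g_i z)^k dx dy / y^2. *)
Definition petersson_integrand (k : nat) (f h : C -> C) (z : C) : C :=
  Cmult (Cmult (f z) (Cconj (h z))) (RtoC (Im z ^ k)).

Definition petersson_zero (N : Z) (k : nat) (f h : C -> C) : Prop :=
  exists L, coset_reps N L /\
    let G := fun x y =>
      List.fold_right Cplus (RtoC 0)
        (List.map (fun g => let '(a0, b0, c0, d0) := g in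
                    petersson_integrand k f h (mob a0 b0 c0 d0 (x, y))) L) in
    intF_R (fun x y => Re (G x y)) = 0 /\ intF_R (fun x y => Im (G x y)) = 0.

Definition in_newspace (N : Z) (k : nat) (chi : Z -> C) (f : C -> C) : Prop :=
  forall (M d : Z) (chi' : Z -> C) (g : C -> C) (b : nat -> C),
    (0 < M)%Z -> (M < N)%Z -> (0 < d)%Z -> (d * M | N)%Z ->
    dirichlet_char M chi' ->
    (forall n, Z.gcd n N = 1%Z -> chi' n = chi n) ->
    cuspform M k chi' g b ->
    petersson_zero N k f (fun z => g (Cmult (ZtoC d) z)).

(** Hecke eigenform for all T_p (p not dividing N) and U_p (p | N):
    a(pn) + chi(p) p^{k-1} a(n/p) = lambda_p a(n) for all n >= 1. *)
Definition hecke_eigen (k : nat) (chi : Z -> C) (a : nat -> C) : Prop :=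
  forall p : nat, prime (Z.of_nat p) ->
    exists lam : C, forall n : nat, (1 <= n)%nat ->
      Cplus (a (p * n)%nat)
            (Cmult (Cmult (chi (Z.of_nat p)) (RtoC (INR p ^ (k - 1))))
                   (if Nat.eqb (n mod p) 0 then a (n / p)%nat else RtoC 0))
      = Cmult lam (a n).

Definition newform (N : Z) (k : nat) (chi : Z -> C) (f : C -> C) (a : nat -> C) : Prop :=
  cuspform N k chi f a /\ a 1%nat = RtoC 1 /\ hecke_eigen k chi a /\
  in_newspace N k chi f.

Definition ind (P : Prop) : R :=
  if excluded_middle_informative P then 1 else 0.

Fixpoint count_primes (P : nat -> Prop) (x : nat) : R :=
  match x with
  | O => 0
  | S m => count_primes P m + ind (prime (Z.of_nat (S m)) /\ P (S m))
  end.

Definition density_one (P : nat -> Prop) : Prop :=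
  is_lim_seq (fun x => count_primes P x / count_primes (fun _ => True) x) 1.

Definition has_CM (a : nat -> C) : Prop :=
  exists (m : Z) (psi : Z -> R),
    dirichlet_char m (fun n => RtoC (psi n)) /\
    (exists n, Z.gcd n m = 1%Z /\ psi n <> 1) /\
    density_one (fun p => a p = Cmult (RtoC (psi (Z.of_nat p))) (a p)).

Definition level_k (k : nat) : Z :=
  if Nat.even k then 32%Z else if Nat.eqb (k mod 4) 1 then 4%Z else 16%Z.
Definition char_k (k : nat) : Z -> C :=
  if Nat.even k then triv_char 32 else chi_m4.

(* Main.v *)
Require Import Defs.
From Stdlib Require Import Reals ZArith Znumtheory Lra Lia List Permutation Bool
  ClassicalEpsilon FunctionalExtensionality.
From Coquelicot Require Import Coquelicot.
Import ListNotations.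
Open Scope R_scope.

(** Write k - 1 = kappa.  There is a Hecke character, unramified outside 2, Phi(alpha) = psi(alpha) alpha^kappa
    on Z[i] that is invariant under units, and f = 1/4 sum_alpha Phi(alpha) q^(N alpha); multiplicativity of Phi
    gives the Hecke relations and the formula for gamma(p).

    Averaging over units, f is a theta series c Th[0, beta](2z) of Z^2 with harmonic factor (x + iy)^kappa and
    a rational characteristic beta.  The one-dimensional Jacobi inversion formula with a complex parameter,
    differentiated kappa times in the direction (1, i), gives the transformation of Th under S; the action of
    Gamma_0(4) on characteristics then yields modularity at level N, and also f | g = -f for g in
    Gamma_0(N/2) outside Gamma_0(N) when N is 16 or 32.

    For newness, let h be the Petersson integrand of f and of an oldform coming from level M via z -> dz.
    At N = 4 no character of smaller level is compatible.  If dM divides N/2, the coset representatives cancel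
    in pairs.  If dM = N, then d is even and h(z + 1/2) = -h(z); with R(z) = sum_j h(z / (2jz + 1)) the sum over
    cosets is R(z) + R(-1/z) + R(-1/(z+1)), while R(z/2) + R((z+1)/2) + R(-1/(2z)) = 0, and the
    integral vanishes because the surviving compact region is antisymmetric under z -> -1/(2z).  The finite
    combinatorics of cosets is settled by computation. *)

(** * Complex exponential *)

(** The obstacle is newness: an oldform is known only through its q-expansion, its transformation
    law and its vanishing at the cusps, and the Petersson product is an iterated integral over one
    fixed domain. No unfolding is used, only symmetries of h. In the case dM = N, R is the trace of
    h from Gamma_0(N) to Gamma_0(2), and the two three-term sums are the traces to level 1 of R and
    of its transform under z -> -1/(2z). This involution normalises Gamma_0(2), so both traces
    should have the same integral; that equality is the one analytic fact required, and elementary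
    substitutions prove it.

    The complex parameter in the inversion formula serves to create the factor (x + iy)^kappa one
    power at a time: (1, i) is isotropic, so differentiation along it leaves no lower-order terms.
    As two one-dimensional formulas are multiplied, only the square i/z of the Gaussian constant
    enters, and no branch of a square root is ever chosen. *)

Definition Cexp (w : C) : C := (exp (Re w) * cos (Im w), exp (Re w) * sin (Im w)).

Lemma C_eq (a b : C) : Re a = Re b -> Im a = Im b -> a = b.
Proof. destruct a, b; simpl; intros; subst; reflexivity. Qed.

Lemma Cexp_plus a b : Cexp (a + b) = (Cexp a * Cexp b)%C.
Proof.
  apply C_eq; destruct a as [a1 a2], b as [b1 b2]; unfold Cexp; simpl;
    rewrite exp_plus, ?cos_plus, ?sin_plus; ring.
Qed.

Lemma Cexp_0 : Cexp 0 = 1.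
Proof. apply C_eq; unfold Cexp; simpl; rewrite exp_0, ?cos_0, ?sin_0; ring. Qed.

Lemma Cmod_Cexp w : Cmod (Cexp w) = exp (Re w).
Proof.
  unfold Cexp, Cmod; simpl.
  replace (_ + _) with (Rsqr (exp (Re w))).
  - apply sqrt_Rsqr, Rlt_le, exp_pos.
  - pose proof (sin2_cos2 (Im w)) as H; unfold Rsqr in *.
    transitivity (exp (Re w) * exp (Re w) * (sin (Im w) * sin (Im w) + cos (Im w) * cos (Im w)));
      [rewrite H|]; ring.
Qed.

Lemma Cexp_pow w n : (Cexp w ^ n)%C = Cexp (RtoC (INR n) * w).
Proof.
  induction n as [|n IH]; [simpl|].
  - rewrite <- Cexp_0; f_equal; ring.
  - rewrite Cpow_S, IH, <- Cexp_plus, S_INR, RtoC_plus; f_equal; ring.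
Qed.

(** Two mean value theorems in place of Taylor's formula, at the cost of the factor 1/2. *)
Lemma second_order_bound (g g' g'' : R -> R) M :
  (forall s, is_derive g s (g' s)) -> (forall s, is_derive g' s (g'' s)) ->
  (forall s, 0 <= s <= 1 -> Rabs (g'' s) <= M) -> Rabs (g 1 - g 0 - g' 0) <= M.
Proof.
  intros D1 D2 B.
  assert (C1 : forall s, continuity_pt g s)
    by (intros s; apply derivable_continuous_pt; exists (g' s); apply is_derive_Reals, D1).
  assert (C2 : forall s, continuity_pt g' s)
    by (intros s; apply derivable_continuous_pt; exists (g'' s); apply is_derive_Reals, D2).
  destruct (MVT_gen g 0 1 g') as [c [Hc E]]; auto.
  destruct (MVT_gen g' 0 c g'') as [d [Hd E2]]; auto.
  rewrite Rmin_left, Rmax_right in Hc by lra.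
  rewrite Rmin_left, Rmax_right in Hd by lra.
  replace (g 1 - g 0 - g' 0) with (g'' d * c) by lra.
  rewrite Rabs_mult, (Rabs_pos_eq c) by lra.
  pose proof (B d ltac:(lra)); pose proof (Rabs_pos (g'' d)); nra.
Qed.

Lemma Cmod_le_sum (z : C) : Cmod z <= Rabs (Re z) + Rabs (Im z).
Proof.
  unfold Cmod; destruct z as [a b]; simpl.
  rewrite <- (sqrt_Rsqr (Rabs a + Rabs b)) by (pose proof (Rabs_pos a); pose proof (Rabs_pos b); lra).
  apply sqrt_le_1_alt; unfold Rsqr.
  pose proof (Rabs_pos a); pose proof (Rabs_pos b).
  replace (a * (a * 1)) with (Rabs a * Rabs a) by (rewrite <- Rabs_mult, Rabs_pos_eq; [ring|nra]).
  replace (b * (b * 1)) with (Rabs b * Rabs b) by (rewrite <- Rabs_mult, Rabs_pos_eq; [ring|nra]).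
  nra.
Qed.

Lemma im_le_Cmod (c : C) : Rabs (Im c) <= Cmod c.
Proof. eapply Rle_trans; [apply Rmax_r | apply Rmax_Cmod]. Qed.

Lemma Cmod_sqr_eq (z : C) : Cmod z * Cmod z = Re z * Re z + Im z * Im z.
Proof. pose proof (Cmod2_alt z) as H; simpl in H; lra. Qed.

Lemma rotation_bound X Y p : Rabs (X * cos p + Y * sin p) <= sqrt (X * X + Y * Y).
Proof.
  rewrite <- sqrt_Rsqr_abs; apply sqrt_le_1_alt.
  pose proof (sin2_cos2 p) as H; unfold Rsqr in *.
  replace (X * X + Y * Y) with ((X * X + Y * Y) * (sin p * sin p + cos p * cos p)) by (rewrite H; ring).
  pose proof (Rle_0_sqr (X * sin p - Y * cos p)) as K; unfold Rsqr in K; nra.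
Qed.

Lemma exp_mono x y : x <= y -> exp x <= exp y.
Proof. intros [h| ->]; [apply Rlt_le, exp_increasing, h|lra]. Qed.

(** Along the segment s -> s w the second derivatives of the real and imaginary parts are rotations
    of w^2 times exp(s Re w), each at most |w|^2 exp |w|; the factor 2 adds the two parts. *)
Lemma Cexp_taylor w : Cmod (Cexp w - 1 - w) <= 2 * (Cmod w ^ 2 * exp (Cmod w)).
Proof.
  destruct w as [p q]; set (W := Cmod (p, q)).
  assert (HW : W * W = p * p + q * q) by apply (Cmod_sqr_eq (p, q)).
  assert (W0 : 0 <= W) by apply Cmod_ge_0.
  assert (Hp : Rabs p <= W) by apply (re_le_Cmod (p, q)).
  assert (E : forall X Y s, 0 <= s <= 1 -> X * X + Y * Y = (p * p + q * q) * (p * p + q * q) ->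
      Rabs (exp (s * p) * (X * cos (s * q) + Y * sin (s * q))) <= W ^ 2 * exp W).
  { intros X Y s Hs HX.
    rewrite Rabs_mult, Rabs_pos_eq by (apply Rlt_le, exp_pos).
    rewrite Rmult_comm; apply Rmult_le_compat.
    - apply Rabs_pos.
    - apply Rlt_le, exp_pos.
    - eapply Rle_trans; [apply rotation_bound|].
      rewrite HX, <- HW. change (sqrt (Rsqr (W * W)) <= W ^ 2); rewrite sqrt_Rsqr; nra.
    - apply exp_mono. pose proof (Rle_abs p). pose proof (Rabs_pos p). nra. }
  eapply Rle_trans; [apply Cmod_le_sum|].
  replace (2 * _) with (W ^ 2 * exp W + W ^ 2 * exp W) by (fold W; ring).
  apply Rplus_le_compat.
  - replace (Re _) with (exp (1 * p) * cos (1 * q) - exp (0 * p) * cos (0 * q)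
         - (exp (0 * p) * (p * cos (0 * q) - q * sin (0 * q)))).
    2:{ unfold Cexp; simpl; rewrite !Rmult_0_l, !Rmult_1_l, exp_0, cos_0, sin_0; ring. }
    apply (second_order_bound (fun s => exp (s * p) * cos (s * q))
       (fun s => exp (s * p) * (p * cos (s * q) - q * sin (s * q)))
       (fun s => exp (s * p) * ((p * p - q * q) * cos (s * q) + (- (2 * p * q)) * sin (s * q)))).
    + intros s; auto_derive; [easy|ring].
    + intros s; auto_derive; [easy|ring].
    + intros s Hs; apply E; [easy|ring].
  - replace (Im _) with (exp (1 * p) * sin (1 * q) - exp (0 * p) * sin (0 * q)
         - (exp (0 * p) * (p * sin (0 * q) + q * cos (0 * q)))).
    2:{ unfold Cexp; simpl; rewrite !Rmult_0_l, !Rmult_1_l, exp_0, cos_0, sin_0; ring. }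
    apply (second_order_bound (fun s => exp (s * p) * sin (s * q))
       (fun s => exp (s * p) * (p * sin (s * q) + q * cos (s * q)))
       (fun s => exp (s * p) * ((2 * p * q) * cos (s * q) + (p * p - q * q) * sin (s * q)))).
    + intros s; auto_derive; [easy|ring].
    + intros s; auto_derive; [easy|ring].
    + intros s Hs; apply E; [easy|ring].
Qed.

Definition ex1 (x : R) : C := Cexp (RtoC (2 * PI * x) * Ci).

Lemma ex1_plus x y : ex1 (x + y) = (ex1 x * ex1 y)%C.
Proof. unfold ex1; rewrite <- Cexp_plus, <- Cmult_plus_distr_r, <- RtoC_plus; do 3 f_equal; ring. Qed.

Lemma ex1_cos x : ex1 x = (cos (2 * PI * x), sin (2 * PI * x)).
Proof.
  apply C_eq; unfold ex1, Cexp; simpl;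
    replace (2 * PI * x * 0 - 0 * 1) with 0 by ring;
    replace (2 * PI * x * 1 + 0 * 0) with (2 * PI * x) by ring; rewrite exp_0; ring.
Qed.

Lemma ex1_0 : ex1 0 = 1.
Proof. rewrite ex1_cos, Rmult_0_r, cos_0, sin_0; reflexivity. Qed.

Lemma ex1_Z n : ex1 (IZR n) = 1.
Proof.
  assert (H1 : ex1 1 = 1) by (rewrite ex1_cos, Rmult_1_r, cos_2PI, sin_2PI; reflexivity).
  assert (Hn : forall n : nat, ex1 (INR n) = 1).
  { intros m; induction m as [|m IH]; [apply ex1_0|].
    rewrite S_INR, ex1_plus, IH, H1; ring. }
  destruct (Z_le_dec 0 n) as [h|h].
  - rewrite <- (Z2Nat.id n) by easy; rewrite <- INR_IZR_INZ; apply Hn.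
  - pose proof (Hn (Z.to_nat (- n))) as K.
    rewrite INR_IZR_INZ, Z2Nat.id, opp_IZR in K by lia.
    assert (E : (ex1 (IZR n) * ex1 (- IZR n) = 1)%C)
      by (rewrite <- ex1_plus, Rplus_opp_r; apply ex1_0).
    rewrite K in E; rewrite <- E; ring.
Qed.

Lemma Cmod_ex1 x : Cmod (ex1 x) = 1.
Proof. unfold ex1; rewrite Cmod_Cexp; simpl; rewrite <- exp_0; f_equal; ring. Qed.

Lemma ex1_period x n : ex1 (x + IZR n) = ex1 x.
Proof. rewrite ex1_plus, ex1_Z; ring. Qed.

(** * Unordered sums *)

(** Classical decidable equality makes [nodup] available over every index type. *)
Definition cdec {I : Type} (x y : I) : {x = y} + {x <> y} := excluded_middle_informative (x = y).

Definition lsum {I} (f : I -> C) (A : list I) : C := fold_right (fun i s => (f i + s)%C) (RtoC 0) A.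
Definition rsum {I} (f : I -> R) (A : list I) : R := fold_right (fun i s => f i + s) 0 A.

(** Convergence along the finite subsets of an arbitrary index type, a duplicate-free list standing
    for a set. Reindexing by bijections and products of sums then require no rearrangement
    theorem. *)
Definition usum {I} (f : I -> C) (l : C) : Prop :=
  forall eps, 0 < eps -> exists A0 : list I, forall A, NoDup A -> incl A0 A -> Cmod (lsum f A - l) < eps.

(** Summability of a majorant, expressed by a bound on its finite sums so that explicit constants
    suffice. *)
Definition bounded_sum {I} (g : I -> R) (B : R) : Prop := forall A, NoDup A -> rsum g A <= B.

Section Sums.
Context {I : Type}.
Implicit Types (f : I -> C) (g : I -> R) (A : list I).

Lemma lsum_app f A B : lsum f (A ++ B) = (lsum f A + lsum f B)%C.
Proof. induction A as [|a A IH]; simpl; [ring|rewrite IH; ring]. Qed.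

Lemma rsum_app g A B : rsum g (A ++ B) = rsum g A + rsum g B.
Proof. induction A as [|a A IH]; simpl; [ring|rewrite IH; ring]. Qed.

Lemma lsum_perm f A B : Permutation A B -> lsum f A = lsum f B.
Proof. induction 1; simpl; try congruence; ring. Qed.

Lemma lsum_ext_in f f' A : (forall i, In i A -> f i = f' i) -> lsum f A = lsum f' A.
Proof. induction A; simpl; intros H; auto; rewrite H, IHA; auto. Qed.

Lemma lsum_plus f f' A : lsum (fun i => f i + f' i)%C A = (lsum f A + lsum f' A)%C.
Proof. induction A as [|a A IH]; simpl; [ring|rewrite IH; ring]. Qed.

Lemma lsum_scal c f A : lsum (fun i => c * f i)%C A = (c * lsum f A)%C.
Proof. induction A as [|a A IH]; simpl; [ring|rewrite IH; ring]. Qed.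

Lemma rsum_plus g g' A : rsum (fun i => g i + g' i) A = rsum g A + rsum g' A.
Proof. induction A as [|a A IH]; simpl; [ring|rewrite IH; ring]. Qed.

Lemma rsum_scal c g A : rsum (fun i => c * g i) A = c * rsum g A.
Proof. induction A as [|a A IH]; simpl; [ring|rewrite IH; ring]. Qed.

Lemma rsum_le g g' A : (forall i, g i <= g' i) -> rsum g A <= rsum g' A.
Proof. intros H; induction A as [|a A IH]; simpl; [lra|pose proof (H a); lra]. Qed.

Lemma rsum_nonneg g A : (forall i, 0 <= g i) -> 0 <= rsum g A.
Proof. intros H; induction A as [|a A IH]; simpl; [lra|pose proof (H a); lra]. Qed.

Lemma Cmod_lsum f g A : (forall i, Cmod (f i) <= g i) -> Cmod (lsum f A) <= rsum g A.
Proof.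
  intros H; induction A as [|a A IH]; simpl; [rewrite Cmod_0; lra|].
  eapply Rle_trans; [apply Cmod_triangle|]; pose proof (H a); lra.
Qed.

Lemma rsum_incl g A B : (forall i, 0 <= g i) -> NoDup A -> incl A B -> rsum g A <= rsum g B.
Proof.
  intros Hg HA; revert B; induction HA as [|a A Ha HA IH]; intros B HB; simpl.
  - apply rsum_nonneg, Hg.
  - destruct (in_split a B) as [l1 [l2 E]]; [apply HB; now left|]; subst B.
    assert (K : rsum g A <= rsum g (l1 ++ l2)).
    { apply IH; intros x Hx.
      assert (x <> a) by (intros ->; contradiction).
      specialize (HB x (or_intror Hx)); rewrite in_app_iff in *; simpl in HB.
      destruct HB as [?|[?|?]]; auto; congruence. }
    rewrite rsum_app in *; simpl; lra.
Qed.

Lemma usum_unique f l l' : usum f l -> usum f l' -> l = l'.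
Proof.
  intros H H'.
  destruct (Req_dec (Cmod (l - l')) 0) as [E|E].
  - apply Cmod_eq_0 in E.
    replace l with (l - l' + l')%C by ring; rewrite E; ring.
  - assert (P : 0 < Cmod (l - l') / 2) by (pose proof (Cmod_ge_0 (l - l')); lra).
    destruct (H _ P) as [A0 H0]; destruct (H' _ P) as [A1 H1].
    set (A := nodup cdec (A0 ++ A1)).
    assert (N : NoDup A) by apply NoDup_nodup.
    specialize (H0 A N); specialize (H1 A N).
    assert (Cmod (lsum f A - l) < Cmod (l - l') / 2)
      by (apply H0; intros x Hx; apply nodup_In, in_or_app; auto).
    assert (Cmod (lsum f A - l') < Cmod (l - l') / 2)
      by (apply H1; intros x Hx; apply nodup_In, in_or_app; auto).
    assert (Cmod (l - l') <= Cmod (lsum f A - l') + Cmod (lsum f A - l)).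
    { replace (l - l')%C with ((lsum f A - l') + - (lsum f A - l))%C by ring.
      eapply Rle_trans; [apply Cmod_triangle|]; rewrite Cmod_opp; lra. }
    lra.
Qed.

Lemma usum_ext f f' l : (forall i, f i = f' i) -> usum f l -> usum f' l.
Proof.
  intros E H eps He; destruct (H eps He) as [A0 K]; exists A0; intros A N Ha.
  rewrite <- (lsum_ext_in f f') by auto; auto.
Qed.

Lemma usum_plus f f' l l' : usum f l -> usum f' l' -> usum (fun i => f i + f' i)%C (l + l')%C.
Proof.
  intros H H' eps He.
  destruct (H (eps / 2)) as [A0 K0]; [lra|]; destruct (H' (eps / 2)) as [A1 K1]; [lra|].
  exists (A0 ++ A1); intros A N Ha.
  rewrite lsum_plus.
  replace (_ - _)%C with ((lsum f A - l) + (lsum f' A - l'))%C by ring.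
  eapply Rle_lt_trans; [apply Cmod_triangle|].
  specialize (K0 A N ltac:(intros x Hx; apply Ha, in_or_app; auto)).
  specialize (K1 A N ltac:(intros x Hx; apply Ha, in_or_app; auto)); lra.
Qed.

Lemma usum_scal c f l : usum f l -> usum (fun i => c * f i)%C (c * l)%C.
Proof.
  intros H eps He.
  assert (Hc : 0 < Cmod c + 1) by (pose proof (Cmod_ge_0 c); lra).
  destruct (H (eps / (Cmod c + 1))) as [A0 K]; [apply Rdiv_lt_0_compat; lra|].
  exists A0; intros A N Ha; specialize (K A N Ha).
  rewrite lsum_scal; replace (_ - _)%C with (c * (lsum f A - l))%C by ring.
  rewrite Cmod_mult.
  apply Rle_lt_trans with ((Cmod c) * (eps / (Cmod c + 1))).
  - apply Rmult_le_compat_l; [apply Cmod_ge_0|lra].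
  - replace eps with ((Cmod c + 1) * (eps / (Cmod c + 1))) at 2 by (field; lra).
    apply Rmult_lt_compat_r; [apply Rdiv_lt_0_compat; lra|lra].
Qed.

Lemma usum_bound f g l B :
  usum f l -> (forall i, Cmod (f i) <= g i) -> bounded_sum g B -> Cmod l <= B.
Proof.
  intros H Hg HB; apply Rnot_lt_le; intros K.
  destruct (H (Cmod l - B)) as [A0 K0]; [lra|].
  specialize (K0 (nodup cdec A0) (NoDup_nodup _ _) ltac:(intros x Hx; apply nodup_In; auto)).
  pose proof (HB (nodup cdec A0) (NoDup_nodup _ _)).
  pose proof (Cmod_lsum f g (nodup cdec A0) Hg).
  assert (Cmod l <= Cmod (lsum f (nodup cdec A0)) + Cmod (lsum f (nodup cdec A0) - l)).
  { replace l with (lsum f (nodup cdec A0) + - (lsum f (nodup cdec A0) - l))%C at 1 by ring.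
    eapply Rle_trans; [apply Cmod_triangle|]; rewrite Cmod_opp; lra. }
  lra.
Qed.

Lemma rsum_sup g B : (forall i, 0 <= g i) -> bounded_sum g B ->
  exists L, forall eps, 0 < eps -> exists A0, forall A, NoDup A -> incl A0 A -> Rabs (rsum g A - L) < eps.
Proof.
  intros Hg HB.
  destruct (completeness (fun s => exists A, NoDup A /\ s = rsum g A)) as [L [HL1 HL2]].
  - exists B; intros s [A [N ->]]; apply HB, N.
  - exists 0, []; split; [constructor|reflexivity].
  - exists L; intros eps He.
    destruct (excluded_middle_informative (exists A, NoDup A /\ L - eps < rsum g A)) as [[A0 [N0 K]]|K].
    + exists A0; intros A N HA.
      pose proof (rsum_incl g A0 A Hg N0 HA).
      assert (rsum g A <= L) by (apply HL1; exists A; auto).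
      apply Rabs_def1; lra.
    + assert (L <= L - eps); [|lra].
      apply HL2; intros s [A [N ->]]; apply Rnot_lt_le; intros Hs; apply K; exists A; auto.
Qed.

(** Write [h] as the difference of the nonnegative families [h + g] and [g], each of which converges
    to its supremum. *)
Lemma usum_real_ex (h g : I -> R) B : (forall i, Rabs (h i) <= g i) -> bounded_sum g B ->
  exists L, forall eps, 0 < eps -> exists A0, forall A, NoDup A -> incl A0 A -> Rabs (rsum h A - L) < eps.
Proof.
  intros Hh HB.
  assert (Hg : forall i, 0 <= g i) by (intros i; pose proof (Rabs_pos (h i)); pose proof (Hh i); lra).
  destruct (rsum_sup g B Hg HB) as [L1 H1].
  destruct (rsum_sup (fun i => h i + g i) (2 * B)) as [L2 H2].
  - intros i; pose proof (Hh i) as K; apply Rabs_le_between in K; lra.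
  - intros A N; apply Rle_trans with (rsum (fun i => 2 * g i) A).
    + apply rsum_le; intros i; pose proof (Hh i) as K; apply Rabs_le_between in K; lra.
    + rewrite rsum_scal; pose proof (HB A N); lra.
  - exists (L2 - L1); intros eps He.
    destruct (H1 (eps / 2)) as [A1 K1]; [lra|]; destruct (H2 (eps / 2)) as [A2 K2]; [lra|].
    exists (A1 ++ A2); intros A N HA.
    specialize (K1 A N ltac:(intros x Hx; apply HA, in_or_app; auto)).
    specialize (K2 A N ltac:(intros x Hx; apply HA, in_or_app; auto)).
    rewrite rsum_plus in K2.
    apply Rabs_def2 in K1; apply Rabs_def2 in K2; apply Rabs_def1; lra.
Qed.

Lemma lsum_parts f A : lsum f A = (rsum (fun i => Re (f i)) A, rsum (fun i => Im (f i)) A).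
Proof. induction A as [|a A IH]; simpl; [reflexivity|]; rewrite IH; apply C_eq; reflexivity. Qed.

Lemma usum_ex f g B : (forall i, Cmod (f i) <= g i) -> bounded_sum g B -> exists l, usum f l.
Proof.
  intros Hf HB.
  destruct (usum_real_ex (fun i => Re (f i)) g B) as [L1 H1]; auto.
  { intros i; eapply Rle_trans; [apply re_le_Cmod|auto]. }
  destruct (usum_real_ex (fun i => Im (f i)) g B) as [L2 H2]; auto.
  { intros i; eapply Rle_trans; [apply im_le_Cmod|auto]. }
  exists (L1, L2); intros eps He.
  destruct (H1 (eps / 2)) as [A1 K1]; [lra|]; destruct (H2 (eps / 2)) as [A2 K2]; [lra|].
  exists (A1 ++ A2); intros A N HA.
  specialize (K1 A N ltac:(intros x Hx; apply HA, in_or_app; auto)).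
  specialize (K2 A N ltac:(intros x Hx; apply HA, in_or_app; auto)).
  rewrite lsum_parts.
  eapply Rle_lt_trans; [apply Cmod_le_sum|]; unfold Cminus, Cplus, Copp; simpl.
  unfold Rminus in *; lra.
Qed.

(** Passage from unordered to ordered sums: symmetric intervals of integers for Fourier series, norm
    shells for q-expansions. *)
Lemma usum_exhaust f l (E : nat -> list I) :
  (forall n, NoDup (E n)) -> (forall i, exists n0, forall n, (n0 <= n)%nat -> In i (E n)) -> usum f l ->
  forall eps, 0 < eps -> exists n0, forall n, (n0 <= n)%nat -> Cmod (lsum f (E n) - l) < eps.
Proof.
  intros N X H eps He; destruct (H eps He) as [A0 K].
  assert (Y : exists n0, forall n, (n0 <= n)%nat -> incl A0 (E n)).
  { clear K; induction A0 as [|a A0 [n1 IH]].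
    - exists 0%nat; intros n _ x [].
    - destruct (X a) as [n2 H2]; exists (Nat.max n1 n2); intros n Hn x [<-|Hx].
      + apply H2; lia.
      + apply IH; [lia|auto]. }
  destruct Y as [n0 Y]; exists n0; intros n Hn; apply K; auto.
Qed.

End Sums.

Lemma lsum_map {I J} (phi : J -> I) (f : I -> C) A : lsum f (map phi A) = lsum (fun j => f (phi j)) A.
Proof. induction A as [|a A IH]; simpl; [reflexivity|rewrite IH; reflexivity]. Qed.

Lemma usum_bij {I J} (phi : J -> I) (psi : I -> J) (f : I -> C) l :
  (forall j, psi (phi j) = j) -> (forall i, phi (psi i) = i) ->
  usum f l -> usum (fun j => f (phi j)) l.
Proof.
  intros P Q H eps He; destruct (H eps He) as [A0 K].
  exists (map psi A0); intros A N HA.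
  rewrite <- (lsum_map phi); apply K.
  - apply FinFun.Injective_map_NoDup; auto.
    intros x y E; rewrite <- (P x), <- (P y), E; reflexivity.
  - intros i Hi; rewrite <- (Q i); apply in_map, HA, in_map, Hi.
Qed.

Lemma list_prod_NoDup {I J} (A : list I) (B : list J) : NoDup A -> NoDup B -> NoDup (list_prod A B).
Proof.
  intros HA HB; induction HA as [|a A Ha HA IH]; simpl; [constructor|].
  apply NoDup_app; auto.
  - apply FinFun.Injective_map_NoDup; auto. intros x y E; congruence.
  - intros [x y] H1 H2; apply in_map_iff in H1; destruct H1 as [b [E _]].
    apply in_prod_iff in H2; destruct H2 as [H2 _]; congruence.
Qed.

Lemma rsum_prod {I J} (g : I -> R) (h : J -> R) A B :
  rsum (fun p => g (fst p) * h (snd p)) (list_prod A B) = rsum g A * rsum h B.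
Proof.
  induction A as [|a A IH]; simpl; [ring|].
  rewrite rsum_app, IH.
  replace (rsum _ (map _ B)) with (g a * rsum h B); [ring|].
  clear; induction B as [|b B IH]; simpl; [ring|rewrite <- IH; ring].
Qed.

Lemma lsum_prod {I J} (g : I -> C) (h : J -> C) A B :
  lsum (fun p => g (fst p) * h (snd p))%C (list_prod A B) = (lsum g A * lsum h B)%C.
Proof.
  induction A as [|a A IH]; simpl; [ring|].
  rewrite lsum_app, IH.
  replace (lsum _ (map _ B)) with (g a * lsum h B)%C; [ring|].
  clear; induction B as [|b B IH]; simpl; [ring|rewrite <- IH; ring].
Qed.

Lemma bounded_sum_prod {I J} (g : I -> R) (h : J -> R) B B' :
  (forall i, 0 <= g i) -> (forall j, 0 <= h j) -> bounded_sum g B -> bounded_sum h B' ->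
  bounded_sum (fun p => g (fst p) * h (snd p)) (B * B').
Proof.
  intros Hg Hh HB HB' A N.
  set (A1 := nodup cdec (map fst A)); set (A2 := nodup cdec (map snd A)).
  apply Rle_trans with (rsum (fun p => g (fst p) * h (snd p)) (list_prod A1 A2)).
  - apply rsum_incl; auto.
    + intros p; apply Rmult_le_pos; auto.
    + intros [x y] Hp; apply in_prod; apply nodup_In.
      * apply (in_map fst A (x, y)), Hp.
      * apply (in_map snd A (x, y)), Hp.
  - rewrite rsum_prod; apply Rmult_le_compat.
    + apply rsum_nonneg, Hg.
    + apply rsum_nonneg, Hh.
    + apply HB, NoDup_nodup.
    + apply HB', NoDup_nodup.
Qed.

(** Domination already gives some limit [L]; it is identified with [l * l'] on finite rectangles,
    where the sum factors. *)
Lemma usum_prod {I J} (f : I -> C) (f' : J -> C) (g : I -> R) (h : J -> R) B B' l l' :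
  (forall i, Cmod (f i) <= g i) -> (forall j, Cmod (f' j) <= h j) ->
  bounded_sum g B -> bounded_sum h B' -> usum f l -> usum f' l' ->
  usum (fun p => f (fst p) * f' (snd p))%C (l * l')%C.
Proof.
  intros Hf Hf' HB HB' H H'.
  assert (Hg : forall i, 0 <= g i) by (intros i; eapply Rle_trans; [apply Cmod_ge_0|apply Hf]).
  assert (Hh : forall i, 0 <= h i) by (intros i; eapply Rle_trans; [apply Cmod_ge_0|apply Hf']).
  destruct (usum_ex (fun p => f (fst p) * f' (snd p))%C (fun p => g (fst p) * h (snd p)) (B * B'))
    as [L HL].
  - intros p; rewrite Cmod_mult; apply Rmult_le_compat; auto using Cmod_ge_0.
  - apply bounded_sum_prod; auto.
  - replace (l * l')%C with L; [exact HL|].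
    destruct (Req_dec (Cmod (L - l * l')) 0) as [E|E].
    { apply Cmod_eq_0 in E; replace L with (L - l * l' + l * l')%C by ring; rewrite E; ring. }
    assert (P : 0 < Cmod (L - l * l')) by (pose proof (Cmod_ge_0 (L - l * l')); lra).
    set (e := Cmod (L - l * l')) in *.
    pose proof (Cmod_ge_0 l) as P1. pose proof (Cmod_ge_0 l') as P2.
    (* Chosen so that u v + u l' + l v, with u and v the errors of the two factors, has modulus at
       most e / 4. *)
    set (e1 := Rmin 1 (e / (4 * (1 + Cmod l + Cmod l')))).
    assert (D : 0 < 4 * (1 + Cmod l + Cmod l')) by lra.
    assert (Pe : 0 < e1) by (apply Rmin_pos; [lra|apply Rdiv_lt_0_compat; lra]).
    assert (Pe1 : e1 <= 1) by apply Rmin_l.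
    assert (Pe2 : e1 * (4 * (1 + Cmod l + Cmod l')) <= e).
    { apply Rle_trans with (e / (4 * (1 + Cmod l + Cmod l')) * (4 * (1 + Cmod l + Cmod l'))).
      - apply Rmult_le_compat_r; [lra|apply Rmin_r].
      - right; field; lra. }
    destruct (HL (e / 2)) as [A0 K0]; [lra|].
    destruct (H e1 Pe) as [A1 K1]; destruct (H' e1 Pe) as [A2 K2].
    set (X := nodup cdec (A1 ++ map fst A0)); set (Y := nodup cdec (A2 ++ map snd A0)).
    specialize (K1 X (NoDup_nodup _ _) ltac:(intros x Hx; apply nodup_In, in_or_app; auto)).
    specialize (K2 Y (NoDup_nodup _ _) ltac:(intros x Hx; apply nodup_In, in_or_app; auto)).
    assert (N : NoDup (list_prod X Y)) by (apply list_prod_NoDup; apply NoDup_nodup).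
    specialize (K0 _ N).
    assert (Inc : incl A0 (list_prod X Y)).
    { intros [x y] Hp; apply in_prod; apply nodup_In, in_or_app; right.
      - apply (in_map fst A0 (x, y)), Hp.
      - apply (in_map snd A0 (x, y)), Hp. }
    specialize (K0 Inc); rewrite lsum_prod in K0.
    set (u := (lsum f X - l)%C) in *; set (v := (lsum f' Y - l')%C) in *.
    assert (e <= Cmod (lsum f X * lsum f' Y - L) + Cmod (u * v + (u * l' + l * v))).
    { unfold e; replace (L - l * l')%C with (- (lsum f X * lsum f' Y - L) + (u * v + (u * l' + l * v)))%C.
      - eapply Rle_trans; [apply Cmod_triangle|]; rewrite Cmod_opp; lra.
      - unfold u, v; ring. }
    assert (Cmod (u * v + (u * l' + l * v)) <= Cmod u * Cmod v + (Cmod u * Cmod l' + Cmod l * Cmod v)).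
    { eapply Rle_trans; [apply Cmod_triangle|]; rewrite Cmod_mult; apply Rplus_le_compat_l.
      eapply Rle_trans; [apply Cmod_triangle|]; rewrite !Cmod_mult; lra. }
    pose proof (Cmod_ge_0 u); pose proof (Cmod_ge_0 v).
    assert (Cmod u * Cmod v <= e1 * 1) by (apply Rmult_le_compat; lra).
    assert (Cmod u * Cmod l' <= e1 * Cmod l') by (apply Rmult_le_compat; lra).
    assert (Cmod l * Cmod v <= Cmod l * e1) by (apply Rmult_le_compat; lra).
    nra.
Qed.

(** * Exponential weights on the integers *)

Definition wZ (n : Z) : R := exp (- Rabs (IZR n)).

Fixpoint zrange (n : nat) : list Z :=
  match n with O => [0%Z] | S m => Z.of_nat (S m) :: (- Z.of_nat (S m))%Z :: zrange m end.

Lemma in_zrange n z : In z (zrange n) <-> (Z.abs z <= Z.of_nat n)%Z.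
Proof.
  induction n as [|n IH]; cbn [zrange In]; [lia|]. rewrite IH; lia.
Qed.

Lemma zrange_NoDup n : NoDup (zrange n).
Proof.
  induction n as [|n IH]; cbn [zrange].
  - constructor; [easy|constructor].
  - constructor; [|constructor]; auto; simpl; rewrite in_zrange; lia.
Qed.

Lemma incl_zrange (A : list Z) : exists n, incl A (zrange n).
Proof.
  induction A as [|a A [n IH]]; [exists 0%nat; intros x []|].
  exists (Nat.max n (Z.to_nat (Z.abs a))); intros x [<-|Hx]; apply in_zrange; [lia|].
  apply IH, in_zrange in Hx; lia.
Qed.

Lemma wZ_pos n : 0 <= wZ n. Proof. apply Rlt_le, exp_pos. Qed.

(** As e >= 2, the weights are at most 2^(-|n|), and 1 + 2 (1/2 + 1/4 + ...) = 3. *)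
Lemma wZ_bounded : bounded_sum wZ 3.
Proof.
  intros A N; destruct (incl_zrange A) as [n Hn].
  apply Rle_trans with (rsum wZ (zrange n)); [apply rsum_incl; auto using wZ_pos|].
  assert (K : forall n, wZ (Z.of_nat n) <= (/ 2) ^ n).
  { intros m; unfold wZ; rewrite <- INR_IZR_INZ, Rabs_pos_eq by apply pos_INR.
    induction m as [|m IH]; [simpl; rewrite Ropp_0, exp_0; lra|].
    rewrite S_INR, Ropp_plus_distr, exp_plus; simpl.
    rewrite Rmult_comm; apply Rmult_le_compat; try (apply Rlt_le, exp_pos); auto.
    rewrite exp_Ropp; apply Rinv_le_contravar; [lra|]; pose proof (exp_ineq1_le 1); lra. }
  assert (Q : rsum wZ (zrange n) <= 3 - 2 * (/ 2) ^ n).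
  { clear -K; induction n as [|n IH]; cbn [zrange rsum fold_right].
    - pose proof (K 0%nat); simpl in *; lra.
    - pose proof (K (S n)) as K1.
      replace (wZ (- Z.of_nat (S n))) with (wZ (Z.of_nat (S n)))
        by (unfold wZ; rewrite opp_IZR, Rabs_Ropp; reflexivity).
      fold (rsum wZ (zrange n)); simpl pow in *; lra. }
  pose proof (pow_le (/ 2) n); lra.
Qed.

Definition w2 (p : Z * Z) : R := wZ (fst p) * wZ (snd p).

Lemma w2_bounded : bounded_sum w2 (3 * 3).
Proof. apply (bounded_sum_prod wZ wZ); auto using wZ_pos, wZ_bounded. Qed.

Lemma bounded_sum_scal {I} (g : I -> R) K B : 0 <= K -> bounded_sum g B -> bounded_sum (fun i => K * g i) (K * B).
Proof. intros HK H A N; rewrite rsum_scal; apply Rmult_le_compat_l; auto. Qed.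

(** * Calculus of complex-valued functions of a real variable *)

(* Differentiability with a quadratic error term: such estimates pass to sums and integrals termwise. *)
Definition tder (f : R -> C) (s : R) (l : C) : Prop :=
  exists K d, 0 < d /\ forall h, Rabs h <= d -> Cmod (f (s + h)%R - f s - RtoC h * l) <= K * (h * h).

Definition ccont (f : R -> C) (x : R) : Prop :=
  forall eps, 0 < eps -> exists d, 0 < d /\ forall h, Rabs h < d -> Cmod (f (x + h)%R - f x) < eps.

Lemma Cmod_minus_triangle a b : Cmod (a - b) <= Cmod a + Cmod b.
Proof. unfold Cminus; rewrite <- (Cmod_opp b); apply Cmod_triangle. Qed.

Lemma Rabs_sqr h : h * h = Rabs h * Rabs h.
Proof. rewrite <- Rabs_mult, Rabs_pos_eq; nra. Qed.

Lemma tder_ccont f s l : tder f s l -> ccont f s.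
Proof.
  intros [K [d [Hd H]]] eps He.
  pose proof (Cmod_ge_0 l) as Hl.
  set (B := Rabs K * d + Cmod l + 1).
  assert (HB : 0 < B) by (unfold B; pose proof (Rabs_pos K); nra).
  exists (Rmin d (eps / B)); split; [apply Rmin_pos; [lra|apply Rdiv_lt_0_compat; lra]|].
  intros h Hh.
  assert (h1 : Rabs h < d) by (eapply Rlt_le_trans; [apply Hh|apply Rmin_l]).
  assert (h2 : Rabs h < eps / B) by (eapply Rlt_le_trans; [apply Hh|apply Rmin_r]).
  specialize (H h ltac:(lra)).
  replace (f (s + h)%R - f s)%C with ((f (s + h)%R - f s - RtoC h * l) + RtoC h * l)%C by ring.
  eapply Rle_lt_trans; [apply Cmod_triangle|]; rewrite Cmod_mult, Cmod_R.
  rewrite Rabs_sqr in H.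
  pose proof (Rabs_pos h); pose proof (Rle_abs K); pose proof (Rabs_pos K).
  assert (K * (Rabs h * Rabs h) <= Rabs K * d * Rabs h).
  { rewrite Rmult_assoc; apply Rle_trans with (Rabs K * (Rabs h * Rabs h)).
    - apply Rmult_le_compat_r; nra.
    - apply Rmult_le_compat_l; nra. }
  apply Rle_lt_trans with (B * Rabs h); [unfold B; nra|].
  apply Rlt_le_trans with (B * (eps / B)); [apply Rmult_lt_compat_l; lra|right; field; lra].
Qed.

Lemma ccont_parts f x : ccont f x ->
  continuous (fun u => Re (f u)) x /\ continuous (fun u => Im (f u)) x.
Proof.
  intros H; split; apply filterlim_locally; intros eps;
    destruct (H eps (cond_pos eps)) as [d [Hd K]]; exists (mkposreal d Hd); intros y Hy; change R in y;
    change (Rabs (y - x) < d) in Hy; specialize (K (y - x) Hy);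
    replace (x + (y - x)) with y in K by (simpl; ring).
  - change (Rabs (Re (f y) - Re (f x)) < eps); eapply Rle_lt_trans; [|apply K].
    apply (re_le_Cmod (f y - f x)).
  - change (Rabs (Im (f y) - Im (f x)) < eps); eapply Rle_lt_trans; [|apply K].
    apply (im_le_Cmod (f y - f x)).
Qed.

Lemma ccont_bounded f x : ccont f x -> exists d, 0 < d /\ forall h, Rabs h < d -> Cmod (f (x + h)%R) < Cmod (f x) + 1.
Proof.
  intros H; destruct (H 1 Rlt_0_1) as [d [Hd K]]; exists d; split; auto; intros h Hh.
  specialize (K h Hh).
  replace (f (x + h)%R) with ((f (x + h)%R - f x) + f x)%C by ring.
  eapply Rle_lt_trans; [apply Cmod_triangle|lra].
Qed.

Lemma ccont_const c x : ccont (fun _ => c) x.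
Proof. intros e He; exists 1; split; [lra|]; intros; replace (c - c)%C with (RtoC 0) by ring; rewrite Cmod_0; lra. Qed.

Lemma ccont_plus f g x : ccont f x -> ccont g x -> ccont (fun u => f u + g u)%C x.
Proof.
  intros H H' e He; destruct (H (e / 2)) as [d [Hd K]]; [lra|]; destruct (H' (e / 2)) as [d' [Hd' K']]; [lra|].
  exists (Rmin d d'); split; [apply Rmin_pos; auto|]; intros h Hh.
  specialize (K h ltac:(eapply Rlt_le_trans; [apply Hh|apply Rmin_l])).
  specialize (K' h ltac:(eapply Rlt_le_trans; [apply Hh|apply Rmin_r])).
  replace (_ - _)%C with ((f (x + h)%R - f x) + (g (x + h)%R - g x))%C by ring.
  eapply Rle_lt_trans; [apply Cmod_triangle|lra].
Qed.

Lemma ccont_mult f g x : ccont f x -> ccont g x -> ccont (fun u => f u * g u)%C x.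
Proof.
  intros H H' e He.
  destruct (ccont_bounded _ _ H) as [d0 [Hd0 K0]].
  pose proof (Cmod_ge_0 (f x)); pose proof (Cmod_ge_0 (g x)).
  set (B := Cmod (f x) + Cmod (g x) + 2).
  assert (HB : 0 < B) by (unfold B; lra).
  assert (He' : 0 < e / B / 2) by (apply Rdiv_lt_0_compat; [apply Rdiv_lt_0_compat|]; lra).
  destruct (H (e / B / 2) He') as [d [Hd K]]; destruct (H' (e / B / 2) He') as [d' [Hd' K']].
  exists (Rmin d0 (Rmin d d')); split; [repeat apply Rmin_pos; auto|]; intros h Hh.
  assert (h0 : Rabs h < d0) by (eapply Rlt_le_trans; [apply Hh|apply Rmin_l]).
  assert (h12 : Rabs h < Rmin d d') by (eapply Rlt_le_trans; [apply Hh|apply Rmin_r]).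
  specialize (K0 h h0).
  specialize (K h ltac:(eapply Rlt_le_trans; [apply h12|apply Rmin_l])).
  specialize (K' h ltac:(eapply Rlt_le_trans; [apply h12|apply Rmin_r])).
  replace (_ - _)%C with (f (x + h)%R * (g (x + h)%R - g x) + (f (x + h)%R - f x) * g x)%C by ring.
  eapply Rle_lt_trans; [apply Cmod_triangle|]; rewrite !Cmod_mult.
  pose proof (Cmod_ge_0 (f (x + h)%R)); pose proof (Cmod_ge_0 (g (x + h)%R - g x));
  pose proof (Cmod_ge_0 (f (x + h)%R - f x)).
  assert (Cmod (f (x + h)%R) * Cmod (g (x + h)%R - g x) <= B * (e / B / 2)) by (apply Rmult_le_compat; unfold B in *; lra).
  assert (Cmod (f (x + h)%R - f x) * Cmod (g x) <= (e / B / 2) * (B - 1)) by (apply Rmult_le_compat; unfold B in *; lra).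
  assert (E : B * (e / B / 2) = e / 2) by (field; lra).
  nra.
Qed.

Lemma ccont_inv (f : R -> C) x : f x <> RtoC 0 -> ccont f x -> ccont (fun u => / f u)%C x.
Proof.
  intros N H e He.
  assert (Hm : 0 < Cmod (f x)) by exact (proj1 (Cmod_gt_0 _) N).
  set (m := Cmod (f x)) in *.
  destruct (H (Rmin (m / 2) (e * (m / 2 * m)))) as [d [Hd K]].
  { apply Rmin_pos; [lra|]; repeat apply Rmult_lt_0_compat; lra. }
  exists d; split; auto; intros h Hh; specialize (K h Hh).
  assert (K1 : Cmod (f (x + h)%R - f x) < m / 2) by (eapply Rlt_le_trans; [apply K|apply Rmin_l]).
  assert (K2 : Cmod (f (x + h)%R - f x) < e * (m / 2 * m)) by (eapply Rlt_le_trans; [apply K|apply Rmin_r]).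
  assert (L : m / 2 < Cmod (f (x + h)%R)).
  { assert (m <= Cmod (f (x + h)%R) + Cmod (f (x + h)%R - f x)); [|lra].
    unfold m; replace (f x) with (f (x + h)%R - (f (x + h)%R - f x))%C at 1 by ring; apply Cmod_minus_triangle. }
  assert (N' : f (x + h)%R <> 0) by (apply (proj2 (Cmod_gt_0 _)); lra).
  replace (_ - _)%C with (- ((f (x + h)%R - f x) / (f (x + h)%R * f x)))%C by (field; split; auto).
  rewrite Cmod_opp, Cmod_div, Cmod_mult by (apply Cmult_neq_0; auto); fold m.
  apply Rlt_div_l; [apply Rmult_lt_0_compat; lra|].
  eapply Rlt_le_trans; [apply K2|]; apply Rmult_le_compat_l; [lra|]; apply Rmult_le_compat_r; lra.
Qed.

Lemma ccont_ext_loc f g x d : 0 < d -> (forall h, Rabs h < d -> f (x + h)%R = g (x + h)%R) -> ccont f x -> ccont g x.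
Proof.
  intros Hd E H e He; destruct (H e He) as [d' [Hd' K]]; exists (Rmin d d'); split; [apply Rmin_pos; auto|].
  intros h Hh; rewrite <- E by (eapply Rlt_le_trans; [apply Hh|apply Rmin_l]).
  pose proof (E 0 ltac:(rewrite Rabs_R0; lra)) as E0; rewrite Rplus_0_r in E0; rewrite <- E0.
  apply K; eapply Rlt_le_trans; [apply Hh|apply Rmin_r].
Qed.

Lemma is_derive_quadratic (f : R -> R) s l K d : 0 < d ->
  (forall h, Rabs h <= d -> Rabs (f (s + h)%R - f s - h * l) <= K * (h * h)) -> is_derive f s l.
Proof.
  intros Hd H; apply is_derive_Reals; intros eps He.
  pose proof (Rabs_pos K).
  assert (D : 0 < Rmin d (eps / (Rabs K + 1))) by (apply Rmin_pos; [|apply Rdiv_lt_0_compat]; lra).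
  exists (mkposreal _ D); intros h Hh0 Hh; simpl in Hh.
  assert (h1 : Rabs h < d) by (eapply Rlt_le_trans; [apply Hh|apply Rmin_l]).
  assert (h2 : Rabs h < eps / (Rabs K + 1)) by (eapply Rlt_le_trans; [apply Hh|apply Rmin_r]).
  specialize (H h ltac:(lra)).
  replace ((f (s + h)%R - f s) / h - l) with ((f (s + h)%R - f s - h * l) / h) by (field; auto).
  assert (Ph : 0 < Rabs h) by (apply Rabs_pos_lt; auto).
  unfold Rdiv at 1; rewrite Rabs_mult, Rabs_inv.
  apply Rlt_div_l; auto.
  rewrite Rabs_sqr in H; eapply Rle_lt_trans; [apply H|].
  apply Rle_lt_trans with ((Rabs K + 1) * Rabs h * Rabs h); [pose proof (Rle_abs K); nra|].
  apply Rmult_lt_compat_r; auto.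
  apply Rlt_le_trans with ((Rabs K + 1) * (eps / (Rabs K + 1))); [apply Rmult_lt_compat_l; lra|right; field; lra].
Qed.

Lemma tder_parts f s l : tder f s l ->
  is_derive (fun u => Re (f u)) s (Re l) /\ is_derive (fun u => Im (f u)) s (Im l).
Proof.
  intros [K [d [Hd H]]]; split; apply (is_derive_quadratic _ _ _ K d Hd); intros h Hh;
    (eapply Rle_trans; [|apply (H h Hh)]).
  - replace (_ - _ - _) with (Re (f (s + h)%R - f s - RtoC h * l)).
    + apply re_le_Cmod.
    + destruct (f (s + h)%R), (f s), l; simpl; ring.
  - replace (_ - _ - _) with (Im (f (s + h)%R - f s - RtoC h * l)).
    + apply im_le_Cmod.
    + destruct (f (s + h)%R), (f s), l; simpl; ring.
Qed.

Lemma tder_unique f s l l' : tder f s l -> tder f s l' -> l = l'.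
Proof.
  intros H H'; apply tder_parts in H; apply tder_parts in H'; destruct H as [A B], H' as [A' B'].
  apply C_eq.
  - rewrite <- (is_derive_unique _ _ _ A); apply is_derive_unique, A'.
  - rewrite <- (is_derive_unique _ _ _ B); apply is_derive_unique, B'.
Qed.

Lemma tder_zero_const f : (forall s, 0 <= s <= 1 -> tder f s 0) -> f 1 = f 0.
Proof.
  intros H.
  assert (G : forall g : R -> R, (forall s, 0 <= s <= 1 -> is_derive g s 0) -> g 1 = g 0).
  { intros g Hg; destruct (MVT_gen g 0 1 (fun _ => 0)) as [c [_ E]].
    - intros s Hs; rewrite Rmin_left, Rmax_right in Hs by lra; apply Hg; lra.
    - intros s Hs; rewrite Rmin_left, Rmax_right in Hs by lra.
      apply derivable_continuous_pt; exists 0; apply is_derive_Reals, Hg; lra.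
    - lra. }
  apply C_eq.
  - apply (G (fun u => Re (f u))); intros s Hs; apply (tder_parts f s 0 (H s Hs)).
  - apply (G (fun u => Im (f u))); intros s Hs; apply (tder_parts f s 0 (H s Hs)).
Qed.

Lemma tder_ext f g s l : (forall u, f u = g u) -> tder f s l -> tder g s l.
Proof. intros E [K [d [Hd H]]]; exists K, d; split; auto; intros; rewrite <- !E; auto. Qed.

Lemma tder_scal c f s l : tder f s l -> tder (fun u => c * f u)%C s (c * l)%C.
Proof.
  intros [K [d [Hd H]]]; exists (Cmod c * K), d; split; auto; intros h Hh.
  replace (_ - _ - _)%C with (c * (f (s + h)%R - f s - RtoC h * l))%C by ring.
  rewrite Cmod_mult, Rmult_assoc; apply Rmult_le_compat_l; [apply Cmod_ge_0|auto].
Qed.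

Lemma tder_mult f g s l l' : tder f s l -> tder g s l' -> tder (fun u => f u * g u)%C s (l * g s + f s * l')%C.
Proof.
  intros Hf Hg.
  destruct (ccont_bounded _ _ (tder_ccont _ _ _ Hg)) as [d0 [Hd0 B]].
  destruct Hf as [K [d [Hd H]]], Hg as [K' [d' [Hd' H']]].
  pose proof (Cmod_ge_0 (g s)); pose proof (Cmod_ge_0 l); pose proof (Cmod_ge_0 l'); pose proof (Cmod_ge_0 (f s)).
  exists (Rabs K * (Cmod (g s) + 1) + Cmod (f s) * Rabs K' + Cmod l * (Rabs K' * d' + Cmod l')).
  exists (Rmin (d0 / 2) (Rmin d d')); split; [repeat apply Rmin_pos; lra|]; intros h Hh.
  assert (h0 : Rabs h < d0) by (eapply Rle_lt_trans; [eapply Rle_trans; [apply Hh|apply Rmin_l]|lra]).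
  assert (h12 : Rabs h <= Rmin d d') by (eapply Rle_trans; [apply Hh|apply Rmin_r]).
  specialize (B h h0).
  assert (h2 : Rabs h <= d') by (eapply Rle_trans; [apply h12|apply Rmin_r]).
  specialize (H h ltac:(eapply Rle_trans; [apply h12|apply Rmin_l])); specialize (H' h h2).
  set (a := (f (s + h)%R - f s - RtoC h * l)%C) in *; set (b := (g (s + h)%R - g s - RtoC h * l')%C) in *.
  replace (_ - _ - _)%C with (a * g (s + h)%R + f s * b + RtoC h * l * (b + RtoC h * l'))%C by (unfold a, b; ring).
  eapply Rle_trans; [apply Cmod_triangle|].
  eapply Rle_trans; [apply Rplus_le_compat_r, Cmod_triangle|].
  rewrite !Cmod_mult, Cmod_R.
  assert (T : Cmod (b + RtoC h * l') <= (Rabs K' * d' + Cmod l') * Rabs h).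
  { eapply Rle_trans; [apply Cmod_triangle|]; rewrite Cmod_mult, Cmod_R.
    rewrite Rabs_sqr in H'; pose proof (Rabs_pos h); pose proof (Rle_abs K'); pose proof (Rabs_pos K').
    assert (K' * (Rabs h * Rabs h) <= Rabs K' * (Rabs h * d')); [|nra].
    apply Rle_trans with (Rabs K' * (Rabs h * Rabs h)); [apply Rmult_le_compat_r; nra|apply Rmult_le_compat_l; nra]. }
  assert (T1 : Cmod a * Cmod (g (s + h)%R) <= Rabs K * (h * h) * (Cmod (g s) + 1)).
  { apply Rmult_le_compat; try apply Cmod_ge_0; [|lra].
    eapply Rle_trans; [apply H|]; apply Rmult_le_compat_r; [nra|apply Rle_abs]. }
  assert (T2 : Cmod (f s) * Cmod b <= Cmod (f s) * (Rabs K' * (h * h))).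
  { apply Rmult_le_compat_l; auto; eapply Rle_trans; [apply H'|]; apply Rmult_le_compat_r; [nra|apply Rle_abs]. }
  assert (T3 : Rabs h * Cmod l * Cmod (b + RtoC h * l') <= Rabs h * Cmod l * ((Rabs K' * d' + Cmod l') * Rabs h)).
  { apply Rmult_le_compat_l; auto; apply Rmult_le_pos; auto; apply Rabs_pos. }
  assert (T4 : Rabs h * Cmod l * ((Rabs K' * d' + Cmod l') * Rabs h) = Cmod l * (Rabs K' * d' + Cmod l') * (h * h))
    by (rewrite (Rabs_sqr h); ring).
  apply Rle_trans with (Rabs K * (h * h) * (Cmod (g s) + 1) + Cmod (f s) * (Rabs K' * (h * h)) +
     Cmod l * (Rabs K' * d' + Cmod l') * (h * h)); [lra|right; ring].
Qed.

(** The exponent has the form produced by translating a Gaussian by h: a linear term, which gives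
    the derivative, and a quadratic one, which goes into the error. *)
Lemma Cexp_quadratic_estimate (a c : C) h : Rabs h <= 1 ->
  Cmod (Cexp (RtoC h * a + RtoC (h * h) * c) - 1 - RtoC h * a)
  <= (2 * (Cmod a + Cmod c) ^ 2 * exp (Cmod a + Cmod c) + Cmod c) * (h * h).
Proof.
  intros Hh; set (w := (RtoC h * a + RtoC (h * h) * c)%C).
  pose proof (Cmod_ge_0 a); pose proof (Cmod_ge_0 c); pose proof (Rabs_pos h).
  assert (W : Cmod w <= Rabs h * (Cmod a + Cmod c)).
  { unfold w; eapply Rle_trans; [apply Cmod_triangle|]; rewrite !Cmod_mult, !Cmod_R, Rabs_mult.
    rewrite Rmult_plus_distr_l; apply Rplus_le_compat_l; rewrite Rmult_assoc; apply Rmult_le_compat_l; nra. }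
  assert (W1 : Cmod w <= Cmod a + Cmod c) by nra.
  pose proof (Cmod_ge_0 w).
  replace (Cexp w - 1 - RtoC h * a)%C with ((Cexp w - 1 - w) + RtoC (h * h) * c)%C by (unfold w; ring).
  eapply Rle_trans; [apply Cmod_triangle|]; rewrite Cmod_mult, Cmod_R, (Rabs_pos_eq (h * h)) by nra.
  rewrite (Rmult_plus_distr_r _ (Cmod c)), (Rmult_comm (h * h)); apply Rplus_le_compat_r.
  eapply Rle_trans; [apply Cexp_taylor|].
  replace (2 * (Cmod a + Cmod c) ^ 2 * exp (Cmod a + Cmod c) * (h * h))
    with (2 * ((Rabs h * (Cmod a + Cmod c)) ^ 2 * exp (Cmod a + Cmod c)))
    by (rewrite (Rabs_sqr h); ring).
  apply Rmult_le_compat_l; [lra|].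
  apply Rmult_le_compat; [apply pow_le; lra|apply Rlt_le, exp_pos|apply pow_incr; lra|apply exp_mono; lra].
Qed.

Lemma tder_Cexp_quad (q0 q1 q2 : C) s :
  tder (fun u => Cexp (q0 + RtoC u * q1 + RtoC (u * u) * q2)) s
    ((q1 + 2 * RtoC s * q2) * Cexp (q0 + RtoC s * q1 + RtoC (s * s) * q2))%C.
Proof.
  set (a := (q1 + 2 * RtoC s * q2)%C).
  exists (Cmod (Cexp (q0 + RtoC s * q1 + RtoC (s * s) * q2)) *
     (2 * (Cmod a + Cmod q2) ^ 2 * exp (Cmod a + Cmod q2) + Cmod q2)), 1; split; [lra|]; intros h Hh.
  replace (Cexp (q0 + RtoC (s + h) * q1 + RtoC ((s + h) * (s + h)) * q2)) with
    (Cexp (q0 + RtoC s * q1 + RtoC (s * s) * q2) * Cexp (RtoC h * a + RtoC (h * h) * q2))%C.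
  2:{ rewrite <- Cexp_plus; f_equal; unfold a; rewrite !RtoC_mult, !RtoC_plus; ring. }
  set (X := Cexp (q0 + RtoC s * q1 + RtoC (s * s) * q2)).
  replace (_ - _ - _)%C with (X * (Cexp (RtoC h * a + RtoC (h * h) * q2) - 1 - RtoC h * a))%C by ring.
  rewrite Cmod_mult, Rmult_assoc; apply Rmult_le_compat_l; [apply Cmod_ge_0|].
  apply Cexp_quadratic_estimate, Hh.
Qed.

Lemma tder_ex1 c s : tder (fun u => ex1 (c * u)) s (RtoC (2 * PI * c) * Ci * ex1 (c * s))%C.
Proof.
  pose proof (tder_Cexp_quad 0 (RtoC (2 * PI * c) * Ci) 0 s) as H.
  replace (RtoC (2 * PI * c) * Ci * ex1 (c * s))%C with
   ((RtoC (2 * PI * c) * Ci + 2 * RtoC s * 0) * Cexp (0 + RtoC s * (RtoC (2 * PI * c) * Ci) + RtoC (s * s) * 0))%C.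
  - eapply tder_ext; [|exact H]; intros u; unfold ex1; f_equal; rewrite !RtoC_mult; ring.
  - unfold ex1; replace (0 + RtoC s * (RtoC (2 * PI * c) * Ci) + RtoC (s * s) * 0)%C with (RtoC (2 * PI * (c * s)) * Ci)%C;
      [ring|rewrite !RtoC_mult; ring].
Qed.

Lemma ccont_ex1 c x : ccont (fun u => ex1 (c * u)) x.
Proof. eapply tder_ccont, tder_ex1. Qed.

(** * Integrals of complex-valued functions *)

Definition Cint (f : R -> C) (a b : R) : C := (RInt (fun u => Re (f u)) a b, RInt (fun u => Im (f u)) a b).

Lemma RInt_shift (g : R -> R) a b c : ex_RInt g (a + c) (b + c) ->
  RInt (fun u => g (u + c)) a b = RInt g (a + c) (b + c).
Proof.
  intros H; pose proof (RInt_comp_lin (V := R_CompleteNormedModule) g 1 c a b) as K.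
  rewrite !Rmult_1_l in K; rewrite <- K by auto.
  apply RInt_ext; intros x _; change (g (x + c) = 1 * g (1 * x + c)); rewrite !Rmult_1_l; reflexivity.
Qed.

Section CInt.
Implicit Types (f g : R -> C).
Local Notation contf f := (forall x, ccont f x).

Lemma ex_RInt_Re f a b : contf f -> ex_RInt (fun u => Re (f u)) a b.
Proof. intros H; apply (@ex_RInt_continuous R_CompleteNormedModule); intros z _; exact (proj1 (ccont_parts f z (H z))). Qed.
Lemma ex_RInt_Im f a b : contf f -> ex_RInt (fun u => Im (f u)) a b.
Proof. intros H; apply (@ex_RInt_continuous R_CompleteNormedModule); intros z _; exact (proj2 (ccont_parts f z (H z))). Qed.
Hint Resolve ex_RInt_Re ex_RInt_Im : core.

Lemma Cint_ext f g a b : (forall u, f u = g u) -> Cint f a b = Cint g a b.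
Proof. intros E; unfold Cint; f_equal; apply RInt_ext; intros; rewrite E; reflexivity. Qed.

Lemma Cint_plus f g a b : contf f -> contf g -> Cint (fun u => f u + g u)%C a b = (Cint f a b + Cint g a b)%C.
Proof.
  intros Hf Hg; apply C_eq; unfold Cint; simpl.
  - rewrite <- (RInt_plus (V := R_CompleteNormedModule)); auto.
  - rewrite <- (RInt_plus (V := R_CompleteNormedModule)); auto.
Qed.

Lemma Cint_scal c f a b : contf f -> Cint (fun u => c * f u)%C a b = (c * Cint f a b)%C.
Proof.
  intros Hf.
  assert (E : forall k l, RInt (fun u => k * Re (f u) + l * Im (f u)) a b =
     k * RInt (fun u => Re (f u)) a b + l * RInt (fun u => Im (f u)) a b).
  { intros k l.
    rewrite (RInt_plus (V := R_CompleteNormedModule) (fun u => scal k (Re (f u))) (fun u => scal l (Im (f u)))).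
    - rewrite !(RInt_scal (V := R_CompleteNormedModule)); auto.
    - apply (ex_RInt_scal (V := R_CompleteNormedModule)); auto.
    - apply (ex_RInt_scal (V := R_CompleteNormedModule)); auto. }
  apply C_eq; unfold Cint; simpl.
  - rewrite (RInt_ext _ (fun u => Re c * Re (f u) + (- Im c) * Im (f u))), E; [unfold Re, Im; ring|].
    intros u _; unfold Re, Im; simpl; ring.
  - rewrite (RInt_ext _ (fun u => Im c * Re (f u) + Re c * Im (f u))), E; [unfold Re, Im; ring|].
    intros u _; unfold Re, Im; simpl; ring.
Qed.

(** The factor 2 comes from bounding the real and imaginary parts separately. *)
Lemma Cint_bound f a b M : a <= b -> contf f -> (forall u, a <= u <= b -> Cmod (f u) <= M) ->
  Cmod (Cint f a b) <= 2 * (M * (b - a)).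
Proof.
  intros Hab Hf HM; eapply Rle_trans; [apply Cmod_le_sum|]; unfold Cint; simpl.
  assert (E : forall g : R -> R, ex_RInt g a b -> (forall u, a <= u <= b -> Rabs (g u) <= M) ->
     Rabs (RInt g a b) <= M * (b - a)).
  { intros g Hg Bg; rewrite Rmult_comm.
    apply (abs_RInt_le_const g a b M Hab Hg); auto. }
  pose proof (E _ (ex_RInt_Re f a b Hf)
    ltac:(intros u Hu; eapply Rle_trans; [apply re_le_Cmod|auto])).
  pose proof (E _ (ex_RInt_Im f a b Hf)
    ltac:(intros u Hu; eapply Rle_trans; [apply im_le_Cmod|auto])).
  lra.
Qed.

Lemma Cint_tder F f a b : (forall u, tder F u (f u)) -> contf f -> Cint f a b = (F b - F a)%C.
Proof.
  intros D Hf; apply C_eq; unfold Cint; simpl.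
  - apply is_RInt_unique, (is_RInt_derive (fun u => Re (F u)) (fun u => Re (f u))); intros x _.
    + apply (tder_parts F x _ (D x)).
    + exact (proj1 (ccont_parts f x (Hf x))).
  - apply is_RInt_unique, (is_RInt_derive (fun u => Im (F u)) (fun u => Im (f u))); intros x _.
    + apply (tder_parts F x _ (D x)).
    + exact (proj2 (ccont_parts f x (Hf x))).
Qed.

Lemma Cint_shift f a b c : contf f -> Cint (fun u => f (u + c)) a b = Cint f (a + c) (b + c).
Proof. intros Hf; unfold Cint; f_equal; apply (RInt_shift (fun u => _ (f u))); auto. Qed.

Lemma Cint_Chasles f a b c : contf f -> (Cint f a b + Cint f b c)%C = Cint f a c.
Proof.
  intros Hf; apply C_eq; unfold Cint; simpl.
  - apply (RInt_Chasles (V := R_CompleteNormedModule)); auto.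
  - apply (RInt_Chasles (V := R_CompleteNormedModule)); auto.
Qed.

Lemma Cint_periodic f c : contf f -> (forall u, f (u + 1) = f u) -> Cint (fun u => f (u + c)) 0 1 = Cint f 0 1.
Proof.
  intros Hf P; rewrite Cint_shift by auto.
  rewrite <- (Cint_Chasles f (0 + c) 0 (1 + c)), <- (Cint_Chasles f 0 1 (1 + c)) by auto.
  assert (E : Cint f (0 + 1) (c + 1) = Cint f 0 c) by (rewrite <- Cint_shift by auto; apply Cint_ext; auto).
  rewrite Rplus_0_l in E; rewrite (Rplus_comm 1 c), E.
  replace (0 + c) with c by ring.
  assert (Z : (Cint f c 0 + Cint f 0 c)%C = 0).
  { rewrite Cint_Chasles by auto; unfold Cint; rewrite !RInt_point; reflexivity. }
  replace (_ + _)%C with ((Cint f c 0 + Cint f 0 c) + Cint f 0 1)%C by ring; rewrite Z; ring.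
Qed.
End CInt.

(** * Pointwise Fourier inversion *)

Definition fc (P : R -> C) (m : Z) : C := Cint (fun u => P u * ex1 (- IZR m * u))%C 0 1.

(** A shift by h = 1/(2m) changes the sign of e(-mu), so twice the coefficient is that of Q(u) - Q(u
    + h), which is small by uniform continuity. *)
Lemma riemann_lebesgue (Q : R -> C) : (forall x, ccont Q x) -> (forall u, Q (u + 1) = Q u) ->
  forall eps, 0 < eps -> exists M : Z, forall m, (M <= Z.abs m)%Z -> Cmod (fc Q m) < eps.
Proof.
  intros HQ PQ eps He.
  (* The interval [-1, 2] contains u and u + h for u in [0, 1], since |h| <= 1/2. *)
  assert (U : forall g : R -> R, (forall x, continuous g x) -> exists d, 0 < d /\
    forall x y, -1 <= x <= 2 -> -1 <= y <= 2 -> Rabs (x - y) < d -> Rabs (g x - g y) < eps / 8).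
  { intros g Hg.
    destruct (Heine_cor2 (f := g) (a := -1) (b := 2)) with (eps := mkposreal (eps / 8) ltac:(lra)) as [d Hd].
    - intros x _; apply continuity_pt_filterlim, Hg.
    - exists d; split; [apply cond_pos|exact Hd]. }
  destruct (U (fun u => Re (Q u))) as [d1 [Hd1 U1]]; [intros x; exact (proj1 (ccont_parts Q x (HQ x)))|].
  destruct (U (fun u => Im (Q u))) as [d2 [Hd2 U2]]; [intros x; exact (proj2 (ccont_parts Q x (HQ x)))|].
  set (d := Rmin d1 d2). assert (Hd : 0 < d) by (apply Rmin_pos; auto).
  destruct (archimed (/ d)) as [HM _]; set (M := Z.max 1 (up (/ d))).
  exists M; intros m Hm.
  assert (m1 : 1 <= Rabs (IZR m)) by (rewrite <- abs_IZR; apply IZR_le; lia).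
  assert (m2 : / d < Rabs (IZR m)) by (rewrite <- abs_IZR; eapply Rlt_le_trans; [apply HM|apply IZR_le; lia]).
  assert (m0 : IZR m <> 0) by (intros E; rewrite E, Rabs_R0 in m1; lra).
  set (h := / (2 * IZR m)).
  assert (Ah : Rabs h = / 2 * / Rabs (IZR m)).
  { unfold h; rewrite Rabs_inv, Rabs_mult, (Rabs_pos_eq 2) by lra. field. lra. }
  assert (im : / Rabs (IZR m) <= 1) by (rewrite <- Rinv_1; apply Rinv_le_contravar; lra).
  assert (im2 : / Rabs (IZR m) < d).
  { rewrite <- (Rinv_inv d); apply Rinv_lt_contravar; auto.
    apply Rmult_lt_0_compat; [apply Rinv_0_lt_compat; auto|lra]. }
  assert (h1 : Rabs h <= / 2) by lra.
  assert (h2 : Rabs h < d) by (pose proof (Rinv_0_lt_compat (Rabs (IZR m))); lra).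
  assert (CE : forall x, ccont (fun u => ex1 (- IZR m * u)) x) by (intros; apply ccont_ex1).
  assert (CQE : forall x, ccont (fun u => Q u * ex1 (- IZR m * u))%C x) by (intros; apply ccont_mult; auto).
  assert (CQh : forall x, ccont (fun u => Q (u + h)) x).
  { intros x e' He'; destruct (HQ (x + h) e' He') as [e2 [He2 K]]; exists e2; split; auto; intros t Ht.
    replace (x + t + h) with (x + h + t) by ring; auto. }
  assert (mh : - IZR m * h = / 2 + IZR (-1)) by (unfold h; simpl; field; auto).
  assert (S : fc Q m = (-1 * Cint (fun u => Q (u + h)%R * ex1 (- IZR m * u)) 0 1)%C).
  { unfold fc; rewrite <- (Cint_periodic (fun u => Q u * ex1 (- IZR m * u))%C h) by
      (auto; intros u; rewrite PQ; f_equal;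
       replace (- IZR m * (u + 1)) with (- IZR m * u + IZR (- m)) by (rewrite opp_IZR; ring); apply ex1_period).
    rewrite <- Cint_scal by (intros; apply ccont_mult; auto).
    apply Cint_ext; intros u.
    replace (- IZR m * (u + h)) with (- IZR m * u + (/ 2 + IZR (-1))) by (rewrite <- mh; ring).
    rewrite ex1_plus, ex1_period.
    replace (ex1 (/ 2)) with (RtoC (-1)); [ring|].
    rewrite ex1_cos; replace (2 * PI * / 2) with PI by field; rewrite cos_PI, sin_PI; reflexivity. }
  assert (D : (2 * fc Q m)%C = Cint (fun u => (Q u + -1 * Q (u + h)%R) * ex1 (- IZR m * u))%C 0 1).
  { replace (2 * fc Q m)%C with (fc Q m + fc Q m)%C by ring.
    rewrite S at 2; unfold fc; rewrite <- Cint_scal by (intros; apply ccont_mult; auto).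
    rewrite <- Cint_plus.
    - apply Cint_ext; intros; ring.
    - auto.
    - intros; apply ccont_mult; [apply ccont_const|]; apply ccont_mult; auto. }
  assert (B : Cmod (2 * fc Q m) <= 2 * (eps / 4 * (1 - 0))).
  { rewrite D; apply Cint_bound; [lra| |].
    - intros; apply ccont_mult; auto; apply ccont_plus; auto; apply ccont_mult; auto; apply ccont_const.
    - intros u Hu; rewrite Cmod_mult, Cmod_ex1, Rmult_1_r.
      eapply Rle_trans; [apply Cmod_le_sum|].
      apply Rabs_le_between in h1.
      assert (Rabs (u - (u + h)) < d) by (replace (u - (u + h)) with (- h) by ring; rewrite Rabs_Ropp; auto).
      specialize (U1 u (u + h) ltac:(lra) ltac:(lra) ltac:(eapply Rlt_le_trans; [eassumption|apply Rmin_l])).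
      specialize (U2 u (u + h) ltac:(lra) ltac:(lra) ltac:(eapply Rlt_le_trans; [eassumption|apply Rmin_r])).
      replace (Re (Q u + -1 * Q (u + h)%R)) with (Re (Q u) - Re (Q (u + h)))
        by (destruct (Q u), (Q (u + h)); simpl; ring).
      replace (Im (Q u + -1 * Q (u + h)%R)) with (Im (Q u) - Im (Q (u + h)))
        by (destruct (Q u), (Q (u + h)); simpl; ring).
      lra. }
  rewrite Cmod_mult, Cmod_R, Rabs_pos_eq in B by lra; lra.
Qed.

Lemma ex1_eq_1 u : ex1 u = 1 -> exists n, u = IZR n.
Proof.
  intros H; exists (Int_part u).
  pose proof (base_Int_part u) as [B1 B2].
  set (r := u - IZR (Int_part u)).
  assert (E : ex1 r = 1).
  { unfold r; replace (u - IZR (Int_part u)) with (u + IZR (- Int_part u)) by (rewrite opp_IZR; ring).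
    rewrite ex1_period; auto. }
  rewrite ex1_cos in E; injection E as E1 _.
  replace (2 * PI * r) with (2 * (PI * r)) in E1 by ring.
  rewrite cos_2a_sin in E1.
  destruct (Req_dec r 0) as [Z|Z]; [unfold r in Z; lra|].
  assert (0 < r < 1) by (unfold r in *; lra).
  pose proof PI_RGT_0.
  assert (0 < sin (PI * r)) by (apply sin_gt_0; nra).
  nra.
Qed.

Lemma fc_const c m : fc (fun _ => c) m = if Z.eq_dec m 0 then c else RtoC 0.
Proof.
  unfold fc; rewrite Cint_scal by (intros; apply ccont_ex1).
  destruct (Z.eq_dec m 0) as [->|N].
  - rewrite (Cint_ext _ (fun _ => RtoC 1)).
    + replace (Cint (fun _ => RtoC 1) 0 1) with (RtoC 1); [ring|].
      apply C_eq; unfold Cint; simpl; rewrite RInt_const; change scal with Rmult; simpl; ring.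
    + intros u; replace (- 0 * u) with 0 by ring; apply ex1_0.
  - assert (N' : IZR m <> 0) by (apply not_0_IZR; auto).
    pose proof PI_RGT_0 as HP.
    assert (X : (RtoC (2 * PI * - IZR m) * Ci)%C <> 0).
    { apply Cmult_neq_0; [|apply Cmod_gt_0; rewrite Cmod_Ci; lra].
      apply Cmod_gt_0; rewrite Cmod_R; apply Rabs_pos_lt.
      apply Rmult_integral_contrapositive; split; lra. }
    rewrite (Cint_tder (fun u => / (RtoC (2 * PI * - IZR m) * Ci) * ex1 (- IZR m * u))%C).
    + replace (- IZR m * 1) with (0 + IZR (- m)) by (rewrite opp_IZR; ring).
      rewrite ex1_period, Rmult_0_r; ring.
    + intros u; pose proof (tder_scal (/ (RtoC (2 * PI * - IZR m) * Ci))%C _ _ _ (tder_ex1 (- IZR m) u)) as T.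
      replace (ex1 (- IZR m * u)) with
        (/ (RtoC (2 * PI * - IZR m) * Ci) * (RtoC (2 * PI * - IZR m) * Ci * ex1 (- IZR m * u)))%C; [exact T|].
      rewrite Cmult_assoc, Cinv_l by auto; ring.
    + intros; apply ccont_ex1.
Qed.

Lemma lsum_fc_const c n : lsum (fc (fun _ => c)) (zrange n) = c.
Proof.
  induction n as [|n IH]; cbn [zrange lsum fold_right].
  - rewrite fc_const; simpl; ring.
  - fold (lsum (fc (fun _ => c)) (zrange n)); rewrite IH, !fc_const.
    destruct (Z.eq_dec (Z.of_nat (S n)) 0); [lia|]; destruct (Z.eq_dec (- Z.of_nat (S n)) 0); [lia|]; ring.
Qed.

Lemma lsum_telescope (q : Z -> C) n :
  lsum (fun m => q (m - 1)%Z - q m)%C (zrange n) = (q (- Z.of_nat n - 1)%Z - q (Z.of_nat n))%C.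
Proof.
  induction n as [|n IH]; cbn [zrange lsum fold_right].
  - simpl; ring.
  - fold (lsum (fun m => q (m - 1)%Z - q m)%C (zrange n)); rewrite IH.
    replace (Z.of_nat (S n) - 1)%Z with (Z.of_nat n) by lia.
    replace (- Z.of_nat n - 1)%Z with (- Z.of_nat (S n))%Z by lia; ring.
Qed.

(* Chernoff's argument: P(u) - P(0) = (e(u) - 1) Q(u) with Q continuous, so the partial sums of the
   coefficients of P telescope to coefficients of Q, which vanish at infinity. *)
Lemma fourier_inversion_at_0 (P P' : R -> C) : (forall u, tder P u (P' u)) -> (forall u, P (u + 1) = P u) ->
  forall eps, 0 < eps -> exists n0, forall n, (n0 <= n)%nat -> Cmod (lsum (fc P) (zrange n) - P 0) < eps.
Proof.
  intros D Per.
  assert (PerZ : forall n u, P (u + IZR n) = P u).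
  { assert (N : forall (k : nat) u, P (u + INR k) = P u).
    { induction k as [|k IH]; intros u; [rewrite Rplus_0_r; auto|].
      rewrite S_INR, <- Rplus_assoc, Per; auto. }
    intros n u; destruct (Z_le_dec 0 n).
    - rewrite <- (Z2Nat.id n), <- INR_IZR_INZ by auto; apply N.
    - rewrite <- (N (Z.to_nat (- n)) (u + IZR n)), INR_IZR_INZ, Z2Nat.id, opp_IZR by lia; f_equal; ring. }
  set (c0 := (RtoC (2 * PI) * Ci)%C).
  pose proof PI_RGT_0 as HP.
  assert (Hc0 : c0 <> 0).
  { apply Cmod_gt_0; unfold c0; rewrite Cmod_mult, Cmod_R, Cmod_Ci, Rabs_pos_eq; lra. }
  (* The value at the integers is the limit of the quotient there, P'(0) / (2 pi i). *)
  set (Q := fun u => if excluded_middle_informative (ex1 u = RtoC 1) then (P' 0 / c0)%C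
                     else ((P u - P 0%R) * / (ex1 u - 1))%C).
  assert (CP : forall x, ccont P x) by (intros; eapply tder_ccont; eauto).
  assert (C1 : forall x, ccont ex1 x).
  { intros x; apply (ccont_ext_loc (fun u => ex1 (1 * u)) _ x 1); [lra| |apply ccont_ex1].
    intros; rewrite Rmult_1_l; auto. }
  assert (QP : forall u, (P u - P 0%R = (ex1 u - 1) * Q u)%C).
  { intros u; unfold Q; destruct (excluded_middle_informative _) as [E|E].
    - destruct (ex1_eq_1 u E) as [n ->]; rewrite E, <- (PerZ n 0), Rplus_0_l; ring.
    - field; intros K; apply E; replace (ex1 u) with (ex1 u - 1 + 1)%C by ring; rewrite K; ring. }
  assert (CQ : forall x, ccont Q x).
  { intros x; destruct (excluded_middle_informative (ex1 x = RtoC 1)) as [E|E].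
    - destruct (ex1_eq_1 x E) as [n Hn].
      destruct (D 0) as [K [d [Hd HK]]].
      destruct (tder_ex1 1 0) as [K1 [d1 [Hd1 HK1]]].
      rewrite Rmult_1_r, Rmult_0_r, ex1_0, Cmult_1_r in HK1; fold c0 in HK1.
      set (B := (2 * PI * Rabs K + Cmod (P' 0) * Rabs K1) / (2 * PI) + 1).
      assert (HB : 0 < B).
      { unfold B; pose proof (Rabs_pos K); pose proof (Rabs_pos K1); pose proof (Cmod_ge_0 (P' 0)).
        enough (0 <= (2 * PI * Rabs K + Cmod (P' 0) * Rabs K1) / (2 * PI)) by lra.
        apply Rdiv_le_0_compat; [|lra].
        apply Rplus_le_le_0_compat; apply Rmult_le_pos; lra. }
      intros eps He.
      set (dd := Rmin (Rmin d d1) (Rmin (/ (Rabs K1 + 1)) (eps / B))).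
      exists dd; split.
      { pose proof (Rabs_pos K1); repeat apply Rmin_pos; auto; [apply Rinv_0_lt_compat; lra|apply Rdiv_lt_0_compat; lra]. }
      intros h Hh.
      assert (h1 : Rabs h < Rmin d d1) by (eapply Rlt_le_trans; [apply Hh|apply Rmin_l]).
      assert (h2 : Rabs h < Rmin (/ (Rabs K1 + 1)) (eps / B)) by (eapply Rlt_le_trans; [apply Hh|apply Rmin_r]).
      assert (h3 : Rabs h < d) by (eapply Rlt_le_trans; [apply h1|apply Rmin_l]).
      assert (h4 : Rabs h < d1) by (eapply Rlt_le_trans; [apply h1|apply Rmin_r]).
      assert (h5 : Rabs h < / (Rabs K1 + 1)) by (eapply Rlt_le_trans; [apply h2|apply Rmin_l]).
      assert (h6 : Rabs h < eps / B) by (eapply Rlt_le_trans; [apply h2|apply Rmin_r]).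
      specialize (HK h ltac:(lra)); specialize (HK1 h ltac:(lra)); rewrite Rplus_0_l, ?Rmult_1_l in *.
      unfold Q; destruct (excluded_middle_informative (ex1 x = RtoC 1)) as [_|]; [|contradiction].
      destruct (excluded_middle_informative _) as [E1|E1].
      { replace (_ - _)%C with (RtoC 0) by ring; rewrite Cmod_0; auto. }
      rewrite Hn, (Rplus_comm (IZR n)), PerZ, ex1_period.
      rewrite Hn, (Rplus_comm (IZR n)), ex1_period in E1.
      assert (NZ : (ex1 h - 1)%C <> 0).
      { intros X; apply E1; replace (ex1 h) with (ex1 h - 1 + 1)%C by ring; rewrite X; ring. }
      assert (Hh0 : 0 < Rabs h).
      { apply Rabs_pos_lt; intros ->; apply E1; apply ex1_0. }
      set (e1 := (P h - P 0%R - RtoC h * P' 0)%C) in *; set (e2 := (ex1 h - 1 - RtoC h * c0)%C) in *.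
      replace (_ - _)%C with ((c0 * e1 - P' 0 * e2) / (c0 * (ex1 h - 1)))%C
        by (unfold e1, e2; field; split; auto).
      assert (Cc : Cmod c0 = 2 * PI) by (unfold c0; rewrite Cmod_mult, Cmod_R, Cmod_Ci, Rabs_pos_eq; lra).
      rewrite Cmod_div, Cmod_mult, Cc by (apply Cmult_neq_0; auto).
      (* Near 0 the modulus of e(h) - 1 is at least 2 pi |h| minus an error of at most |h|, hence at
         least |h|. *)
      assert (L : Rabs h <= Cmod (ex1 h - 1)).
      { assert (2 * PI * Rabs h <= Cmod (ex1 h - 1) + Cmod e2).
        { replace (2 * PI * Rabs h) with (Cmod (RtoC h * c0)) by (rewrite Cmod_mult, Cmod_R, Cc; ring).
          replace (RtoC h * c0)%C with ((ex1 h - 1) - e2)%C by (unfold e2; ring); apply Cmod_minus_triangle. }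
        assert (Cmod e2 <= Rabs h).
        { eapply Rle_trans; [apply HK1|]; rewrite Rabs_sqr.
          assert ((Rabs K1 + 1) * Rabs h < 1).
          { pose proof (Rabs_pos K1); replace 1 with ((Rabs K1 + 1) * / (Rabs K1 + 1)) at 2 by (field; lra).
            apply Rmult_lt_compat_l; lra. }
          pose proof (Rle_abs K1); nra. }
        pose proof PI2_1; nra. }
      apply Rlt_div_l; [apply Rmult_lt_0_compat; lra|].
      apply Rle_lt_trans with ((2 * PI * Rabs K + Cmod (P' 0) * Rabs K1) * (Rabs h * Rabs h)).
      { eapply Rle_trans; [apply Cmod_minus_triangle|]; rewrite !Cmod_mult, Cc, <- Rabs_sqr.
        pose proof (Rle_abs K); pose proof (Rle_abs K1); pose proof (Cmod_ge_0 (P' 0)).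
        assert (Cmod e1 <= Rabs K * (h * h)) by nra.
        assert (Cmod e2 <= Rabs K1 * (h * h)) by nra.
        assert (2 * PI * Cmod e1 <= 2 * PI * (Rabs K * (h * h))) by (apply Rmult_le_compat_l; lra).
        assert (Cmod (P' 0) * Cmod e2 <= Cmod (P' 0) * (Rabs K1 * (h * h))) by (apply Rmult_le_compat_l; lra).
        lra. }
      apply Rle_lt_trans with (Rabs h * B * (2 * PI * Rabs h)).
      { unfold B; set (X := 2 * PI * Rabs K + Cmod (P' 0) * Rabs K1).
        replace (Rabs h * (X / (2 * PI) + 1) * (2 * PI * Rabs h)) with
          (X * (Rabs h * Rabs h) + 2 * PI * (Rabs h * Rabs h)) by (field; lra).
        assert (0 <= 2 * PI * (Rabs h * Rabs h)) by (apply Rmult_le_pos; nra); lra. }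
      apply Rlt_le_trans with (eps * (2 * PI * Rabs h)).
      { apply Rmult_lt_compat_r; [nra|].
        apply Rlt_le_trans with (eps / B * B); [apply Rmult_lt_compat_r; auto|right; field; lra]. }
      apply Rmult_le_compat_l; [lra|]; apply Rmult_le_compat_l; lra.
    - assert (NZ : (ex1 x - 1)%C <> 0).
      { intros X; apply E; replace (ex1 x) with (ex1 x - 1 + 1)%C by ring; rewrite X; ring. }
      assert (Cd : ccont (fun u => ex1 u - 1)%C x) by (apply (ccont_plus _ (fun _ => - (1))%C); auto; apply ccont_const).
      assert (Cf : ccont (fun u => (P u - P 0%R) * / (ex1 u - 1))%C x).
      { apply ccont_mult; [apply (ccont_plus _ (fun _ => - P 0%R)%C); auto; apply ccont_const|].
        apply (ccont_inv (fun u => ex1 u - 1)%C); auto. }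
      destruct (Cd (Cmod (ex1 x - 1)) (proj1 (Cmod_gt_0 _) NZ)) as [d [Hd K]].
      apply (ccont_ext_loc _ Q x d Hd) in Cf; auto.
      intros h Hh; specialize (K h Hh); unfold Q; destruct (excluded_middle_informative _) as [X|X]; auto.
      exfalso; rewrite X in K; replace (1 - 1 - (ex1 x - 1))%C with (- (ex1 x - 1))%C in K by ring.
      rewrite Cmod_opp in K; lra. }
  assert (PQ : forall u, Q (u + 1) = Q u).
  { intros u; unfold Q; rewrite Per; change 1 with (IZR 1) at 1; replace (ex1 (u + 1)) with (ex1 u); auto.
    change 1 with (IZR 1); rewrite ex1_period; auto. }
  assert (FC : forall m, fc P m = (fc (fun _ => P 0%R) m + (fc Q (m - 1) - fc Q m))%C).
  { intros m; unfold fc, Cminus.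
    replace (- Cint (fun u => Q u * ex1 (- IZR m * u)) 0 1)%C with
      (Cint (fun u => (- (1)) * (Q u * ex1 (- IZR m * u)))%C 0 1).
    2:{ rewrite Cint_scal; [ring|]; intros; apply ccont_mult; auto; apply ccont_ex1. }
    rewrite <- !Cint_plus.
    - apply Cint_ext; intros u.
      replace (P u) with (P 0%R + (ex1 u - 1) * Q u)%C by (rewrite <- QP; ring).
      replace (- IZR (m - 1) * u) with (- IZR m * u + u) by (rewrite minus_IZR; ring).
      rewrite ex1_plus; ring.
    - intros; apply ccont_mult; [apply ccont_const|apply ccont_ex1].
    - intros; apply ccont_plus; [apply ccont_mult; auto; apply ccont_ex1|].
      apply ccont_mult; [apply ccont_const|]; apply ccont_mult; auto; apply ccont_ex1.
    - intros; apply ccont_mult; auto; apply ccont_ex1.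
    - intros; apply ccont_mult; [apply ccont_const|]; apply ccont_mult; auto; apply ccont_ex1. }
  intros eps He; destruct (riemann_lebesgue Q CQ PQ (eps / 2)) as [M HM]; [lra|].
  exists (Z.to_nat M); intros n Hn.
  rewrite (lsum_ext_in _ (fun m => fc (fun _ => P 0%R) m + (fc Q (m - 1) - fc Q m))%C) by auto.
  rewrite lsum_plus, lsum_fc_const, (lsum_telescope (fc Q)).
  replace (P 0 + (fc Q (- Z.of_nat n - 1) - fc Q (Z.of_nat n)) - P 0)%C
    with (fc Q (- Z.of_nat n - 1) - fc Q (Z.of_nat n))%C by ring.
  eapply Rle_lt_trans; [apply Cmod_minus_triangle|].
  pose proof (HM (- Z.of_nat n - 1)%Z ltac:(lia)); pose proof (HM (Z.of_nat n) ltac:(lia)); lra.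
Qed.

(** * One-dimensional theta series *)

(** Choice makes the sum total, so that theta functions are defined for all arguments; the value has
    a meaning where [USum_usum] applies. *)
Definition USum {I} (f : I -> C) : C := epsilon (inhabits (RtoC 0)) (usum f).

Lemma USum_correct {I} (f : I -> C) l : usum f l -> USum f = l.
Proof. intros H; apply (usum_unique f); auto; unfold USum; apply epsilon_spec; exists l; auto. Qed.

Lemma USum_usum {I} (f : I -> C) : (exists l, usum f l) -> usum f (USum f).
Proof. intros H; unfold USum; apply epsilon_spec, H. Qed.

Lemma usum_taylor {I} (f : I -> R -> C) (f' : I -> C) (F : R -> C) L s d g B :
  0 <= d -> (forall h, Rabs h <= d -> usum (fun i => f i (s + h)%R) (F (s + h)%R)) -> usum f' L ->
  (forall i h, Rabs h <= d -> Cmod (f i (s + h)%R - f i s - RtoC h * f' i) <= g i * (h * h)) ->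
  bounded_sum g B ->
  forall h, Rabs h <= d -> Cmod (F (s + h)%R - F s - RtoC h * L) <= B * (h * h).
Proof.
  intros Hd HF HL HE HB h Hh.
  apply (usum_bound (fun i => f i (s + h)%R - f i s - RtoC h * f' i)%C (fun i => (h * h) * g i)).
  - pose proof (HF 0 ltac:(rewrite Rabs_R0; auto)) as H0; rewrite Rplus_0_r in H0.
    replace (F (s + h)%R - F s - RtoC h * L)%C with (F (s + h)%R + - (1) * F s + - RtoC h * L)%C by ring.
    eapply usum_ext; [|apply usum_plus; [apply usum_plus; [apply HF, Hh|apply usum_scal, H0]|apply usum_scal, HL]].
    intros i; simpl; ring.
  - intros i; rewrite (Rmult_comm _ (g i)); auto.
  - rewrite (Rmult_comm B); apply bounded_sum_scal; auto; nra.
Qed.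

Definition gauss (t : R) (b z : C) : C :=
  Cexp (RtoC (PI * (t * t)) * Ci * z + RtoC (2 * PI * t) * Ci * b).

Lemma Cmod_gauss t b z : Cmod (gauss t b z) = exp (- PI * Im z * (t * t) - 2 * PI * Im b * t).
Proof. unfold gauss; rewrite Cmod_Cexp; f_equal; destruct b, z; simpl; ring. Qed.

Lemma abs_le_exp t : Rabs t <= exp (Rabs t).
Proof. pose proof (exp_ineq1_le (Rabs t)); lra. Qed.

(** Uniformity in u, b and z on a half-plane lets one majorant serve for convergence, for Taylor
    estimates and for integration over a period. *)
Lemma gauss_dominated y0 B D U : 0 < y0 -> exists K, 0 <= K /\ forall n u b z,
  Rabs u <= U -> y0 <= Im z -> Rabs (Im b) <= B ->
  exp (D * Rabs (IZR n + u)) * Cmod (gauss (IZR n + u) b z) <= K * wZ n.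
Proof.
  intros Hy; pose proof PI_RGT_0 as HP.
  set (c := PI * y0); assert (Hc : 0 < c) by (unfold c; nra).
  set (G := D + 2 * PI * B).
  (* Maximum of -c t^2 + (G + 1)|t|: the extra 1 leaves the weight exp(-|n|), and U pays for
     replacing |t| by |n|. *)
  exists (exp ((G + 1) * (G + 1) / (4 * c) + U)); split; [apply Rlt_le, exp_pos|].
  intros n u b z Hu Hz Hb; rewrite Cmod_gauss; unfold wZ; rewrite <- !exp_plus; apply exp_mono.
  set (t := IZR n + u).
  assert (Hn : Rabs (IZR n) <= Rabs t + U).
  { replace (IZR n) with (t - u) by (unfold t; ring); eapply Rle_trans; [apply Rabs_triang|]; rewrite Rabs_Ropp; lra. }
  assert (Q : - (2 * PI * Im b * t) <= 2 * PI * B * Rabs t).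
  { eapply Rle_trans; [apply Rle_abs|]; rewrite Rabs_Ropp, !Rabs_mult, (Rabs_pos_eq 2), (Rabs_pos_eq PI) by lra.
    pose proof (Rabs_pos t); assert (Rabs (Im b) * Rabs t <= B * Rabs t) by (apply Rmult_le_compat_r; auto); nra. }
  assert (Q2 : - PI * Im z * (t * t) <= - c * (Rabs t * Rabs t)).
  { rewrite <- Rabs_sqr; unfold c; assert (PI * y0 * (t * t) <= PI * Im z * (t * t)); [|lra].
    apply Rmult_le_compat_r; [nra|apply Rmult_le_compat_l; lra]. }
  assert (Q3 : - c * (Rabs t * Rabs t) + (G + 1) * Rabs t <= (G + 1) * (G + 1) / (4 * c)).
  { apply Rle_div_r; [lra|]. pose proof (Rle_0_sqr (2 * c * Rabs t - (G + 1))) as S; unfold Rsqr in S; nra. }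
  unfold G in *; lra.
Qed.

(* Functions whose first order expansion is controlled by the Gaussian up to an exponential factor. *)
Definition gauss_tame (b z : C) (f f' : R -> C) : Prop :=
  exists A D, 0 <= A /\ 0 <= D /\
    (forall t h, Rabs h <= 1 ->
       Cmod (f (t + h)%R - f t - RtoC h * f' t) <= A * (exp (D * Rabs t) * Cmod (gauss t b z)) * (h * h)) /\
    (forall t, Cmod (f' t) <= A * (exp (D * Rabs t) * Cmod (gauss t b z))).

Lemma exp_D_mono D D' t x : D <= D' -> 0 <= x -> exp (D * Rabs t) * x <= exp (D' * Rabs t) * x.
Proof. intros; apply Rmult_le_compat_r; auto; apply exp_mono, Rmult_le_compat_r; auto using Rabs_pos. Qed.

Definition mono (j : nat) (b z : C) (t : R) : C := (RtoC (t ^ j) * gauss t b z)%C.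

(** The successor case is the Leibniz rule for t times the previous monomial. *)
Fixpoint dmono (j : nat) (b z : C) (t : R) : C :=
  match j with
  | O => (RtoC (2 * PI) * Ci * (RtoC t * z + b) * gauss t b z)%C
  | S i => (mono i b z t + RtoC t * dmono i b z t)%C
  end.

Lemma mono_bound j b z t : Cmod (mono j b z t) <= exp (INR j * Rabs t) * Cmod (gauss t b z).
Proof.
  unfold mono; rewrite Cmod_mult, Cmod_R; apply Rmult_le_compat_r; [apply Cmod_ge_0|].
  rewrite <- RPow_abs. induction j as [|j IH]; [simpl; rewrite Rmult_0_l, exp_0; lra|].
  rewrite S_INR, Rmult_plus_distr_r, Rmult_1_l, exp_plus, Rmult_comm; simpl.
  rewrite Rmult_comm. rewrite (Rmult_comm (exp _)).
  apply Rmult_le_compat; auto using Rabs_pos, abs_le_exp. apply pow_le, Rabs_pos.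
Qed.

Lemma gauss_shift t h b z :
  gauss (t + h) b z = (gauss t b z * Cexp (RtoC h * (RtoC (2 * PI) * Ci * (RtoC t * z + b))
     + RtoC (h * h) * (RtoC PI * Ci * z)))%C.
Proof.
  unfold gauss; rewrite <- Cexp_plus; f_equal.
  rewrite !RtoC_mult, !RtoC_plus; ring.
Qed.

(** Bounds the two coefficients of the exponent in [gauss_shift]; their growth in t is what the
    exponential factor of [gauss_tame] absorbs. *)
Lemma linear_growth (z b : C) t :
  Cmod (RtoC (2 * PI) * Ci * (RtoC t * z + b)) + Cmod (RtoC PI * Ci * z)
  <= 2 * PI * (Cmod z + Cmod b) * (1 + Rabs t).
Proof.
  pose proof PI_RGT_0; rewrite !Cmod_mult, !Cmod_R, Cmod_Ci, !Rabs_pos_eq by lra.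
  assert (Cmod (RtoC t * z + b) <= Rabs t * Cmod z + Cmod b)
    by (eapply Rle_trans; [apply Cmod_triangle|]; rewrite Cmod_mult, Cmod_R; lra).
  pose proof (Cmod_ge_0 z); pose proof (Cmod_ge_0 b); pose proof (Rabs_pos t).
  assert (0 <= PI * Cmod z) by nra. assert (0 <= PI * (Cmod b * Rabs t)) by (apply Rmult_le_pos; nra).
  assert (2 * PI * Cmod (RtoC t * z + b) <= 2 * PI * (Rabs t * Cmod z + Cmod b)) by (apply Rmult_le_compat_l; lra).
  nra.
Qed.

Lemma gauss_tame_0 b z : gauss_tame b z (mono 0 b z) (dmono 0 b z).
Proof.
  pose proof PI_RGT_0.
  set (X := 2 * PI * (Cmod z + Cmod b)).
  assert (HX : 0 <= X) by (unfold X; pose proof (Cmod_ge_0 z); pose proof (Cmod_ge_0 b); apply Rmult_le_pos; lra).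
  exists (2 * X ^ 2 * exp X + X), (2 + X).
  assert (HA : 0 <= 2 * X ^ 2 * exp X).
  { apply Rmult_le_pos; [apply Rmult_le_pos; [lra|apply pow_le; auto]|apply Rlt_le, exp_pos]. }
  split; [lra|]; split; [lra|].
  assert (G : forall t, 1 + Rabs t <= exp (Rabs t)) by (intros; apply exp_ineq1_le).
  split.
  - intros t h Hh; unfold mono; simpl pow.
    rewrite gauss_shift; simpl dmono.
    set (a := (RtoC (2 * PI) * Ci * (RtoC t * z + b))%C); set (c := (RtoC PI * Ci * z)%C).
    replace (_ - _ - _)%C with (gauss t b z * (Cexp (RtoC h * a + RtoC (h * h) * c) - 1 - RtoC h * a))%C
      by ring.
    rewrite Cmod_mult.
    assert (S : Cmod a + Cmod c <= X * (1 + Rabs t)) by apply linear_growth.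
    pose proof (Cmod_ge_0 a); pose proof (Cmod_ge_0 c); pose proof (Rabs_pos t); pose proof (Cmod_ge_0 (gauss t b z)).
    assert (S1 : 2 * (Cmod a + Cmod c) ^ 2 * exp (Cmod a + Cmod c) + Cmod c <=
       (2 * X ^ 2 * exp X + X) * exp ((2 + X) * Rabs t)).
    { rewrite Rmult_plus_distr_r; apply Rplus_le_compat.
      - replace (2 * X ^ 2 * exp X * exp ((2 + X) * Rabs t)) with
          (2 * (X * exp (Rabs t)) ^ 2 * exp (X + X * Rabs t)).
        + apply Rmult_le_compat.
          * apply Rmult_le_pos; [lra|apply pow_le; lra].
          * apply Rlt_le, exp_pos.
          * apply Rmult_le_compat_l; [lra|apply pow_incr; split; [lra|]].
            eapply Rle_trans; [apply S|]; apply Rmult_le_compat_l; auto.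
          * apply exp_mono; lra.
        + rewrite exp_plus; replace ((2 + X) * Rabs t) with (Rabs t + Rabs t + X * Rabs t) by ring.
          rewrite !exp_plus; ring.
      - apply Rle_trans with (X * (1 + Rabs t)); [lra|]; apply Rmult_le_compat_l; auto.
        eapply Rle_trans; [apply G|]; apply exp_mono; nra. }
    eapply Rle_trans; [apply Rmult_le_compat_l; [auto|apply Cexp_quadratic_estimate, Hh]|].
    rewrite <- Rmult_assoc; apply Rmult_le_compat_r; [nra|].
    rewrite <- Rmult_assoc, Rmult_comm; apply Rmult_le_compat_r; auto.
  - intros t; simpl; rewrite Cmod_mult, <- Rmult_assoc; apply Rmult_le_compat_r; [apply Cmod_ge_0|].
    pose proof (linear_growth z b t) as L; fold X in L; pose proof (Cmod_ge_0 (RtoC PI * Ci * z)).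
    pose proof (Rabs_pos t).
    apply Rle_trans with (X * exp ((2 + X) * Rabs t)).
    + apply Rle_trans with (X * (1 + Rabs t)); [lra|]; apply Rmult_le_compat_l; auto.
      eapply Rle_trans; [apply G|]; apply exp_mono; nra.
    + apply Rmult_le_compat_r; [apply Rlt_le, exp_pos|lra].
Qed.

(** Multiplication by t is paid for by |t| <= exp |t|, an increase of the exponential rate. The
    cross term h^2 f' is the reason why [gauss_tame] also bounds f'. *)
Lemma gauss_tame_mono j b z : gauss_tame b z (mono j b z) (dmono j b z).
Proof.
  induction j as [|j [A [D [HA [HD [H1 H2]]]]]]; [apply gauss_tame_0|].
  exists (3 * A + 1), (D + 1 + INR j); split; [lra|]; pose proof (pos_INR j); split; [lra|].
  assert (ES : forall t, mono (S j) b z t = (RtoC t * mono j b z t)%C)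
    by (intros t; unfold mono; simpl; rewrite RtoC_mult; ring).
  assert (W1 : forall t, exp (D * Rabs t) * Cmod (gauss t b z) <= exp ((D + 1 + INR j) * Rabs t) * Cmod (gauss t b z))
    by (intros; apply exp_D_mono; [lra|apply Cmod_ge_0]).
  assert (W2 : forall t, Rabs t * (exp (D * Rabs t) * Cmod (gauss t b z)) <= exp ((D + 1 + INR j) * Rabs t) * Cmod (gauss t b z)).
  { intros t; rewrite <- Rmult_assoc; apply Rmult_le_compat_r; [apply Cmod_ge_0|].
    apply Rle_trans with (exp (Rabs t) * exp (D * Rabs t)).
    - apply Rmult_le_compat_r; [apply Rlt_le, exp_pos|apply abs_le_exp].
    - rewrite <- exp_plus; apply exp_mono; pose proof (Rabs_pos t); nra. }
  assert (W3 : forall t, Cmod (mono j b z t) <= exp ((D + 1 + INR j) * Rabs t) * Cmod (gauss t b z)).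
  { intros t; eapply Rle_trans; [apply mono_bound|]; apply exp_D_mono; [lra|apply Cmod_ge_0]. }
  split.
  - intros t h Hh; rewrite !ES; simpl dmono.
    set (e := (mono j b z (t + h) - mono j b z t - RtoC h * dmono j b z t)%C).
    replace (_ - _ - _)%C with (RtoC t * e + RtoC h * e + RtoC (h * h) * dmono j b z t)%C
      by (unfold e; rewrite RtoC_plus, RtoC_mult; ring).
    specialize (H1 t h Hh); specialize (H2 t); specialize (W1 t); specialize (W2 t); fold e in H1.
    eapply Rle_trans; [apply Cmod_triangle|].
    eapply Rle_trans; [apply Rplus_le_compat_r, Cmod_triangle|].
    rewrite !Cmod_mult, !Cmod_R, (Rabs_pos_eq (h * h)) by nra.
    set (x := exp (D * Rabs t) * Cmod (gauss t b z)) in *.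
    set (y := exp ((D + 1 + INR j) * Rabs t) * Cmod (gauss t b z)) in *.
    pose proof (Rabs_pos t); pose proof (Rabs_pos h); pose proof (Cmod_ge_0 e).
    assert (hh : 0 <= h * h) by nra.
    assert (Y : 0 <= y) by (apply Rmult_le_pos; [apply Rlt_le, exp_pos|apply Cmod_ge_0]).
    assert (T1 : Rabs t * Cmod e <= A * y * (h * h)).
    { apply Rle_trans with (Rabs t * (A * x * (h * h))); [apply Rmult_le_compat_l; auto|].
      replace (Rabs t * (A * x * (h * h))) with ((A * (Rabs t * x)) * (h * h)) by ring.
      apply Rmult_le_compat_r; auto; apply Rmult_le_compat_l; auto. }
    assert (T2 : Rabs h * Cmod e <= A * y * (h * h)).
    { apply Rle_trans with (1 * (A * x * (h * h))); [apply Rmult_le_compat; auto|rewrite Rmult_1_l].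
      apply Rmult_le_compat_r; auto; apply Rmult_le_compat_l; auto. }
    assert (T3 : h * h * Cmod (dmono j b z t) <= A * y * (h * h)).
    { rewrite Rmult_comm; apply Rmult_le_compat_r; auto; eapply Rle_trans; [apply H2|]; apply Rmult_le_compat_l; auto. }
    assert (0 <= y * (h * h)) by nra. lra.
  - intros t; simpl; eapply Rle_trans; [apply Cmod_triangle|]; rewrite Cmod_mult, Cmod_R.
    specialize (W2 t); specialize (W3 t); specialize (H2 t).
    set (x := exp (D * Rabs t) * Cmod (gauss t b z)) in *.
    set (y := exp ((D + 1 + INR j) * Rabs t) * Cmod (gauss t b z)) in *.
    pose proof (Rabs_pos t).
    assert (Rabs t * Cmod (dmono j b z t) <= A * y).
    { apply Rle_trans with (Rabs t * (A * x)); [apply Rmult_le_compat_l; auto|].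
      replace (Rabs t * (A * x)) with (A * (Rabs t * x)) by ring; apply Rmult_le_compat_l; auto. }
    assert (Y : 0 <= A * y) by (apply Rmult_le_pos; auto; apply Rmult_le_pos; [apply Rlt_le, exp_pos|apply Cmod_ge_0]).
    lra.
Qed.

Definition th (j : nat) (u : R) (b z : C) : C := USum (fun n : Z => mono j b z (IZR n + u)).

Lemma dominated_usum (f : Z -> C) A D b z u : 0 < Im z ->
  (forall n, Cmod (f n) <= A * (exp (D * Rabs (IZR n + u)) * Cmod (gauss (IZR n + u) b z))) -> 0 <= A ->
  exists l, usum f l.
Proof.
  intros Hz H HA.
  destruct (gauss_dominated (Im z) (Rabs (Im b)) D (Rabs u) Hz) as [K [HK B]].
  apply (usum_ex f (fun n => (A * K) * wZ n) (A * K * 3)).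
  - intros n; eapply Rle_trans; [apply H|]; rewrite Rmult_assoc; apply Rmult_le_compat_l; auto.
    apply B; lra.
  - apply bounded_sum_scal; [nra|apply wZ_bounded].
Qed.

Lemma th_usum j u b z : 0 < Im z -> usum (fun n : Z => mono j b z (IZR n + u)) (th j u b z).
Proof.
  intros Hz; apply USum_usum, (dominated_usum _ 1 (INR j) b z u Hz); [|lra].
  intros n; rewrite Rmult_1_l; apply mono_bound.
Qed.

Lemma th_period j u b z : 0 < Im z -> th j (u + 1) b z = th j u b z.
Proof.
  intros Hz; apply USum_correct.
  apply (usum_ext (fun n => mono j b z (IZR (n + 1) + u))).
  - intros n; rewrite plus_IZR; f_equal; ring.
  - apply (usum_bij (fun n => n + 1)%Z (fun n => n - 1)%Z (fun n => mono j b z (IZR n + u)));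
      [intros; lia|intros; lia|apply th_usum, Hz].
Qed.

Lemma th_tder_u j u b z : 0 < Im z -> exists l, usum (fun n => dmono j b z (IZR n + u)) l /\
  tder (fun v => th j v b z) u l.
Proof.
  intros Hz; destruct (gauss_tame_mono j b z) as [A [D [HA [HD [H1 H2]]]]].
  destruct (dominated_usum (fun n => dmono j b z (IZR n + u)) A D b z u Hz) as [l Hl]; auto.
  exists l; split; auto.
  destruct (gauss_dominated (Im z) (Rabs (Im b)) D (Rabs u) Hz) as [K [HK B]].
  exists (A * K * 3), 1; split; [lra|].
  apply (usum_taylor (fun n v => mono j b z (IZR n + v)) (fun n => dmono j b z (IZR n + u)) (fun v => th j v b z) l u 1
     (fun n => A * K * wZ n)); auto; [lra|intros; apply th_usum, Hz| |].
  - intros n h Hh; rewrite <- Rplus_assoc; eapply Rle_trans; [apply H1; auto|].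
    apply Rmult_le_compat_r; [nra|]; rewrite Rmult_assoc; apply Rmult_le_compat_l; auto; apply B; lra.
  - apply bounded_sum_scal; [nra|apply wZ_bounded].
Qed.

Lemma th_ccont j b z x : 0 < Im z -> ccont (fun v => th j v b z) x.
Proof. intros Hz; destruct (th_tder_u j x b z Hz) as [l [_ H]]; eapply tder_ccont; eauto. Qed.

Lemma th0_tder_u u b z : 0 < Im z ->
  tder (fun v => th 0 v b z) u (RtoC (2 * PI) * Ci * (z * th 1 u b z + b * th 0 u b z))%C.
Proof.
  intros Hz; destruct (th_tder_u 0 u b z Hz) as [l [Hl H]].
  replace (_ * _)%C with l; auto.
  eapply usum_unique; [apply Hl|].
  eapply usum_ext; [|apply usum_scal, usum_plus; apply usum_scal; apply th_usum, Hz].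
  intros n; simpl; unfold mono; simpl; rewrite Rmult_1_r; ring.
Qed.

Lemma th1_tder_u u z : 0 < Im z ->
  tder (fun v => th 1 v 0 z) u (th 0 u 0 z + RtoC (2 * PI) * Ci * z * th 2 u 0 z)%C.
Proof.
  intros Hz; destruct (th_tder_u 1 u 0 z Hz) as [l [Hl H]].
  replace (_ + _)%C with l; auto.
  eapply usum_unique; [apply Hl|].
  eapply usum_ext; [|apply usum_plus; [|apply usum_scal]; apply th_usum, Hz].
  intros n; simpl; unfold mono; simpl; rewrite !Rmult_1_r, !RtoC_mult; ring.
Qed.

Lemma gauss_shift_b t b beta z h :
  gauss t (b + RtoC h * beta) z = (gauss t b z * Cexp (RtoC h * (RtoC (2 * PI * t) * Ci * beta)))%C.
Proof. unfold gauss; rewrite <- Cexp_plus; f_equal; ring. Qed.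

Lemma gauss_shift_z t b z zeta h :
  gauss t b (z + RtoC h * zeta) = (gauss t b z * Cexp (RtoC h * (RtoC (PI * (t * t)) * Ci * zeta)))%C.
Proof. unfold gauss; rewrite <- Cexp_plus; f_equal; ring. Qed.

Lemma Im_RtoC_mult h (b : C) : Im (RtoC h * b) = h * Im b.
Proof. destruct b; simpl; ring. Qed.

(** The constant is uniform over the period u in [0, 1], so that the estimate can be integrated into
    a derivative of [gint]. *)
Lemma th_taylor_b b beta z : 0 < Im z -> exists K, forall u h, 0 <= u <= 1 -> Rabs h <= 1 ->
  Cmod (th 0 u (b + RtoC h * beta) z - th 0 u b z - RtoC h * (RtoC (2 * PI) * Ci * beta * th 1 u b z)) <= K * (h * h).
Proof.
  intros Hz; pose proof PI_RGT_0.
  set (X := 2 * PI * Cmod beta).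
  assert (HX : 0 <= X) by (unfold X; pose proof (Cmod_ge_0 beta); apply Rmult_le_pos; lra).
  destruct (gauss_dominated (Im z) (Rabs (Im b)) (2 + X) 1 Hz) as [K [HK B]].
  exists (2 * X ^ 2 * K * 3); intros u h Hu.
  assert (HA : 0 <= 2 * X ^ 2) by (apply Rmult_le_pos; [lra|apply pow_le; auto]).
  revert h.
  intros h Hh.
  pose proof (usum_taylor (fun n s => mono 0 (b + RtoC s * beta) z (IZR n + u))
    (fun n => RtoC (2 * PI) * Ci * beta * mono 1 b z (IZR n + u))%C
    (fun s => th 0 u (b + RtoC s * beta) z) (RtoC (2 * PI) * Ci * beta * th 1 u b z)%C 0 1
    (fun n => 2 * X ^ 2 * K * wZ n) (2 * X ^ 2 * K * 3) Rle_0_1) as T.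
  replace b with (b + RtoC 0 * beta)%C at 2 by ring.
  rewrite <- (Rplus_0_l h) at 1; apply T; auto.
  - intros; apply th_usum, Hz.
  - apply usum_scal, th_usum, Hz.
  - clear T h Hh; intros n h Hh; rewrite Rplus_0_l.
    replace (b + RtoC 0 * beta)%C with b by ring.
    set (t := IZR n + u); unfold mono; simpl pow; rewrite gauss_shift_b, Rmult_1_r.
    set (a := (RtoC (2 * PI * t) * Ci * beta)%C).
    replace (_ - _ - _)%C with (gauss t b z * (Cexp (RtoC h * a + RtoC (h * h) * 0) - 1 - RtoC h * a))%C.
    2:{ replace (RtoC h * a + RtoC (h * h) * 0)%C with (RtoC h * a)%C by ring.
        unfold a; rewrite !RtoC_mult; ring. }
    rewrite Cmod_mult.
    eapply Rle_trans; [apply Rmult_le_compat_l; [apply Cmod_ge_0|apply Cexp_quadratic_estimate, Hh]|].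
    rewrite <- Rmult_assoc; apply Rmult_le_compat_r; [nra|].
    rewrite Cmod_0, !Rplus_0_r.
    assert (Ea : Cmod a = X * Rabs t).
    { unfold a, X; rewrite !Cmod_mult, Cmod_R, Cmod_Ci, !Rabs_mult, (Rabs_pos_eq 2), (Rabs_pos_eq PI) by lra; ring. }
    rewrite Ea; pose proof (Rabs_pos t).
    apply Rle_trans with (2 * X ^ 2 * (exp ((2 + X) * Rabs t) * Cmod (gauss t b z))).
    + replace (exp ((2 + X) * Rabs t)) with (exp (Rabs t) ^ 2 * exp (X * Rabs t)).
      2:{ replace ((2 + X) * Rabs t) with (Rabs t + Rabs t + X * Rabs t) by ring; rewrite !exp_plus; ring. }
      rewrite Rmult_comm, <- Rmult_assoc; apply Rmult_le_compat_r; [apply Cmod_ge_0|].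
      rewrite <- Rmult_assoc; apply Rmult_le_compat_r; [apply Rlt_le, exp_pos|].
      rewrite Rpow_mult_distr, <- Rmult_assoc; apply Rmult_le_compat_l; auto; apply pow_incr; split; auto; apply abs_le_exp.
    + rewrite (Rmult_assoc (2 * X ^ 2) K); apply Rmult_le_compat_l; auto; apply B; [rewrite Rabs_pos_eq; lra|lra|lra].
  - apply bounded_sum_scal; [apply Rmult_le_pos; auto|apply wZ_bounded].
Qed.

(** Moving z may weaken the Gaussian decay, so the step [d] keeps the imaginary part above half its
    value. *)
Lemma th_taylor_z z zeta : 0 < Im z -> exists K d, 0 < d /\ forall u h, 0 <= u <= 1 -> Rabs h <= d ->
  Cmod (th 0 u 0 (z + RtoC h * zeta) - th 0 u 0 z - RtoC h * (RtoC PI * Ci * zeta * th 2 u 0 z)) <= K * (h * h).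
Proof.
  intros Hz; pose proof PI_RGT_0.
  pose proof (Cmod_ge_0 zeta).
  set (d := Im z / 2 / (Cmod zeta + 1)).
  assert (Hd : 0 < d) by (unfold d; apply Rdiv_lt_0_compat; lra).
  assert (Hd2 : d * Cmod zeta <= Im z / 2).
  { assert (E : d * (Cmod zeta + 1) = Im z / 2) by (unfold d; field; lra); lra. }
  assert (Hz2 : 0 < Im (0, Im z / 2)) by (simpl; lra).
  set (X := PI * Cmod zeta).
  assert (HX : 0 <= X) by (unfold X; apply Rmult_le_pos; lra).
  (* The rate 4 accounts for the factor t^4 of the second-order remainder. *)
  destruct (gauss_dominated (Im z / 2) 0 4 1 ltac:(lra)) as [K [HK B]].
  exists (2 * X ^ 2 * K * 3), d; split; auto; intros u h Hu Hh.
  assert (HA : 0 <= 2 * X ^ 2) by (apply Rmult_le_pos; [lra|apply pow_le; auto]).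
  pose proof (usum_taylor (fun n s => mono 0 0 (z + RtoC s * zeta) (IZR n + u))
    (fun n => RtoC PI * Ci * zeta * mono 2 0 z (IZR n + u))%C
    (fun s => th 0 u 0 (z + RtoC s * zeta)) (RtoC PI * Ci * zeta * th 2 u 0 z)%C 0 d
    (fun n => 2 * X ^ 2 * K * wZ n) (2 * X ^ 2 * K * 3) (Rlt_le _ _ Hd)) as T.
  replace z with (z + RtoC 0 * zeta)%C at 2 by ring.
  rewrite <- (Rplus_0_l h) at 1; apply T; auto.
  - intros h' Hh'; apply th_usum; rewrite Rplus_0_l; unfold Im in *; simpl in *.
    rewrite Rmult_0_l, Rplus_0_r.
    assert (Rabs (h' * snd zeta) <= Im z / 2).
    { rewrite Rabs_mult; eapply Rle_trans; [|apply Hd2]; apply Rmult_le_compat; auto using Rabs_pos; apply im_le_Cmod. }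
    unfold Im in *; apply Rabs_le_between in H1; lra.
  - apply usum_scal, th_usum, Hz.
  - clear T h Hh; intros n h Hh; rewrite Rplus_0_l.
    replace (z + RtoC 0 * zeta)%C with z by ring.
    set (t := IZR n + u); unfold mono; simpl pow; rewrite gauss_shift_z, Rmult_1_r.
    set (w := (RtoC h * (RtoC (PI * (t * t)) * Ci * zeta))%C).
    replace (_ - _ - _)%C with (gauss t 0 z * (Cexp w - 1 - w))%C
      by (unfold w; rewrite !RtoC_mult; ring).
    assert (tt0 : 0 <= t * t) by nra.
    assert (Ew : Cmod w = Rabs h * X * (t * t)).
    { unfold w, X; rewrite !Cmod_mult, !Cmod_R, Cmod_Ci, Rabs_mult, (Rabs_pos_eq PI), (Rabs_pos_eq (t * t)) by lra; ring. }
    rewrite Cmod_mult.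
    eapply Rle_trans; [apply Rmult_le_compat_l; [apply Cmod_ge_0|apply Cexp_taylor]|].
    rewrite Ew; pose proof (Rabs_pos t).
    (* Half of the decay absorbs the exponential of the Taylor remainder; the other half makes the
       series converge. *)
    assert (EG : Cmod (gauss t 0 z) * exp (Rabs h * X * (t * t)) <= Cmod (gauss t 0 (0, Im z / 2))).
    { rewrite !Cmod_gauss, <- exp_plus; apply exp_mono; simpl.
      assert (Rabs h * Cmod zeta <= Im z / 2) by (eapply Rle_trans; [|apply Hd2]; apply Rmult_le_compat_r; auto).
      assert (PI * (t * t) * (Rabs h * Cmod zeta) <= PI * (t * t) * (Im z / 2)) by (apply Rmult_le_compat_l; auto; nra).
      unfold X; nra. }
    replace (Cmod (gauss t 0 z) * (2 * ((Rabs h * X * (t * t)) ^ 2 * exp (Rabs h * X * (t * t)))))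
      with ((2 * X ^ 2) * ((t * t) ^ 2 * (Cmod (gauss t 0 z) * exp (Rabs h * X * (t * t)))) * (Rabs h * Rabs h)) by ring.
    rewrite <- Rabs_sqr; apply Rmult_le_compat_r; [nra|]; rewrite (Rmult_assoc (2 * X ^ 2) K); apply Rmult_le_compat_l; auto.
    apply Rle_trans with (exp (4 * Rabs t) * Cmod (gauss t 0 (0, Im z / 2))).
    + apply Rmult_le_compat; auto; [apply pow_le; auto|apply Rmult_le_pos; [apply Cmod_ge_0|apply Rlt_le, exp_pos]|].
      replace (4 * Rabs t) with (Rabs t + Rabs t + (Rabs t + Rabs t)) by ring; rewrite !exp_plus.
      rewrite Rabs_sqr; pose proof (abs_le_exp t).
      assert (Rabs t * Rabs t <= exp (Rabs t) * exp (Rabs t)) by (apply Rmult_le_compat; auto).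
      simpl; rewrite Rmult_1_r; apply Rmult_le_compat; auto; nra.
    + apply B; [rewrite Rabs_pos_eq; lra|simpl; lra|simpl; rewrite Rabs_R0; lra].
  - apply bounded_sum_scal; [apply Rmult_le_pos; auto|apply wZ_bounded].
Qed.

(* The Fourier transform of the Gaussian, as an integral over one period of the theta series. *)
Definition gint (b z : C) : C := Cint (fun u => th 0 u b z) 0 1.

Lemma tder_Cint (F : R -> R -> C) (F' : R -> C) s K d : 0 < d ->
  (forall h u, Rabs h <= d -> ccont (F (s + h)%R) u) -> (forall u, ccont F' u) ->
  (forall u h, 0 <= u <= 1 -> Rabs h <= d -> Cmod (F (s + h)%R u - F s u - RtoC h * F' u) <= K * (h * h)) ->
  tder (fun v => Cint (F v) 0 1) s (Cint F' 0 1).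
Proof.
  intros Hd CF CF' H; exists (2 * K), d; split; auto; intros h Hh.
  assert (C0 : forall u, ccont (F s) u) by (intros u; pose proof (CF 0 u) as X; rewrite Rplus_0_r in X; apply X; rewrite Rabs_R0; lra).
  replace (_ - _ - _)%C with (Cint (fun u => F (s + h)%R u + (- (1) * F s u + - RtoC h * F' u))%C 0 1).
  - replace (2 * K * (h * h)) with (2 * (K * (h * h) * (1 - 0))) by ring.
    apply Cint_bound; [lra| |].
    + intros x; apply ccont_plus; auto; apply ccont_plus; apply ccont_mult; auto; apply ccont_const.
    + intros u Hu; replace (_ + _)%C with (F (s + h)%R u - F s u - RtoC h * F' u)%C by ring; auto.
  - rewrite Cint_plus, Cint_plus, !Cint_scal; auto; try (intros; apply ccont_mult; auto using ccont_const); [ring|].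
    intros x; apply ccont_plus; apply ccont_mult; auto using ccont_const.
Qed.

Lemma two_pi_i_neq_0 : (RtoC (2 * PI) * Ci)%C <> 0.
Proof. pose proof PI_RGT_0; apply Cmod_gt_0; rewrite Cmod_mult, Cmod_R, Cmod_Ci, Rabs_pos_eq; lra. Qed.

Lemma Im_pos_neq_0 z : 0 < Im z -> z <> RtoC 0.
Proof. intros H ->; simpl in H; lra. Qed.

Lemma Cmult_eq_0_reg (a b : C) : a <> 0 -> (a * b = 0)%C -> b = 0.
Proof. intros Ha E; rewrite <- (Cmult_1_l b), <- (Cinv_l a), <- Cmult_assoc, E by auto; ring. Qed.

(** Integration by parts: the derivative in u of the periodic function [th 0] integrates to zero
    over a period, which relates the first moment of the Gaussian to [gint]. *)
Lemma Cint_th1 b z : 0 < Im z -> Cint (fun u => th 1 u b z) 0 1 = (- (b / z) * gint b z)%C.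
Proof.
  intros Hz; pose proof (Im_pos_neq_0 z Hz) as Nz.
  assert (E : (z * Cint (fun u => th 1 u b z) 0 1 + b * gint b z = 0)%C).
  { apply (Cmult_eq_0_reg (RtoC (2 * PI) * Ci)%C); [apply two_pi_i_neq_0|].
    unfold gint; rewrite <- !Cint_scal, <- Cint_plus, <- Cint_scal;
      try (intros; auto using th_ccont; fail);
      try (intros; apply ccont_mult; [apply ccont_const|apply th_ccont; auto]; fail).
    - rewrite (Cint_tder (fun u => th 0 u b z)).
      + pose proof (th_period 0 0 b z Hz) as P; rewrite Rplus_0_l in P; rewrite P; ring.
      + intros u; apply th0_tder_u, Hz.
      + intros u; apply ccont_mult; [apply ccont_const|]; apply ccont_plus; apply ccont_mult; try apply ccont_const; apply th_ccont, Hz.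
    - intros u; apply ccont_plus; apply ccont_mult; try apply ccont_const; apply th_ccont, Hz. }
  replace (Cint (fun u => th 1 u b z) 0 1) with
    (/ z * ((z * Cint (fun u => th 1 u b z) 0 1 + b * gint b z) - b * gint b z))%C by (field; auto).
  rewrite E; field; auto.
Qed.

(** The derivative of [th 1] integrates to zero over a period as well, which gives the second
    moment. *)
Lemma Cint_th2 z : 0 < Im z -> (RtoC (2 * PI) * Ci * z * Cint (fun u => th 2 u 0 z) 0 1)%C = (- gint 0 z)%C.
Proof.
  intros Hz.
  assert (E : (gint 0 z + RtoC (2 * PI) * Ci * z * Cint (fun u => th 2 u 0 z) 0 1 = 0)%C).
  { unfold gint; rewrite <- !Cint_scal, <- Cint_plus;
      try (intros; auto using th_ccont; fail).
    - rewrite (Cint_tder (fun u => th 1 u 0 z)).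
      + pose proof (th_period 1 0 0 z Hz) as P; rewrite Rplus_0_l in P; rewrite P; ring.
      + intros u; apply th1_tder_u, Hz.
      + intros u; apply ccont_plus; [|apply ccont_mult; try apply ccont_const]; apply th_ccont, Hz.
    - intros u; apply ccont_mult; try apply ccont_const; apply th_ccont, Hz. }
  replace (_ * _)%C with ((gint 0 z + RtoC (2 * PI) * Ci * z * Cint (fun u => th 2 u 0 z) 0 1) - gint 0 z)%C by ring.
  rewrite E; ring.
Qed.

(** Along s -> s b the Gaussian integral solves a linear differential equation, by the first-moment
    relation; the square is thus completed without a contour shift. *)
Lemma gint_b b z : 0 < Im z -> gint b z = (gint 0 z * Cexp (- (RtoC PI * Ci * (b * b) / z)))%C.
Proof.
  intros Hz; pose proof (Im_pos_neq_0 z Hz) as Nz.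
  set (q := (RtoC PI * Ci * (b * b) / z)%C).
  set (G := fun s : R => (gint (0 + RtoC s * b) z * Cexp (0 + RtoC s * 0 + RtoC (s * s) * q))%C).
  assert (E : G 1 = G 0).
  { apply tder_zero_const; intros s _.
    assert (T : tder (fun s => gint (0 + RtoC s * b) z) s (RtoC (2 * PI) * Ci * b * Cint (fun u => th 1 u (0 + RtoC s * b) z) 0 1)%C).
    { destruct (th_taylor_b (0 + RtoC s * b) b z Hz) as [K HK].
      rewrite <- Cint_scal by (intros; apply th_ccont, Hz).
      apply (tder_Cint (fun s u => th 0 u (0 + RtoC s * b) z) _ s K 1); [lra| | |].
      - intros; apply th_ccont, Hz.
      - intros; apply ccont_mult; [apply ccont_const|apply th_ccont, Hz].
      - intros u h Hu Hh.
        replace (0 + RtoC (s + h) * b)%C with (0 + RtoC s * b + RtoC h * b)%C by (rewrite RtoC_plus; ring); auto. }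
    pose proof (tder_mult _ _ s _ _ T (tder_Cexp_quad 0 0 q s)) as T2.
    cbv beta in T2; rewrite Cint_th1 in T2 by auto.
    set (Y := Cexp (0 + RtoC s * 0 + RtoC (s * s) * q)) in T2; set (X := gint (0 + RtoC s * b) z) in T2.
    match type of T2 with tder _ _ ?e => replace (RtoC 0) with e; [exact T2|] end.
    unfold q; rewrite RtoC_mult; field; auto. }
  unfold G in E.
  replace (0 + RtoC 1 * b)%C with b in E by ring; replace (0 + RtoC 0 * b)%C with (RtoC 0) in E by ring.
  replace (0 + RtoC 1 * 0 + RtoC (1 * 1) * q)%C with q in E by (rewrite Rmult_1_l; ring).
  replace (0 + RtoC 0 * 0 + RtoC (0 * 0) * q)%C with (RtoC 0) in E by (rewrite Rmult_0_l; ring).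
  rewrite Cexp_0, Cmult_1_r in E; rewrite <- E, <- Cmult_assoc, <- Cexp_plus.
  replace (q + - q)%C with (RtoC 0) by ring; rewrite Cexp_0; ring.
Qed.

(** By the second-moment relation the expression has derivative zero along the segment from i to z.
    Squaring avoids a branch of the square root. *)
Lemma gint_sqr_const z : 0 < Im z -> (gint 0 z * gint 0 z * z = gint 0 Ci * gint 0 Ci * Ci)%C.
Proof.
  intros Hz; set (zeta := (z - Ci)%C).
  set (H := fun s : R => (gint 0 (Ci + RtoC s * zeta) * gint 0 (Ci + RtoC s * zeta) * (Ci + RtoC s * zeta))%C).
  assert (E : H 1 = H 0).
  { apply tder_zero_const; intros s Hs; set (w := (Ci + RtoC s * zeta)%C).
    assert (Hw : 0 < Im w) by (unfold w, zeta; destruct z as [z1 z2]; simpl in *; nra).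
    pose proof (Im_pos_neq_0 w Hw) as Nw.
    assert (T : tder (fun s => gint 0 (Ci + RtoC s * zeta)) s (RtoC PI * Ci * zeta * Cint (fun u => th 2 u 0 w) 0 1)%C).
    { destruct (th_taylor_z w zeta Hw) as [K [d [Hd HK]]].
      rewrite <- Cint_scal by (intros; apply th_ccont, Hw).
      set (d' := Rmin d (Im w / 2 / (Cmod zeta + 1))).
      pose proof (Cmod_ge_0 zeta).
      assert (D1 : 0 < Im w / 2 / (Cmod zeta + 1)) by (apply Rdiv_lt_0_compat; lra).
      assert (Hw' : forall h, (Ci + RtoC (s + h) * zeta)%C = (w + RtoC h * zeta)%C)
        by (intros; unfold w; rewrite RtoC_plus; ring).
      apply (tder_Cint (fun s u => th 0 u 0 (Ci + RtoC s * zeta)) _ s K d').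
      - apply Rmin_pos; auto.
      - intros h u Hh; rewrite Hw'; apply th_ccont.
        change (0 < Im w + Im (RtoC h * zeta)); rewrite Im_RtoC_mult.
        assert (Rabs (h * Im zeta) <= Im w / 2).
        { rewrite Rabs_mult; apply Rle_trans with (Im w / 2 / (Cmod zeta + 1) * (Cmod zeta + 1)).
          - apply Rmult_le_compat; auto using Rabs_pos.
            + eapply Rle_trans; [apply Hh|apply Rmin_r].
            + pose proof (im_le_Cmod zeta); lra.
          - right; field; lra. }
        apply Rabs_le_between in H1; lra.
      - intros; apply ccont_mult; [apply ccont_const|apply th_ccont, Hw].
      - intros u h Hu Hh; rewrite Hw'; apply HK; auto; eapply Rle_trans; [apply Hh|apply Rmin_l]. }
    assert (T1 : tder (fun s => Ci + RtoC s * zeta)%C s zeta).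
    { exists 0, 1; split; [lra|]; intros h _; rewrite RtoC_plus.
      replace (_ - _ - _)%C with (RtoC 0) by ring; rewrite Cmod_0; lra. }
    pose proof (tder_mult _ _ s _ _ (tder_mult _ _ s _ _ T T) T1) as T2; cbv beta in T2; fold w in T2.
    match type of T2 with tder _ _ ?e => replace (RtoC 0) with e; [exact T2|] end.
    pose proof (Cint_th2 w Hw) as C2.
    set (X := gint 0 w) in *; set (Y := Cint (fun u => th 2 u 0 w) 0 1) in *.
    replace (_ + _)%C with (zeta * X * (RtoC (2 * PI) * Ci * w * Y) + X * X * zeta)%C by (rewrite RtoC_mult; ring).
    rewrite C2; ring. }
  unfold H in E.
  replace (Ci + RtoC 1 * zeta)%C with z in E by (unfold zeta; ring).
  replace (Ci + RtoC 0 * zeta)%C with Ci in E by ring; exact E.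
Qed.

Lemma Cexp_ex1 x w : (ex1 x * Cexp w)%C = Cexp (RtoC (2 * PI * x) * Ci + w).
Proof. unfold ex1; rewrite <- Cexp_plus; reflexivity. Qed.

Lemma Im_opp_inv z : 0 < Im z -> 0 < Im (- / z).
Proof.
  intros H; destruct z as [x y]; simpl in *.
  unfold Rdiv; rewrite <- Ropp_mult_distr_l, Ropp_involutive.
  apply Rmult_lt_0_compat; auto; apply Rinv_0_lt_compat; nra.
Qed.

(** Multiplication by e(-m(u + a)) is the shift b -> b - m, because e(-mn) = 1 for the summation
    index n. *)
Lemma fc_th a b z m : 0 < Im z ->
  fc (fun u => th 0 (u + a) b z) m = (ex1 (IZR m * a) * gint (b - RtoC (IZR m)) z)%C.
Proof.
  intros Hz; unfold fc, gint.
  rewrite <- (Cint_periodic (fun u => th 0 u (b - RtoC (IZR m)) z) a);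
    [|intros; apply th_ccont, Hz|intros; apply th_period, Hz].
  rewrite <- Cint_scal.
  2:{ intros x; intros e He; destruct (th_ccont 0 (b - RtoC (IZR m)) z (x + a) Hz e He) as [d [Hd K]].
      exists d; split; auto; intros h Hh; replace (x + h + a) with (x + a + h) by ring; auto. }
  apply Cint_ext; intros u.
  transitivity (ex1 (IZR m * a) * (ex1 (- IZR m * (u + a)) * th 0 (u + a) b z))%C.
  { replace (- IZR m * u) with (IZR m * a + - IZR m * (u + a)) by ring; rewrite ex1_plus; ring. }
  f_equal; symmetry; apply USum_correct.
  eapply usum_ext; [|apply usum_scal, th_usum, Hz].
  intros n; unfold mono; simpl pow.
  replace (ex1 (- IZR m * (u + a))) with (ex1 (- IZR m * (IZR n + (u + a)))).
  2:{ replace (- IZR m * (IZR n + (u + a))) with (- IZR m * (u + a) + IZR (- m * n)) by (rewrite mult_IZR, opp_IZR; ring).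
      apply ex1_period. }
  rewrite !Cmult_1_l; unfold gauss; rewrite Cexp_ex1; f_equal.
  rewrite !RtoC_mult, ?RtoC_opp; ring.
Qed.

(** Poisson summation: the Fourier coefficients, Gaussian in m, have the right side as unordered
    sum, while pointwise inversion gives the left side as limit of their symmetric partial sums. The
    constant [gint 0 z] is evaluated afterwards. *)
Lemma jacobi_gint a b z : 0 < Im z ->
  th 0 a b z = (gint 0 z * Cexp (- (RtoC PI * Ci * (b * b) / z)) * th 0 0 (RtoC a + b / z) (- / z))%C.
Proof.
  intros Hz; pose proof (Im_pos_neq_0 z Hz) as Nz.
  set (K := (gint 0 z * Cexp (- (RtoC PI * Ci * (b * b) / z)))%C).
  assert (U : usum (fc (fun u => th 0 (u + a) b z)) (K * th 0 0 (RtoC a + b / z) (- / z))%C).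
  { eapply usum_ext; [|apply usum_scal, th_usum, Im_opp_inv, Hz].
    intros m; rewrite fc_th, gint_b by auto; unfold K, mono; simpl pow; rewrite Rplus_0_r, Cmult_1_l.
    rewrite <- Cmult_assoc; unfold gauss; rewrite <- Cexp_plus.
    replace (ex1 (IZR m * a) * (gint 0 z * Cexp (- (RtoC PI * Ci * ((b - RtoC (IZR m)) * (b - RtoC (IZR m))) / z))))%C
      with (gint 0 z * (ex1 (IZR m * a) * Cexp (- (RtoC PI * Ci * ((b - RtoC (IZR m)) * (b - RtoC (IZR m))) / z))))%C by ring.
    rewrite Cexp_ex1; do 2 f_equal; rewrite !RtoC_mult; field; auto. }
  destruct (Req_dec (Cmod (th 0 a b z - K * th 0 0 (RtoC a + b / z) (- / z))) 0) as [Q|Q].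
  { apply Cmod_eq_0 in Q; fold K.
    replace (th 0 a b z) with (th 0 a b z - K * th 0 0 (RtoC a + b / z) (- / z) + K * th 0 0 (RtoC a + b / z) (- / z))%C by ring.
    rewrite Q; ring. }
  exfalso; set (e := Cmod (th 0 a b z - K * th 0 0 (RtoC a + b / z) (- / z))) in *.
  assert (He : 0 < e) by (pose proof (Cmod_ge_0 (th 0 a b z - K * th 0 0 (RtoC a + b / z) (- / z))); fold e in H; lra).
  assert (X : forall i, exists n0, forall n, (n0 <= n)%nat -> In i (zrange n))
    by (intros i; exists (Z.to_nat (Z.abs i)); intros n Hn; apply in_zrange; lia).
  destruct (usum_exhaust _ _ zrange zrange_NoDup X U (e / 2)) as [n1 N1]; [lra|].
  destruct (fourier_inversion_at_0 (fun u => th 0 (u + a) b z)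
    (fun u => RtoC (2 * PI) * Ci * (z * th 1 (u + a)%R b z + b * th 0 (u + a)%R b z))%C) with (eps := e / 2) as [n2 N2].
  - intros u; destruct (th0_tder_u (u + a) b z Hz) as [K' [d [Hd T]]]; exists K', d; split; auto.
    intros h Hh; replace (u + h + a) with (u + a + h) by ring; auto.
  - intros u; replace (u + 1 + a) with (u + a + 1) by ring; apply th_period, Hz.
  - lra.
  - specialize (N1 (n1 + n2)%nat ltac:(lia)); specialize (N2 (n1 + n2)%nat ltac:(lia)).
    rewrite Rplus_0_l in N2.
    set (S := lsum (fc (fun u => th 0 (u + a) b z)) (zrange (n1 + n2))) in *.
    assert (e <= Cmod (S - K * th 0 0 (RtoC a + b / z) (- / z)) + Cmod (S - th 0 a b z)); [|lra].
    unfold e; replace (th 0 a b z - K * th 0 0 (RtoC a + b / z) (- / z))%C with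
      ((S - K * th 0 0 (RtoC a + b / z) (- / z)) - (S - th 0 a b z))%C by ring; apply Cmod_minus_triangle.
Qed.

(** At the fixed point i of S, with a = b = 0, the formula reads t = [gint 0 Ci] t, and t is nonzero
    since its terms are positive and the one of index 0 equals 1. *)
Lemma gint_Ci : gint 0 Ci = 1.
Proof.
  assert (Hi : 0 < Im Ci) by (simpl; lra).
  pose proof (jacobi_gint 0 0 Ci Hi) as J.
  assert (N : (Ci <> 0)%C) by apply Im_pos_neq_0, Hi.
  replace (- (RtoC PI * Ci * (0 * 0) / Ci))%C with (RtoC 0) in J by (field; auto).
  replace (RtoC 0 + 0 / Ci)%C with (RtoC 0) in J by (field; auto).
  replace (- / Ci)%C with Ci in J by (apply C_eq; simpl; field).
  rewrite Cexp_0, Cmult_1_r in J.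
  set (t := th 0 0 0 Ci) in *.
  assert (Nt : t <> 0).
  { intros Zt; pose proof (th_usum 0 0 0 Ci Hi) as U; fold t in U; rewrite Zt in U.
    destruct (U 1 Rlt_0_1) as [A0 HA].
    specialize (HA (nodup cdec (0%Z :: A0)) (NoDup_nodup _ _) ltac:(intros x Hx; apply nodup_In; now right)).
    set (A := nodup cdec (0%Z :: A0)) in *.
    assert (R1 : forall n : Z, mono 0 0 Ci (IZR n + 0) = RtoC (exp (- PI * ((IZR n) * (IZR n))))).
    { intros n; unfold mono, gauss; simpl pow; rewrite Rplus_0_r, Cmult_1_l; apply C_eq; unfold Cexp; simpl.
      - replace (_ + _) with (- PI * (IZR n * IZR n)) by ring.
        match goal with |- _ * cos ?x = _ => replace x with 0 by ring end; rewrite cos_0; ring.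
      - match goal with |- _ * sin ?x = _ => replace x with 0 by ring end; rewrite sin_0; ring. }
    rewrite (lsum_ext_in _ (fun n => RtoC (exp (- PI * ((IZR n) * (IZR n)))))) in HA by (intros; apply R1).
    pose proof (re_le_Cmod (lsum (fun n => RtoC (exp (- PI * ((IZR n) * (IZR n))))) A - 0)) as L.
    assert (1 <= Re (lsum (fun n => RtoC (exp (- PI * ((IZR n) * (IZR n))))) A - 0)).
    { rewrite lsum_parts; simpl.
      apply Rle_trans with (rsum (fun n => exp (- PI * (IZR n * IZR n))) [0%Z]).
      - simpl; rewrite Rmult_0_l, Rmult_0_r, exp_0; lra.
      - rewrite Ropp_0, Rplus_0_r; apply rsum_incl.
        + intros; apply Rlt_le, exp_pos.
        + constructor; [easy|constructor].
        + intros x [<-|[]]; apply nodup_In; now left. }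
    pose proof (Rle_abs (Re (lsum (fun n => RtoC (exp (- PI * ((IZR n) * (IZR n))))) A - 0))); lra. }
  replace (gint 0 Ci) with (gint 0 Ci * t / t)%C by (field; auto); rewrite <- J; field; auto.
Qed.

Lemma gint_sqr z : 0 < Im z -> (gint 0 z * gint 0 z = Ci / z)%C.
Proof.
  intros Hz; pose proof (gint_sqr_const z Hz) as E; rewrite gint_Ci in E.
  pose proof (Im_pos_neq_0 z Hz).
  replace (gint 0 z * gint 0 z)%C with (gint 0 z * gint 0 z * z / z)%C by (field; auto).
  rewrite E; field; auto.
Qed.

(** * Two-dimensional theta series with a harmonic factor *)

Definition pt (a1 a2 : R) (p : Z * Z) : C := (IZR (fst p) + a1, IZR (snd p) + a2).

Definition term2 (k : nat) (a1 a2 : R) (b1 b2 z : C) (p : Z * Z) : C :=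
  (pt a1 a2 p ^ k * (gauss (IZR (fst p) + a1) b1 z * gauss (IZR (snd p) + a2) b2 z))%C.

Definition th2 (k : nat) (a1 a2 : R) (b1 b2 z : C) : C := USum (term2 k a1 a2 b1 b2 z).

Definition wt2 (D : R) (a1 a2 : R) (b1 b2 z : C) (p : Z * Z) : R :=
  exp (D * Rabs (IZR (fst p) + a1)) * Cmod (gauss (IZR (fst p) + a1) b1 z) *
  (exp (D * Rabs (IZR (snd p) + a2)) * Cmod (gauss (IZR (snd p) + a2) b2 z)).

Lemma wt2_dominated D a1 a2 b1 b2 z : 0 < Im z -> exists K, 0 <= K /\ forall p, wt2 D a1 a2 b1 b2 z p <= K * w2 p.
Proof.
  intros Hz.
  destruct (gauss_dominated (Im z) (Rabs (Im b1)) D (Rabs a1) Hz) as [K1 [HK1 B1]].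
  destruct (gauss_dominated (Im z) (Rabs (Im b2)) D (Rabs a2) Hz) as [K2 [HK2 B2]].
  exists (K1 * K2); split; [nra|]; intros [n1 n2]; unfold wt2, w2; simpl.
  replace (K1 * K2 * (wZ n1 * wZ n2)) with (K1 * wZ n1 * (K2 * wZ n2)) by ring.
  assert (P : forall x y, 0 <= exp x * Cmod y) by (intros; apply Rmult_le_pos; [apply Rlt_le, exp_pos|apply Cmod_ge_0]).
  apply Rmult_le_compat; auto; [apply B1|apply B2]; lra.
Qed.

Lemma Cmod_pt_le a1 a2 p : Cmod (pt a1 a2 p) <= exp (Rabs (IZR (fst p) + a1)) * exp (Rabs (IZR (snd p) + a2)).
Proof.
  eapply Rle_trans; [apply Cmod_le_sum|]; simpl.
  set (x := Rabs _); set (y := Rabs (IZR (snd p) + a2)).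
  assert (0 <= x) by apply Rabs_pos; assert (0 <= y) by apply Rabs_pos.
  rewrite <- exp_plus; pose proof (exp_ineq1_le (x + y)); lra.
Qed.

Lemma Cmod_pt_exp_le X a1 a2 p : 0 <= X ->
  exp (X * Cmod (pt a1 a2 p)) <= exp (X * Rabs (IZR (fst p) + a1)) * exp (X * Rabs (IZR (snd p) + a2)).
Proof.
  intros HX; rewrite <- exp_plus, <- Rmult_plus_distr_l; apply exp_mono, Rmult_le_compat_l; auto.
  apply Cmod_le_sum.
Qed.

Lemma exp_pow_INR x k : exp x ^ k = exp (INR k * x).
Proof.
  induction k as [|k IH]; [simpl; rewrite Rmult_0_l, exp_0; auto|].
  rewrite S_INR, Rmult_plus_distr_r, exp_plus, Rmult_1_l; simpl; rewrite IH; ring.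
Qed.

(** The exponential of X |x + iy| is the one occurring in the Taylor remainder of [th2_tder]. *)
Lemma wt2_bound k X a1 a2 b1 b2 z p : 0 <= X ->
  Cmod (pt a1 a2 p) ^ k * exp (X * Cmod (pt a1 a2 p)) *
    (Cmod (gauss (IZR (fst p) + a1) b1 z) * Cmod (gauss (IZR (snd p) + a2) b2 z))
  <= wt2 (INR k + X) a1 a2 b1 b2 z p.
Proof.
  intros HX; unfold wt2.
  set (x := Rabs (IZR (fst p) + a1)); set (y := Rabs (IZR (snd p) + a2)).
  set (g1 := Cmod (gauss (IZR (fst p) + a1) b1 z)); set (g2 := Cmod (gauss (IZR (snd p) + a2) b2 z)).
  assert (0 <= g1) by apply Cmod_ge_0; assert (0 <= g2) by apply Cmod_ge_0.
  replace (exp ((INR k + X) * x) * g1 * (exp ((INR k + X) * y) * g2)) with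
    ((exp x * exp y) ^ k * (exp (X * x) * exp (X * y)) * (g1 * g2)).
  - apply Rmult_le_compat_r; [nra|]; apply Rmult_le_compat.
    + apply pow_le, Cmod_ge_0.
    + apply Rlt_le, exp_pos.
    + apply pow_incr; split; [apply Cmod_ge_0|apply Cmod_pt_le].
    + apply Cmod_pt_exp_le, HX.
  - rewrite Rpow_mult_distr, !exp_pow_INR, !Rmult_plus_distr_r, !exp_plus; ring.
Qed.

Lemma term2_bound k a1 a2 b1 b2 z p : Cmod (term2 k a1 a2 b1 b2 z p) <= wt2 (INR k) a1 a2 b1 b2 z p.
Proof.
  pose proof (wt2_bound k 0 a1 a2 b1 b2 z p (Rle_refl 0)) as H; rewrite Rmult_0_l, exp_0, Rmult_1_r, Rplus_0_r in H.
  unfold term2; rewrite !Cmod_mult, Cmod_pow; exact H.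
Qed.

Lemma th2_usum k a1 a2 b1 b2 z : 0 < Im z -> usum (term2 k a1 a2 b1 b2 z) (th2 k a1 a2 b1 b2 z).
Proof.
  intros Hz; apply USum_usum; destruct (wt2_dominated (INR k) a1 a2 b1 b2 z Hz) as [K [HK B]].
  apply (usum_ex _ (fun p => K * w2 p) (K * (3 * 3))).
  - intros p; eapply Rle_trans; [apply term2_bound|auto].
  - apply bounded_sum_scal; auto using w2_bounded.
Qed.

Lemma th2_prod a1 a2 b1 b2 z : 0 < Im z -> th2 0 a1 a2 b1 b2 z = (th 0 a1 b1 z * th 0 a2 b2 z)%C.
Proof.
  intros Hz; apply USum_correct.
  destruct (gauss_dominated (Im z) (Rabs (Im b1)) 0 (Rabs a1) Hz) as [K1 [HK1 B1]].
  destruct (gauss_dominated (Im z) (Rabs (Im b2)) 0 (Rabs a2) Hz) as [K2 [HK2 B2]].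
  eapply usum_ext; [|apply (usum_prod (fun n => mono 0 b1 z (IZR n + a1)) (fun n => mono 0 b2 z (IZR n + a2))
     (fun n => K1 * wZ n) (fun n => K2 * wZ n) (K1 * 3) (K2 * 3))].
  - intros p; unfold term2, mono; simpl; ring.
  - intros n; eapply Rle_trans; [apply mono_bound|]; apply B1; lra.
  - intros n; eapply Rle_trans; [apply mono_bound|]; apply B2; lra.
  - apply bounded_sum_scal; auto using wZ_bounded.
  - apply bounded_sum_scal; auto using wZ_bounded.
  - apply th_usum, Hz.
  - apply th_usum, Hz.
Qed.

(** The two exponents combine into a multiple of the lattice point x + iy itself, so each derivative
    at h = 0 contributes one factor x + iy. *)
Lemma term2_shift k a1 a2 b1 b2 z zeta h p :
  term2 k a1 a2 (b1 + RtoC h * zeta) (b2 + RtoC h * (Ci * zeta)) z p =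
  (term2 k a1 a2 b1 b2 z p * Cexp (RtoC h * (RtoC (2 * PI) * Ci * zeta * pt a1 a2 p) + RtoC (h * h) * 0))%C.
Proof.
  unfold term2; rewrite !gauss_shift_b.
  set (X := Cexp _); set (Y := Cexp (RtoC h * (RtoC (2 * PI * (IZR (snd p) + a2)) * Ci * (Ci * zeta)))).
  transitivity (pt a1 a2 p ^ k * (gauss (IZR (fst p) + a1) b1 z * gauss (IZR (snd p) + a2) b2 z) * (X * Y))%C; [ring|].
  f_equal; unfold X, Y; rewrite <- Cexp_plus; f_equal.
  replace (pt a1 a2 p) with (RtoC (IZR (fst p) + a1) + RtoC (IZR (snd p) + a2) * Ci)%C.
  - rewrite !RtoC_mult; ring.
  - apply C_eq; simpl; ring.
Qed.

(* The direction (1, i) kills the quadratic term, which is the harmonicity of (x + iy)^k. *)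
Lemma th2_tder k a1 a2 b1 b2 z zeta s : 0 < Im z ->
  tder (fun t => th2 k a1 a2 (b1 + RtoC t * zeta) (b2 + RtoC t * (Ci * zeta)) z) s
    (RtoC (2 * PI) * Ci * zeta * th2 (S k) a1 a2 (b1 + RtoC s * zeta) (b2 + RtoC s * (Ci * zeta)) z)%C.
Proof.
  intros Hz; pose proof PI_RGT_0.
  set (c1 := (b1 + RtoC s * zeta)%C); set (c2 := (b2 + RtoC s * (Ci * zeta))%C).
  set (X := 2 * PI * Cmod zeta).
  assert (HX : 0 <= X) by (unfold X; pose proof (Cmod_ge_0 zeta); apply Rmult_le_pos; lra).
  destruct (wt2_dominated (INR (k + 2) + X) a1 a2 c1 c2 z Hz) as [K [HK B]].
  exists (2 * X ^ 2 * K * (3 * 3)), 1; split; [lra|].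
  assert (HA : 0 <= 2 * X ^ 2) by (apply Rmult_le_pos; [lra|apply pow_le; auto]).
  apply (usum_taylor (fun p t => term2 k a1 a2 (b1 + RtoC t * zeta) (b2 + RtoC t * (Ci * zeta)) z p)
     (fun p => RtoC (2 * PI) * Ci * zeta * term2 (S k) a1 a2 c1 c2 z p)%C
     (fun t => th2 k a1 a2 (b1 + RtoC t * zeta) (b2 + RtoC t * (Ci * zeta)) z)
     _ s 1 (fun p => 2 * X ^ 2 * K * w2 p)); [lra| | | |].
  - intros; apply th2_usum, Hz.
  - apply usum_scal, th2_usum, Hz.
  - intros p h Hh.
    replace (b1 + RtoC (s + h) * zeta)%C with (c1 + RtoC h * zeta)%C by (unfold c1; rewrite RtoC_plus; ring).
    replace (b2 + RtoC (s + h) * (Ci * zeta))%C with (c2 + RtoC h * (Ci * zeta))%C by (unfold c2; rewrite RtoC_plus; ring).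
    rewrite term2_shift; fold c1 c2.
    set (a := (RtoC (2 * PI) * Ci * zeta * pt a1 a2 p)%C).
    replace (_ - _ - _)%C with (term2 k a1 a2 c1 c2 z p * (Cexp (RtoC h * a + RtoC (h * h) * 0) - 1 - RtoC h * a))%C
      by (unfold a, term2; rewrite Cpow_S; ring).
    rewrite Cmod_mult.
    eapply Rle_trans; [apply Rmult_le_compat_l; [apply Cmod_ge_0|apply Cexp_quadratic_estimate, Hh]|].
    rewrite <- Rmult_assoc; apply Rmult_le_compat_r; [nra|].
    rewrite Cmod_0, !Rplus_0_r.
    assert (Ea : Cmod a = X * Cmod (pt a1 a2 p)).
    { unfold a, X; rewrite !Cmod_mult, Cmod_R, Cmod_Ci, Rabs_pos_eq by lra; ring. }
    rewrite Ea, (Rmult_assoc (2 * X ^ 2) K).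
    apply Rle_trans with (2 * X ^ 2 * wt2 (INR (k + 2) + X) a1 a2 c1 c2 z p); [|apply Rmult_le_compat_l; auto].
    replace (Cmod (term2 k a1 a2 c1 c2 z p) * (2 * (X * Cmod (pt a1 a2 p)) ^ 2 * exp (X * Cmod (pt a1 a2 p)))) with
     (2 * X ^ 2 * (Cmod (pt a1 a2 p) ^ (k + 2) * exp (X * Cmod (pt a1 a2 p)) *
       (Cmod (gauss (IZR (fst p) + a1) c1 z) * Cmod (gauss (IZR (snd p) + a2) c2 z)))).
    + apply Rmult_le_compat_l; auto; apply wt2_bound, HX.
    + unfold term2; rewrite !Cmod_mult, Cmod_pow, pow_add; ring.
  - apply bounded_sum_scal; [apply Rmult_le_pos; auto|apply w2_bounded].
Qed.

(** Separates the real part beta, which becomes a characteristic on the dual side, from the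
    parameter tau in which the formula is to be differentiated. *)
Lemma jacobi_real a (beta : R) tau z : 0 < Im z ->
  th 0 a (RtoC beta + tau) z =
  (gint 0 z * Cexp (- (RtoC PI * Ci * (tau * tau) / z)) * ex1 (beta * a) * th 0 (- beta) (RtoC a + tau / z) (- / z))%C.
Proof.
  intros Hz; pose proof (Im_pos_neq_0 z Hz) as Nz; pose proof (Im_opp_inv z Hz) as Hz'.
  rewrite jacobi_gint by auto.
  rewrite <- !Cmult_assoc; f_equal.
  eapply usum_unique; [apply usum_scal, th_usum, Hz'|].
  eapply usum_ext; [|apply usum_scal, usum_scal, th_usum, Hz'].
  intros m; unfold mono, gauss; simpl pow.
  rewrite !Cmult_1_l, Cexp_ex1, <- !Cexp_plus; f_equal.
  rewrite Rplus_0_r, !RtoC_mult, !RtoC_plus, RtoC_opp; field; auto.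
Qed.

(** Induction on k by differentiating both sides in t: the derivative produces 2 pi i on the left
    and 2 pi i / z on the right, hence one more factor 1/z. *)
Lemma jacobi2 k a1 a2 (b1 b2 : R) z : 0 < Im z -> forall t : R,
  th2 k a1 a2 (RtoC b1 + RtoC t * 1) (RtoC b2 + RtoC t * (Ci * 1)) z =
  (Ci / z * (/ z) ^ k * ex1 (b1 * a1 + b2 * a2) *
    th2 k (- b1) (- b2) (RtoC a1 + RtoC t * / z) (RtoC a2 + RtoC t * (Ci * / z)) (- / z))%C.
Proof.
  intros Hz; pose proof (Im_pos_neq_0 z Hz) as Nz; pose proof (Im_opp_inv z Hz) as Hz'.
  induction k as [|k IH]; intros t.
  - rewrite !th2_prod, (jacobi_real a1 b1), (jacobi_real a2 b2) by auto.
    replace (RtoC t * 1 / z)%C with (RtoC t * / z)%C by (field; auto).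
    replace (RtoC t * (Ci * 1) / z)%C with (RtoC t * (Ci * / z))%C by (field; auto).
    rewrite <- gint_sqr, ex1_plus by auto.
    set (T1 := th 0 _ _ _); set (T2 := th 0 (- b2) _ _).
    set (e1 := Cexp _); set (e2 := Cexp (- (RtoC PI * Ci * (RtoC t * (Ci * 1) * (RtoC t * (Ci * 1))) / z))).
    (* The factors exp(-pi i tau^2 / z) of the two coordinates cancel, since the second tau is i
       times the first. *)
    assert (E : (e1 * e2 = 1)%C).
    { unfold e1, e2; rewrite <- Cexp_plus; transitivity (Cexp 0); [f_equal|apply Cexp_0].
      assert (I2 : (Ci * Ci = - (1))%C) by (apply C_eq; simpl; ring).
      transitivity (- (RtoC PI * Ci * (RtoC t * RtoC t) / z) * (1 + Ci * Ci))%C; [field; auto|rewrite I2; ring]. }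
    transitivity (gint 0 z * gint 0 z * (e1 * e2) * (ex1 (b1 * a1) * ex1 (b2 * a2)) * (T1 * T2))%C; [ring|].
    rewrite E; change ((/ z) ^ 0)%C with (RtoC 1); ring.
  - pose proof (th2_tder k a1 a2 (RtoC b1) (RtoC b2) z 1 t Hz) as D1.
    pose proof (tder_scal (Ci / z * (/ z) ^ k * ex1 (b1 * a1 + b2 * a2))%C _ _ _
       (th2_tder k (- b1) (- b2) (RtoC a1) (RtoC a2) (- / z) (/ z) t Hz')) as D2.
    assert (D3 := tder_ext _ _ _ _ (fun u => eq_sym (IH u)) D2).
    pose proof (tder_unique _ _ _ _ D1 D3) as E.
    set (L := th2 (S k) a1 a2 _ _ z) in *; set (M := th2 (S k) (- b1) _ _ _ _) in *.
    assert (E' : (RtoC (2 * PI) * Ci * L = RtoC (2 * PI) * Ci * (Ci / z * (/ z) ^ S k * ex1 (b1 * a1 + b2 * a2) * M))%C).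
    { transitivity (RtoC (2 * PI) * Ci * 1 * L)%C; [ring|]; rewrite E, Cpow_S; ring. }
    pose proof two_pi_i_neq_0 as N.
    rewrite <- (Cmult_1_l L), <- (Cinv_l _ N), <- Cmult_assoc, E', Cmult_assoc, Cinv_l by auto; ring.
Qed.

Lemma th2_neg k a1 a2 b1 b2 z : 0 < Im z ->
  th2 k (- a1) (- a2) (- b1) (- b2) z = ((- (1)) ^ k * th2 k a1 a2 b1 b2 z)%C.
Proof.
  intros Hz; apply USum_correct.
  apply (usum_ext (fun p => ((- (1)) ^ k * term2 k a1 a2 b1 b2 z (- fst p, - snd p)%Z)%C)).
  - intros [n1 n2]; unfold term2; cbn [fst snd].
    replace (pt (- a1) (- a2) (n1, n2)) with (- (1) * pt a1 a2 (- n1, - n2)%Z)%C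
      by (apply C_eq; simpl; rewrite !opp_IZR; ring).
    rewrite Cpow_mult_l, <- Cmult_assoc; do 2 f_equal; rewrite !opp_IZR; unfold gauss; f_equal; f_equal.
    + rewrite !RtoC_mult, !RtoC_plus, !RtoC_opp; ring.
    + rewrite !RtoC_mult, !RtoC_plus, !RtoC_opp; ring.
  - apply usum_scal.
    apply (usum_bij (fun p : Z * Z => (- fst p, - snd p)%Z) (fun p => (- fst p, - snd p)%Z));
      [intros [x y]; simpl; f_equal; lia|intros [x y]; simpl; f_equal; lia|apply th2_usum, Hz].
Qed.

(* The prefactor makes the transformation laws under S and T^2 free of phases. *)
Definition Th (k : nat) (a1 a2 b1 b2 : R) (w : C) : C :=
  (ex1 (- (a1 * b1 + a2 * b2) / 2) * th2 k a1 a2 (RtoC b1) (RtoC b2) w)%C.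

Lemma Th_neg k a1 a2 b1 b2 w : 0 < Im w -> Th k (- a1) (- a2) (- b1) (- b2) w = ((- (1)) ^ k * Th k a1 a2 b1 b2 w)%C.
Proof.
  intros Hw; unfold Th; rewrite !RtoC_opp, th2_neg by auto.
  replace (- (- a1 * - b1 + - a2 * - b2) / 2) with (- (a1 * b1 + a2 * b2) / 2) by field; ring.
Qed.

Lemma Th_S k a1 a2 b1 b2 w : 0 < Im w ->
  Th k a1 a2 b1 b2 w = (Ci / w * (- / w) ^ k * Th k b1 b2 (- a1) (- a2) (- / w))%C.
Proof.
  intros Hw; pose proof (Im_opp_inv w Hw) as Hw'.
  pose proof (jacobi2 k a1 a2 b1 b2 w Hw 0) as J.
  replace (RtoC b1 + RtoC 0 * 1)%C with (RtoC b1) in J by ring.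
  replace (RtoC b2 + RtoC 0 * (Ci * 1))%C with (RtoC b2) in J by ring.
  replace (RtoC a1 + RtoC 0 * / w)%C with (- RtoC (- a1))%C in J by (rewrite RtoC_opp; ring).
  replace (RtoC a2 + RtoC 0 * (Ci * / w))%C with (- RtoC (- a2))%C in J by (rewrite RtoC_opp; ring).
  rewrite th2_neg in J by auto.
  unfold Th; rewrite J.
  replace (- (/ w))%C with (- (1) * / w)%C by ring; rewrite Cpow_mult_l.
  replace (ex1 (- (a1 * b1 + a2 * b2) / 2)) with (ex1 (- (b1 * a1 + b2 * a2)) * ex1 (- (b1 * - a1 + b2 * - a2) / 2))%C
    by (rewrite <- ex1_plus; f_equal; field).
  replace (- (1) * / w)%C with (- / w)%C by ring.
  set (T := th2 k b1 b2 _ _ _).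
  assert (E : (ex1 (- (b1 * a1 + b2 * a2)) * ex1 (b1 * a1 + b2 * a2) = 1)%C)
    by (rewrite <- ex1_plus, <- ex1_0; f_equal; ring).
  transitivity (ex1 (- (b1 * a1 + b2 * a2)) * ex1 (b1 * a1 + b2 * a2) * (ex1 (- (b1 * - a1 + b2 * - a2) / 2) *
    (Ci / w * (/ w) ^ k * ((- (1)) ^ k * T))))%C; [ring|]; rewrite E; ring.
Qed.

Lemma gauss_ex1_b t (b c : R) z : gauss t (RtoC (b + c)) z = (ex1 (t * c) * gauss t (RtoC b) z)%C.
Proof. unfold gauss; rewrite Cexp_ex1; f_equal; rewrite !RtoC_mult, RtoC_plus; ring. Qed.

Lemma gauss_ex1_z t b z (x : R) : gauss t b (z + RtoC x) = (ex1 (t * t * x / 2) * gauss t b z)%C.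
Proof. unfold gauss; rewrite Cexp_ex1; f_equal; replace (2 * PI * (t * t * x / 2)) with (PI * (t * t) * x) by field; rewrite !RtoC_mult; ring. Qed.

Lemma th2_scal_ext k a1 a2 b1 b2 w b1' b2' w' c : 0 < Im w ->
  (forall p, term2 k a1 a2 b1' b2' w' p = (c * term2 k a1 a2 b1 b2 w p)%C) ->
  th2 k a1 a2 b1' b2' w' = (c * th2 k a1 a2 b1 b2 w)%C.
Proof. intros Hw E; apply USum_correct; eapply usum_ext; [|apply usum_scal, th2_usum, Hw]; intros p; rewrite E; auto. Qed.

(** The integers n^2 and n have the same parity. *)
Lemma ex1_half_sqr n j : ex1 (IZR n * IZR n * IZR j / 2) = ex1 (IZR n * (IZR j / 2)).
Proof.
  destruct (Z.Even_or_Odd (n * n - n)) as [[m E]|[m E]]; [|exfalso; nia || (destruct (Z.Even_or_Odd n) as [[q ->]|[q ->]]; nia)].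
  replace (IZR n * IZR n * IZR j / 2) with (IZR n * (IZR j / 2) + IZR (m * j)); [apply ex1_period|].
  rewrite mult_IZR; replace (IZR m) with ((IZR n * IZR n - IZR n) / 2); [field|].
  rewrite <- mult_IZR, <- minus_IZR, E, mult_IZR; field.
Qed.

(** The shift by j/2 comes from the congruence of n^2 and n modulo 2. The phase is left unspecified
    because the lemma serves only estimates at the cusps. *)
Lemma Th_Tj k a1 a2 b1 b2 j : exists c, Cmod c = 1 /\ forall w, 0 < Im w ->
  Th k a1 a2 b1 b2 (w + RtoC (IZR j)) =
  (c * Th k a1 a2 (b1 + (IZR j * a1 + IZR j / 2)) (b2 + (IZR j * a2 + IZR j / 2)) w)%C.
Proof.
  set (c1 := IZR j * a1 + IZR j / 2); set (c2 := IZR j * a2 + IZR j / 2).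
  set (u := a1 * a1 * IZR j / 2 + a2 * a2 * IZR j / 2 - (a1 * c1 + a2 * c2)).
  exists (ex1 ((a1 * c1 + a2 * c2) / 2) * ex1 u)%C; split; [rewrite Cmod_mult, !Cmod_ex1; ring|].
  intros w Hw; unfold Th.
  rewrite (th2_scal_ext k a1 a2 (RtoC (b1 + c1)) (RtoC (b2 + c2)) w (RtoC b1) (RtoC b2) _ (ex1 u) Hw).
  - replace (ex1 (- (a1 * b1 + a2 * b2) / 2)) with
      (ex1 ((a1 * c1 + a2 * c2) / 2) * ex1 (- (a1 * (b1 + c1) + a2 * (b2 + c2)) / 2))%C
      by (rewrite <- ex1_plus; f_equal; field); ring.
  - intros [n1 n2]; unfold term2; cbn [fst snd]; rewrite !gauss_ex1_z, !gauss_ex1_b.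
    assert (K : forall n a, ex1 ((IZR n + a) * (IZR n + a) * IZR j / 2) =
       (ex1 (a * a * IZR j / 2 - a * (IZR j * a + IZR j / 2)) * ex1 ((IZR n + a) * (IZR j * a + IZR j / 2)))%C).
    { intros n a; rewrite <- ex1_plus.
      replace ((IZR n + a) * (IZR n + a) * IZR j / 2) with
        (IZR n * IZR n * IZR j / 2 + (IZR n * a * IZR j + a * a * IZR j / 2)) by field.
      rewrite ex1_plus, ex1_half_sqr, <- ex1_plus; f_equal; field. }
    rewrite !K; fold c1 c2.
    replace (ex1 u) with (ex1 (a1 * a1 * IZR j / 2 - a1 * c1) * ex1 (a2 * a2 * IZR j / 2 - a2 * c2))%C
      by (rewrite <- ex1_plus; f_equal; unfold u; ring); ring.
Qed.

Lemma Th_T2 k a1 a2 b1 b2 w : 0 < Im w -> Th k a1 a2 b1 b2 (w + 2) = Th k a1 a2 (b1 + 2 * a1) (b2 + 2 * a2) w.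
Proof.
  intros Hw; unfold Th.
  rewrite (th2_scal_ext k a1 a2 (RtoC (b1 + 2 * a1)) (RtoC (b2 + 2 * a2)) w (RtoC b1) (RtoC b2) _ (ex1 (- (a1 * a1 + a2 * a2))) Hw).
  - rewrite Cmult_assoc, <- ex1_plus; do 2 f_equal; field.
  - intros [n1 n2]; unfold term2; cbn [fst snd]; rewrite !gauss_ex1_z, !gauss_ex1_b.
    assert (K : forall n a, ex1 ((IZR n + a) * (IZR n + a) * 2 / 2) = (ex1 (- (a * a)) * ex1 ((IZR n + a) * (2 * a)))%C).
    { intros n a; rewrite <- ex1_plus.
      replace ((IZR n + a) * (IZR n + a) * 2 / 2) with (- (a * a) + (IZR n + a) * (2 * a) + IZR (n * n)) by (rewrite mult_IZR; field).
      apply ex1_period. }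
    rewrite !K.
    replace (ex1 (- (a1 * a1 + a2 * a2))) with (ex1 (- (a1 * a1)) * ex1 (- (a2 * a2)))%C by (rewrite <- ex1_plus; f_equal; ring); ring.
Qed.

Lemma Th_lattice_a k a1 a2 b1 b2 l1 l2 w : 0 < Im w ->
  Th k (a1 + IZR l1) (a2 + IZR l2) b1 b2 w = (ex1 (- (IZR l1 * b1 + IZR l2 * b2) / 2) * Th k a1 a2 b1 b2 w)%C.
Proof.
  intros Hw; unfold Th.
  replace (th2 k (a1 + IZR l1) (a2 + IZR l2) (RtoC b1) (RtoC b2) w) with (th2 k a1 a2 (RtoC b1) (RtoC b2) w).
  - rewrite Cmult_assoc, <- ex1_plus; do 2 f_equal; field.
  - symmetry; apply USum_correct.
    apply (usum_ext (fun p => term2 k a1 a2 (RtoC b1) (RtoC b2) w (fst p + l1, snd p + l2)%Z)).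
    + intros [n1 n2]; unfold term2, pt; cbn [fst snd]; rewrite !plus_IZR.
      replace (IZR n1 + IZR l1 + a1) with (IZR n1 + (a1 + IZR l1)) by ring.
      replace (IZR n2 + IZR l2 + a2) with (IZR n2 + (a2 + IZR l2)) by ring; reflexivity.
    + apply (usum_bij (fun p : Z * Z => (fst p + l1, snd p + l2)%Z) (fun p => (fst p - l1, snd p - l2)%Z));
        [intros [x y]; simpl; f_equal; lia|intros [x y]; simpl; f_equal; lia|apply th2_usum, Hw].
Qed.

Lemma Th_lattice_b k b1 b2 l1 l2 w : 0 < Im w -> Th k 0 0 (b1 + IZR l1) (b2 + IZR l2) w = Th k 0 0 b1 b2 w.
Proof.
  intros Hw; unfold Th.
  rewrite (th2_scal_ext k 0 0 (RtoC b1) (RtoC b2) w _ _ _ 1 Hw).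
  - rewrite Cmult_1_l; do 2 f_equal; field.
  - intros [n1 n2]; unfold term2; cbn [fst snd]; rewrite !gauss_ex1_b, !Rplus_0_r, <- !mult_IZR, !ex1_Z; ring.
Qed.

(** The map is S T^(-2) S, with [v] the point reached after the first S and T^(-2); the automorphy
    factors of the two inversions combine to a power of 2w + 1. *)
Lemma Th_U k a1 a2 b1 b2 w : 0 < Im w ->
  Th k a1 a2 b1 b2 (w / (2 * w + 1)) = ((2 * w + 1) ^ S k * Th k (a1 + 2 * b1) (a2 + 2 * b2) b1 b2 w)%C.
Proof.
  intros Hw; pose proof (Im_opp_inv w Hw) as Hw'; pose proof (Im_pos_neq_0 w Hw) as Nw.
  set (v := (- / w + RtoC (-2))%C).
  assert (Hv : 0 < Im v) by (unfold v; simpl in *; lra).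
  pose proof (Im_pos_neq_0 v Hv) as Nv.
  assert (N2 : (2 * w + 1)%C <> 0).
  { intros E; assert (Im (2 * w + 1) = 0) by (rewrite E; reflexivity); destruct w; simpl in *; lra. }
  assert (Ev : (w / (2 * w + 1) = - / v)%C).
  { replace v with (- (2 * w + 1) / w)%C; [field; auto|]; unfold v; replace (RtoC (-2)) with (- (2))%C by (apply C_eq; simpl; ring); field; auto. }
  rewrite Ev.
  assert (E1 : Th k a1 a2 b1 b2 (- / v) = (Ci / (- / v) * (- / (- / v)) ^ k * Th k b1 b2 (- a1) (- a2) v)%C).
  { pose proof (Th_S k a1 a2 b1 b2 (- / v) (Im_opp_inv v Hv)) as X; rewrite X; do 2 f_equal.
    field; auto. }
  assert (E2 : Th k b1 b2 (- a1) (- a2) v = Th k b1 b2 (- (a1 + 2 * b1)) (- (a2 + 2 * b2)) (- / w)).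
  { pose proof (Th_T2 k b1 b2 (- (a1 + 2 * b1)) (- (a2 + 2 * b2)) v Hv) as X.
    replace (- (a1 + 2 * b1) + 2 * b1) with (- a1) in X by ring; replace (- (a2 + 2 * b2) + 2 * b2) with (- a2) in X by ring.
    rewrite <- X; f_equal; unfold v; replace (RtoC (-2)) with (- (2))%C by (apply C_eq; simpl; ring); ring. }
  assert (E3 := Th_S k (a1 + 2 * b1) (a2 + 2 * b2) b1 b2 w Hw).
  rewrite E1, E2, E3.
  set (X := Th k b1 b2 _ _ _).
  assert (Vw : v = (- (2 * w + 1) / w)%C).
  { unfold v; replace (RtoC (-2)) with (- (2))%C by (apply C_eq; simpl; ring); field; auto. }
  replace (- / - / v)%C with v by (field; auto).
  replace (v ^ k)%C with ((2 * w + 1) ^ k * (- / w) ^ k)%C by (rewrite <- Cpow_mult_l, Vw; f_equal; field; auto).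
  replace (Ci / - / v)%C with ((2 * w + 1) * (Ci / w))%C by (rewrite Vw; field; auto).
  rewrite Cpow_S; ring.
Qed.

(** * Moebius transformations *)

Definition den (c d : Z) (z : C) : C := (ZtoC c * z + ZtoC d)%C.

Lemma den_neq_0 c d z : inH z -> (c <> 0 \/ d <> 0)%Z -> den c d z <> 0.
Proof.
  unfold inH; intros Hz H E.
  assert (E1 : Re (den c d z) = 0) by (rewrite E; reflexivity).
  assert (E2 : Im (den c d z) = 0) by (rewrite E; reflexivity).
  destruct z as [x y]; unfold den, ZtoC in *; simpl in *.
  assert (IZR c = 0) by nra.
  assert (IZR d = 0) by nra.
  destruct H as [H|H]; apply H; apply eq_IZR; auto.
Qed.

Lemma det_neq_0 a b c d : (a * d - b * c = 1)%Z -> (c <> 0 \/ d <> 0)%Z.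
Proof. intros H; destruct (Z.eq_dec c 0) as [->|]; [right; nia|left; auto]. Qed.

Lemma Im_mob a b c d z : (a * d - b * c = 1)%Z -> inH z ->
  Im (mob a b c d z) = Im z / (Cmod (den c d z) * Cmod (den c d z)).
Proof.
  intros H Hz.
  pose proof (den_neq_0 c d z Hz (det_neq_0 _ _ _ _ H)) as N.
  rewrite Cmod_sqr_eq.
  assert (P : 0 < Re (den c d z) * Re (den c d z) + Im (den c d z) * Im (den c d z)).
  { rewrite <- Cmod_sqr_eq; apply Cmod_gt_0 in N; nra. }
  assert (H' : IZR a * IZR d - IZR b * IZR c = 1) by (rewrite <- !mult_IZR, <- minus_IZR, H; auto).
  unfold mob; change (Cplus (Cmult (ZtoC c) z) (ZtoC d)) with (den c d z).
  destruct z as [x y]; unfold den, ZtoC, inH in *; simpl in *.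
  field_simplify_eq; [|nra].
  transitivity (y * (IZR a * IZR d - IZR b * IZR c)); [ring|rewrite H'; ring].
Qed.

Lemma mob_inH a b c d z : (a * d - b * c = 1)%Z -> inH z -> inH (mob a b c d z).
Proof.
  intros H Hz; unfold inH; rewrite Im_mob by auto.
  pose proof (den_neq_0 c d z Hz (det_neq_0 _ _ _ _ H)) as N; apply Cmod_gt_0 in N.
  apply Rdiv_lt_0_compat; auto; nra.
Qed.

Lemma ZtoC_plus m n : ZtoC (m + n) = (ZtoC m + ZtoC n)%C.
Proof. unfold ZtoC; rewrite plus_IZR, RtoC_plus; auto. Qed.
Lemma ZtoC_mult m n : ZtoC (m * n) = (ZtoC m * ZtoC n)%C.
Proof. unfold ZtoC; rewrite mult_IZR, RtoC_mult; auto. Qed.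

Lemma mob_comp a b c d a' b' c' d' z : inH z -> (a' * d' - b' * c' = 1)%Z -> (a * d - b * c = 1)%Z ->
  mob a b c d (mob a' b' c' d' z) = mob (a * a' + b * c') (a * b' + b * d') (c * a' + d * c') (c * b' + d * d') z.
Proof.
  intros Hz H' H.
  pose proof (den_neq_0 c' d' z Hz (det_neq_0 _ _ _ _ H')) as N'.
  assert (D : ((a * a' + b * c') * (c * b' + d * d') - (a * b' + b * d') * (c * a' + d * c') = 1)%Z)
    by (transitivity ((a * d - b * c) * (a' * d' - b' * c'))%Z; [ring|rewrite H, H'; ring]).
  pose proof (den_neq_0 _ _ z Hz (det_neq_0 _ _ _ _ D)) as N.
  unfold den, mob in *; rewrite !ZtoC_plus, !ZtoC_mult in *.
  field; repeat split; auto; intros E; apply N; rewrite <- E; ring.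
Qed.

Lemma den_comp a' b' c' d' c d z : inH z -> (a' * d' - b' * c' = 1)%Z ->
  (den c d (mob a' b' c' d' z) * den c' d' z)%C = den (c * a' + d * c') (c * b' + d * d') z.
Proof.
  intros Hz H'; pose proof (den_neq_0 c' d' z Hz (det_neq_0 _ _ _ _ H')) as N'.
  unfold den, mob in *; rewrite !ZtoC_plus, !ZtoC_mult; field; auto.
Qed.

(** * The action of Gamma_0(4) on theta series *)

(** In the variable 2z the matrix becomes (a, 2b; c/2, d), and the pairs (a_i, b_i) transform as row
    vectors under right multiplication by it. *)
Definition ThA (k : nat) (a b c d : Z) : Prop := forall a1 a2 b1 b2 z, inH z ->
  Th k a1 a2 b1 b2 (2 * mob a b c d z) =
  (chi_m4 d * den c d z ^ S k *
   Th k (IZR a * a1 + IZR c / 2 * b1) (IZR a * a2 + IZR c / 2 * b2)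
        (2 * IZR b * a1 + IZR d * b1) (2 * IZR b * a2 + IZR d * b2) (2 * z))%C.

Lemma ThA_comp k a b c d a' b' c' d' : (a * d - b * c = 1)%Z -> (a' * d' - b' * c' = 1)%Z ->
  chi_m4 (c * b' + d * d') = (chi_m4 d * chi_m4 d')%C ->
  ThA k a b c d -> ThA k a' b' c' d' ->
  ThA k (a * a' + b * c') (a * b' + b * d') (c * a' + d * c') (c * b' + d * d').
Proof.
  intros D D' X H H' a1 a2 b1 b2 z Hz.
  rewrite <- mob_comp by auto.
  rewrite H by (apply mob_inH; auto); rewrite H' by auto.
  rewrite X, <- (den_comp a' b' c' d') by auto; rewrite Cpow_mult_l.
  match goal with |- (?x * ?y * (?x' * ?y' * ?t) = ?x * ?x' * (?y * ?y') * ?t')%C => replace t' with t; [ring|] end.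
  f_equal; rewrite !plus_IZR, !mult_IZR; field.
Qed.

Lemma two_z_pos z : inH z -> 0 < Im (2 * z).
Proof. unfold inH; destruct z; simpl; lra. Qed.

Lemma Im_shift z n : inH z -> inH (z + ZtoC n).
Proof. unfold inH, ZtoC; destruct z; simpl; lra. Qed.

Lemma chi_m4_1 : chi_m4 1 = 1. Proof. reflexivity. Qed.

Lemma mob_T b z : mob 1 b 0 1 z = (z + ZtoC b)%C.
Proof. unfold mob, ZtoC; field; intros E; injection E; lra. Qed.

Lemma den_T z : den 0 1 z = 1.
Proof. unfold den, ZtoC; ring. Qed.

Lemma ThA_T k b : ThA k 1 b 0 1.
Proof.
  intros a1 a2 b1 b2 z Hz; rewrite mob_T, den_T, chi_m4_1, Cpow_1_l.
  replace (1 * a1 + 0 / 2 * b1) with a1 by field; replace (1 * a2 + 0 / 2 * b2) with a2 by field.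
  rewrite !Rmult_1_l, !Cmult_1_l.
  assert (N : forall (m : nat) c1 c2 w, inH w -> Th k a1 a2 c1 c2 (2 * (w + ZtoC (Z.of_nat m))) =
    Th k a1 a2 (2 * INR m * a1 + c1) (2 * INR m * a2 + c2) (2 * w)).
  { induction m as [|m IH]; intros c1 c2 w Hw.
    - f_equal; simpl; try ring; unfold ZtoC; ring.
    - rewrite Nat2Z.inj_succ; unfold Z.succ; rewrite ZtoC_plus.
      replace (2 * (w + (ZtoC (Z.of_nat m) + ZtoC 1)))%C with (2 * (w + ZtoC (Z.of_nat m)) + 2)%C by (unfold ZtoC; ring).
      rewrite Th_T2 by (apply two_z_pos, Im_shift; auto).
      rewrite IH by auto; rewrite S_INR; f_equal; ring. }
  destruct (Z_le_dec 0 b) as [h|h].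
  - rewrite <- (Z2Nat.id b) by auto; rewrite N, INR_IZR_INZ by auto; auto.
  - pose proof (N (Z.to_nat (- b)) (2 * IZR b * a1 + b1) (2 * IZR b * a2 + b2) (z + ZtoC b)%C (Im_shift z b Hz)) as E.
    rewrite INR_IZR_INZ, Z2Nat.id in E by lia.
    replace (z + ZtoC b + ZtoC (- b))%C with z in E by (unfold ZtoC; rewrite opp_IZR, RtoC_opp; ring).
    rewrite E, opp_IZR; f_equal; ring.
Qed.

Lemma ThA_U k : ThA k 1 0 4 1.
Proof.
  intros a1 a2 b1 b2 z Hz.
  replace (2 * mob 1 0 4 1 z)%C with ((2 * z) / (2 * (2 * z) + 1))%C.
  - rewrite Th_U by (apply two_z_pos; auto); rewrite chi_m4_1, Cmult_1_l.
    f_equal; [f_equal; unfold den, ZtoC; ring|f_equal; field].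
  - pose proof (den_neq_0 4 1 z Hz ltac:(lia)) as N; unfold den, mob, ZtoC in *; field; repeat split; auto;
    intros E; apply N; rewrite <- E; ring.
Qed.

Lemma ThA_Uinv k : ThA k 1 0 (-4) 1.
Proof.
  intros a1 a2 b1 b2 z Hz.
  assert (Dt : (1 * 1 - 0 * -4 = 1)%Z) by lia.
  set (w := mob 1 0 (-4) 1 z); assert (Hw : inH w) by (apply mob_inH; auto).
  pose proof (ThA_U k (a1 - 2 * b1) (a2 - 2 * b2) b1 b2 w Hw) as E.
  unfold w in E at 1; rewrite mob_comp in E by (auto; lia).
  replace (mob (1 * 1 + 0 * -4) (1 * 0 + 0 * 1) (4 * 1 + 1 * -4) (4 * 0 + 1 * 1) z) with z in E.
  2:{ change (z = mob 1 0 0 1 z); rewrite mob_T; unfold ZtoC; ring. }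
  pose proof (den_comp 1 0 (-4) 1 4 1 z Hz Dt) as Dn; fold w in Dn.
  change (den (4 * 1 + 1 * -4) (4 * 0 + 1 * 1) z) with (den 0 1 z) in Dn; rewrite den_T in Dn.
  rewrite chi_m4_1, Cmult_1_l in *.
  replace (1 * (a1 - 2 * b1) + 4 / 2 * b1) with a1 in E by field.
  replace (1 * (a2 - 2 * b2) + 4 / 2 * b2) with a2 in E by field.
  replace (2 * 0 * (a1 - 2 * b1) + 1 * b1) with b1 in E by ring.
  replace (2 * 0 * (a2 - 2 * b2) + 1 * b2) with b2 in E by ring.
  replace (1 * a1 + -4 / 2 * b1) with (a1 - 2 * b1) by field.
  replace (1 * a2 + -4 / 2 * b2) with (a2 - 2 * b2) by field.
  replace (2 * 0 * a1 + 1 * b1) with b1 by ring.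
  replace (2 * 0 * a2 + 1 * b2) with b2 by ring.
  rewrite E, Cmult_assoc, <- Cpow_mult_l.
  replace (den (-4) 1 z * den 4 1 w)%C with (RtoC 1) by (rewrite <- Dn; ring).
  rewrite Cpow_1_l; ring.
Qed.

Lemma chi_m4_mod d m : chi_m4 (d + 4 * m) = chi_m4 d.
Proof.
  unfold chi_m4; rewrite Z.odd_add_mul_even by (exists 2%Z; auto).
  replace (d + 4 * m)%Z with (d + m * 4)%Z by ring; rewrite Z.mod_add by lia; auto.
Qed.

(** Euclidean descent on |c| + |d| with the generators T, (1, 0; 4, 1) and -1: right multiplication
    changes c by 4d when |c| > 2|d|, and d by c otherwise. Equality |c| = 2|d| cannot occur, as d is
    odd and 4 divides c, and neither move changes d modulo 4. *)
Lemma ThA_Gamma0_4 k : forall (n : nat) a b c d, (Z.abs c + Z.abs d <= Z.of_nat n)%Z ->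
  (a * d - b * c = 1)%Z -> (4 | c)%Z -> ThA k a b c d.
Proof.
  induction n as [|n IH]; intros a b c d Hn D [c' Hc].
  { exfalso; assert (c = 0 /\ d = 0)%Z as [-> ->] by lia; lia. }
  assert (Od : Z.odd d = true).
  { destruct (Z.odd d) eqn:O; auto; exfalso.
    rewrite <- Z.negb_even in O; destruct (Z.even d) eqn:E; [|discriminate].
    apply Z.even_spec in E; destruct E as [e ->]; lia. }
  apply Z.odd_spec in Od; destruct Od as [d' Hd].
  destruct (Z.eq_dec c 0) as [Z0|Z0].
  - clear Hc Hd c' d'; subst c.
    assert (X : ((a = 1 /\ d = 1) \/ (a = -1 /\ d = -1))%Z).
    { assert (Had : (a * d = 1)%Z) by lia; destruct (Z.eq_mul_1 a d Had); subst; lia. }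
    destruct X as [[-> ->]|[-> ->]]; [apply ThA_T|].
    intros a1 a2 b1 b2 z Hz.
    replace (mob (-1) b 0 (-1) z) with (mob 1 (- b) 0 1 z).
    2:{ rewrite mob_T; unfold mob, ZtoC; rewrite opp_IZR, !RtoC_opp; field; intros X; injection X; lra. }
    rewrite ThA_T, den_T, chi_m4_1, Cpow_1_l, !Cmult_1_l by auto.
    replace (den 0 (-1) z) with (- (1))%C by (unfold den, ZtoC; apply C_eq; simpl; ring).
    replace (-1 * a1 + 0 / 2 * b1) with (- a1) by field.
    replace (-1 * a2 + 0 / 2 * b2) with (- a2) by field.
    replace (2 * IZR b * a1 + -1 * b1) with (- (- (2 * IZR b * a1) + b1)) by ring.
    replace (2 * IZR b * a2 + -1 * b2) with (- (- (2 * IZR b * a2) + b2)) by ring.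
    rewrite Th_neg by (apply two_z_pos; auto).
    replace (1 * a1 + 0 / 2 * b1) with a1 by field; replace (1 * a2 + 0 / 2 * b2) with a2 by field.
    replace (2 * IZR (- b) * a1 + 1 * b1) with (- (2 * IZR b * a1) + b1) by (rewrite opp_IZR; ring).
    replace (2 * IZR (- b) * a2 + 1 * b2) with (- (2 * IZR b * a2) + b2) by (rewrite opp_IZR; ring).
    set (X := Th k a1 _ _ _ _).
    replace (chi_m4 (-1)) with (- (1))%C by (apply C_eq; simpl; ring).
    rewrite Cpow_S.
    (* For the matrices with d = -1, the sign (-1)^k of [Th_neg] cancels chi(-1) (-1)^(k+1). *)
    assert (S2 : ((- (1)) ^ k * (- (1)) ^ k = 1)%C).
    { rewrite <- Cpow_mult_l; replace (- (1) * - (1))%C with (RtoC 1) by ring; apply Cpow_1_l. }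
    transitivity (((- (1)) ^ k * (- (1)) ^ k) * X)%C; [rewrite S2; ring|ring].
  - assert (Step : forall a' b' c' d', (a' * d' - b' * c' = 1)%Z -> (4 | c')%Z -> ThA k a' b' c' d' ->
       chi_m4 d' = 1 -> d' = 1%Z ->
       ThA k (a * d' - b * c')%Z (- a * b' + b * a')%Z (c * d' - d * c')%Z (- c * b' + d * a')%Z ->
       chi_m4 d = chi_m4 (- c * b' + d * a') ->
       ThA k a b c d).
    { intros a' b' c'' d'' D' [q Hq] HA X1 X2 HB Hchi.
      pose proof (ThA_comp k (a * d'' - b * c'')%Z (- a * b' + b * a')%Z (c * d'' - d * c'')%Z (- c * b' + d * a')%Z
        a' b' c'' d'') as T.
      assert (E1 : ((a * d'' - b * c'') * a' + (- a * b' + b * a') * c'' = a)%Z) by (transitivity (a * (a' * d'' - b' * c''))%Z; [ring|rewrite D'; ring]).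
      assert (E2 : ((a * d'' - b * c'') * b' + (- a * b' + b * a') * d'' = b)%Z) by (transitivity (b * (a' * d'' - b' * c''))%Z; [ring|rewrite D'; ring]).
      assert (E3 : ((c * d'' - d * c'') * a' + (- c * b' + d * a') * c'' = c)%Z) by (transitivity (c * (a' * d'' - b' * c''))%Z; [ring|rewrite D'; ring]).
      assert (E4 : ((c * d'' - d * c'') * b' + (- c * b' + d * a') * d'' = d)%Z) by (transitivity (d * (a' * d'' - b' * c''))%Z; [ring|rewrite D'; ring]).
      rewrite E1, E2, E3, E4 in T; apply T; auto.
      - transitivity ((a * d - b * c) * (a' * d'' - b' * c''))%Z; [ring|rewrite D, D'; ring].
      - rewrite X1, <- Hchi; ring. }
    assert (Sg : ((0 < c /\ 0 < d \/ c < 0 /\ d < 0) \/ (0 < c /\ d < 0 \/ c < 0 /\ 0 < d))%Z) by lia.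
    destruct (Z_lt_dec (2 * Z.abs d) (Z.abs c)) as [L|L].
    + destruct Sg as [P|P].
      * apply (Step 1 0 4 1)%Z; [lia|now exists (1)%Z|apply ThA_U|reflexivity|reflexivity| |].
        -- apply IH; [lia|transitivity (a * d - b * c)%Z; [ring|auto]|exists (c' - d)%Z; lia].
        -- f_equal; ring.
      * apply (Step 1 0 (-4) 1)%Z; [lia|now exists (-1)%Z|apply ThA_Uinv|reflexivity|reflexivity| |].
        -- apply IH; [lia|transitivity (a * d - b * c)%Z; [ring|auto]|exists (c' + d)%Z; lia].
        -- f_equal; ring.
    + destruct Sg as [P|P].
      * apply (Step 1 1 0 1)%Z; [lia|now exists (0)%Z|apply ThA_T|reflexivity|reflexivity| |].
        -- apply IH; [lia|transitivity (a * d - b * c)%Z; [ring|auto]|exists c'; lia].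
        -- replace (- c * 1 + d * 1)%Z with (d + 4 * - c')%Z by lia; rewrite chi_m4_mod; auto.
      * apply (Step 1 (-1) 0 1)%Z; [lia|now exists (0)%Z|apply ThA_T|reflexivity|reflexivity| |].
        -- apply IH; [lia|transitivity (a * d - b * c)%Z; [ring|auto]|exists c'; lia].
        -- replace (- c * -1 + d * 1)%Z with (d + 4 * c')%Z by lia; rewrite chi_m4_mod; auto.
Qed.

Lemma Th_Gamma0_4 k a b c d b1 b2 z : (a * d - b * c = 1)%Z -> (4 | c)%Z -> inH z ->
  Th k 0 0 b1 b2 (2 * mob a b c d z) =
  (chi_m4 d * den c d z ^ S k * Th k (IZR c / 2 * b1) (IZR c / 2 * b2) (IZR d * b1) (IZR d * b2) (2 * z))%C.
Proof.
  intros D Hc Hz.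
  rewrite (ThA_Gamma0_4 k (Z.to_nat (Z.abs c + Z.abs d)) a b c d) by (auto; lia).
  f_equal; f_equal; ring.
Qed.

(** * Decay at the cusps *)

Lemma lattice_gap a : exists m, 0 < m /\ forall n, IZR n + a = 0 \/ m <= Rabs (IZR n + a).
Proof.
  pose proof (base_Int_part a) as [B1 B2]; set (q := Int_part a) in *.
  destruct (Req_dec (a - IZR q) 0) as [E|E].
  - exists 1; split; [lra|]; intros n; destruct (Z.eq_dec (n + q) 0) as [Z0|Z0].
    + left; replace a with (IZR q) by lra; rewrite <- plus_IZR, Z0; auto.
    + right; replace a with (IZR q) by lra; rewrite <- plus_IZR, <- abs_IZR; apply IZR_le; lia.
  - exists (Rmin (a - IZR q) (1 - (a - IZR q))); split; [apply Rmin_pos; lra|]; intros n; right.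
    replace (IZR n + a) with (IZR (n + q) + (a - IZR q)) by (rewrite plus_IZR; ring).
    destruct (Z_le_dec 0 (n + q)) as [P|P].
    + assert (0 <= IZR (n + q)) by (apply IZR_le; lia).
      rewrite Rabs_pos_eq by lra; eapply Rle_trans; [apply Rmin_l|lra].
    + assert (IZR (n + q) <= -1) by (apply IZR_le; lia).
      rewrite Rabs_left by lra; eapply Rle_trans; [apply Rmin_r|lra].
Qed.

(** For k >= 1 the harmonic factor removes a lattice point at the origin. Every other point has
    squared modulus at least m^2, which gains exp(-pi m^2 (Im w - 1)) termwise over the majorant at
    w = i. *)
Lemma Th_decay k a1 a2 b1 b2 : (1 <= k)%nat -> exists K mu, 0 <= K /\ 0 < mu /\ forall w, 1 <= Im w ->
  Cmod (Th k a1 a2 b1 b2 w) <= K * exp (- mu * Im w).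
Proof.
  intros Hk; destruct (lattice_gap a1) as [m1 [P1 G1]]; destruct (lattice_gap a2) as [m2 [P2 G2]].
  set (m := Rmin m1 m2); assert (Pm : 0 < m) by (apply Rmin_pos; auto).
  pose proof PI_RGT_0.
  assert (Hi : 0 < Im Ci) by (simpl; lra).
  destruct (wt2_dominated (INR k) a1 a2 (RtoC b1) (RtoC b2) Ci Hi) as [K [HK B]].
  exists (exp (PI * (m * m)) * K * (3 * 3)), (PI * (m * m)).
  split; [apply Rmult_le_pos; [apply Rmult_le_pos; auto; apply Rlt_le, exp_pos|lra]|].
  split; [apply Rmult_lt_0_compat; nra|]; intros w Hw.
  unfold Th; rewrite Cmod_mult, Cmod_ex1, Rmult_1_l.
  set (E := exp (PI * (m * m)) * exp (- (PI * (m * m)) * Im w)).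
  assert (HE : 0 <= E) by (apply Rmult_le_pos; apply Rlt_le, exp_pos).
  replace (_ * exp (- (PI * (m * m)) * Im w)) with (E * K * (3 * 3)) by (unfold E; ring).
  apply (usum_bound (term2 k a1 a2 (RtoC b1) (RtoC b2) w) (fun p => E * K * w2 p)).
  - apply th2_usum; lra.
  - intros p; rewrite Rmult_assoc; eapply Rle_trans; [|apply Rmult_le_compat_l; [auto|apply B]].
    apply Rle_trans with (E * Cmod (term2 k a1 a2 (RtoC b1) (RtoC b2) Ci p)); [|apply Rmult_le_compat_l; auto; apply term2_bound].
    unfold term2; rewrite !Cmod_mult, !Cmod_gauss; simpl Im; rewrite !Rmult_0_r.
    set (t1 := IZR (fst p) + a1); set (t2 := IZR (snd p) + a2).
    destruct (Req_dec (t1 * t1 + t2 * t2) 0) as [Z0|Z0].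
    + assert (T1 : t1 = 0) by nra; assert (T2 : t2 = 0) by nra.
      replace (pt a1 a2 p) with (RtoC 0) by (unfold pt; fold t1 t2; rewrite T1, T2; auto).
      rewrite Cmod_pow, Cmod_0, pow_ne_zero by lia; lra.
    + assert (M : m * m <= t1 * t1 + t2 * t2).
      { destruct (G1 (fst p)) as [g1|g1]; destruct (G2 (snd p)) as [g2|g2]; fold t1 in g1; fold t2 in g2.
        - exfalso; apply Z0; rewrite g1, g2; ring.
        - rewrite (Rabs_sqr t2); assert (m <= Rabs t2) by (eapply Rle_trans; [apply Rmin_r|auto]); nra.
        - rewrite (Rabs_sqr t1); assert (m <= Rabs t1) by (eapply Rle_trans; [apply Rmin_l|auto]); nra.
        - rewrite (Rabs_sqr t1); assert (m <= Rabs t1) by (eapply Rle_trans; [apply Rmin_l|auto]); nra. }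
      rewrite Rmult_comm, (Rmult_comm (Cmod _)), <- (Rmult_assoc E); apply Rmult_le_compat_r; [apply Cmod_ge_0|].
      unfold E; rewrite <- !exp_plus; apply exp_mono.
      assert (PI * ((Im w - 1) * (m * m)) <= PI * ((Im w - 1) * (t1 * t1 + t2 * t2))).
      { apply Rmult_le_compat_l; [lra|]; apply Rmult_le_compat_l; lra. }
      lra.
  - apply bounded_sum_scal; [apply Rmult_le_pos; auto|apply w2_bounded].
Qed.

Lemma Cmod_Th_S k a1 a2 b1 b2 w : 0 < Im w ->
  Cmod (Th k a1 a2 b1 b2 (- / w)) = Cmod w ^ S k * Cmod (Th k b1 b2 (- a1) (- a2) w).
Proof.
  intros Hw; pose proof (Im_pos_neq_0 w Hw) as N.
  rewrite (Th_S k a1 a2 b1 b2 (- / w)) by (apply Im_opp_inv; auto).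
  replace (- / - / w)%C with w by (field; auto).
  replace (Ci / - / w)%C with (- Ci * w)%C by (field; auto).
  rewrite !Cmod_mult, Cmod_opp, Cmod_Ci, Cmod_pow; simpl; ring.
Qed.

(** In the variable 2z the map is -1/w with w = (z + m)/2, hence the halved decay rate. *)
Lemma Th_cusp_S k b1 b2 m : (1 <= k)%nat -> exists K mu, 0 <= K /\ 0 < mu /\ forall z, 2 <= Im z ->
  Cmod (Th k 0 0 b1 b2 (2 * mob 0 (-1) 1 m z)) <= Cmod (den 1 m z) ^ S k * (K * exp (- mu * Im z)).
Proof.
  intros Hk; destruct (Th_decay k b1 b2 (- 0) (- 0) Hk) as [K [mu [HK [Hm B]]]].
  exists K, (mu / 2); split; auto; split; [lra|]; intros z Hz.
  set (w := (den 1 m z / 2)%C).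
  assert (Hw : Im w = Im z / 2) by (unfold w, den, ZtoC; destruct z; simpl; field).
  assert (HI : inH z) by (unfold inH; lra).
  pose proof (den_neq_0 1 m z HI ltac:(lia)) as N.
  replace (2 * mob 0 (-1) 1 m z)%C with (- / w)%C.
  2:{ unfold w, mob; fold (den 1 m z); unfold ZtoC.
      replace (RtoC (-1)) with (- (1))%C by (apply C_eq; simpl; ring); field; auto. }
  rewrite Cmod_Th_S by lra.
  apply Rmult_le_compat; try apply Cmod_ge_0; [apply pow_le, Cmod_ge_0| |].
  - apply pow_incr; split; [apply Cmod_ge_0|].
    unfold w; rewrite Cmod_div, Cmod_R, Rabs_pos_eq by (try lra; intros E; injection E; lra).
    pose proof (Cmod_ge_0 (den 1 m z)); lra.
  - eapply Rle_trans; [apply B; lra|]; right; rewrite Hw; do 2 f_equal; field.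
Qed.

(** In the variable 2z the map is S T^(-j) S; the two inversions contribute |v| and |w|, and v w =
    -(2jz + 1). *)
Lemma Th_cusp_U k b1 b2 j : (1 <= k)%nat -> exists K mu, 0 <= K /\ 0 < mu /\ forall z, 2 <= Im z ->
  Cmod (Th k 0 0 b1 b2 (2 * mob 1 0 (2 * j) 1 z)) <= Cmod (den (2 * j) 1 z) ^ S k * (K * exp (- mu * Im z)).
Proof.
  intros Hk.
  destruct (Th_Tj k b1 b2 (- 0) (- 0) (- j)) as [c [Hc T]].
  set (e1 := - 0 + _) in T; set (e2 := - 0 + (IZR (- j) * b2 + _)) in T.
  destruct (Th_decay k e1 e2 (- b1) (- b2) Hk) as [K [mu [HK [Hm B]]]].
  exists K, (mu * 2); split; auto; split; [lra|]; intros z Hz.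
  assert (HI : inH z) by (unfold inH; lra).
  assert (Hw : Im (2 * z) = 2 * Im z) by (destruct z; simpl; ring).
  set (w := (2 * z)%C) in *.
  assert (Hw' : 0 < Im (- / w)) by (apply Im_opp_inv; lra).
  set (v := (- / w + RtoC (IZR (- j)))%C).
  assert (Hv : 0 < Im v) by (unfold v; simpl in *; lra).
  pose proof (den_neq_0 (2 * j) 1 z HI ltac:(lia)) as N.
  pose proof (Im_pos_neq_0 w ltac:(lra)) as Nw. pose proof (Im_pos_neq_0 v Hv) as Nv.
  assert (Vw : (v * w = - den (2 * j) 1 z)%C).
  { unfold v, den, ZtoC; rewrite opp_IZR, RtoC_opp, mult_IZR, RtoC_mult.
    replace ((- / w + - RtoC (IZR j)) * w)%C with (- (1) - RtoC (IZR j) * w)%C by (field; auto).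
    unfold w; ring. }
  replace (2 * mob 1 0 (2 * j) 1 z)%C with (- / v)%C.
  2:{ transitivity (w / den (2 * j) 1 z)%C; [|unfold mob; fold (den (2 * j) 1 z); unfold w, ZtoC; field; auto].
      replace (den (2 * j) 1 z) with (- (v * w))%C by (rewrite Vw; ring); field; auto. }
  rewrite Cmod_Th_S by auto; unfold v at 2; rewrite T by auto.
  rewrite Cmod_mult, Hc, Rmult_1_l, Cmod_Th_S by lra.
  rewrite <- Rmult_assoc, <- Rpow_mult_distr, <- Cmod_mult, Vw, Cmod_opp.
  apply Rmult_le_compat_l; [apply pow_le, Cmod_ge_0|].
  eapply Rle_trans; [apply B; lra|]; right; rewrite Hw; do 2 f_equal; ring.
Qed.

(** * Iterated integrals *)

(** Continuity on the whole plane, so that integrability holds for all limits of integration;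
    integrands are extended or clamped to meet it. *)
Definition gc2 (phi : R -> R -> R) : Prop := forall x y, continuity_2d_pt phi x y.

Lemma continuous_eps (f : R -> R) x :
  (forall eps, 0 < eps -> exists d, 0 < d /\ forall y, Rabs (y - x) < d -> Rabs (f y - f x) < eps) -> continuous f x.
Proof.
  intros H; apply filterlim_locally; intros eps; destruct (H eps (cond_pos eps)) as [d [Hd K]].
  exists (mkposreal d Hd); intros y Hy; apply K, Hy.
Qed.

Lemma continuous_eps_inv (f : R -> R) x : continuous f x ->
  forall eps, 0 < eps -> exists d, 0 < d /\ forall y, Rabs (y - x) < d -> Rabs (f y - f x) < eps.
Proof.
  intros H eps He.
  assert (K := proj1 (filterlim_locally f (f x)) H (mkposreal eps He)).
  destruct K as [d Hd]; exists d; split; [apply cond_pos|intros y Hy; apply (Hd y Hy)].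
Qed.

Lemma cont2_comp phi (a b : R -> R -> R) x y : continuity_2d_pt phi (a x y) (b x y) ->
  continuity_2d_pt a x y -> continuity_2d_pt b x y -> continuity_2d_pt (fun u v => phi (a u v) (b u v)) x y.
Proof.
  intros H Ha Hb eps; destruct (H eps) as [d Hd]; destruct (Ha d) as [d1 H1]; destruct (Hb d) as [d2 H2].
  exists (mkposreal (Rmin d1 d2) (Rmin_pos _ _ (cond_pos d1) (cond_pos d2))); intros u v Hu Hv; simpl in *.
  apply Hd; [apply H1|apply H2]; eapply Rlt_le_trans; eauto; solve [apply Rmin_l | apply Rmin_r].
Qed.

Lemma cont2_curve phi (a b : R -> R) x : continuity_2d_pt phi (a x) (b x) ->
  continuous a x -> continuous b x -> continuous (fun u => phi (a u) (b u)) x.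
Proof.
  intros H Ha Hb; apply continuous_eps; intros eps He; destruct (H (mkposreal eps He)) as [d Hd].
  destruct (continuous_eps_inv a x Ha d (cond_pos d)) as [d1 [P1 H1]].
  destruct (continuous_eps_inv b x Hb d (cond_pos d)) as [d2 [P2 H2]].
  exists (Rmin d1 d2); split; [apply Rmin_pos; auto|]; intros y Hy; apply Hd; [apply H1|apply H2];
    eapply Rlt_le_trans; eauto; solve [apply Rmin_l | apply Rmin_r].
Qed.

Lemma gc2_snd phi x y : gc2 phi -> continuous (phi x) y.
Proof. intros H; apply (cont2_curve phi (fun _ => x) (fun y => y)); [apply H|apply continuous_const|apply continuous_id]. Qed.

Lemma gc2_ex_RInt phi x a b : gc2 phi -> ex_RInt (phi x) a b.
Proof. intros H; apply (@ex_RInt_continuous R_CompleteNormedModule); intros; apply gc2_snd, H. Qed.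

Lemma cont2_of_1d_l (a : R -> R) x y : continuous a x -> continuity_2d_pt (fun u _ => a u) x y.
Proof.
  intros H eps; destruct (continuous_eps_inv a x H eps (cond_pos eps)) as [d [P K]].
  exists (mkposreal d P); intros u v Hu _; apply K, Hu.
Qed.

Lemma RInt_lin (f : R -> R) u v a b : ex_RInt f (u * a + v) (u * b + v) ->
  RInt (fun y => u * f (u * y + v)) a b = RInt f (u * a + v) (u * b + v) :> R.
Proof. intros H; apply (RInt_comp_lin (V := R_CompleteNormedModule) f u v a b H). Qed.

Lemma RInt_ext_all (f g : R -> R) a b : (forall x, f x = g x) -> RInt f a b = RInt g a b :> R.
Proof. intros H; apply RInt_ext; intros; apply H. Qed.

Lemma RInt_ext_le (f g : R -> R) a b : a <= b -> (forall x, a <= x <= b -> f x = g x) -> RInt f a b = RInt g a b :> R.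
Proof. intros Hab H; apply RInt_ext; intros x Hx; rewrite Rmin_left, Rmax_right in Hx by auto; apply H; lra. Qed.

Lemma RInt_scalR (f : R -> R) k a b : ex_RInt f a b -> RInt (fun x => k * f x) a b = k * RInt f a b :> R.
Proof. intros H; apply (RInt_scal (V := R_CompleteNormedModule) f a b k H). Qed.

Lemma RInt_plusR (f g : R -> R) a b : ex_RInt f a b -> ex_RInt g a b ->
  RInt (fun x => f x + g x) a b = RInt f a b + RInt g a b :> R.
Proof. intros; apply (RInt_plus (V := R_CompleteNormedModule)); auto. Qed.

Lemma RInt_minusR (f g : R -> R) a b : ex_RInt f a b -> ex_RInt g a b ->
  RInt (fun x => f x - g x) a b = RInt f a b - RInt g a b :> R.
Proof. intros; apply (RInt_minus (V := R_CompleteNormedModule)); auto. Qed.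

Lemma RInt_ChaslesR (f : R -> R) a b c : ex_RInt f a b -> ex_RInt f b c -> RInt f a c = RInt f a b + RInt f b c :> R.
Proof. intros; symmetry; apply (RInt_Chasles (V := R_CompleteNormedModule)); auto. Qed.

Lemma RInt_swapR (f : R -> R) a b : ex_RInt f b a -> RInt f a b = - RInt f b a :> R.
Proof. intros H; symmetry; apply (opp_RInt_swap (V := R_CompleteNormedModule)), H. Qed.

Lemma continuous_RInt_01 (Phi : R -> R -> R) x :
  (forall s, 0 <= s <= 1 -> continuity_2d_pt Phi x s) -> (forall u, ex_RInt (Phi u) 0 1) ->
  continuous (fun u => RInt (Phi u) 0 1) x.
Proof.
  intros H E; apply continuous_eps; intros eps He.
  destruct (uniform_continuity_2d_1d' Phi 0 1 x H (mkposreal (eps / 2) ltac:(lra))) as [d Hd]; simpl in Hd.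
  exists d; split; [apply cond_pos|]; intros y Hy.
  rewrite <- RInt_minusR by auto.
  eapply Rle_lt_trans; [apply (abs_RInt_le_const _ 0 1 (eps / 2))|]; [lra| | |lra].
  - apply (ex_RInt_minus (V := R_CompleteNormedModule)); auto.
  - intros t Ht; apply Rlt_le.
    apply Rabs_def2 in Hy.
    pose proof (cond_pos d).
    apply (Hd t x t y); try lra.
    rewrite Rminus_diag, Rabs_R0; apply cond_pos.
Qed.

(** An affine change of variable fixes the interval to [0, 1], where uniform continuity applies. *)
Lemma continuous_RInt_param phi (lo hi : R -> R) x : gc2 phi -> continuous lo x -> continuous hi x ->
  continuous (fun u => RInt (phi u) (lo u) (hi u)) x.
Proof.
  intros H Hl Hh.
  apply (continuous_ext (fun u => RInt (fun s => (hi u - lo u) * phi u ((hi u - lo u) * s + lo u)) 0 1)).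
  { intros u; rewrite (RInt_lin (phi u)) by (apply gc2_ex_RInt, H); f_equal; ring. }
  assert (Hd : continuous (fun u => hi u - lo u) x) by (apply (continuous_minus (V := R_NormedModule) hi lo); auto).
  apply (continuous_RInt_01 (fun u s => (hi u - lo u) * phi u ((hi u - lo u) * s + lo u))).
  - intros s _; apply continuity_2d_pt_mult; [apply (cont2_of_1d_l (fun u => hi u - lo u)); auto|].
    apply (cont2_comp phi (fun u _ => u) (fun u s => (hi u - lo u) * s + lo u)); [apply H|apply continuity_2d_pt_id1|].
    apply continuity_2d_pt_plus; [apply continuity_2d_pt_mult; [|apply continuity_2d_pt_id2]|].
    + apply (cont2_of_1d_l (fun u => hi u - lo u)); auto.
    + apply (cont2_of_1d_l lo); auto.
  - intros u; apply (@ex_RInt_continuous R_CompleteNormedModule); intros s _.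
    apply (continuous_mult (fun _ => hi u - lo u)); [apply continuous_const|].
    apply (cont2_curve phi (fun _ => u) (fun s => (hi u - lo u) * s + lo u)); [apply H|apply continuous_const|].
    apply (ex_derive_continuous (K := R_AbsRing) (V := R_NormedModule)); auto_derive; auto.
Qed.

Lemma ex_RInt_param phi (lo hi : R -> R) a b : a <= b -> gc2 phi ->
  (forall x, a <= x <= b -> continuous lo x) -> (forall x, a <= x <= b -> continuous hi x) ->
  ex_RInt (fun u => RInt (phi u) (lo u) (hi u)) a b.
Proof.
  intros Hab H Hl Hh; apply (@ex_RInt_continuous R_CompleteNormedModule); intros x Hx.
  rewrite Rmin_left, Rmax_right in Hx by auto; apply continuous_RInt_param; auto.
Qed.

Lemma gc2_flip phi : gc2 phi -> gc2 (fun x y => phi y x).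
Proof.
  intros H x y; apply (cont2_comp phi (fun _ v => v) (fun u _ => u)); [apply H|apply continuity_2d_pt_id2|apply continuity_2d_pt_id1].
Qed.

Lemma is_derive_RInt_upper phi x c u : gc2 phi -> is_derive (fun z => RInt (phi x) c z) u (phi x u).
Proof.
  intros H; apply (is_derive_RInt (phi x) _ c).
  - exists (mkposreal 1 Rlt_0_1); intros y _; apply (RInt_correct (V := R_CompleteNormedModule)), gc2_ex_RInt, H.
  - apply gc2_snd, H.
Qed.

Lemma derive_zero_const (g : R -> R) a b : (forall s, is_derive g s 0) -> g a = g b.
Proof.
  intros Hg; destruct (MVT_gen g a b (fun _ => 0)) as [c [_ E]]; auto.
  - intros s _; apply derivable_continuous_pt; exists 0; apply is_derive_Reals, Hg.
  - lra.
Qed.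

(** Both sides have the same derivative in the upper limit d and vanish at d = c. *)
Lemma fubini_rect phi a b c d : gc2 phi ->
  RInt (fun x => RInt (phi x) c d) a b = RInt (fun s => RInt (fun x => phi x s) a b) c d :> R.
Proof.
  intros H.
  set (F := fun u => RInt (fun x => RInt (phi x) c u) a b - RInt (fun s => RInt (fun x => phi x s) a b) c u).
  assert (D : forall u, is_derive F u 0).
  { intros u; unfold F.
    replace 0 with (RInt (fun t => Derive (fun z => RInt (phi t) c z) u) a b - RInt (fun x => phi x u) a b).
    2:{ rewrite (RInt_ext_all _ (fun x => phi x u)); [ring|]; intros t; apply is_derive_unique, is_derive_RInt_upper, H. }
    apply (is_derive_minus (K := R_AbsRing) (V := R_NormedModule)).
    - apply (is_derive_RInt_param (fun z t => RInt (phi t) c z)).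
      + exists (mkposreal 1 Rlt_0_1); intros y _ t _; eexists; apply is_derive_RInt_upper, H.
      + intros t _; apply (continuity_2d_pt_ext (fun u v => phi v u)); [|apply (gc2_flip phi H)].
        intros; symmetry; apply is_derive_unique, is_derive_RInt_upper, H.
      + exists (mkposreal 1 Rlt_0_1); intros y _; apply (@ex_RInt_continuous R_CompleteNormedModule); intros x _.
        apply (continuous_RInt_param phi (fun _ => c) (fun _ => y)); auto; apply continuous_const.
    - apply (is_derive_RInt (fun s => RInt (fun x => phi x s) a b) _ c).
      + exists (mkposreal 1 Rlt_0_1); intros y _; apply (RInt_correct (V := R_CompleteNormedModule)).
        apply (@ex_RInt_continuous R_CompleteNormedModule); intros x _.
        apply (continuous_RInt_param (fun s x => phi x s) (fun _ => a) (fun _ => b)); try apply continuous_const; apply gc2_flip, H.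
      + apply (continuous_RInt_param (fun s x => phi x s) (fun _ => a) (fun _ => b)); try apply continuous_const; apply gc2_flip, H. }
  pose proof (derive_zero_const F d c D) as E; unfold F in E.
  rewrite (RInt_ext_all (fun x => RInt (phi x) c c) (fun _ => 0)) in E
    by (intros; apply (RInt_point (V := R_CompleteNormedModule))).
  rewrite (RInt_const (V := R_CompleteNormedModule)), (RInt_point (V := R_CompleteNormedModule)) in E.
  change scal with Rmult in E; change zero with 0 in E; simpl in E; lra.
Qed.

(** Both sides have the same derivative in the upper limit b: the boundary term of the moving limit
    is an integral over a single point. *)
Lemma fubini_triangle phi a b : gc2 phi ->
  RInt (fun x => RInt (phi x) x b) a b = RInt (fun s => RInt (fun x => phi x s) a s) a b :> R.
Proof.
  intros H.
  set (F := fun u => RInt (fun x => RInt (phi x) x u) a u - RInt (fun s => RInt (fun x => phi x s) a s) a u).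
  assert (DU : forall t u, is_derive (fun z => RInt (phi t) t z) u (phi t u)) by (intros; apply is_derive_RInt_upper, H).
  assert (CD : forall u t, continuity_2d_pt (fun u v : R => Derive (fun z : R => RInt (phi v) v z) u) u t).
  { intros u t; apply (continuity_2d_pt_ext (fun u v => phi v u)); [|apply (gc2_flip phi H)].
    intros; symmetry; apply is_derive_unique, DU. }
  assert (EX : forall y a' b', ex_RInt (fun t => RInt (phi t) t y) a' b').
  { intros y a' b'; apply (@ex_RInt_continuous R_CompleteNormedModule); intros x _.
    apply (continuous_RInt_param phi (fun x => x) (fun _ => y)); auto; [apply continuous_id|apply continuous_const]. }
  assert (CF : forall x, continuous (fun s => RInt (fun x => phi x s) a s) x).
  { intros x; apply (continuous_RInt_param (fun s x => phi x s) (fun _ => a) (fun s => s));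
      [apply gc2_flip, H|apply continuous_const|apply continuous_id]. }
  assert (D : forall u, is_derive F u 0).
  { intros u; unfold F.
    replace 0 with ((RInt (fun t => Derive (fun z => RInt (phi t) t z) u) a u + RInt (phi u) u u * 1) - RInt (fun x => phi x u) a u).
    2:{ rewrite (RInt_ext_all _ (fun x => phi x u)) by (intros t; apply is_derive_unique, DU).
        rewrite (RInt_point (V := R_CompleteNormedModule)); change zero with 0; simpl; ring. }
    apply (is_derive_minus (K := R_AbsRing) (V := R_NormedModule)).
    - apply (is_derive_RInt_param_bound_comp_aux3 (fun z t => RInt (phi t) t z) a (fun u => u)).
      + exists (mkposreal 1 Rlt_0_1); intros y _; apply EX.
      + exists (mkposreal 1 Rlt_0_1); exists (mkposreal 1 Rlt_0_1); intros y _; apply EX.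
      + apply (is_derive_id (K := R_AbsRing)).
      + exists (mkposreal 1 Rlt_0_1); exists (mkposreal 1 Rlt_0_1); intros y _ t _; eexists; apply DU.
      + intros t _; apply CD.
      + exists (mkposreal 1 Rlt_0_1); intros y t _ _; apply CD.
      + apply continuity_pt_filterlim.
        apply (continuous_RInt_param phi (fun x => x) (fun _ => u)); auto; [apply continuous_id|apply continuous_const].
    - apply (is_derive_RInt (fun s => RInt (fun x => phi x s) a s) _ a); auto.
      exists (mkposreal 1 Rlt_0_1); intros y _; apply (RInt_correct (V := R_CompleteNormedModule)).
      apply (@ex_RInt_continuous R_CompleteNormedModule); intros x _; apply CF. }
  pose proof (derive_zero_const F b a D) as E; unfold F in E.
  rewrite !(RInt_point (V := R_CompleteNormedModule)) in E; change zero with 0 in E; simpl in E; lra.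
Qed.

Lemma RInt_subst (f g dg : R -> R) a b : (forall x, continuous f x) ->
  (forall x, Rmin a b <= x <= Rmax a b -> is_derive g x (dg x)) ->
  (forall x, Rmin a b <= x <= Rmax a b -> continuous dg x) ->
  RInt (fun y => dg y * f (g y)) a b = RInt f (g a) (g b) :> R.
Proof.
  intros Hf Hg Hd; apply (RInt_comp (V := R_CompleteNormedModule) f g dg); auto.
Qed.

(** * Invariance of the integral under the Fricke involution of level 2 *)

(** The arc |z| = 1 in the coordinate t = 1/y, in which the domain above the arc becomes 0 < t <=
    [topF x]. *)
Definition topF (x : R) : R := / sqrt (1 - x * x).

Lemma topF_cont x : -1 < x < 1 -> continuous topF x.
Proof.
  intros Hx; apply (ex_derive_continuous (K := R_AbsRing) (V := R_NormedModule)); unfold topF.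
  assert (0 < 1 - x * x) by nra.
  auto_derive; split; auto; split; auto; apply Rgt_not_eq, sqrt_lt_R0; auto.
Qed.

Lemma topF_lin_cont u v x : -1 < u * x + v < 1 -> continuous (fun x => 2 * topF (u * x + v)) x.
Proof.
  intros Hx; apply (continuous_mult (fun _ => 2)); [apply continuous_const|].
  apply (continuous_comp (fun x => u * x + v) topF); [|apply topF_cont, Hx].
  apply (ex_derive_continuous (K := R_AbsRing) (V := R_NormedModule)); auto_derive; auto.
Qed.

(** Half of the fundamental domain; the reflection x -> -x is folded into the integrand. *)
Definition intM (phi : R -> R -> R) : R := RInt (fun x => RInt (phi x) 0 (topF x)) 0 (/ 2).

(** The sum over z/2 and (z + 1)/2, the latter composed with x -> -x so as to stay in 0 <= x <= 1/2;
    halving y doubles t. *)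
Definition half_sum (phi : R -> R -> R) (x t : R) : R := phi (x / 2) (2 * t) + phi ((1 - x) / 2) (2 * t).

Lemma gc2_lin phi u v w : gc2 phi -> gc2 (fun x t => phi (u * x + v) (w * t)).
Proof.
  intros H x t; apply (cont2_comp phi (fun x _ => u * x + v) (fun _ t => w * t)); [apply H| |].
  - apply continuity_2d_pt_plus; [apply continuity_2d_pt_mult|]; solve [apply continuity_2d_pt_const | apply continuity_2d_pt_id1].
  - apply continuity_2d_pt_mult; [apply continuity_2d_pt_const | apply continuity_2d_pt_id2].
Qed.

Lemma gc2_ext phi phi' : (forall x t, phi x t = phi' x t) -> gc2 phi -> gc2 phi'.
Proof. intros E H x t; apply (continuity_2d_pt_ext phi); auto. Qed.

Lemma gc2_plus phi phi' : gc2 phi -> gc2 phi' -> gc2 (fun x t => phi x t + phi' x t).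
Proof. intros H H' x t; apply continuity_2d_pt_plus; auto. Qed.

Lemma gc2_minus phi phi' : gc2 phi -> gc2 phi' -> gc2 (fun x t => phi x t - phi' x t).
Proof. intros H H' x t; apply continuity_2d_pt_minus; auto. Qed.

Lemma gc2_half_sum phi : gc2 phi -> gc2 (half_sum phi).
Proof.
  intros H; apply gc2_plus.
  - apply (gc2_ext (fun x t => phi (/ 2 * x + 0) (2 * t))); [intros; f_equal; field|apply gc2_lin, H].
  - apply (gc2_ext (fun x t => phi (- / 2 * x + / 2) (2 * t))); [intros; f_equal; field|apply gc2_lin, H].
Qed.

Lemma intM_ex phi : gc2 phi -> ex_RInt (fun x => RInt (phi x) 0 (topF x)) 0 (/ 2).
Proof.
  intros H; apply (ex_RInt_param phi (fun _ => 0) topF); auto; [lra|intros; apply continuous_const|].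
  intros x Hx; apply topF_cont; lra.
Qed.

Lemma intM_plus phi phi' : gc2 phi -> gc2 phi' -> intM (fun x t => phi x t + phi' x t) = intM phi + intM phi'.
Proof.
  intros H H'; unfold intM; rewrite <- RInt_plusR by (apply intM_ex; auto).
  apply RInt_ext_all; intros x; apply RInt_plusR; apply gc2_ex_RInt; auto.
Qed.

Lemma intM_minus phi phi' : gc2 phi -> gc2 phi' -> intM (fun x t => phi x t - phi' x t) = intM phi - intM phi'.
Proof.
  intros H H'; unfold intM; rewrite <- RInt_minusR by (apply intM_ex; auto).
  apply RInt_ext_all; intros x; apply RInt_minusR; apply gc2_ex_RInt; auto.
Qed.

(** Halving z preserves dx dt. The two images of the half domain lie above the arcs |z| = 1/2 for x
    <= 1/4 and |z - 1/2| = 1/2 for x >= 1/4. *)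
Lemma intM_half_sum phi : gc2 phi -> intM (half_sum phi) =
  RInt (fun x => RInt (phi x) 0 (2 * topF (2 * x + 0))) 0 (/ 4) +
  RInt (fun x => RInt (phi x) 0 (2 * topF (-2 * x + 1))) (/ 4) (/ 2).
Proof.
  intros H.
  assert (E1 : ex_RInt (fun x => RInt (phi x) 0 (2 * topF (2 * x + 0))) 0 (/ 4)).
  { apply (ex_RInt_param phi (fun _ => 0) (fun x => 2 * topF (2 * x + 0))); auto; [lra|intros; apply continuous_const|].
    intros x Hx; apply topF_lin_cont; lra. }
  assert (E2 : ex_RInt (fun x => RInt (phi x) 0 (2 * topF (-2 * x + 1))) (/ 4) (/ 2)).
  { apply (ex_RInt_param phi (fun _ => 0) (fun x => 2 * topF (-2 * x + 1))); auto; [lra|intros; apply continuous_const|].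
    intros x Hx; apply topF_lin_cont; lra. }
  unfold half_sum; rewrite (intM_plus (fun x t => phi (x / 2) (2 * t)) (fun x t => phi ((1 - x) / 2) (2 * t))).
  2:{ apply (gc2_ext (fun x t => phi (/ 2 * x + 0) (2 * t))); [intros; f_equal; field|apply gc2_lin, H]. }
  2:{ apply (gc2_ext (fun x t => phi (- / 2 * x + / 2) (2 * t))); [intros; f_equal; field|apply gc2_lin, H]. }
  assert (In : forall x' T, RInt (fun t => phi x' (2 * t)) 0 T = / 2 * RInt (phi x') 0 (2 * T)).
  { intros x' T; pose proof (RInt_lin (phi x') 2 0 0 T (gc2_ex_RInt _ _ _ _ H)) as E.
    rewrite !Rplus_0_r, Rmult_0_r in E; rewrite RInt_scalR in E.
    - rewrite (RInt_ext_all (fun t => phi x' (2 * t)) (fun y => phi x' (2 * y + 0))) by (intros; f_equal; ring).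
      apply (Rmult_eq_reg_l 2); [|lra]; rewrite E, <- Rmult_assoc, Rinv_r, Rmult_1_l by lra; reflexivity.
    - apply (@ex_RInt_continuous R_CompleteNormedModule); intros t _.
      apply (cont2_curve phi (fun _ => x') (fun t => 2 * t + 0)); [apply H|apply continuous_const|].
      apply (ex_derive_continuous (K := R_AbsRing) (V := R_NormedModule)); auto_derive; auto. }
  unfold intM; f_equal.
  - pose proof (RInt_lin (fun x => RInt (phi x) 0 (2 * topF (2 * x + 0))) (/ 2) 0 0 (/ 2)) as E.
    replace (/ 2 * 0 + 0) with 0 in E by field; replace (/ 2 * / 2 + 0) with (/ 4) in E by field.
    rewrite <- E by auto; apply RInt_ext_all; intros x; rewrite In; f_equal.
    replace (2 * (/ 2 * x + 0) + 0) with x by field; replace (/ 2 * x + 0) with (x / 2) by field; auto.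
  - pose proof (RInt_lin (fun x => RInt (phi x) 0 (2 * topF (-2 * x + 1))) (- / 2) (/ 2) 0 (/ 2)) as E.
    replace (- / 2 * 0 + / 2) with (/ 2) in E by field; replace (- / 2 * / 2 + / 2) with (/ 4) in E by field.
    rewrite <- (Ropp_involutive (RInt _ (/ 4) (/ 2))), <- RInt_swapR by auto.
    rewrite <- E by (apply ex_RInt_swap; auto).
    assert (Sg : forall a b : R, b = -1 * a -> a = - b) by (intros; lra); apply Sg.
    rewrite <- RInt_scalR.
    + apply RInt_ext_all; intros x; rewrite In.
      replace (-2 * (- / 2 * x + / 2) + 1) with x by field; replace (- / 2 * x + / 2) with ((1 - x) / 2) by field; ring.
    + apply (intM_ex (fun x t => phi ((1 - x) / 2) (2 * t))).
      apply (gc2_ext (fun x t => phi (- / 2 * x + / 2) (2 * t))); [intros; f_equal; field|apply gc2_lin, H].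
Qed.

(* In the coordinate s = |z|^2 at fixed x, with the height clamped from below to be defined everywhere. *)
Definition msq (x s : R) : R := Rmax (s - x * x) (3 / 16).
Definition radial (phi : R -> R -> R) (x s : R) : R := phi x (/ sqrt (msq x s)) * / (2 * (msq x s * sqrt (msq x s))).

Lemma msq_pos x s : 0 < msq x s.
Proof. unfold msq; eapply Rlt_le_trans; [|apply Rmax_r]; lra. Qed.

Lemma gc2_msq : gc2 msq.
Proof.
  intros x s; unfold msq.
  assert (P : continuity_2d_pt (fun x s => s - x * x) x s).
  { apply continuity_2d_pt_minus; [apply continuity_2d_pt_id2|apply continuity_2d_pt_mult; apply continuity_2d_pt_id1]. }
  intros eps; destruct (P eps) as [d Hd]; exists d; intros u v Hu Hv; specialize (Hd u v Hu Hv).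
  unfold Rmax; destruct (Rle_dec (v - u * u) (3 / 16)), (Rle_dec (s - x * x) (3 / 16));
    apply Rabs_def2 in Hd; apply Rabs_def1; pose proof (cond_pos eps); lra.
Qed.

Lemma gc2_sqrt_msq : gc2 (fun x s => sqrt (msq x s)).
Proof.
  intros x s; apply (continuity_1d_2d_pt_comp sqrt); [apply continuity_pt_sqrt, Rlt_le, msq_pos|apply gc2_msq].
Qed.

Lemma gc2_radial phi : gc2 phi -> gc2 (radial phi).
Proof.
  intros H x s; unfold radial.
  pose proof (msq_pos x s) as P; pose proof (sqrt_lt_R0 _ P) as P'.
  apply continuity_2d_pt_mult.
  - apply (cont2_comp phi (fun x _ => x) (fun x s => / sqrt (msq x s))); [apply H|apply continuity_2d_pt_id1|].
    apply continuity_2d_pt_inv; [apply gc2_sqrt_msq|lra].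
  - apply continuity_2d_pt_inv; [|nra].
    apply continuity_2d_pt_mult; [apply continuity_2d_pt_const|].
    apply continuity_2d_pt_mult; [apply gc2_msq|apply gc2_sqrt_msq].
Qed.

(** Substitution t = (s - x^2)^(-1/2) at fixed x. On the region of interest s - x^2 is at least
    3/16, with equality at the corner x = s = 1/4, so the clamp is inactive there. *)
Lemma radial_integral phi x s0 : gc2 phi -> s0 <= 1 -> 3 / 16 <= s0 - x * x ->
  RInt (radial phi x) s0 1 = RInt (phi x) (topF x) (/ sqrt (s0 - x * x)) :> R.
Proof.
  intros H Hs0 Hx.
  set (g := fun s => / sqrt (s - x * x)).
  set (dg := fun s => - / (2 * ((s - x * x) * sqrt (s - x * x)))).
  assert (E : RInt (fun s => dg s * phi x (g s)) s0 1 = RInt (phi x) (g s0) (g 1)).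
  { apply RInt_subst.
    - intros; apply gc2_snd, H.
    - rewrite Rmin_left, Rmax_right by auto; intros s Hs; unfold g, dg.
      assert (P : 0 < s - x * x) by lra; pose proof (sqrt_lt_R0 _ P) as P'.
      auto_derive; [split; [exact P|split; [exact (Rgt_not_eq _ _ P')|exact I]]|].
      pose proof (sqrt_sqrt (s - x * x) ltac:(lra)) as Q.
      assert (Q1 : s - x * x <> 0) by lra. assert (Q2 : sqrt (s - x * x) <> 0) by lra.
      replace (s + - (x * x)) with (s - x * x) by ring.
      set (r := sqrt (s - x * x)) in *; rewrite <- Q; field; lra.
    - rewrite Rmin_left, Rmax_right by auto; intros s Hs; unfold dg.
      assert (P : 0 < s - x * x) by lra; pose proof (sqrt_lt_R0 _ P) as P'.
      apply (ex_derive_continuous (K := R_AbsRing) (V := R_NormedModule)); auto_derive.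
      repeat split; auto. apply Rgt_not_eq. apply Rmult_lt_0_compat; [lra|]. apply Rmult_lt_0_compat; auto. }
  rewrite (RInt_swapR (phi x) (topF x)) by apply gc2_ex_RInt, H.
  change (topF x) with (g 1); change (/ sqrt (s0 - x * x)) with (g s0).
  rewrite <- E.
  rewrite (RInt_ext_le (fun s => dg s * phi x (g s)) (fun s => -1 * radial phi x s)); auto.
  - rewrite RInt_scalR by (apply (gc2_ex_RInt (radial phi)), gc2_radial, H); lra.
  - intros s Hs; unfold radial, dg, g, msq; rewrite Rmax_left by lra; ring.
Qed.

Lemma two_topF u v : 0 < v -> 1 - u * u = 4 * v -> 2 * topF u = / sqrt v.
Proof.
  intros Hv E; unfold topF; rewrite E, sqrt_mult by lra.
  replace 4 with (2 * 2) by ring; rewrite sqrt_square by lra.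
  pose proof (sqrt_lt_R0 _ Hv); field; lra.
Qed.

(** The two integrals differ by one over a compact region below the arc |z| = 1. In the coordinates
    (x, s) it consists of 0 <= x <= s for 1/4 <= s <= 1/2 and of 0 <= x <= 1/2 for 1/2 <= s <= 1,
    and (x, s) -> (x/(2s), 1/(4s)) exchanges these two pieces. *)
Lemma fricke_antisymmetric phi : gc2 phi ->
  (forall x t, 0 < t -> phi (x / (2 * (x * x + / t * / t))) (2 * (x * x + / t * / t) * t) = - phi x t) ->
  intM (half_sum phi) = intM phi.
Proof.
  intros H A; rewrite intM_half_sum by auto.
  pose proof (gc2_radial phi H) as HR.
  assert (EM : intM phi = RInt (fun x => RInt (phi x) 0 (topF x)) 0 (/ 4) + RInt (fun x => RInt (phi x) 0 (topF x)) (/ 4) (/ 2)).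
  { apply RInt_ChaslesR; apply (ex_RInt_param phi (fun _ => 0) topF); auto; try lra; try (intros; apply continuous_const);
      intros x Hx; apply topF_cont; lra. }
  rewrite EM.
  set (psi := radial phi) in *.
  assert (D1 : RInt (fun x => RInt (phi x) 0 (2 * topF (2 * x + 0))) 0 (/ 4) =
     RInt (fun x => RInt (phi x) 0 (topF x)) 0 (/ 4) + RInt (fun x => RInt (psi x) (/ 4) 1) 0 (/ 4)).
  { rewrite <- RInt_plusR.
    - apply RInt_ext_le; [lra|]; intros x Hx; unfold psi.
      rewrite (radial_integral phi x (/ 4)) by (auto; nra).
      rewrite (two_topF (2 * x + 0) (/ 4 - x * x)) by (nra || field).
      apply RInt_ChaslesR; apply gc2_ex_RInt, H.
    - apply (ex_RInt_param phi (fun _ => 0) topF); auto; try lra; try (intros; apply continuous_const);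
        intros x Hx; apply topF_cont; lra.
    - apply (ex_RInt_param psi (fun _ => / 4) (fun _ => 1)); auto; [lra|intros; apply continuous_const|intros; apply continuous_const]. }
  assert (D2 : RInt (fun x => RInt (phi x) 0 (2 * topF (-2 * x + 1))) (/ 4) (/ 2) =
     RInt (fun x => RInt (phi x) 0 (topF x)) (/ 4) (/ 2) + RInt (fun x => RInt (psi x) x 1) (/ 4) (/ 2)).
  { rewrite <- RInt_plusR.
    - apply RInt_ext_le; [lra|]; intros x Hx; unfold psi.
      rewrite (radial_integral phi x x) by (auto; nra).
      rewrite (two_topF (-2 * x + 1) (x - x * x)) by (nra || field).
      apply RInt_ChaslesR; apply gc2_ex_RInt, H.
    - apply (ex_RInt_param phi (fun _ => 0) topF); auto; try lra; try (intros; apply continuous_const);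
        intros x Hx; apply topF_cont; lra.
    - apply (ex_RInt_param psi (fun x => x) (fun _ => 1)); auto; [lra|intros; apply continuous_id|intros; apply continuous_const]. }
  assert (HF : gc2 (fun s x => psi x s)) by (apply gc2_flip, HR).
  assert (EXc : forall a b c d, c <= d -> ex_RInt (fun s => RInt (fun x => psi x s) a b) c d).
  { intros; apply (ex_RInt_param (fun s x => psi x s) (fun _ => a) (fun _ => b)); auto; intros; apply continuous_const. }
  assert (EXt : forall a c d, c <= d -> ex_RInt (fun s => RInt (fun x => psi x s) a s) c d).
  { intros; apply (ex_RInt_param (fun s x => psi x s) (fun _ => a) (fun s => s)); auto; intros; [apply continuous_const|apply continuous_id]. }
  assert (F1 : RInt (fun x => RInt (psi x) (/ 4) 1) 0 (/ 4) =
     RInt (fun s => RInt (fun x => psi x s) 0 (/ 4)) (/ 4) (/ 2) + RInt (fun s => RInt (fun x => psi x s) 0 (/ 4)) (/ 2) 1).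
  { rewrite fubini_rect by auto; apply RInt_ChaslesR; apply EXc; lra. }
  assert (F2 : RInt (fun x => RInt (psi x) x 1) (/ 4) (/ 2) =
     RInt (fun s => RInt (fun x => psi x s) (/ 4) s) (/ 4) (/ 2) + RInt (fun s => RInt (fun x => psi x s) (/ 4) (/ 2)) (/ 2) 1).
  { rewrite <- fubini_triangle, <- fubini_rect by auto; rewrite <- RInt_plusR.
    - apply RInt_ext_all; intros x; apply RInt_ChaslesR; apply (gc2_ex_RInt psi), HR.
    - apply (ex_RInt_param psi (fun x => x) (fun _ => / 2)); auto; [lra|intros; apply continuous_id|intros; apply continuous_const].
    - apply (ex_RInt_param psi (fun _ => / 2) (fun _ => 1)); auto; [lra|intros; apply continuous_const|intros; apply continuous_const]. }
  (* Fibre integrals at fixed s over the pieces s <= 1/2 and s >= 1/2. *)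
  set (P := fun s => RInt (fun x => psi x s) 0 s); set (Q := fun s => RInt (fun x => psi x s) 0 (/ 2)).
  assert (Ein : forall s a b, ex_RInt (fun x => psi x s) a b) by (intros; apply (gc2_ex_RInt (fun s x => psi x s)), HF).
  assert (S1 : RInt (fun s => RInt (fun x => psi x s) 0 (/ 4)) (/ 4) (/ 2) + RInt (fun s => RInt (fun x => psi x s) (/ 4) s) (/ 4) (/ 2)
     = RInt P (/ 4) (/ 2)).
  { rewrite <- RInt_plusR; [|apply EXc; lra|apply EXt; lra]; apply RInt_ext_all; intros s; unfold P; symmetry; apply RInt_ChaslesR; auto. }
  assert (S2 : RInt (fun s => RInt (fun x => psi x s) 0 (/ 4)) (/ 2) 1 + RInt (fun s => RInt (fun x => psi x s) (/ 4) (/ 2)) (/ 2) 1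
     = RInt Q (/ 2) 1).
  { rewrite <- RInt_plusR by (apply EXc; lra); apply RInt_ext_all; intros s; unfold Q; symmetry; apply RInt_ChaslesR; auto. }
  assert (CQ : forall s, continuous Q s).
  { intros s; apply (continuous_RInt_param (fun s x => psi x s) (fun _ => 0) (fun _ => / 2)); auto; apply continuous_const. }
  assert (Sub : RInt (fun s => - / (4 * (s * s)) * Q (/ (4 * s))) (/ 4) (/ 2) = RInt Q (/ (4 * / 4)) (/ (4 * / 2))).
  { apply (RInt_subst Q (fun s => / (4 * s)) (fun s => - / (4 * (s * s)))); auto;
      rewrite Rmin_left, Rmax_right by lra; intros s Hs.
    - auto_derive; [lra|field; lra].
    - apply (ex_derive_continuous (K := R_AbsRing) (V := R_NormedModule)); auto_derive; nra. }
  replace (/ (4 * / 4)) with 1 in Sub by field; replace (/ (4 * / 2)) with (/ 2) in Sub by field.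
  rewrite (RInt_swapR Q 1) in Sub by (apply (@ex_RInt_continuous R_CompleteNormedModule); auto).
  (* The coefficient is the derivative of s -> 1/(4s), so [Sub] makes the integral of [P] the
     opposite of that of [Q]. *)
  assert (PQ : forall s, / 4 <= s <= / 2 -> P s = - / (4 * (s * s)) * Q (/ (4 * s))).
  { intros s Hs; unfold P, Q.
    pose proof (RInt_lin (fun x => psi x (/ (4 * s))) (/ (2 * s)) 0 0 s (Ein _ _ _)) as E.
    replace (/ (2 * s) * 0 + 0) with 0 in E by (field; lra); replace (/ (2 * s) * s + 0) with (/ 2) in E by (field; lra).
    rewrite <- E, <- RInt_scalR.
    - apply RInt_ext_le; [lra|]; intros x Hx.
      assert (M1 : 3 / 16 <= s - x * x) by nra.
      assert (Hm : 0 < s - x * x) by lra.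
      pose proof (sqrt_lt_R0 _ Hm) as Hr; pose proof (sqrt_sqrt (s - x * x) ltac:(lra)) as Q0.
      replace (/ (2 * s) * x + 0) with (x / (2 * s)) by (field; lra).
      unfold psi, radial, msq; rewrite (Rmax_left (s - x * x)) by auto.
      set (r := sqrt (s - x * x)) in *.
      assert (Em : / (4 * s) - x / (2 * s) * (x / (2 * s)) = (r / (2 * s)) * (r / (2 * s))).
      { replace (r / (2 * s) * (r / (2 * s))) with ((r * r) / (4 * (s * s))) by (field; lra); rewrite Q0; field; lra. }
      assert (M2 : 3 / 16 <= r / (2 * s) * (r / (2 * s))).
      { replace (r / (2 * s) * (r / (2 * s))) with ((r * r) / (4 * (s * s))) by (field; lra); rewrite Q0.
        assert (x * x <= s * s) by nra; assert (s * s <= s * / 2) by nra.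
        assert (0 < s * s) by nra; apply (Rle_div_r (3 / 16) (s - x * x) (4 * (s * s))); lra. }
      rewrite Em, Rmax_left by auto.
      assert (Pr : 0 < r / (2 * s)) by (apply Rdiv_lt_0_compat; lra).
      rewrite sqrt_square by lra.
      assert (Es : x * x + / / r * / / r = s) by (rewrite Rinv_inv, Q0; ring).
      pose proof (A x (/ r) ltac:(apply Rinv_0_lt_compat; auto)) as Ax; rewrite Es in Ax.
      replace (/ (r / (2 * s))) with (2 * s * / r) by (field; lra).
      rewrite Ax, <- Q0; field; lra.
    - apply (@ex_RInt_continuous R_CompleteNormedModule); intros x _.
      apply (continuous_mult (fun _ => / (2 * s))); [apply continuous_const|].
      apply (cont2_curve psi (fun x => / (2 * s) * x + 0) (fun _ => / (4 * s))); [apply HR| |apply continuous_const].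
      apply (ex_derive_continuous (K := R_AbsRing) (V := R_NormedModule)); auto_derive; auto. }
  rewrite <- (RInt_ext_le P) in Sub by (auto; lra).
  lra.
Qed.

(* The coordinate t = 1/y turns dx dy / y^2 into dx dt and moves the cusp to t = 0. *)
Definition cext (F : R -> R -> R) (x t : R) : R := if Rlt_dec 0 t then F x (/ t) else 0.

Definition cusp_null (F : R -> R -> R) : Prop :=
  forall eps, 0 < eps -> exists Y, forall x y, Y < y -> Rabs (F x y) < eps.

Definition cont_H (F : R -> R -> R) : Prop := forall x y, 0 < y -> continuity_2d_pt F x y.

(** Vanishing at the cusp, uniformly in x, is exactly continuity of the extension by 0 across t =
    0. *)
Lemma gc2_cext F : cont_H F -> cusp_null F -> gc2 (cext F).
Proof.
  intros HF HN x t; destruct (Rtotal_order t 0) as [T|[T|T]].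
  - apply (continuity_2d_pt_ext_loc (fun _ _ => 0)); [|apply continuity_2d_pt_const].
    exists (mkposreal (- t) ltac:(lra)); simpl; intros u v _ Hv; apply Rabs_def2 in Hv.
    unfold cext; destruct (Rlt_dec 0 v); auto; lra.
  - subst t; intros eps; destruct (HN eps (cond_pos eps)) as [Y HY].
    assert (P : 0 < / (Rabs Y + 1)) by (apply Rinv_0_lt_compat; pose proof (Rabs_pos Y); lra).
    exists (mkposreal _ P); simpl; intros u v _ Hv; rewrite Rminus_0_r in Hv.
    unfold cext; destruct (Rlt_dec 0 0) as [|_]; [lra|]; rewrite Rminus_0_r.
    destruct (Rlt_dec 0 v) as [V|V]; [|rewrite Rabs_R0; apply cond_pos].
    apply HY; rewrite Rabs_pos_eq in Hv by lra.
    apply Rle_lt_trans with (Rabs Y + 1 - 1); [pose proof (Rle_abs Y); lra|].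
    assert (Rabs Y + 1 < / v); [|lra].
    rewrite <- (Rinv_inv (Rabs Y + 1)); apply Rinv_lt_contravar; auto; apply Rmult_lt_0_compat; auto.
  - apply (continuity_2d_pt_ext_loc (fun x t => F x (/ t))).
    + exists (mkposreal t T); simpl; intros u v _ Hv; apply Rabs_def2 in Hv.
      unfold cext; destruct (Rlt_dec 0 v); auto; lra.
    + apply (cont2_comp F (fun x _ => x) (fun _ t => / t)); [apply HF, Rinv_0_lt_compat; auto|apply continuity_2d_pt_id1|].
      apply continuity_2d_pt_inv; [apply continuity_2d_pt_id2|lra].
Qed.

(** After the substitution the improper limit is continuity of the integral of [phi] in its lower
    endpoint at 0. *)
Lemma is_RInt_gen_inv (phi : R -> R) c : (forall t, continuous phi t) -> 0 < c ->
  is_RInt_gen (fun y => phi (/ y) / (y * y)) (at_point c) (Rbar_locally p_infty) (RInt phi 0 (/ c)).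
Proof.
  intros H Hc.
  assert (Ex : forall a b, ex_RInt phi a b) by (intros; apply (@ex_RInt_continuous R_CompleteNormedModule); auto).
  assert (E : forall Y, c <= Y -> is_RInt (fun y => phi (/ y) / (y * y)) c Y (RInt phi (/ Y) (/ c))).
  { intros Y HY.
    rewrite RInt_swapR by auto.
    assert (K : is_RInt (fun y => scal (- / (y * y)) (phi (/ y))) c Y (RInt phi (/ c) (/ Y))).
    { apply (is_RInt_comp (V := R_CompleteNormedModule) phi (fun y => / y) (fun y => - / (y * y))); auto.
      rewrite Rmin_left, Rmax_right by auto; intros y Hy; split.
      - auto_derive; [lra|field; lra].
      - apply (ex_derive_continuous (K := R_AbsRing) (V := R_NormedModule)); auto_derive; nra. }
    apply (is_RInt_opp (V := R_NormedModule)) in K.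
    eapply is_RInt_ext; [|exact K]; intros y Hy; rewrite Rmin_left, Rmax_right in Hy by auto.
    change (- (- / (y * y) * phi (/ y)) = phi (/ y) / (y * y)); field; lra. }
  assert (Cn : continuous (fun u => RInt phi u (/ c)) 0).
  { apply (continuous_RInt_param (fun _ => phi) (fun u => u) (fun _ => / c)); [|apply continuous_id|apply continuous_const].
    intros x y; apply (continuity_1d_2d_pt_comp phi (fun _ v => v)); [apply continuity_pt_filterlim, H|apply continuity_2d_pt_id2]. }
  intros P [eps HP].
  destruct (continuous_eps_inv _ _ Cn eps (cond_pos eps)) as [d [Hd K]].
  apply (Filter_prod _ _ _ (fun a => a = c) (fun Y => Rmax c (/ d) < Y)).
  - reflexivity.
  - exists (Rmax c (/ d)); auto.
  - intros a Y -> HY; exists (RInt phi (/ Y) (/ c)); simpl.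
    assert (Y1 : c < Y) by (eapply Rle_lt_trans; [apply Rmax_l|apply HY]).
    assert (Y2 : / d < Y) by (eapply Rle_lt_trans; [apply Rmax_r|apply HY]).
    split; [apply E; lra|].
    apply HP; apply K; rewrite Rminus_0_r, Rabs_pos_eq by (apply Rlt_le, Rinv_0_lt_compat; lra).
    rewrite <- (Rinv_inv d); apply Rinv_lt_contravar; auto.
    apply Rmult_lt_0_compat; [apply Rinv_0_lt_compat|]; lra.
Qed.

Definition inversion_of (F : R -> R -> R) (x y : R) : R := F (- x / (x * x + y * y)) (y / (x * x + y * y)).

Lemma cont_H_inversion F : cont_H F -> cont_H (inversion_of F).
Proof.
  intros H x y Hy; unfold inversion_of.
  assert (P : 0 < x * x + y * y) by nra.
  assert (C : continuity_2d_pt (fun x y => / (x * x + y * y)) x y).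
  { apply continuity_2d_pt_inv; [|lra]; apply continuity_2d_pt_plus; apply continuity_2d_pt_mult;
      solve [apply continuity_2d_pt_id1 | apply continuity_2d_pt_id2]. }
  apply (cont2_comp F (fun x y => - x / (x * x + y * y)) (fun x y => y / (x * x + y * y))).
  - apply H, Rdiv_lt_0_compat; auto.
  - apply continuity_2d_pt_mult; auto; apply continuity_2d_pt_opp, continuity_2d_pt_id1.
  - apply continuity_2d_pt_mult; auto; apply continuity_2d_pt_id2.
Qed.

(** From here on the improper integral of the definition is replaced by ordinary integrals over
    compact intervals. *)
Lemma intF_R_cext g : cont_H g -> cusp_null g ->
  intF_R g = intM (fun x t => cext g x t + cext g (- x) t).
Proof.
  intros Hc Hn; pose proof (gc2_cext g Hc Hn) as G.
  unfold intF_R.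
  rewrite (RInt_ext_le _ (fun x => RInt (cext g x) 0 (topF x))); [|lra|].
  - assert (Ex : forall a b, -1 < a -> b < 1 -> a <= b -> ex_RInt (fun x => RInt (cext g x) 0 (topF x)) a b).
    { intros a b Ha Hb Hab; apply (ex_RInt_param (cext g) (fun _ => 0) topF); auto; [intros; apply continuous_const|].
      intros; apply topF_cont; lra. }
    assert (G' : gc2 (fun x t => cext g (- x) t)).
    { apply (gc2_ext (fun x t => cext g (-1 * x + 0) (1 * t))); [intros; f_equal; ring|apply gc2_lin, G]. }
    rewrite (intM_plus (cext g) (fun x t => cext g (- x) t)) by auto.
    rewrite (RInt_ChaslesR _ (- / 2) 0 (/ 2)) by (apply Ex; lra).
    rewrite Rplus_comm; apply f_equal2; [reflexivity|].
    pose proof (RInt_lin (fun x => RInt (cext g x) 0 (topF x)) (-1) 0 0 (/ 2)) as E.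
    replace (-1 * 0 + 0) with 0 in E by ring; replace (-1 * / 2 + 0) with (- / 2) in E by ring.
    rewrite RInt_swapR by (apply ex_RInt_swap, Ex; lra); rewrite <- E by (apply ex_RInt_swap, Ex; lra).
    rewrite RInt_scalR.
    + assert (Sg : forall a b : R, a = b -> - (-1 * a) = b) by (intros; lra); apply Sg; unfold intM; apply RInt_ext_all; intros x.
      replace (-1 * x + 0) with (- x) by ring; unfold topF; replace (- x * - x) with (x * x) by ring; reflexivity.
    + eapply ex_RInt_ext; [|apply (intM_ex _ G')]; intros x _; cbv beta.
      replace (-1 * x + 0) with (- x) by ring; unfold topF; replace (- x * - x) with (x * x) by ring; reflexivity.
  - intros x Hx.
    assert (P : 0 < 1 - x * x) by nra.
    pose proof (sqrt_lt_R0 _ P) as P'.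
    apply is_RInt_gen_unique.
    assert (K := is_RInt_gen_inv (cext g x) (sqrt (1 - x * x)) (fun t => gc2_snd _ _ _ G) P').
    unfold topF; revert K; apply is_RInt_gen_ext.
    apply (Filter_prod _ _ _ (fun a => a = sqrt (1 - x * x)) (fun Y => sqrt (1 - x * x) < Y)).
    + reflexivity.
    + exists (sqrt (1 - x * x)); auto.
    + intros a Y -> HY y Hy; simpl in Hy; rewrite Rmin_left, Rmax_right in Hy by lra.
      assert (0 < / y) by (apply Rinv_0_lt_compat; lra).
      unfold cext; destruct (Rlt_dec 0 (/ y)); [|lra]; rewrite Rinv_inv; reflexivity.
Qed.

(** Let r be F symmetrised in x, let w be F(-1/(2z)) symmetrised in x, let I be [intM], and write a
    prime for [half_sum]. The integral is I(r) + I(w'). The last hypothesis gives r' + w = 0, and r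
    - w is antisymmetric under z -> -1/(2z), so I(r') - I(w') = I(r) - I(w). Hence I(r) + I(w') =
    I(r') + I(w) = 0. *)
Theorem fricke_integral (F : R -> R -> R) :
  cont_H F -> cusp_null F -> cusp_null (inversion_of F) ->
  (forall x y, 0 < y -> F (x + 1) y = F x y) ->
  (forall x y, 0 < y -> inversion_of F (x + 2) y = inversion_of F x y) ->
  (forall x y, 0 < y -> F (x / 2) (y / 2) + F ((x + 1) / 2) (y / 2) + inversion_of F (2 * x) (2 * y) = 0) ->
  intF_R (fun x y => F x y + inversion_of F x y + inversion_of F (x + 1) y) = 0.
Proof.
  intros HF N1 N2 P1 P2 Van.
  set (V := inversion_of F) in *.
  pose proof (cont_H_inversion F HF) as HV; fold V in HV.
  set (g := fun x y => F x y + V x y + V (x + 1) y).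
  assert (Hg : cont_H g).
  { intros x y Hy; repeat apply continuity_2d_pt_plus; auto.
    apply (cont2_comp V (fun x _ => x + 1) (fun _ y => y)); [apply HV; auto| |apply continuity_2d_pt_id2].
    apply continuity_2d_pt_plus; [apply continuity_2d_pt_id1|apply continuity_2d_pt_const]. }
  assert (Ng : cusp_null g).
  { intros eps He; destruct (N1 (eps / 3)) as [Y1 H1]; [lra|]; destruct (N2 (eps / 3)) as [Y2 H2]; [lra|].
    exists (Rmax Y1 Y2); intros x y Hy.
    pose proof (H1 x y ltac:(eapply Rle_lt_trans; [apply Rmax_l|apply Hy])) as A.
    pose proof (H2 x y ltac:(eapply Rle_lt_trans; [apply Rmax_r|apply Hy])) as B.
    pose proof (H2 (x + 1) y ltac:(eapply Rle_lt_trans; [apply Rmax_r|apply Hy])) as D.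
    unfold g; apply Rabs_def2 in A; apply Rabs_def2 in B; apply Rabs_def2 in D; apply Rabs_def1; lra. }
  rewrite intF_R_cext by auto.
  pose proof (gc2_cext F HF N1) as GF; pose proof (gc2_cext V HV N2) as GV.
  set (r := fun x t => cext F x t + cext F (- x) t).
  set (w := fun x t => cext V (2 * x) (t / 2) + cext V (- (2 * x)) (t / 2)).
  assert (Gr : gc2 r).
  { apply gc2_plus; auto; apply (gc2_ext (fun x t => cext F (-1 * x + 0) (1 * t))); [intros; f_equal; ring|apply gc2_lin, GF]. }
  assert (Gw : gc2 w).
  { apply gc2_plus.
    - apply (gc2_ext (fun x t => cext V (2 * x + 0) (/ 2 * t))); [intros; f_equal; field|apply gc2_lin, GV].
    - apply (gc2_ext (fun x t => cext V (-2 * x + 0) (/ 2 * t))); [intros; f_equal; field|apply gc2_lin, GV]. }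
  assert (PV : forall x t, cext V (x + 2) t = cext V x t).
  { intros x t; unfold cext; destruct (Rlt_dec 0 t); auto; apply P2, Rinv_0_lt_compat; auto. }
  assert (PF : forall x t, cext F (x + 1) t = cext F x t).
  { intros x t; unfold cext; destruct (Rlt_dec 0 t); auto; apply P1, Rinv_0_lt_compat; auto. }
  assert (E1 : forall x t, cext g x t = cext F x t + cext V x t + cext V (x + 1) t).
  { intros x t; unfold cext, g; destruct (Rlt_dec 0 t); lra. }
  (* By 2-periodicity the terms V(x), V(-x), V(x + 1) and V(1 - x) are those of [half_sum w]. *)
  assert (E2 : intM (fun x t => cext g x t + cext g (- x) t) = intM r + intM (half_sum w)).
  { rewrite <- intM_plus by (auto; apply gc2_half_sum; auto).
    unfold intM; apply RInt_ext_all; intros x; apply RInt_ext_all; intros t.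
    rewrite !E1; unfold r, half_sum, w.
    replace (2 * (x / 2)) with x by field; replace (2 * ((1 - x) / 2)) with (1 - x) by field.
    replace (2 * t / 2) with t by field.
    replace (- x + 1) with (1 - x) by ring.
    rewrite <- (PV (- (1 - x)) t); replace (- (1 - x) + 2) with (x + 1) by ring; ring. }
  assert (VanE : forall x t, cext F (x / 2) (2 * t) + cext F ((x + 1) / 2) (2 * t) + cext V (2 * x) (t / 2) = 0).
  { intros x t; unfold cext; destruct (Rlt_dec 0 (2 * t)), (Rlt_dec 0 (t / 2)); try lra.
    rewrite <- (Van x (/ t)) by (apply Rinv_0_lt_compat; lra).
    replace (/ (2 * t)) with (/ t / 2) by (field; lra); replace (/ (t / 2)) with (2 * / t) by (field; lra); reflexivity. }
  assert (Z : forall x t, half_sum r x t + w x t = 0).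
  { intros x t; unfold half_sum, r, w.
    pose proof (VanE x t) as A; pose proof (VanE (- x) t) as B.
    replace (- x / 2) with (- (x / 2)) in B by field.
    replace ((- x + 1) / 2) with ((1 - x) / 2) in B by field.
    replace (2 * - x) with (- (2 * x)) in B by ring.
    rewrite <- (PF (- ((1 - x) / 2))); replace (- ((1 - x) / 2) + 1) with ((x + 1) / 2) by field; lra. }
  assert (Z' : intM (half_sum r) + intM w = 0).
  { rewrite <- intM_plus by (auto; apply gc2_half_sum; auto).
    unfold intM; rewrite (RInt_ext_all _ (fun _ => 0)).
    - rewrite (RInt_const (V := R_CompleteNormedModule)); change scal with Rmult; simpl; lra.
    - intros x; rewrite (RInt_ext_all _ (fun _ => 0)) by (intros; apply Z).
      rewrite (RInt_const (V := R_CompleteNormedModule)); change scal with Rmult; simpl; lra. }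
  set (phi := fun x t => r x t - w x t).
  (* Up to the sign of x, which the symmetrisation makes harmless, (x/(2s), 2st) are the coordinates
     of -1/(2z), with s = |z|^2. *)
  assert (W1 : forall x t, 0 < t -> let s := x * x + / t * / t in r (x / (2 * s)) (2 * s * t) = w x t).
  { intros x t Ht s; assert (Hi : 0 < / t) by (apply Rinv_0_lt_compat; auto); assert (Hs : 0 < s) by (unfold s; nra).
    unfold r, w, cext; destruct (Rlt_dec 0 (2 * s * t)) as [_|X]; [|exfalso; apply X; repeat apply Rmult_lt_0_compat; lra].
    destruct (Rlt_dec 0 (t / 2)) as [_|]; [|lra].
    assert (S4 : forall e, e * e = 1 -> (e * (2 * x)) * (e * (2 * x)) + / (t / 2) * / (t / 2) = 4 * s).
    { intros e He; replace (e * (2 * x) * (e * (2 * x))) with (4 * (x * x) * (e * e)) by ring; rewrite He; unfold s; field; lra. }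
    unfold V, inversion_of.
    pose proof (S4 1 ltac:(ring)) as Sa; pose proof (S4 (-1) ltac:(ring)) as Sb.
    rewrite Rmult_1_l in Sa; replace (-1 * (2 * x)) with (- (2 * x)) in Sb by ring.
    rewrite Sa, Sb, Rplus_comm; f_equal; f_equal; field; lra. }
  assert (W2 : forall x t, 0 < t -> let s := x * x + / t * / t in w (x / (2 * s)) (2 * s * t) = r x t).
  { intros x t Ht s; assert (Hi : 0 < / t) by (apply Rinv_0_lt_compat; auto); assert (Hs : 0 < s) by (unfold s; nra).
    rewrite <- (W1 (x / (2 * s)) (2 * s * t)) by (repeat apply Rmult_lt_0_compat; lra).
    assert (Es : x / (2 * s) * (x / (2 * s)) + / (2 * s * t) * / (2 * s * t) = / (4 * s)).
    { transitivity ((x * x + / t * / t) / (4 * s * s)); [field; lra|fold s; field; lra]. }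
    rewrite Es; f_equal; field; lra. }
  assert (A := fricke_antisymmetric phi (gc2_minus _ _ Gr Gw)
    ltac:(intros x t Ht; unfold phi; rewrite W1, W2 by auto; ring)).
  unfold phi in A; rewrite intM_minus in A by auto.
  assert (HS : intM (half_sum (fun x t => r x t - w x t)) = intM (half_sum r) - intM (half_sum w)).
  { rewrite <- intM_minus by (apply gc2_half_sum; auto).
    unfold intM; apply RInt_ext_all; intros x; apply RInt_ext_all; intros t; unfold half_sum; ring. }
  rewrite HS in A; rewrite E2; lra.
Qed.

Open Scope Z_scope.
(** * Sums of two squares *)

Lemma involution_even_length {A : Type} (dec : forall x y : A, {x = y} + {x <> y}) (f : A -> A) :
  forall n (L : list A), length L = n -> NoDup L -> (forall x, In x L -> In (f x) L /\ f (f x) = x /\ f x <> x) ->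
  Nat.even (length L) = true.
Proof.
  induction n as [n IH] using (well_founded_induction lt_wf); intros L Hn N H.
  destruct L as [|a L]; [reflexivity|].
  inversion N as [|? ? Na NL]; subst.
  destruct (H a (or_introl eq_refl)) as [H1 [H2 H3]].
  assert (Hin : In (f a) L) by (destruct H1 as [E|]; auto; congruence).
  set (L' := remove dec (f a) L).
  assert (NL' : NoDup L') by (unfold L'; clear -NL; induction NL as [|b L Hb NL IH]; simpl;
     [constructor|destruct (dec (f a) b); auto; constructor; auto; intros K; apply in_remove in K; destruct K; auto]).
  assert (Len : length L = S (length L')).
  { unfold L'; clear -Hin NL; induction L as [|b L IH]; [destruct Hin|].
    inversion NL; subst; simpl; destruct (dec (f a) b) as [E|E].
    - rewrite notin_remove; [reflexivity|congruence].
    - simpl; f_equal; apply IH; auto; destruct Hin; congruence. }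
  simpl; rewrite Len; simpl.
  apply (IH (length L')); [simpl; rewrite Len; lia|reflexivity|auto|].
  intros x Hx; unfold L' in Hx; apply in_remove in Hx; destruct Hx as [Hx Hxa].
  destruct (H x (or_intror Hx)) as [K1 [K2 K3]]; repeat split; auto.
  apply in_in_remove.
  - intros E; apply Na; assert (x = a) by (rewrite <- K2, E; auto); subst; auto.
  - destruct K1 as [E|]; auto; exfalso; apply Hxa; rewrite E; auto.
Qed.

Definition iotaZ (n : nat) : list Z := map Z.of_nat (seq 1 n).

Lemma in_iotaZ n z : In z (iotaZ n) <-> 1 <= z <= Z.of_nat n.
Proof.
  unfold iotaZ; rewrite in_map_iff; split.
  - intros [x [<- Hx]]; apply in_seq in Hx; lia.
  - intros H; exists (Z.to_nat z); split; [lia|apply in_seq; lia].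
Qed.

Lemma iotaZ_NoDup n : NoDup (iotaZ n).
Proof. apply FinFun.Injective_map_NoDup; [intros x y; lia|apply seq_NoDup]. Qed.

(* Multiplication by a square root of -1, followed by the choice of a representative in [1, (p-1)/2],
   is a fixed point free involution of that interval. *)
Lemma sqrt_minus_one_mod p t : prime p -> p mod 4 = 3 -> (p | t * t + 1) -> False.
Proof.
  intros Hp H3 Ht.
  pose proof (prime_ge_2 p Hp) as P2.
  set (n := Z.to_nat ((p - 1) / 2)).
  assert (Pm : p = 4 * (p / 4) + 3) by (rewrite <- H3; apply Z.div_mod; lia).
  assert (Hn : Z.of_nat n = 2 * (p / 4) + 1).
  { unfold n; rewrite Z2Nat.id by (apply Z.div_pos; lia).
    replace (p - 1) with ((2 * (p / 4) + 1) * 2) by lia; apply Z.div_mul; lia. }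
  set (f := fun u => let v := (t * u) mod p in if Z_lt_dec (2 * v) p then v else p - v).
  assert (F : forall u, exists e, (e = 1 \/ e = -1) /\ (p | f u - e * (t * u)) /\ 0 <= f u <= Z.of_nat n).
  { intros u; unfold f; pose proof (Z.mod_pos_bound (t * u) p ltac:(lia)) as B.
    pose proof (Z.div_mod (t * u) p ltac:(lia)) as D.
    destruct (Z_lt_dec (2 * ((t * u) mod p)) p).
    - exists 1; repeat split; auto; try lia. exists (- ((t * u) / p)); lia.
    - exists (-1); repeat split; auto; try lia. exists (1 + (t * u) / p); lia. }
  assert (Ev : Nat.even (length (iotaZ n)) = true).
  { apply (involution_even_length Z.eq_dec f n); auto using iotaZ_NoDup.
    - unfold iotaZ; rewrite length_map, length_seq; auto.
    - intros u Hu; apply in_iotaZ in Hu.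
      destruct (F u) as [e [He [[q Hq] B]]].
      assert (Nu : ~ (p | u)) by (intros K; apply Z.divide_pos_le in K; lia).
      assert (Nt : ~ (p | t)).
      { intros K; assert (p | 1); [|apply Z.divide_1_r in H; lia].
        replace 1 with (t * t + 1 - t * t) by ring; apply Z.divide_sub_r; auto; apply Z.divide_mul_l; auto. }
      assert (Nf : ~ (p | f u)).
      { intros K. assert (K' : (p | t * u)).
        { assert ((p | e * (t * u))) by (replace (e * (t * u)) with (f u - q * p) by lia; apply Z.divide_sub_r; auto; exists q; ring).
          destruct He as [-> | ->]; [rewrite Z.mul_1_l in H; auto|].
          replace (t * u) with (- (-1 * (t * u))) by ring; apply Z.divide_opp_r; auto. }
        apply prime_mult in K'; auto; tauto. }
      repeat split.
      + apply in_iotaZ; split; [|lia].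
        assert (f u <> 0) by (intros K; apply Nf; rewrite K; apply Z.divide_0_r); lia.
      + destruct (F (f u)) as [e' [He' [[q' Hq'] B']]].
        destruct Ht as [k Hk].
        assert (X : exists e2, (e2 = 1 \/ e2 = -1) /\ (p | f (f u) - e2 * u)).
        { exists (- (e' * e)); split; [destruct He as [-> | ->], He' as [-> | ->]; lia|].
          exists (q' + e' * t * q + e' * e * k * u).
          assert (f u = q * p + e * (t * u)) by lia.
          replace (f (f u)) with (q' * p + e' * (t * f u)) by lia; rewrite H.
          transitivity ((q' + e' * t * q) * p + e' * e * u * (t * t + 1)); [ring|rewrite Hk; ring]. }
        (* Both f(f u) and u lie in [0, (p - 1)/2] and u is positive, so f(f u) cannot be -u modulo
           p. *)
        destruct X as [e2 [[-> | ->] [m Hm]]].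
        * assert (-1 < m) by (apply (Z.mul_lt_mono_pos_r p); lia).
          assert (m < 1) by (apply (Z.mul_lt_mono_pos_r p); lia).
          assert (m = 0) by lia; subst m; lia.
        * assert (0 < m) by (apply (Z.mul_lt_mono_pos_r p); lia).
          assert (m < 1) by (apply (Z.mul_lt_mono_pos_r p); lia); lia.
      (* A fixed point forces t to be 1 or -1 modulo p, hence t^2 = 1, against t^2 = -1. *)
      + intros E.
        assert (K : (p | (e * t - 1) * u)) by (exists (- q); rewrite E in Hq; lia).
        apply prime_mult in K; auto; destruct K as [K|K]; [|tauto].
        assert (K2 : (p | t * t - 1)).
        { replace (t * t - 1) with ((e * t - 1) * (e * t + 1)) by (destruct He as [-> | ->]; ring); apply Z.divide_mul_l; auto. }
        assert (K3 : (p | 2)) by (replace 2 with ((t * t + 1) - (t * t - 1)) by ring; apply Z.divide_sub_r; auto).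
        apply Z.divide_pos_le in K3; lia. }
  (* The interval has (p - 1)/2 elements, an odd number when p is 3 modulo 4. *)
  unfold iotaZ in Ev; rewrite length_map, length_seq in Ev.
  apply Nat.even_spec in Ev; destruct Ev as [m Hm]; lia.
Qed.

(** If p did not divide b, then a / b would be a square root of -1 modulo p. *)
Lemma prime_3_mod_4_divides p x y : prime p -> p mod 4 = 3 -> (p | x * x + y * y) -> (p | x) /\ (p | y).
Proof.
  intros Hp H3 H.
  pose proof (prime_ge_2 p Hp) as P2.
  assert (K : forall a b, (p | a * a + b * b) -> (p | a)).
  { intros a b Hab; destruct (Zdivide_dec p b) as [D|D].
    - assert (p | a * a) by (replace (a * a) with (a * a + b * b - b * b) by ring; apply Z.divide_sub_r; auto; apply Z.divide_mul_l; auto).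
      apply prime_mult in H0; tauto.
    - exfalso.
      assert (R : rel_prime b p) by (apply rel_prime_sym, prime_rel_prime; auto).
      apply rel_prime_bezout in R; destruct R as [u v E].
      apply (sqrt_minus_one_mod p (a * u) Hp H3).
      destruct Hab as [k Hk].
      exists (k * u * u + v * (2 - v * p)).
      assert (E' : u * b = 1 - v * p) by lia.
      transitivity (u * u * (a * a + b * b) - (u * b) * (u * b) + 1); [ring|rewrite Hk, E'; ring]. }
  split; [apply (K x y H)|apply (K y x)]; rewrite Z.add_comm; auto.
Qed.

Lemma triple_eq (a b c a' b' c' : Z) : a = a' -> b = b' -> c = c' -> (a, b, c) = (a', b', c').
Proof. congruence. Qed.

(** Zagier's involution on the positive solutions of x^2 + 4yz = p. *)
Definition zagier (w : Z * Z * Z) : Z * Z * Z :=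
  let '(x, y, z) := w in
  if Z_lt_dec x (y - z) then (x + 2 * z, z, y - x - z)
  else if Z_lt_dec x (2 * y) then (2 * y - x, y, x - y + z)
  else (x - 2 * y, x - y + z, y).

(* Zagier's one-sentence proof. *)
Lemma two_squares p : prime p -> p mod 4 = 1 -> exists x y, p = x * x + y * y.
Proof.
  intros Hp H1; pose proof (prime_ge_2 p Hp) as P2.
  assert (Pm : p = 4 * (p / 4) + 1) by (rewrite <- H1; apply Z.div_mod; lia).
  set (k := p / 4) in *.
  assert (dec : forall u v : Z * Z * Z, {u = v} + {u <> v}) by (repeat decide equality).
  set (B := iotaZ (Z.to_nat p)).
  set (L := filter (fun w : Z * Z * Z => let '(x, y, z) := w in x * x + 4 * y * z =? p) (list_prod (list_prod B B) B)).
  assert (HL : forall x y z, In (x, y, z) L <-> 0 < x /\ 0 < y /\ 0 < z /\ x * x + 4 * y * z = p).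
  { intros x y z; unfold L; rewrite filter_In, in_prod_iff, in_prod_iff; unfold B; rewrite !in_iotaZ, Z2Nat.id, Z.eqb_eq by lia.
    split; [lia|]; intros [hx [hy [hz E]]]; repeat split; try lia; nia. }
  assert (NP : forall A C (l1 : list A) (l2 : list C), NoDup l1 -> NoDup l2 -> NoDup (list_prod l1 l2)).
  { intros A C l1 l2 N1 N2; induction N1 as [|a l1 Ha N1 IH]; simpl; [constructor|].
    apply NoDup_app; auto.
    - apply FinFun.Injective_map_NoDup; auto; intros ? ?; congruence.
    - intros [u v] K1 K2; apply in_map_iff in K1; destruct K1 as [b [E _]]; apply in_prod_iff in K2; destruct K2; congruence. }
  assert (NL : NoDup L) by (apply NoDup_filter; repeat apply NP; apply iotaZ_NoDup).
  assert (np : forall m n, 1 < m -> 1 < n -> p <> m * n).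
  { intros m n Hm Hn E; destruct (prime_divisors p Hp m) as [D|[D|[D|D]]]; try nia; exists n; lia. }
  (* On the boundaries between the three cases p would be a square or a multiple of 4. *)
  assert (nsq : forall x y z, x * x + 4 * y * z = p -> x <> y - z /\ x <> 2 * y).
  { intros x y z E; split; intros ->.
    - assert (p = (y + z) * (y + z)) by (rewrite <- E; ring).
      assert (1 < Z.abs (y + z)) by nia. apply (np (Z.abs (y + z)) (Z.abs (y + z))); auto; nia.
    - assert (p = 4 * (y * y + y * z)) by (rewrite <- E; ring); lia. }
  (* A fixed point has x = y, so x (x + 4z) = p and x = 1. *)
  assert (FP : forall x y z, 0 < x -> 0 < y -> 0 < z -> x * x + 4 * y * z = p -> zagier (x, y, z) = (x, y, z) -> (x, y, z) = (1, 1, k)).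
  { intros x y z hx hy hz E F; unfold zagier in F.
    destruct (Z_lt_dec x (y - z)); [injection F; lia|].
    destruct (Z_lt_dec x (2 * y)).
    - injection F as F1 F2; assert (x = y) by lia; subst y.
      assert (p = x * (x + 4 * z)) by (rewrite <- E; ring).
      assert (x = 1) by (destruct (Z.eq_dec x 1); auto; exfalso; apply (np x (x + 4 * z)); lia).
      subst x; do 2 f_equal; lia.
    - injection F; intros; lia. }
  assert (ZI : forall x y z, 0 < x -> 0 < y -> 0 < z -> x * x + 4 * y * z = p ->
     In (zagier (x, y, z)) L /\ zagier (zagier (x, y, z)) = (x, y, z)).
  { intros x y z hx hy hz E; destruct (nsq x y z E) as [n1 n2]; unfold zagier at 1 3.
    destruct (Z_lt_dec x (y - z)); [|destruct (Z_lt_dec x (2 * y))]; split.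
    - apply HL; repeat split; try lia; rewrite <- E; ring.
    - unfold zagier; destruct (Z_lt_dec (x + 2 * z) (z - (y - x - z))); [lia|].
      destruct (Z_lt_dec (x + 2 * z) (2 * z)); [lia|]; apply triple_eq; lia.
    - apply HL; repeat split; try lia; rewrite <- E; ring.
    - unfold zagier; destruct (Z_lt_dec (2 * y - x) (y - (x - y + z))); [lia|].
      destruct (Z_lt_dec (2 * y - x) (2 * y)); [|lia]; apply triple_eq; lia.
    - apply HL; repeat split; try lia; rewrite <- E; ring.
    - unfold zagier; destruct (Z_lt_dec (x - 2 * y) (x - y + z - y)); [|lia]; apply triple_eq; lia. }
  assert (K1 : 0 < k) by (destruct (Z.eq_dec k 0); [exfalso; rewrite e in Pm; lia|]; assert (0 <= k) by (apply Z.div_pos; lia); lia).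
  assert (In1 : In (1, 1, k) L) by (apply HL; repeat split; lia).
  assert (F1 : zagier (1, 1, k) = (1, 1, k)).
  { unfold zagier; destruct (Z_lt_dec 1 (1 - k)); [lia|]; destruct (Z_lt_dec 1 (2 * 1)); [|lia]; apply triple_eq; lia. }
  destruct (in_split _ _ In1) as [l1 [l2 EL]].
  assert (NL2 : NoDup (l1 ++ l2)) by (rewrite EL in NL; apply NoDup_remove_1 in NL; auto).
  assert (Nin : ~ In (1, 1, k) (l1 ++ l2)) by (rewrite EL in NL; apply NoDup_remove_2 in NL; auto).
  assert (InL : forall w, In w (l1 ++ l2) <-> In w L /\ w <> (1, 1, k)).
  { intros w; rewrite EL, !in_app_iff; simpl; split.
    - intros Hw; split; [tauto|]; intros ->; apply Nin, in_app_iff; auto.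
    - intros [[?|[?|?]] N]; auto; congruence. }
  assert (Ev : Nat.even (length (l1 ++ l2)) = true).
  { apply (involution_even_length dec zagier (length (l1 ++ l2))); auto.
    intros [[x y] z] Hw; apply InL in Hw; destruct Hw as [Hw Nw]; apply HL in Hw; destruct Hw as [hx [hy [hz E]]].
    destruct (ZI x y z hx hy hz E) as [Z1 Z2]; repeat split; auto.
    apply InL; split; auto; intros K; apply Nw; rewrite <- Z2, K; auto. }
  assert (Odd : Nat.even (length L) = false).
  { rewrite EL, length_app; rewrite length_app in Ev; simpl.
    rewrite Nat.add_succ_r, Nat.even_succ, <- Nat.negb_even, Ev; auto. }
  (* The number of solutions is odd, so the exchange of y and z has a fixed point too, and there p =
     x^2 + (2y)^2. *)
  destruct (existsb (fun w : Z * Z * Z => let '(x, y, z) := w in y =? z) L) eqn:Ex.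
  - apply existsb_exists in Ex; destruct Ex as [[[x y] z] [Hw E]].
    apply Z.eqb_eq in E; subst z; apply HL in Hw; exists x, (2 * y); lia.
  - exfalso.
    assert (Ev2 : Nat.even (length L) = true); [|congruence].
    apply (involution_even_length dec (fun w => let '(x, y, z) := w in (x, z, y)) (length L)); auto.
    intros [[x y] z] Hw; apply HL in Hw as Hw'; repeat split.
    + apply HL; lia.
    + intros E; injection E as E1 E2; clear E2; subst z.
      assert (existsb (fun w : Z * Z * Z => let '(x, y, z) := w in y =? z) L = true); [|congruence].
      apply existsb_exists; exists (x, y, y); split; auto; apply Z.eqb_refl.
Qed.
Close Scope Z_scope.

(** * The Hecke character *)

Definition Gmul (p q : Z * Z) : Z * Z :=
  (fst p * fst q - snd p * snd q, fst p * snd q + snd p * fst q)%Z.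

Definition Gnorm (p : Z * Z) : Z := (fst p * fst p + snd p * snd p)%Z.

Definition G2C (p : Z * Z) : C := (IZR (fst p), IZR (snd p)).

Lemma G2C_mul p q : G2C (Gmul p q) = (G2C p * G2C q)%C.
Proof. apply C_eq; unfold G2C, Gmul; simpl; rewrite ?minus_IZR, ?plus_IZR, !mult_IZR; ring. Qed.

Lemma Gnorm_mul p q : Gnorm (Gmul p q) = (Gnorm p * Gnorm q)%Z.
Proof. unfold Gnorm, Gmul; simpl; ring. Qed.

Definition ipow (r : nat) : Z * Z :=
  match r with O => (1, 0) | S O => (0, 1) | S (S O) => (-1, 0) | _ => (0, -1) end%Z.

Definition sgn4 (n : Z) : Z := (if n mod 4 =? 1 then 1 else -1)%Z.

(* The finite part of the Hecke character of Z[i] with infinity type r mod 4, which depends on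
   x + iy mod 4 only; for odd r it is the character of conductor 2 + 2i. *)
Definition psi (r : nat) (p : Z * Z) : Z * Z :=
  let '(x, y) := p in
  match r with
  | O => (1, 0)
  | S (S O) => if Z.odd x then (if Z.odd y then (0, 0) else (1, 0)) else (if Z.odd y then (-1, 0) else (0, 0))
  | _ => if Z.odd x then (if Z.odd y then (0, 0) else (sgn4 (x + y), 0))
         else (if Z.odd y then Gmul (sgn4 (x - y), 0) (ipow r) else (0, 0))
  end%Z.

Lemma odd_mod4 x : Z.odd (x mod 4) = Z.odd x.
Proof.
  rewrite (Z.div_mod x 4) at 2 by lia; rewrite Z.add_comm, Z.odd_add_mul_even; auto; exists 2%Z; auto.
Qed.

Lemma psi_mod r x y : psi r (x, y) = psi r (x mod 4, y mod 4)%Z.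
Proof.
  assert (P : forall a b, sgn4 (a mod 4 + b mod 4) = sgn4 (a + b)) by (intros; unfold sgn4; rewrite <- Zplus_mod; auto).
  assert (M : forall a b, sgn4 (a mod 4 - b mod 4) = sgn4 (a - b)) by (intros; unfold sgn4; rewrite <- Zminus_mod; auto).
  unfold psi; rewrite !odd_mod4, P, M; auto.
Qed.

Definition z4 : list Z := [0; 1; 2; 3]%Z.

Lemma in_z4 x : In (x mod 4)%Z z4.
Proof. pose proof (Z.mod_pos_bound x 4 ltac:(lia)); simpl; lia. Qed.

Definition Geqb (p q : Z * Z) : bool := Z.eqb (fst p) (fst q) && Z.eqb (snd p) (snd q).

Lemma Geqb_eq p q : Geqb p q = true -> p = q.
Proof. destruct p, q; unfold Geqb; simpl; rewrite andb_true_iff, !Z.eqb_eq; intros [-> ->]; auto. Qed.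

(** Both sides depend on residues modulo 4 only, which leaves a finite check. *)
Lemma psi_mul r p q : (r < 4)%nat -> psi r (Gmul p q) = Gmul (psi r p) (psi r q).
Proof.
  intros Hr; destruct p as [x y], q as [u v].
  assert (K : forallb (fun r => forallb (fun x => forallb (fun y => forallb (fun u => forallb (fun v =>
     Geqb (psi r (Gmul (x, y) (u, v))) (Gmul (psi r (x, y)) (psi r (u, v)))) z4) z4) z4) z4) (seq 0 4) = true)
    by (vm_compute; reflexivity).
  rewrite forallb_forall in K; specialize (K r ltac:(apply in_seq; lia)).
  rewrite forallb_forall in K; specialize (K (x mod 4)%Z (in_z4 x)).
  rewrite forallb_forall in K; specialize (K (y mod 4)%Z (in_z4 y)).
  rewrite forallb_forall in K; specialize (K (u mod 4)%Z (in_z4 u)).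
  rewrite forallb_forall in K; specialize (K (v mod 4)%Z (in_z4 v)).
  apply Geqb_eq in K.
  rewrite (psi_mod r x y), (psi_mod r u v), <- K; unfold Gmul; simpl fst; simpl snd.
  rewrite psi_mod; symmetry; rewrite psi_mod; f_equal; f_equal.
  - rewrite Zminus_mod, <- !Zmult_mod, <- Zminus_mod; auto.
  - rewrite Zplus_mod, <- !Zmult_mod, <- Zplus_mod; auto.
Qed.

Definition Phi (k : nat) (p : Z * Z) : C := (G2C (psi (k mod 4) p) * G2C p ^ k)%C.

Lemma mod4_lt k : (k mod 4 < 4)%nat.
Proof. apply Nat.mod_upper_bound; lia. Qed.

Lemma Phi_mul k p q : Phi k (Gmul p q) = (Phi k p * Phi k q)%C.
Proof. unfold Phi; rewrite psi_mul, !G2C_mul, Cpow_mult_l by apply mod4_lt; ring. Qed.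

Lemma Ci_pow k : (Ci ^ k)%C = G2C (ipow (k mod 4)).
Proof.
  rewrite (Nat.div_mod_eq k 4) at 1; rewrite Cpow_add_r, Cpow_mult_r.
  replace (Ci ^ 4)%C with (RtoC 1) by (apply C_eq; simpl; ring); rewrite Cpow_1_l, Cmult_1_l.
  pose proof (mod4_lt k); destruct (k mod 4)%nat as [|[|[|[|?]]]]; [| | | |lia]; apply C_eq; simpl; ring.
Qed.

(** The finite part cancels i^k, which makes Phi trivial on units and hence a function of ideals. *)
Lemma Phi_i k : Phi k (0, 1)%Z = 1.
Proof.
  unfold Phi; change (G2C (0, 1)%Z) with Ci; rewrite Ci_pow, <- G2C_mul.
  pose proof (mod4_lt k); destruct (k mod 4)%nat as [|[|[|[|?]]]]; [| | | |lia]; reflexivity.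
Qed.

(** * Fourier coefficients *)

Definition shell (n : nat) : list (Z * Z) :=
  filter (fun p => Z.eqb (Gnorm p) (Z.of_nat n)) (list_prod (zrange n) (zrange n)).

Lemma in_shell n p : In p (shell n) <-> Gnorm p = Z.of_nat n.
Proof.
  unfold shell; rewrite filter_In, Z.eqb_eq; split; [tauto|]; intros H; split; auto.
  destruct p as [x y]; unfold Gnorm in H; simpl in H.
  apply in_prod; apply in_zrange; nia.
Qed.

Lemma shell_NoDup n : NoDup (shell n).
Proof. apply NoDup_filter, list_prod_NoDup; apply zrange_NoDup. Qed.

(** The factor 1/4 counts each nonzero ideal once among its four generators. *)
Definition coef (k n : nat) : C := (/ 4 * lsum (Phi k) (shell n))%C.

Lemma lsum_reindex {I J} (f : J -> C) (m : I -> J) A B : NoDup A -> NoDup B ->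
  (forall x y, m x = m y -> x = y) -> (forall b, In b B <-> exists a, In a A /\ b = m a) ->
  lsum f B = lsum (fun a => f (m a)) A.
Proof.
  intros NA NB Inj H; rewrite <- (lsum_map m); apply lsum_perm.
  apply NoDup_Permutation; auto; [apply FinFun.Injective_map_NoDup; auto|].
  intros b; rewrite H, in_map_iff; split; intros [a [X Y]]; exists a; auto.
Qed.

Lemma Gmul_inj g : (0 < Gnorm g)%Z -> forall x y, Gmul g x = Gmul g y -> x = y.
Proof.
  intros Hg [x1 x2] [y1 y2] E; destruct g as [u v]; unfold Gmul, Gnorm in *; simpl in *; injection E as E1 E2.
  assert (K1 : ((u * u + v * v) * (x1 - y1) = 0)%Z)
    by (transitivity (u * (u * x1 - v * x2 - (u * y1 - v * y2)) + v * (u * x2 + v * x1 - (u * y2 + v * y1)))%Z; [ring|rewrite E1, E2; ring]).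
  assert (K2 : ((u * u + v * v) * (x2 - y2) = 0)%Z)
    by (transitivity (u * (u * x2 + v * x1 - (u * y2 + v * y1)) - v * (u * x1 - v * x2 - (u * y1 - v * y2)))%Z; [ring|rewrite E1, E2; ring]).
  apply Z.mul_eq_0 in K1; apply Z.mul_eq_0 in K2; f_equal; lia.
Qed.

Lemma lsum_Phi_mul k g A : lsum (fun a => Phi k (Gmul g a)) A = (Phi k g * lsum (Phi k) A)%C.
Proof. rewrite (lsum_ext_in _ (fun a => Phi k g * Phi k a)%C) by (intros; apply Phi_mul); apply lsum_scal. Qed.

Lemma lsum_Phi_image k g (A B : list (Z * Z)) : (0 < Gnorm g)%Z -> NoDup A -> NoDup B ->
  (forall b, In b B <-> exists a, In a A /\ b = Gmul g a) -> lsum (Phi k) B = (Phi k g * lsum (Phi k) A)%C.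
Proof. intros Hg NA NB H; rewrite (lsum_reindex (Phi k) (Gmul g) A B) by (auto; apply Gmul_inj; auto); apply lsum_Phi_mul. Qed.

Lemma coef_1 k : coef k 1 = 1.
Proof.
  unfold coef.
  assert (E : lsum (Phi k) (shell 1) = (1 + 1 + 1 + 1)%C).
  { rewrite (lsum_perm _ _ [(0, 1); Gmul (0, 1) (0, 1); Gmul (0, 1) (Gmul (0, 1) (0, 1)); Gmul (0, 1) (Gmul (0, 1) (Gmul (0, 1) (0, 1)))]%Z).
    - simpl lsum; rewrite !Phi_mul, !Phi_i; ring.
    - apply NoDup_Permutation; [apply shell_NoDup| |].
      + vm_compute; repeat constructor; simpl; intuition congruence.
      + intros [x y]; rewrite in_shell; unfold Gnorm, Gmul; simpl; split.
        * intros H; assert (-1 <= x <= 1)%Z by nia; assert (-1 <= y <= 1)%Z by nia.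
          assert (X : (x = -1 \/ x = 0 \/ x = 1)%Z) by lia; assert (Y : (y = -1 \/ y = 0 \/ y = 1)%Z) by lia.
          destruct X as [-> |[-> | ->]], Y as [-> |[-> | ->]]; simpl in *; try lia; auto.
        * intros [E|[E|[E|[E|[]]]]]; injection E as <- <-; reflexivity. }
  rewrite E; field; intros X; injection X; lra.
Qed.

(** The prime 2 ramifies: in an element of even norm x + y is even, so the element is a multiple of
    1 + i. *)
Lemma coef_2n k n : coef k (2 * n) = (Phi k (1, 1)%Z * coef k n)%C.
Proof.
  unfold coef; rewrite (lsum_Phi_image k (1, 1)%Z (shell n) (shell (2 * n))); [ring|reflexivity|apply shell_NoDup|apply shell_NoDup|].
  intros [x y]; rewrite in_shell; split.
  - unfold Gnorm; simpl fst; simpl snd; intros H.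
    assert (E : Z.Even (x + y)).
    { destruct (Z.Even_or_Odd (x + y)) as [|[m M]]; auto; exfalso.
      assert (y = 2 * m + 1 - x)%Z by lia; subst y; nia. }
    destruct E as [m M]; exists (m, y - m)%Z; rewrite in_shell; unfold Gnorm, Gmul; simpl fst; simpl snd; split.
    + assert (x = 2 * m - y)%Z by lia; subst x; nia.
    + f_equal; lia.
  - intros [a [Ha ->]]; apply in_shell in Ha; rewrite Gnorm_mul, Ha, Nat2Z.inj_mul; reflexivity.
Qed.

Definition coef_quot (k p n : nat) : C := if Nat.eqb (n mod p) 0 then coef k (n / p) else RtoC 0.

(** The contribution of the elements divisible by the rational integer p; such elements exist only
    if p divides n. *)
Lemma lsum_Phi_multiples k p n (B : list (Z * Z)) : (0 < p)%nat -> NoDup B ->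
  (forall b, In b B <-> Gnorm b = (Z.of_nat p * Z.of_nat n)%Z /\ (Z.of_nat p | fst b)%Z /\ (Z.of_nat p | snd b)%Z) ->
  (/ 4 * lsum (Phi k) B)%C = (Phi k (Z.of_nat p, 0)%Z * coef_quot k p n)%C.
Proof.
  intros Hp NB H; unfold coef_quot.
  assert (D : forall x y, (Z.of_nat p | x)%Z -> (Z.of_nat p | y)%Z -> (x * x + y * y = Z.of_nat p * Z.of_nat n)%Z ->
     exists x' y', x = (Z.of_nat p * x')%Z /\ y = (Z.of_nat p * y')%Z /\ (Z.of_nat n = Z.of_nat p * (x' * x' + y' * y'))%Z).
  { intros x y [x' ->] [y' ->] E; exists x', y'; repeat split; try ring.
    apply (Z.mul_reg_l _ _ (Z.of_nat p)); [lia|]; rewrite <- E; ring. }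
  destruct (Nat.eqb (n mod p) 0) eqn:E.
  - apply Nat.eqb_eq in E; apply Nat.Div0.div_exact in E.
    unfold coef; rewrite (lsum_Phi_image k (Z.of_nat p, 0)%Z (shell (n / p)) B); [ring| |apply shell_NoDup|auto|].
    + unfold Gnorm; simpl; nia.
    + intros [x y]; rewrite H; unfold Gnorm; simpl fst; simpl snd; split.
      * intros [N [D1 D2]]; destruct (D x y D1 D2 N) as [x' [y' [-> [-> N']]]].
        exists (x', y'); rewrite in_shell; split.
        -- unfold Gnorm; simpl; apply (Z.mul_reg_l _ _ (Z.of_nat p)); [lia|]; rewrite <- N', <- Nat2Z.inj_mul, <- E; auto.
        -- unfold Gmul; simpl; f_equal; ring.
      * intros [[a b] [Ha E2]]; apply in_shell in Ha; unfold Gmul in E2; simpl in E2; injection E2 as -> ->.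
        unfold Gnorm in Ha; simpl in Ha; repeat split.
        -- rewrite E at 1; rewrite Nat2Z.inj_mul, <- Ha; ring.
        -- exists a; ring.
        -- exists b; ring.
  - assert (B = []) as ->; [|simpl; ring].
    destruct B as [|[x y] B]; auto; exfalso.
    destruct (proj1 (H (x, y)) (or_introl eq_refl)) as [N [D1 D2]]; unfold Gnorm in N; simpl in *.
    destruct (D x y D1 D2 N) as [x' [y' [_ [_ N']]]].
    apply Nat.eqb_neq in E; apply E; apply Nat.Lcm0.mod_divide.
    exists (Z.to_nat (x' * x' + y' * y')); apply Nat2Z.inj; rewrite Nat2Z.inj_mul, Z2Nat.id by (apply Z.add_nonneg_nonneg; apply Z.square_nonneg); rewrite N'; ring.
Qed.

Lemma mod4_Z p r : (p mod 4 = r)%nat -> (Z.of_nat p mod 4 = Z.of_nat r)%Z.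
Proof. intros <-; rewrite Nat2Z.inj_mod; auto. Qed.

(** Such a p is inert: every element of norm divisible by p is itself divisible by p. *)
Lemma coef_3_mod_4 k p n : prime (Z.of_nat p) -> (p mod 4 = 3)%nat ->
  coef k (p * n) = (Phi k (Z.of_nat p, 0)%Z * coef_quot k p n)%C.
Proof.
  intros Hp H3; pose proof (prime_ge_2 _ Hp); unfold coef.
  apply lsum_Phi_multiples; [lia|apply shell_NoDup|].
  intros [x y]; rewrite in_shell, Nat2Z.inj_mul; split; [|tauto]; intros E; split; auto.
  apply (prime_3_mod_4_divides _ x y Hp (mod4_Z _ _ H3)); unfold Gnorm in E; simpl in E; rewrite E.
  exists (Z.of_nat n); ring.
Qed.

Lemma lsum_incl_excl {I} (f : I -> C) (b1 b2 : I -> bool) A : (forall a, In a A -> b1 a || b2 a = true) ->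
  (lsum f A + lsum f (filter (fun a => b1 a && b2 a) A))%C = (lsum f (filter b1 A) + lsum f (filter b2 A))%C.
Proof.
  induction A as [|a A IH]; intros H; simpl; [ring|].
  specialize (IH (fun x Hx => H x (or_intror Hx))); specialize (H a (or_introl eq_refl)).
  destruct (b1 a), (b2 a); simpl in *; try discriminate.
  - transitivity (f a + f a + (lsum f A + lsum f (filter (fun a => b1 a && b2 a) A)))%C; [ring|rewrite IH; ring].
  - transitivity (f a + (lsum f A + lsum f (filter (fun a => b1 a && b2 a) A)))%C; [ring|rewrite IH; ring].
  - transitivity (f a + (lsum f A + lsum f (filter (fun a => b1 a && b2 a) A)))%C; [ring|rewrite IH; ring].
Qed.

(** Divisibility of x + iy by u + iv, tested only on the imaginary part of (x + iy)(u - iv), up to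
    sign; for elements of norm divisible by p the real part follows. *)
Definition divides_by (p u v : Z) (a : Z * Z) : bool := Z.eqb ((fst a * v - snd a * u) mod p) 0.

Lemma divides_by_spec p u v a : (0 < p)%Z -> divides_by p u v a = true <-> (p | fst a * v - snd a * u)%Z.
Proof. intros Hp; unfold divides_by; rewrite Z.eqb_eq; apply Z.mod_divide; lia. Qed.

(** The norm of b (u - iv) is p^2 n, so p divides its real part once it divides its imaginary part;
    the quotient by p is [a]. *)
Lemma divisible_by_gaussian_prime p n u v b : prime p -> p = (u * u + v * v)%Z ->
  (Gnorm b = p * n)%Z -> (p | fst b * v - snd b * u)%Z -> exists a, Gnorm a = n /\ b = Gmul (u, v) a.
Proof.
  intros Hp E N [m Hm]; destruct b as [x y]; unfold Gnorm in N; simpl in *.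
  pose proof (prime_ge_2 p Hp) as P2.
  assert (S : ((x * u + y * v) * (x * u + y * v) = p * (p * n - m * m * p))%Z).
  { transitivity ((x * x + y * y) * (u * u + v * v) - (x * v - y * u) * (x * v - y * u))%Z; [ring|].
    rewrite N, Hm, <- E; ring. }
  assert (D : (p | x * u + y * v)%Z).
  { assert (D2 : (p | (x * u + y * v) * (x * u + y * v))%Z) by (exists (p * n - m * m * p)%Z; rewrite S; ring).
    apply prime_mult in D2; tauto. }
  destruct D as [l Hl].
  exists (l, - m)%Z; unfold Gnorm, Gmul; simpl fst; simpl snd.
  assert (X : (p * x = p * (u * l - v * - m))%Z).
  { transitivity ((x * u + y * v) * u + (x * v - y * u) * v)%Z; [rewrite E; ring|rewrite Hl, Hm; ring]. }
  assert (Y : (p * y = p * (u * - m + v * l))%Z).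
  { transitivity ((x * u + y * v) * v - (x * v - y * u) * u)%Z; [rewrite E; ring|rewrite Hl, Hm; ring]. }
  apply Z.mul_reg_l in X; [|lia]; apply Z.mul_reg_l in Y; [|lia].
  split; [|f_equal; auto].
  apply (Z.mul_reg_l _ _ p); [lia|]; rewrite <- N, X, Y, E; ring.
Qed.

(* Inclusion-exclusion over the divisibility by the two primes above p. *)
Lemma coef_1_mod_4 k p n u v : prime (Z.of_nat p) -> p <> 2%nat -> (Z.of_nat p = u * u + v * v)%Z ->
  (coef k (p * n) + Phi k (Z.of_nat p, 0)%Z * coef_quot k p n)%C = ((Phi k (u, v) + Phi k (u, - v)%Z) * coef k n)%C.
Proof.
  intros Hp H2 E; set (q := Z.of_nat p) in *; pose proof (prime_ge_2 _ Hp) as P2.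
  assert (Q2 : (2 < q)%Z) by lia.
  set (b1 := divides_by q u v); set (b2 := divides_by q u (- v)).
  assert (S : forall a, In a (shell (p * n)) <-> Gnorm a = (q * Z.of_nat n)%Z) by (intros; rewrite in_shell, Nat2Z.inj_mul; tauto).
  (* The product of the two test values is divisible by p, so at least one of the two primes divides
     the element. *)
  assert (B : forall a, In a (shell (p * n)) -> b1 a || b2 a = true).
  { intros [x y] Ha; apply S in Ha; unfold Gnorm in Ha; simpl in Ha.
    assert (D : (q | (x * v - y * u) * (x * - v - y * u))%Z).
    { exists (y * y - Z.of_nat n * v * v)%Z.
      transitivity (y * y * (u * u + v * v) - v * v * (x * x + y * y))%Z; [ring|rewrite <- E, Ha; ring]. }
    apply prime_mult in D; auto; apply orb_true_iff; destruct D as [D|D]; [left|right]; apply divides_by_spec; simpl; auto; lia. }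
  pose proof (lsum_incl_excl (Phi k) b1 b2 (shell (p * n)) B) as IE.
  assert (Img : forall v', (q = u * u + v' * v')%Z ->
     lsum (Phi k) (filter (divides_by q u v') (shell (p * n))) = (Phi k (u, v') * lsum (Phi k) (shell n))%C).
  { intros v' Ev; apply lsum_Phi_image; [unfold Gnorm; simpl; lia|apply shell_NoDup|apply NoDup_filter, shell_NoDup|].
    intros b; rewrite filter_In, S, divides_by_spec by lia; split.
    - intros [N D]; destruct (divisible_by_gaussian_prime q (Z.of_nat n) u v' b Hp Ev N D) as [a [Na ->]].
      exists a; split; auto; apply in_shell; auto.
    - intros [a [Ha ->]]; apply in_shell in Ha; split.
      + rewrite Gnorm_mul, Ha; unfold Gnorm; simpl; rewrite <- Ev; ring.
      + destruct a as [x y]; unfold Gmul; simpl; exists (- y)%Z; rewrite Ev; ring. }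
  unfold b1, b2 in IE; rewrite (Img v E), (Img (- v)%Z) in IE by lia.
  assert (M : (/ 4 * lsum (Phi k) (filter (fun a => divides_by q u v a && divides_by q u (- v) a) (shell (p * n))))%C
     = (Phi k (q, 0)%Z * coef_quot k p n)%C).
  { apply lsum_Phi_multiples; [lia|apply NoDup_filter, shell_NoDup|].
    (* As p divides neither u nor v, an element passing both tests is divisible by p itself. *)
    assert (Nv : forall w w', (q = w * w + w' * w')%Z -> ~ (q | w)%Z).
    { intros w w' Ew [m Hm]. assert (m = 0)%Z by nia. subst m; assert (w = 0)%Z by lia; subst w.
      destruct (prime_divisors q Hp w' ltac:(exists w'; lia)) as [X|[X|[X|X]]]; nia. }
    intros [x y]; rewrite filter_In, S, andb_true_iff, !divides_by_spec by lia; simpl fst; simpl snd; fold q; split.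
    - intros [N [D1 D2]]; split; auto.
      assert (D3 : (q | 2 * (x * v))%Z) by (replace (2 * (x * v))%Z with ((x * v - y * u) - (x * - v - y * u))%Z by ring; apply Z.divide_sub_r; auto).
      assert (D4 : (q | 2 * (y * u))%Z) by (replace (2 * (y * u))%Z with (- ((x * v - y * u) + (x * - v - y * u)))%Z by ring; apply Z.divide_opp_r, Z.divide_add_r; auto).
      assert (N2 : ~ (q | 2)%Z) by (intros X; apply Z.divide_pos_le in X; lia).
      assert (Nu : ~ (q | u)%Z) by (apply (Nv u v); lia).
      assert (Nv' : ~ (q | v)%Z) by (apply (Nv v u); lia).
      apply prime_mult in D3; auto; apply prime_mult in D4; auto.
      destruct D3 as [|D3]; [tauto|]; destruct D4 as [|D4]; [tauto|].
      apply prime_mult in D3; auto; apply prime_mult in D4; auto; tauto.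
    - intros [N [[a ->] [b ->]]]; split; auto; split; [exists (a * v - b * u)%Z|exists (a * - v - b * u)%Z]; ring. }
  rewrite <- M; unfold coef.
  transitivity (/ 4 * (lsum (Phi k) (shell (p * n)) +
    lsum (Phi k) (filter (fun a => divides_by q u v a && divides_by q u (- v) a) (shell (p * n)))))%C; [ring|].
  rewrite IE; ring.
Qed.

Definition chik (k : nat) : Z -> C := char_k (S k).

Lemma even_S_mod4 k : Nat.even (S k) = match (k mod 4)%nat with O | S (S O) => false | _ => true end.
Proof.
  rewrite Nat.even_succ, <- Nat.negb_even, (Nat.div_mod_eq k 4) at 1.
  rewrite Nat.even_add, Nat.even_mul; simpl Nat.even at 1; simpl orb.
  pose proof (mod4_lt k); destruct (k mod 4)%nat as [|[|[|[|?]]]]; [| | | |lia]; reflexivity.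
Qed.

Lemma chi_m4_odd d : Z.odd d = true -> chi_m4 d = RtoC (IZR (sgn4 d)).
Proof. intros H; unfold chi_m4, sgn4; rewrite H; destruct (d mod 4 =? 1)%Z; reflexivity. Qed.

Lemma gcd_pow2_odd d m : Z.odd d = true -> Z.gcd d (2 ^ Z.of_nat m) = 1%Z.
Proof.
  intros H; apply Zgcd_1_rel_prime.
  induction m as [|m IH]; [apply rel_prime_sym, rel_prime_1|].
  rewrite Nat2Z.inj_succ, Z.pow_succ_r by lia.
  apply rel_prime_mult; auto.
  apply rel_prime_sym, prime_rel_prime; [apply prime_2|].
  intros [q Hq]; rewrite Hq, Z.odd_mul in H; rewrite andb_false_r in H; discriminate.
Qed.

Lemma triv_char_odd d : Z.odd d = true -> triv_char 32 d = 1.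
Proof. intros H; unfold triv_char; change 32%Z with (2 ^ Z.of_nat 5)%Z; rewrite gcd_pow2_odd by auto; reflexivity. Qed.

Lemma chik_odd k d : Z.odd d = true ->
  chik k d = match (k mod 4)%nat with O | S (S O) => RtoC (IZR (sgn4 d)) | _ => RtoC 1 end.
Proof.
  intros H; unfold chik, char_k; rewrite even_S_mod4.
  pose proof (mod4_lt k); destruct (k mod 4)%nat as [|[|[|[|?]]]]; [| | | |lia];
    rewrite ?chi_m4_odd, ?triv_char_odd by auto; auto.
Qed.

Lemma chik_even k d : Z.odd d = false -> chik k d = 0.
Proof.
  intros H; unfold chik, char_k; destruct (Nat.even (S k)).
  - unfold triv_char; destruct (Z.eqb_spec (Z.gcd d 32) 1) as [E|E]; auto; exfalso.
    assert (K : (2 | Z.gcd d 32)%Z).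
    { apply Z.gcd_greatest; [|exists 16%Z; auto].
      rewrite <- Z.negb_even in H; apply negb_false_iff, Z.even_spec in H; destruct H as [e ->]; exists e; ring. }
    rewrite E in K; apply Z.divide_1_r in K; lia.
  - unfold chi_m4; rewrite H; auto.
Qed.

(** On odd rational integers the finite part is the nebentypus times the character of Q(i). The
    latter sign separates the split and the inert case in the Hecke relation. *)
Lemma Phi_rational k (x : Z) : Z.odd x = true -> Phi k (x, 0)%Z = (RtoC (IZR (sgn4 x)) * chik k x * RtoC (IZR x ^ k))%C.
Proof.
  intros H; unfold Phi; change (G2C (x, 0)%Z) with (RtoC (IZR x)); rewrite <- RtoC_pow, chik_odd by auto; f_equal.
  assert (S2 : (sgn4 x * sgn4 x = 1)%Z) by (unfold sgn4; destruct (x mod 4 =? 1)%Z; auto).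
  pose proof (mod4_lt k); unfold psi; rewrite H, Z.add_0_r; simpl Z.odd.
  destruct (k mod 4)%nat as [|[|[|[|?]]]]; [| | | |lia]; rewrite <- RtoC_mult, <- ?mult_IZR, ?S2, ?Z.mul_1_r, ?Rmult_1_r; reflexivity.
Qed.

Lemma prime_odd p : prime (Z.of_nat p) -> p <> 2%nat -> Z.odd (Z.of_nat p) = true.
Proof.
  intros Hp H2; destruct (Z.odd (Z.of_nat p)) eqn:O; auto; exfalso.
  rewrite <- Z.negb_even in O; apply negb_false_iff, Z.even_spec in O; destruct O as [e E].
  pose proof (prime_ge_2 _ Hp); destruct (prime_divisors _ Hp 2 ltac:(exists e; lia)) as [X|[X|[X|X]]]; lia.
Qed.

Lemma odd_prime_mod4 p : prime (Z.of_nat p) -> p <> 2%nat -> (p mod 4 = 1)%nat \/ (p mod 4 = 3)%nat.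
Proof.
  intros Hp H2; pose proof (prime_odd p Hp H2) as O; apply Z.odd_spec in O; destruct O as [m M].
  pose proof (Nat.div_mod_eq p 4); pose proof (mod4_lt p); lia.
Qed.

Lemma coef_prime_1_mod_4 k p n u v : prime (Z.of_nat p) -> (p mod 4 = 1)%nat -> (Z.of_nat p = u * u + v * v)%Z ->
  (coef k (p * n) + chik k (Z.of_nat p) * RtoC (INR p ^ k) * coef_quot k p n)%C
  = ((Phi k (u, v) + Phi k (u, - v)%Z) * coef k n)%C.
Proof.
  intros Hp H1 E; assert (H2 : p <> 2%nat) by (intros ->; discriminate).
  rewrite <- (coef_1_mod_4 k p n u v) by auto; rewrite (Phi_rational k) by (apply prime_odd; auto).
  unfold sgn4; rewrite (mod4_Z p 1 H1), INR_IZR_INZ; simpl; ring.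
Qed.

Lemma coef_prime_3_mod_4 k p n : prime (Z.of_nat p) -> (p mod 4 = 3)%nat ->
  (coef k (p * n) + chik k (Z.of_nat p) * RtoC (INR p ^ k) * coef_quot k p n)%C = 0.
Proof.
  intros Hp H3; assert (H2 : p <> 2%nat) by (intros ->; discriminate).
  rewrite coef_3_mod_4 by auto; rewrite (Phi_rational k) by (apply prime_odd; auto).
  unfold sgn4; rewrite (mod4_Z p 3 H3), INR_IZR_INZ; simpl.
  replace (RtoC (-1)) with (- (1))%C by (apply C_eq; simpl; ring); ring.
Qed.

Lemma coef_hecke k : hecke_eigen (S k) (chik k) (coef k).
Proof.
  intros p Hp; simpl Nat.sub; rewrite Nat.sub_0_r.
  destruct (Nat.eq_dec p 2) as [->|H2].
  - exists (Phi k (1, 1)%Z); intros n Hn; rewrite coef_2n, chik_even by reflexivity; ring.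
  - destruct (odd_prime_mod4 p Hp H2) as [H1|H3].
    + destruct (two_squares _ Hp (mod4_Z _ _ H1)) as [u [v E]].
      exists (Phi k (u, v) + Phi k (u, - v)%Z)%C; intros n Hn; apply coef_prime_1_mod_4; auto.
    + exists 0; intros n Hn; rewrite Cmult_0_l; apply coef_prime_3_mod_4; auto.
Qed.

Lemma coef_quot_1 k p : (1 < p)%nat -> coef_quot k p 1 = 0.
Proof. intros Hp; unfold coef_quot; rewrite Nat.mod_small by auto; reflexivity. Qed.

Lemma coef_p_3_mod_4 k p : prime (Z.of_nat p) -> (p mod 4 = 3)%nat -> coef k p = 0.
Proof.
  intros Hp H3; pose proof (prime_ge_2 _ Hp).
  pose proof (coef_prime_3_mod_4 k p 1 Hp H3) as E; rewrite coef_quot_1, Nat.mul_1_r in E by lia.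
  rewrite <- E; ring.
Qed.

Lemma coef_p_1_mod_4 k p x y : prime (Z.of_nat p) -> (p mod 4 = 1)%nat -> (Z.of_nat p = x * x + y * y)%Z ->
  coef k p = (Phi k (x, y) + Phi k (x, - y)%Z)%C.
Proof.
  intros Hp H1 E; pose proof (prime_ge_2 _ Hp).
  pose proof (coef_prime_1_mod_4 k p 1 x y Hp H1 E) as F; rewrite coef_quot_1, Nat.mul_1_r, coef_1 in F by lia.
  transitivity (coef k p + chik k (Z.of_nat p) * RtoC (INR p ^ k) * 0)%C; [ring|rewrite F; ring].
Qed.

(** With x = 2l + 1 and y = 2m the sign is (-1)^((l + m) k): for odd k it records x + y modulo 4,
    for even k it is trivial. Conjugation replaces m by -m, which keeps the parity of l + m. *)
Lemma coef_formula k p x y : prime (Z.of_nat p) -> (p mod 4 = 1)%nat ->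
  (Z.of_nat p = x * x + y * y)%Z -> Z.odd x = true ->
  coef k p = Cmult (if Z.even (((x + y - 1) * (Z.of_nat (S k) - 1)) / 2) then RtoC 1 else RtoC (-1))
               (Cplus (Cpow (IZR x, IZR y) k) (Cpow (IZR x, - IZR y) k)).
Proof.
  intros Hp H1 E Ox; rewrite (coef_p_1_mod_4 k p x y) by auto.
  assert (Oy : Z.odd y = false).
  { destruct (Z.odd y) eqn:O; auto; exfalso.
    apply Z.odd_spec in O; apply Z.odd_spec in Ox; destruct O as [m ->], Ox as [l ->].
    pose proof (mod4_Z p 1 H1) as M; rewrite E in M.
    replace ((2 * l + 1) * (2 * l + 1) + (2 * m + 1) * (2 * m + 1))%Z with (2 + (l * l + l + m * m + m) * 4)%Z in M by ring.
    rewrite Z.mod_add in M by lia; discriminate. }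
  assert (Oy' : Z.odd (- y) = false) by (rewrite Z.odd_opp; auto).
  rewrite <- Z.negb_even in Oy; apply negb_false_iff, Z.even_spec in Oy; destruct Oy as [m Hm].
  pose proof Ox as Ox'; apply Z.odd_spec in Ox'; destruct Ox' as [l Hl].
  assert (D : (((x + y - 1) * (Z.of_nat (S k) - 1)) / 2 = (l + m) * Z.of_nat k)%Z).
  { replace ((x + y - 1) * (Z.of_nat (S k) - 1))%Z with ((l + m) * Z.of_nat k * 2)%Z by lia; apply Z.div_mul; lia. }
  rewrite D, Z.even_mul.
  assert (Sg : forall w, (w = m \/ w = - m)%Z -> sgn4 (x + 2 * w) = if Z.even (l + m) then 1%Z else (-1)%Z).
  { intros w Hw; unfold sgn4.
    assert (Par : Z.even (l + w) = Z.even (l + m)).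
    { destruct Hw as [-> | ->]; auto; rewrite !Z.even_add, Z.even_opp; auto. }
    replace (x + 2 * w)%Z with (2 * (l + w) + 1)%Z by lia; rewrite <- Par.
    destruct (Z.even (l + w)) eqn:Ev.
    - apply Z.even_spec in Ev; destruct Ev as [c Hc]; rewrite Hc.
      replace (2 * (2 * c) + 1)%Z with (1 + c * 4)%Z by ring; rewrite Z.mod_add by lia; reflexivity.
    - rewrite <- Z.negb_odd in Ev; apply negb_false_iff, Z.odd_spec in Ev; destruct Ev as [c Hc]; rewrite Hc.
      replace (2 * (2 * c + 1) + 1)%Z with (3 + c * 4)%Z by ring; rewrite Z.mod_add by lia; reflexivity. }
  assert (Ek : Z.even (Z.of_nat k) = match (k mod 4)%nat with O | S (S O) => true | _ => false end).
  { pose proof (even_S_mod4 k) as X; rewrite Nat.even_succ, <- Nat.negb_even in X.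
    assert (Y : Z.even (Z.of_nat k) = Nat.even k).
    { destruct (Nat.even k) eqn:Ev.
      - apply Nat.even_spec in Ev; destruct Ev as [c ->]; apply Z.even_spec; exists (Z.of_nat c); lia.
      - rewrite <- Nat.negb_odd in Ev; apply negb_false_iff, Nat.odd_spec in Ev; destruct Ev as [c ->].
        rewrite <- Z.negb_odd; apply negb_false_iff, Z.odd_spec; exists (Z.of_nat c); lia. }
    rewrite Y; destruct (Nat.even k); cbn [negb] in X; destruct (k mod 4)%nat as [|[|[|]]]; congruence. }
  rewrite Ek.
  assert (P : forall w, (w = m \/ w = - m)%Z -> psi (k mod 4) (x, 2 * w)%Z =
     (if (Z.even (l + m) || match (k mod 4)%nat with O | S (S O) => true | _ => false end)%bool then 1%Z else (-1)%Z, 0%Z)).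
  { intros w Hw; unfold psi.
    assert (Ow : Z.odd (2 * w) = false) by (rewrite Z.odd_mul; reflexivity).
    rewrite Ox, Ow, (Sg w Hw).
    destruct (k mod 4)%nat as [|[|[|]]]; rewrite ?orb_true_r, ?orb_false_r; auto. }
  unfold Phi; replace (- y)%Z with (2 * (- m))%Z by lia; replace y with (2 * m)%Z by lia.
  rewrite !P by auto.
  unfold G2C; cbn [fst snd].
  replace (IZR (2 * - m)) with (- IZR (2 * m)) by (rewrite <- opp_IZR; f_equal; ring).
  destruct (_ || _)%bool; [change (1, 0) with (RtoC 1)|change (-1, 0) with (RtoC (-1))]; ring.
Qed.

(** * The newform and its q-expansion *)

(** Together with [beta2], chosen so that e(x beta1 + y beta2) sees what defines psi: x + y modulo 4
    for odd k, the parity of y for k congruent to 2 modulo 4, and nothing when 4 divides k. *)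
Definition beta1 (k : nat) : R := match (k mod 4)%nat with O | S (S O) => 0 | _ => / 4 end.
Definition beta2 (k : nat) : R := match (k mod 4)%nat with O => 0 | S (S O) => / 2 | _ => / 4 end.

(* Normalises the average over the units of e(<alpha, beta>) alpha^k to psi(alpha) alpha^k. *)
Definition gam (r : nat) : Z * Z := match r with S O => (-2, 2) | S (S (S O)) => (2, 2) | _ => (4, 0) end%Z.

(* Here and below k is the exponent of the Hecke character: [fk k] has weight [S k]. *)
Definition fk (k : nat) (z : C) : C := (Th k 0 0 (beta1 k) (beta2 k) (2 * z) / G2C (gam (k mod 4)))%C.

(** The root of unity e(x beta1 + y beta2) as a Gaussian integer, which makes the average over units
    computable. *)
Definition phase (r : nat) (p : Z * Z) : Z * Z :=
  match r with
  | O => (1, 0)%Z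
  | S (S O) => (if Z.odd (snd p) then -1 else 1, 0)%Z
  | _ => ipow (Z.to_nat ((fst p + snd p) mod 4))
  end.

Definition Gadd (p q : Z * Z) : Z * Z := (fst p + fst q, snd p + snd q)%Z.
Definition rot (p : Z * Z) : Z * Z := (- snd p, fst p)%Z.

Lemma phase_mod r x y : phase r (x, y) = phase r (x mod 4, y mod 4)%Z.
Proof. unfold phase; simpl fst; simpl snd; rewrite odd_mod4, <- Zplus_mod; auto. Qed.

(** Horner form of the sum over j = 0, 1, 2, 3 of i^(jr) times the phase of i^j p. *)
Definition unit_average (r : nat) (p : Z * Z) : Z * Z :=
  let i := ipow r in
  Gadd (phase r p) (Gmul i (Gadd (phase r (rot p)) (Gmul i (Gadd (phase r (rot (rot p))) (Gmul i (phase r (rot (rot (rot p))))))))).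

Lemma phase_rot_mod r x y : phase r (rot (x, y)) = phase r (rot (x mod 4, y mod 4)%Z).
Proof.
  unfold rot; simpl fst; simpl snd; rewrite phase_mod; symmetry; rewrite phase_mod; f_equal; f_equal.
  - rewrite <- (Z.sub_0_l (y mod 4)), <- (Z.sub_0_l y), Zminus_mod_idemp_r; auto.
  - apply Zmod_mod.
Qed.

Lemma unit_average_psi r p : (r < 4)%nat -> unit_average r p = Gmul (gam r) (psi r p).
Proof.
  intros Hr; destruct p as [x y].
  assert (K : forallb (fun r => forallb (fun x => forallb (fun y =>
     Geqb (unit_average r (x, y)) (Gmul (gam r) (psi r (x, y)))) z4) z4) (seq 0 4) = true)
    by (vm_compute; reflexivity).
  rewrite forallb_forall in K; specialize (K r ltac:(apply in_seq; lia)).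
  rewrite forallb_forall in K; specialize (K (x mod 4)%Z (in_z4 x)).
  rewrite forallb_forall in K; specialize (K (y mod 4)%Z (in_z4 y)).
  apply Geqb_eq in K; rewrite psi_mod, <- K; unfold unit_average.
  assert (M : forall a, ((- (a mod 4)) mod 4 = (- a) mod 4)%Z).
  { intros a; rewrite <- (Z.sub_0_l (a mod 4)), <- (Z.sub_0_l a), Zminus_mod_idemp_r; auto. }
  rewrite (phase_mod r x y), (phase_rot_mod r x y).
  replace (phase r (rot (rot (x, y)))) with (phase r (rot (rot (x mod 4, y mod 4)%Z))).
  2:{ unfold rot at 2; simpl fst; simpl snd; rewrite phase_rot_mod; symmetry; unfold rot at 2; simpl fst; simpl snd.
      rewrite phase_rot_mod, M, Zmod_mod; auto. }
  replace (phase r (rot (rot (rot (x, y))))) with (phase r (rot (rot (rot (x mod 4, y mod 4)%Z)))); auto.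
  unfold rot at 2 3; simpl fst; simpl snd; rewrite phase_rot_mod; symmetry; unfold rot at 2 3; simpl fst; simpl snd.
  rewrite phase_rot_mod, !M; auto.
Qed.

Lemma ex1_quarter n : ex1 (IZR n / 4) = G2C (ipow (Z.to_nat (n mod 4))).
Proof.
  replace (IZR n / 4) with (IZR (n mod 4) / 4 + IZR (n / 4)).
  2:{ rewrite (Z.div_mod n 4) at 3 by lia; rewrite plus_IZR, mult_IZR; field. }
  rewrite ex1_period.
  assert (Q : ex1 (1 / 4) = Ci).
  { rewrite ex1_cos; replace (2 * PI * (1 / 4)) with (PI / 2) by field; rewrite cos_PI2, sin_PI2; reflexivity. }
  pose proof (Z.mod_pos_bound n 4 ltac:(lia)) as B.
  assert (X : (n mod 4 = 0 \/ n mod 4 = 1 \/ n mod 4 = 2 \/ n mod 4 = 3)%Z) by lia.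
  destruct X as [-> |[-> |[-> | ->]]].
  - replace (0 / 4) with 0 by field; rewrite ex1_0; reflexivity.
  - rewrite Q; reflexivity.
  - replace (2 / 4) with (1 / 4 + 1 / 4) by field; rewrite ex1_plus, Q; apply C_eq; simpl; ring.
  - replace (3 / 4) with (1 / 4 + (1 / 4 + 1 / 4)) by field; rewrite !ex1_plus, Q; apply C_eq; simpl; ring.
Qed.

Lemma ex1_phase k x y : ex1 (IZR x * beta1 k + IZR y * beta2 k) = G2C (phase (k mod 4) (x, y)).
Proof.
  unfold beta1, beta2, phase; pose proof (mod4_lt k).
  assert (O : ex1 (IZR x * / 4 + IZR y * / 4) = G2C (ipow (Z.to_nat ((x + y) mod 4)))).
  { replace (IZR x * / 4 + IZR y * / 4) with (IZR (x + y) / 4) by (rewrite plus_IZR; field); apply ex1_quarter. }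
  destruct (k mod 4)%nat as [|[|[|[|?]]]]; [| | | |lia]; auto.
  - replace (IZR x * 0 + IZR y * 0) with 0 by ring; rewrite ex1_0; reflexivity.
  - simpl snd; replace (IZR x * 0 + IZR y * / 2) with (IZR (2 * y) / 4) by (rewrite mult_IZR; field).
    rewrite ex1_quarter; destruct (Z.odd y) eqn:Oy.
    + apply Z.odd_spec in Oy; destruct Oy as [m ->]; replace (2 * (2 * m + 1))%Z with (2 + m * 4)%Z by ring.
      rewrite Z.mod_add by lia; reflexivity.
    + rewrite <- Z.negb_even in Oy; apply negb_false_iff, Z.even_spec in Oy; destruct Oy as [m ->].
      replace (2 * (2 * m))%Z with (0 + m * 4)%Z by ring; rewrite Z.mod_add by lia; reflexivity.
Qed.

Definition qN (z : C) (p : Z * Z) : C := Cexp (RtoC (2 * PI * IZR (Gnorm p)) * Ci * z).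

Lemma term2_qN k x y z :
  term2 k 0 0 (RtoC (beta1 k)) (RtoC (beta2 k)) (2 * z) (x, y) =
  (G2C (x, y) ^ k * G2C (phase (k mod 4) (x, y)) * qN z (x, y))%C.
Proof.
  unfold term2; cbn [fst snd].
  replace (pt 0 0 (x, y)) with (G2C (x, y)) by (unfold pt, G2C; cbn [fst snd]; rewrite !Rplus_0_r; auto).
  rewrite <- Cmult_assoc; f_equal.
  rewrite <- ex1_phase; unfold gauss, qN; rewrite Cexp_ex1, <- Cexp_plus; f_equal.
  unfold Gnorm; cbn [fst snd]; rewrite !Rplus_0_r, plus_IZR, !mult_IZR, !RtoC_mult, !RtoC_plus, !RtoC_mult; ring.
Qed.

Lemma G2C_add p q : G2C (Gadd p q) = (G2C p + G2C q)%C.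
Proof. apply C_eq; unfold G2C, Gadd; simpl; rewrite plus_IZR; auto. Qed.

Lemma G2C_rot p : G2C (rot p) = (Ci * G2C p)%C.
Proof. apply C_eq; unfold G2C, rot; simpl; rewrite ?opp_IZR; ring. Qed.

Lemma qN_rot z p : qN z (rot p) = qN z p.
Proof. unfold qN, Gnorm, rot; cbn [fst snd]; do 6 f_equal; ring. Qed.

Lemma gam_neq_0 r : G2C (gam r) <> 0.
Proof.
  destruct r as [|[|[|[|r]]]]; intros E; injection E; intros; lra.
Qed.

(** Multiplying the index by i permutes the unordered sum, so the theta series is the mean of its
    four rotations, and [unit_average_psi] evaluates the averaged phases. *)
Lemma fk_usum k z : inH z -> usum (fun p => / 4 * Phi k p * qN z p)%C (fk k z).
Proof.
  intros Hz; pose proof (th2_usum k 0 0 (RtoC (beta1 k)) (RtoC (beta2 k)) (2 * z) (two_z_pos z Hz)) as U.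
  set (t := term2 k 0 0 (RtoC (beta1 k)) (RtoC (beta2 k)) (2 * z)) in *.
  set (l := th2 k 0 0 (RtoC (beta1 k)) (RtoC (beta2 k)) (2 * z)) in *.
  assert (Rot : forall f, usum f l -> usum (fun p => f (rot p)) l).
  { intros f Hf; apply (usum_bij rot (fun p => (snd p, - fst p)%Z) f l); auto;
      intros [x y]; unfold rot; simpl; f_equal; lia. }
  pose proof (Rot _ U) as U1; pose proof (Rot _ U1) as U2; pose proof (Rot _ U2) as U3; cbv beta in U1, U2, U3.
  pose proof (gam_neq_0 (k mod 4)) as NG.
  assert (F : fk k z = (/ (4 * G2C (gam (k mod 4))) * (l + (l + (l + l))))%C).
  { unfold fk, Th; fold l; replace (- (0 * beta1 k + 0 * beta2 k) / 2) with 0 by field; rewrite ex1_0; field; auto. }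
  rewrite F.
  eapply usum_ext; [|apply usum_scal; apply (usum_plus _ _ _ _ U (usum_plus _ _ _ _ U1 (usum_plus _ _ _ _ U2 U3)))].
  intros [x y]; cbv beta; unfold t.
  assert (E : forall p, term2 k 0 0 (RtoC (beta1 k)) (RtoC (beta2 k)) (2 * z) p =
     (G2C p ^ k * G2C (phase (k mod 4) p) * qN z p)%C) by (intros [? ?]; apply term2_qN).
  rewrite !E, !qN_rot, !G2C_rot, !Cpow_mult_l, !Ci_pow; unfold Phi.
  set (i := G2C (ipow (k mod 4))); set (A := (G2C (x, y) ^ k)%C); set (q := qN z (x, y)).
  transitivity (/ (4 * G2C (gam (k mod 4))) * (G2C (unit_average (k mod 4) (x, y)) * A * q))%C.
  { unfold unit_average; rewrite !G2C_add, !G2C_mul, !G2C_add, !G2C_mul, !G2C_add, !G2C_mul; fold i; ring. }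
  rewrite unit_average_psi, G2C_mul by apply mod4_lt; field; auto.
Qed.

Lemma qe_Cexp z : qe z = Cexp (RtoC (2 * PI) * Ci * z).
Proof.
  destruct z as [x y].
  replace (RtoC (2 * PI) * Ci * (x, y))%C with ((-2 * PI * y, 2 * PI * x) : C) by (apply C_eq; simpl; ring).
  apply C_eq; unfold qe, Cexp; simpl; ring.
Qed.

Lemma qe_pow z n : (qe z ^ n)%C = Cexp (RtoC (2 * PI * INR n) * Ci * z).
Proof. rewrite qe_Cexp, Cexp_pow; f_equal; rewrite !RtoC_mult; ring. Qed.

Fixpoint shells (n : nat) : list (Z * Z) :=
  match n with O => shell 0 | S m => shells m ++ shell (S m) end.

Lemma in_shells n p : In p (shells n) <-> (Gnorm p <= Z.of_nat n)%Z.
Proof.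
  assert (0 <= Gnorm p)%Z by (unfold Gnorm; nia).
  induction n as [|n IH]; cbn [shells]; [rewrite in_shell; lia|].
  rewrite in_app_iff, IH, in_shell; lia.
Qed.

Lemma shells_NoDup n : NoDup (shells n).
Proof.
  induction n as [|n IH]; cbn [shells]; [apply shell_NoDup|].
  apply NoDup_app; auto using shell_NoDup.
  intros p H1 H2; apply in_shells in H1; apply in_shell in H2; lia.
Qed.

Lemma lsum_shells k z n :
  sum_n (fun n => Cmult (coef k n) (Cpow (qe z) n)) n = lsum (fun p => / 4 * Phi k p * qN z p)%C (shells n).
Proof.
  assert (E : forall n, (coef k n * qe z ^ n)%C = lsum (fun p => / 4 * Phi k p * qN z p)%C (shell n)).
  { intros m; unfold coef; rewrite qe_pow.
    rewrite (lsum_ext_in (fun p => / 4 * Phi k p * qN z p)%C (fun p => (/ 4 * Cexp (RtoC (2 * PI * INR m) * Ci * z)) * Phi k p)%C).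
    - rewrite (lsum_scal _ (Phi k)); ring.
    - intros p Hp; apply in_shell in Hp; unfold qN; rewrite Hp, <- INR_IZR_INZ; ring. }
  induction n as [|n IH]; cbn [shells].
  - rewrite sum_O; apply E.
  - rewrite sum_Sn, IH, lsum_app, <- E; reflexivity.
Qed.

Lemma fk_qexp k : has_qexp (fk k) (coef k).
Proof.
  intros z Hz; apply filterlim_locally; intros eps.
  assert (X : forall p, exists n0, forall n, (n0 <= n)%nat -> In p (shells n))
    by (intros p; exists (Z.to_nat (Gnorm p)); intros n Hn; apply in_shells; lia).
  destruct (usum_exhaust _ _ shells shells_NoDup X (fk_usum k z Hz) eps (cond_pos eps)) as [n0 H].
  exists n0; intros n Hn; apply C_NormedModule_mixin_compat1; rewrite lsum_shells; apply H, Hn.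
Qed.

(** * Continuity of q-expansions *)

Lemma Cmod_qe z : Cmod (qe z) = exp (- 2 * PI * Im z).
Proof. rewrite qe_Cexp, Cmod_Cexp; f_equal; destruct z; simpl; ring. Qed.

(** The factor m on the left avoids the exponent n - 1. *)
Lemma Cpow_diff (q q' : C) m n : Cmod q <= m -> Cmod q' <= m ->
  m * Cmod (q' ^ n - q ^ n) <= INR n * m ^ n * Cmod (q' - q).
Proof.
  intros Hq Hq'; pose proof (Cmod_ge_0 q) as Pq; pose proof (Cmod_ge_0 q') as Pq'.
  induction n as [|n IH].
  - simpl; replace (1 - 1)%C with (RtoC 0) by ring; rewrite Cmod_0; lra.
  - rewrite !Cpow_S, S_INR.
    replace (q' * q' ^ n - q * q ^ n)%C with (q' * (q' ^ n - q ^ n) + (q' - q) * q ^ n)%C by ring.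
    apply Rle_trans with (m * (Cmod q' * Cmod (q' ^ n - q ^ n) + Cmod (q' - q) * Cmod q ^ n)).
    + apply Rmult_le_compat_l; [lra|]; eapply Rle_trans; [apply Cmod_triangle|]; rewrite !Cmod_mult, Cmod_pow; lra.
    + assert (A : Cmod q' * (m * Cmod (q' ^ n - q ^ n)) <= m * (INR n * m ^ n * Cmod (q' - q))).
      { apply Rmult_le_compat; auto; apply Rmult_le_pos; [lra|apply Cmod_ge_0]. }
      assert (B : Cmod (q' - q) * Cmod q ^ n <= Cmod (q' - q) * m ^ n).
      { apply Rmult_le_compat_l; [apply Cmod_ge_0|apply pow_incr; auto]. }
      assert (B' : m * (Cmod (q' - q) * Cmod q ^ n) <= m * (Cmod (q' - q) * m ^ n)) by (apply Rmult_le_compat_l; lra).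
      simpl; lra.
Qed.

(** n s^n is at most 1 + s + ... + s^(n-1). *)
Lemma n_pow_bound s n : 0 < s < 1 -> INR n * s ^ n <= / (1 - s).
Proof.
  intros Hs.
  assert (K : INR n * s ^ n * (1 - s) <= 1 - s ^ n).
  { induction n as [|n IH]; [simpl; lra|]; rewrite S_INR; simpl.
    pose proof (pow_le s n ltac:(lra)); pose proof (pos_INR n).
    assert (Q : s ^ n <= 1) by (rewrite <- (pow1 n); apply pow_incr; lra).
    assert (s * (INR n * s ^ n * (1 - s)) <= s * (1 - s ^ n)) by (apply Rmult_le_compat_l; lra).
    assert (0 <= (1 - s) * (1 - s * s ^ n)) by (apply Rmult_le_pos; nra).
    lra. }
  pose proof (pow_le s n ltac:(lra)).
  apply (Rmult_le_reg_r (1 - s)); [lra|]; rewrite Rinv_l by lra; lra.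
Qed.

Lemma geometric_bound s n : 0 < s < 1 -> sum_n (fun i => s ^ i) n <= / (1 - s).
Proof.
  intros Hs; apply (Rmult_le_reg_r (1 - s)); [lra|]; rewrite Rinv_l by lra.
  assert (K : sum_n (fun i => s ^ i) n * (1 - s) = 1 - s ^ S n).
  { induction n as [|n IH]; [rewrite sum_O; simpl; ring|].
    rewrite sum_Sn; change plus with Rplus; rewrite Rmult_plus_distr_r, IH; simpl; ring. }
  rewrite K; pose proof (pow_le s (S n) ltac:(lra)); lra.
Qed.

Lemma is_series_Cmod_lim (a : nat -> C) l : @is_series C_AbsRing C_NormedModule a l ->
  forall eps, 0 < eps -> exists n0, forall n, (n0 <= n)%nat -> Cmod (sum_n a n - l) < eps.
Proof.
  intros H eps He.
  assert (P : 0 < eps / 2) by lra.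
  destruct (proj1 (filterlim_locally _ _) H (mkposreal _ P)) as [n0 K].
  exists n0; intros n Hn; specialize (K n Hn).
  pose proof (C_NormedModule_mixin_compat2 _ _ _ K) as K2; simpl in K2.
  eapply Rlt_le_trans; [exact K2|].
  assert (sqrt 2 <= 2); [|nra].
  rewrite <- (sqrt_square 2) at 2 by lra; apply sqrt_le_1_alt; lra.
Qed.

(** Convergence at the single point i y0/2 bounds the numbers a_n q0^n, and on the smaller disc this
    gives a Lipschitz bound in q. Nothing else is assumed, so the lemma covers arbitrary
    oldforms. *)
Lemma qexp_lipschitz f a y0 : has_qexp f a -> 0 < y0 -> exists K, 0 <= K /\ forall z z', y0 <= Im z -> y0 <= Im z' ->
  Cmod (f z' - f z) <= K * Cmod (qe z' - qe z).
Proof.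
  intros H Hy; pose proof PI_RGT_0 as HP.
  assert (H0 : inH (0, y0 / 2)) by (unfold inH; simpl; lra).
  destruct (is_series_Cmod_lim _ _ (H _ H0) 1 Rlt_0_1) as [n0 C0].
  set (q0 := exp (- 2 * PI * (y0 / 2))); set (m := exp (- 2 * PI * y0)).
  (* In m = s s q0 one power s^n absorbs the factor n from the difference of n-th powers, and the
     other is summed geometrically. *)
  set (s := exp (- 2 * PI * (y0 / 4))).
  assert (Hs : 0 < s < 1) by (split; [apply exp_pos|unfold s; rewrite <- exp_0; apply exp_increasing; nra]).
  assert (Em : m = s * s * q0) by (unfold m, s, q0; rewrite <- !exp_plus; f_equal; field).
  assert (Pq : 0 < q0) by apply exp_pos. assert (Pm : 0 < m) by apply exp_pos.
  assert (Bd : exists B, 0 <= B /\ forall n, Cmod (a n) * q0 ^ n <= B).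
  { assert (T : forall n, (n0 < n)%nat -> Cmod (a n) * q0 ^ n <= 2).
    { intros n Hn; replace (Cmod (a n) * q0 ^ n) with (Cmod (a n * qe (0, y0 / 2) ^ n))
        by (rewrite Cmod_mult, Cmod_pow, Cmod_qe; reflexivity).
      destruct n as [|n]; [lia|].
      pose proof (C0 n ltac:(lia)) as X; pose proof (C0 (S n) ltac:(lia)) as Y.
      rewrite sum_Sn in Y; change plus with Cplus in Y.
      set (S := sum_n _ n) in *; set (l := f (0, y0 / 2)) in *.
      replace (a (Datatypes.S n) * qe (0%R, (y0 / 2)%R) ^ Datatypes.S n)%C with
        ((S + a (Datatypes.S n) * qe (0%R, (y0 / 2)%R) ^ Datatypes.S n - l) - (S - l))%C by ring.
      eapply Rle_trans; [apply Cmod_minus_triangle|lra]. }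
    assert (F : forall N, exists B, 0 <= B /\ forall n, (n <= N)%nat -> Cmod (a n) * q0 ^ n <= B).
    { induction N as [|N [B [HB IH]]].
      - exists (Cmod (a 0%nat) * q0 ^ 0); split; [apply Rmult_le_pos; [apply Cmod_ge_0|simpl; lra]|]; intros n Hn; replace n with 0%nat by lia; lra.
      - exists (Rmax B (Cmod (a (S N)) * q0 ^ S N)); split; [eapply Rle_trans; [apply HB|apply Rmax_l]|].
        intros n Hn; destruct (Nat.eq_dec n (S N)) as [->|]; [apply Rmax_r|].
        eapply Rle_trans; [apply IH; lia|apply Rmax_l]. }
    destruct (F n0) as [B [HB FB]]; exists (Rmax B 2); split; [eapply Rle_trans; [apply HB|apply Rmax_l]|].
    intros n; destruct (le_lt_dec n n0) as [L|L]; [eapply Rle_trans; [apply FB, L|apply Rmax_l]|eapply Rle_trans; [apply T, L|apply Rmax_r]]. }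
  destruct Bd as [B [HB Bd]].
  set (c := / (1 - s)); assert (Hc : 0 < c) by (apply Rinv_0_lt_compat; lra).
  exists (B * c * c / m); split; [apply Rdiv_le_0_compat; auto; repeat apply Rmult_le_pos; lra|].
  intros z z' Hz Hz'.
  assert (Q : forall w, y0 <= Im w -> Cmod (qe w) <= m) by (intros w Hw; rewrite Cmod_qe; apply exp_mono; nra).
  set (d := Cmod (qe z' - qe z)); assert (Hd : 0 <= d) by apply Cmod_ge_0.
  assert (PS : forall n, m * Cmod (sum_n (fun n => a n * qe z' ^ n)%C n - sum_n (fun n => a n * qe z ^ n)%C n) <= B * c * d * sum_n (fun i => s ^ i) n).
  { assert (T : forall n, m * Cmod (a n * qe z' ^ n - a n * qe z ^ n) <= B * c * d * s ^ n).
    { intros n; replace (a n * qe z' ^ n - a n * qe z ^ n)%C with (a n * (qe z' ^ n - qe z ^ n))%C by ring.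
      rewrite Cmod_mult.
      pose proof (Cpow_diff (qe z) (qe z') m n (Q z Hz) (Q z' Hz')) as D; fold d in D.
      apply Rle_trans with (Cmod (a n) * (INR n * m ^ n * d)).
      - rewrite <- Rmult_assoc, (Rmult_comm m), Rmult_assoc; apply Rmult_le_compat_l; [apply Cmod_ge_0|auto].
      - rewrite Em, !Rpow_mult_distr.
        replace (Cmod (a n) * (INR n * (s ^ n * s ^ n * q0 ^ n) * d)) with ((Cmod (a n) * q0 ^ n) * (INR n * s ^ n) * (d * s ^ n)) by ring.
        replace (B * c * d * s ^ n) with (B * c * (d * s ^ n)) by ring.
        pose proof (pow_le s n ltac:(lra)); pose proof (pow_le q0 n ltac:(lra)).
        apply Rmult_le_compat_r; [apply Rmult_le_pos; auto|].
        apply Rmult_le_compat; auto; [apply Rmult_le_pos; auto; apply Cmod_ge_0|apply Rmult_le_pos; auto; apply pos_INR|apply n_pow_bound, Hs]. }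
    induction n as [|n IH]; [rewrite !sum_O; apply T|].
    rewrite !sum_Sn; change plus with Cplus at 1 2; change plus with Rplus.
    set (S1 := sum_n _ n) in *; set (S2 := sum_n (fun n => a n * qe z ^ n)%C n) in *.
    replace (S1 + a (S n) * qe z' ^ S n - (S2 + a (S n) * qe z ^ S n))%C with
      ((S1 - S2) + (a (S n) * qe z' ^ S n - a (S n) * qe z ^ S n))%C by ring.
    eapply Rle_trans; [apply Rmult_le_compat_l; [lra|apply Cmod_triangle]|].
    specialize (T (S n)); rewrite !Rmult_plus_distr_l; apply Rplus_le_compat; auto. }
  assert (L : m * Cmod (f z' - f z) <= B * c * d * c).
  { apply Rnot_lt_le; intros X.
    set (e := (m * Cmod (f z' - f z) - B * c * d * c) / (2 * m)).
    assert (He : 0 < e) by (unfold e; apply Rdiv_lt_0_compat; lra).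
    assert (hz : inH z) by (unfold inH; lra). assert (hz' : inH z') by (unfold inH; lra).
    destruct (is_series_Cmod_lim _ _ (H _ hz) (e / 2)) as [n1 C1]; [lra|].
    destruct (is_series_Cmod_lim _ _ (H _ hz') (e / 2)) as [n2 C2]; [lra|].
    specialize (C1 (n1 + n2)%nat ltac:(lia)); specialize (C2 (n1 + n2)%nat ltac:(lia)); specialize (PS (n1 + n2)%nat).
    set (S1 := sum_n _ _) in C1; set (S2 := sum_n _ _) in C2.
    change (sum_n (fun n => a n * qe z' ^ n)%C (n1 + n2)) with S2 in PS.
    change (sum_n (fun n => a n * qe z ^ n)%C (n1 + n2)) with S1 in PS.
    assert (G : B * c * d * sum_n (fun i => s ^ i) (n1 + n2) <= B * c * d * c).
    { apply Rmult_le_compat_l; [repeat apply Rmult_le_pos; lra|apply geometric_bound, Hs]. }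
    assert (T : Cmod (f z' - f z) <= Cmod (S2 - S1) + (Cmod (S2 - f z') + Cmod (S1 - f z))).
    { replace (f z' - f z)%C with ((S2 - S1) + (- (S2 - f z') + (S1 - f z)))%C by ring.
      eapply Rle_trans; [apply Cmod_triangle|]; apply Rplus_le_compat_l.
      eapply Rle_trans; [apply Cmod_triangle|]; rewrite Cmod_opp; lra. }
    assert (Cmod (f z' - f z) <= Cmod (S2 - S1) + e) by lra.
    assert (m * Cmod (f z' - f z) <= m * Cmod (S2 - S1) + m * e) by (rewrite <- Rmult_plus_distr_l; apply Rmult_le_compat_l; lra).
    assert (E2 : m * e = (m * Cmod (f z' - f z) - B * c * d * c) / 2) by (unfold e; field; lra).
    lra. }
  apply (Rmult_le_reg_l m); auto; replace (m * (B * c * c / m * d)) with (B * c * d * c) by (field; lra); auto.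
Qed.

Lemma continuity_2d_Re_Im_eps (F : R -> R -> C) x y :
  (forall eps, 0 < eps -> exists d, 0 < d /\ forall u v, Rabs (u - x) < d -> Rabs (v - y) < d -> Cmod (F u v - F x y) < eps) ->
  continuity_2d_pt (fun u v => Re (F u v)) x y /\ continuity_2d_pt (fun u v => Im (F u v)) x y.
Proof.
  intros H; split; intros eps; destruct (H eps (cond_pos eps)) as [d [Hd K]]; exists (mkposreal d Hd);
    intros u v Hu Hv; eapply Rle_lt_trans; [|apply (K u v Hu Hv)| |apply (K u v Hu Hv)].
  - apply (re_le_Cmod (F u v - F x y)).
  - apply (im_le_Cmod (F u v - F x y)).
Qed.

Lemma qexp_continuous f a x y : has_qexp f a -> 0 < y ->
  continuity_2d_pt (fun u v => Re (f (u, v))) x y /\ continuity_2d_pt (fun u v => Im (f (u, v))) x y.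
Proof.
  intros H Hy; destruct (qexp_lipschitz f a (y / 2) H ltac:(lra)) as [K [HK L]].
  apply (continuity_2d_Re_Im_eps (fun u v => f (u, v))); intros eps He.
  assert (E1 : continuity_2d_pt (fun u v => exp (- 2 * PI * v)) x y).
  { apply (continuity_1d_2d_pt_comp (fun v => exp (- 2 * PI * v)) (fun _ v => v)); [|apply continuity_2d_pt_id2].
    apply continuity_pt_filterlim, (ex_derive_continuous (K := R_AbsRing) (V := R_NormedModule) (fun v => exp (- 2 * PI * v))); auto_derive; auto. }
  assert (C1 : continuity_2d_pt (fun u v => cos (2 * PI * u)) x y).
  { apply (continuity_1d_2d_pt_comp (fun v => cos (2 * PI * v)) (fun u _ => u)); [|apply continuity_2d_pt_id1].
    apply continuity_pt_filterlim, (ex_derive_continuous (K := R_AbsRing) (V := R_NormedModule) (fun v => cos (2 * PI * v))); auto_derive; auto. }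
  assert (S1 : continuity_2d_pt (fun u v => sin (2 * PI * u)) x y).
  { apply (continuity_1d_2d_pt_comp (fun v => sin (2 * PI * v)) (fun u _ => u)); [|apply continuity_2d_pt_id1].
    apply continuity_pt_filterlim, (ex_derive_continuous (K := R_AbsRing) (V := R_NormedModule) (fun v => sin (2 * PI * v))); auto_derive; auto. }
  assert (Pe : 0 < eps / (2 * (K + 1))) by (apply Rdiv_lt_0_compat; lra).
  destruct (continuity_2d_pt_mult _ _ _ _ E1 C1 (mkposreal _ Pe)) as [d1 D1].
  destruct (continuity_2d_pt_mult _ _ _ _ E1 S1 (mkposreal _ Pe)) as [d2 D2].
  exists (Rmin (y / 2) (Rmin d1 d2)); split; [repeat apply Rmin_pos; try lra; apply cond_pos|].
  intros u v Hu Hv.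
  assert (Hv1 : Rabs (v - y) < y / 2) by (eapply Rlt_le_trans; [apply Hv|apply Rmin_l]).
  assert (Hu2 : Rabs (u - x) < Rmin d1 d2) by (eapply Rlt_le_trans; [apply Hu|apply Rmin_r]).
  assert (Hv2 : Rabs (v - y) < Rmin d1 d2) by (eapply Rlt_le_trans; [apply Hv|apply Rmin_r]).
  specialize (D1 u v ltac:(eapply Rlt_le_trans; [apply Hu2|apply Rmin_l]) ltac:(eapply Rlt_le_trans; [apply Hv2|apply Rmin_l])).
  specialize (D2 u v ltac:(eapply Rlt_le_trans; [apply Hu2|apply Rmin_r]) ltac:(eapply Rlt_le_trans; [apply Hv2|apply Rmin_r])).
  simpl in D1, D2; apply Rabs_def2 in Hv1.
  eapply Rle_lt_trans; [apply L; simpl; lra|].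
  assert (Q : Cmod (qe (u, v) - qe (x, y)) < eps / (K + 1)).
  { eapply Rle_lt_trans; [apply Cmod_le_sum|].
    replace (eps / (K + 1)) with (eps / (2 * (K + 1)) + eps / (2 * (K + 1))) by (field; lra).
    apply Rplus_lt_compat.
    - eapply Rle_lt_trans; [|apply D1]; right; f_equal; unfold qe; simpl; ring.
    - eapply Rle_lt_trans; [|apply D2]; right; f_equal; unfold qe; simpl; ring. }
  apply Rle_lt_trans with (K * (eps / (K + 1))); [apply Rmult_le_compat_l; lra|].
  apply Rlt_le_trans with ((K + 1) * (eps / (K + 1))); [|right; field; lra].
  apply Rmult_lt_compat_r; [apply Rdiv_lt_0_compat; lra|lra].
Qed.

(** * Characters and complex multiplication *)

Definition chiZ (n : Z) : Z := if Z.odd n then sgn4 n else 0%Z.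

Lemma chi_m4_Z n : chi_m4 n = RtoC (IZR (chiZ n)).
Proof. unfold chi_m4, chiZ, sgn4; destruct (Z.odd n); auto; destruct (n mod 4 =? 1)%Z; auto. Qed.

Lemma chiZ_mod n : chiZ n = chiZ (n mod 4)%Z.
Proof. unfold chiZ, sgn4; rewrite odd_mod4, Zmod_mod; auto. Qed.

Lemma chiZ_mul m n : chiZ (m * n) = (chiZ m * chiZ n)%Z.
Proof.
  assert (K : forallb (fun x => forallb (fun y => Z.eqb (chiZ (x * y)) (chiZ x * chiZ y)) z4) z4 = true) by (vm_compute; reflexivity).
  rewrite forallb_forall in K; specialize (K (m mod 4)%Z (in_z4 m)).
  rewrite forallb_forall in K; specialize (K (n mod 4)%Z (in_z4 n)); apply Z.eqb_eq in K.
  rewrite (chiZ_mod m), (chiZ_mod n), <- K, chiZ_mod, (chiZ_mod (_ * _)), <- Zmult_mod; auto.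
Qed.

Lemma gcd_pow2_even n m : Z.odd n = false -> (1 <= m)%nat -> Z.gcd n (2 ^ Z.of_nat m) <> 1%Z.
Proof.
  intros H Hm E.
  assert (K : (2 | Z.gcd n (2 ^ Z.of_nat m))%Z).
  { apply Z.gcd_greatest.
    - rewrite <- Z.negb_even in H; apply negb_false_iff, Z.even_spec in H; destruct H as [e ->]; exists e; ring.
    - exists (2 ^ (Z.of_nat m - 1))%Z; rewrite Z.mul_comm, <- Z.pow_succ_r by lia; f_equal; lia. }
  rewrite E in K; apply Z.divide_1_r in K; lia.
Qed.

Lemma dirichlet_chi_m4 m : (2 <= m)%nat -> dirichlet_char (2 ^ Z.of_nat m) chi_m4.
Proof.
  intros Hm; repeat split.
  - apply Z.pow_pos_nonneg; lia.
  - intros n; replace (2 ^ Z.of_nat m)%Z with (4 * 2 ^ (Z.of_nat m - 2))%Z; [apply chi_m4_mod|].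
    replace (Z.of_nat m) with (2 + (Z.of_nat m - 2))%Z at 2 by lia; rewrite Z.pow_add_r by lia; reflexivity.
  - intros; rewrite !chi_m4_Z, chiZ_mul, mult_IZR, RtoC_mult; auto.
  - intros E C; destruct (Z.odd n) eqn:O; [|revert C; apply gcd_pow2_even; auto; lia].
    rewrite chi_m4_odd in E by auto; injection E; unfold sgn4; destruct (n mod 4 =? 1)%Z; lra.
  - intros C; destruct (Z.odd n) eqn:O; [|unfold chi_m4; rewrite O; auto].
    exfalso; apply C, gcd_pow2_odd, O.
Qed.

Lemma triv_char_32 n : triv_char 32 n = if Z.odd n then RtoC 1 else RtoC 0.
Proof.
  destruct (Z.odd n) eqn:O; [apply triv_char_odd, O|].
  unfold triv_char; destruct (Z.eqb_spec (Z.gcd n 32) 1) as [E|]; auto.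
  exfalso; revert E; apply (gcd_pow2_even n 5); auto; lia.
Qed.

Lemma dirichlet_triv_32 : dirichlet_char 32 (triv_char 32).
Proof.
  split; [lia|]; repeat split.
  - intros n; rewrite !triv_char_32, Z.odd_add; destruct (Z.odd n); auto.
  - intros; rewrite !triv_char_32, Z.odd_mul; destruct (Z.odd m), (Z.odd n); simpl; ring.
  - rewrite triv_char_32; destruct (Z.odd n) eqn:O; [intros E; injection E; lra|].
    intros _; apply (gcd_pow2_even n 5); auto; lia.
  - intros C; rewrite triv_char_32; destruct (Z.odd n) eqn:O; auto; exfalso; apply C, (gcd_pow2_odd n 5), O.
Qed.

Definition levexp (k : nat) : nat := match (k mod 4)%nat with O => 2 | S (S O) => 4 | _ => 5 end.
Definition lev (k : nat) : Z := (2 ^ Z.of_nat (levexp k))%Z.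

Lemma level_lev k : level_k (S k) = lev k.
Proof.
  unfold level_k, lev, levexp; rewrite even_S_mod4.
  rewrite <- (Nat.add_1_l k), Nat.Div0.add_mod.
  pose proof (mod4_lt k); destruct (k mod 4)%nat as [|[|[|[|?]]]]; [| | | |lia]; reflexivity.
Qed.

Lemma dirichlet_chik k : dirichlet_char (lev k) (chik k).
Proof.
  unfold lev, levexp, chik, char_k; rewrite even_S_mod4.
  pose proof (mod4_lt k); destruct (k mod 4)%nat as [|[|[|[|?]]]]; [| | | |lia];
    solve [apply dirichlet_chi_m4; lia | apply dirichlet_triv_32].
Qed.

(** * Infinitude of primes and density one *)

Lemma prime_divisor n : (2 <= n)%Z -> exists p, prime p /\ (p | n)%Z.
Proof.
  intros Hn; assert (P : (0 <= n)%Z) by lia; revert Hn; pattern n; apply Z_lt_induction; auto; clear n P.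
  intros n IH Hn; destruct (prime_dec n) as [Hp|Hp]; [exists n; split; auto; apply Z.divide_refl|].
  destruct (not_prime_divide n ltac:(lia) Hp) as [m [Hm D]].
  destruct (IH m ltac:(lia) ltac:(lia)) as [p [Pp Dp]]; exists p; split; auto; eapply Z.divide_trans; eauto.
Qed.

Lemma divide_fact p n : (1 <= p <= n)%nat -> (Z.of_nat p | Z.of_nat (fact n))%Z.
Proof.
  induction n as [|n IH]; [lia|]; intros H; rewrite fact_simpl, Nat2Z.inj_mul.
  destruct (Nat.eq_dec p (S n)) as [->|]; [apply Z.divide_mul_l, Z.divide_refl|apply Z.divide_mul_r, IH; lia].
Qed.

Lemma primes_unbounded n : exists p, (n < p)%nat /\ prime (Z.of_nat p).
Proof.
  destruct (prime_divisor (Z.of_nat (fact n) + 1)) as [p [Pp Dp]]; [pose proof (lt_O_fact n); lia|].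
  pose proof (prime_ge_2 p Pp); exists (Z.to_nat p); rewrite Z2Nat.id by lia; split; auto.
  apply Nat.nle_gt; intros L.
  assert (K : (p | 1)%Z); [|apply Z.divide_1_r in K; lia].
  replace 1%Z with (Z.of_nat (fact n) + 1 - Z.of_nat (fact n))%Z by ring; apply Z.divide_sub_r; auto.
  rewrite <- (Z2Nat.id p) by lia; apply divide_fact; lia.
Qed.

Lemma ind_bounds P : 0 <= Defs.ind P <= 1.
Proof. unfold Defs.ind; destruct (excluded_middle_informative P); lra. Qed.

Lemma ind_true (P : Prop) : P -> Defs.ind P = 1.
Proof. intros H; unfold Defs.ind; destruct (excluded_middle_informative P); tauto. Qed.

Lemma ind_false (P : Prop) : ~ P -> Defs.ind P = 0.
Proof. intros H; unfold Defs.ind; destruct (excluded_middle_informative P); tauto. Qed.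

Lemma count_primes_mono P m n : (m <= n)%nat -> count_primes P m <= count_primes P n.
Proof. induction 1; [lra|]; cbn [count_primes]; pose proof (ind_bounds (prime (Z.of_nat (S m0)) /\ P (S m0))); lra. Qed.

Lemma count_primes_unbounded M : exists n, INR M <= count_primes (fun _ => True) n.
Proof.
  induction M as [|M [n IH]]; [exists 0%nat; simpl; lra|].
  destruct (primes_unbounded n) as [p [Hp Pp]]; exists p; rewrite S_INR.
  destruct p as [|p]; [lia|]; cbn [count_primes]; rewrite ind_true by auto.
  pose proof (count_primes_mono (fun _ => True) n p ltac:(lia)); lra.
Qed.

(** The two counting functions differ by at most 1 and the denominator is unbounded. *)
Lemma density_one_except_2 P : (forall p, prime (Z.of_nat p) -> p <> 2%nat -> P p) -> density_one P.
Proof.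
  intros H; apply is_lim_seq_spec; intros eps.
  assert (B : forall x, count_primes (fun _ => True) x - 1 <= count_primes P x <= count_primes (fun _ => True) x).
  { assert (K : forall x, count_primes (fun _ => True) x - (if Nat.leb 2 x then 1 else 0) <= count_primes P x <= count_primes (fun _ => True) x).
    { induction x as [|x IH]; [simpl; lra|]; cbn [count_primes].
      destruct (excluded_middle_informative (prime (Z.of_nat (S x)))) as [Pr|Pr].
      - rewrite (ind_true (prime (Z.of_nat (S x)) /\ True)) by auto.
        pose proof (ind_bounds (prime (Z.of_nat (S x)) /\ P (S x))).
        destruct (Nat.eq_dec (S x) 2) as [E|E].
        + replace x with 1%nat in * by lia; simpl Nat.leb in *; lra.
        + rewrite (ind_true (prime (Z.of_nat (S x)) /\ P (S x))) by auto.
          destruct (Nat.leb 2 x) eqn:E1; [rewrite (proj2 (Nat.leb_le 2 (S x))) by (apply Nat.leb_le in E1; lia); lra|].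
          destruct (Nat.leb 2 (S x)); lra.
      - rewrite !ind_false by tauto.
        destruct (Nat.leb 2 x) eqn:E1; [rewrite (proj2 (Nat.leb_le 2 (S x))) by (apply Nat.leb_le in E1; lia); lra|].
        destruct (Nat.leb 2 (S x)); lra. }
    intros x; specialize (K x); destruct (Nat.leb 2 x); lra. }
  pose proof (cond_pos eps) as He.
  destruct (archimed (/ eps)) as [A _].
  destruct (count_primes_unbounded (S (Z.to_nat (up (/ eps))))) as [n Hn].
  assert (I : / eps < INR (S (Z.to_nat (up (/ eps))))).
  { rewrite S_INR, INR_IZR_INZ, Z2Nat.id; [lra|]. apply le_IZR. pose proof (Rinv_0_lt_compat _ He); lra. }
  exists n; intros m Hm.
  pose proof (count_primes_mono (fun _ => True) n m Hm) as Mm; specialize (B m).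
  set (T := count_primes (fun _ => True) m) in *.
  pose proof (Rinv_0_lt_compat _ He).
  assert (PT : 0 < T) by lra.
  replace (count_primes P m / T - 1) with (- ((T - count_primes P m) / T)) by (field; lra).
  rewrite Rabs_Ropp, Rabs_pos_eq by (apply Rdiv_le_0_compat; lra).
  apply Rlt_div_l; auto.
  apply Rle_lt_trans with 1; [lra|].
  replace 1 with (eps * / eps) by (field; lra); apply Rmult_lt_compat_l; lra.
Qed.

(** The character is that of Q(i); 2 is the only prime where the relation may fail. *)
Lemma coef_has_CM k : has_CM (coef k).
Proof.
  exists 4%Z, (fun n => IZR (chiZ n)); split; [|split].
  - assert (D := dirichlet_chi_m4 2 (le_n 2)); change (2 ^ Z.of_nat 2)%Z with 4%Z in D.
    destruct D as [D1 [D2 [D3 [D4 D5]]]]; repeat split; auto.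
    + intros n; rewrite <- !chi_m4_Z; auto.
    + intros m n; rewrite <- !chi_m4_Z; auto.
    + rewrite <- chi_m4_Z; apply D5.
    + rewrite <- chi_m4_Z; apply D5.
  - exists 3%Z; split; [reflexivity|]; unfold chiZ, sgn4; simpl; lra.
  - apply density_one_except_2; intros p Hp H2.
    destruct (odd_prime_mod4 p Hp H2) as [H1|H3].
    + unfold chiZ, sgn4; rewrite (prime_odd p Hp H2), (mod4_Z p 1 H1); simpl; ring.
    + rewrite (coef_p_3_mod_4 k p Hp H3); ring.
Qed.

(** * Modularity *)

Definition sgnp (n : Z) : R := if Z.even n then 1 else -1.

Lemma ex1_half_odd c d : Z.odd d = true -> ex1 (- (IZR c * IZR d) / 2) = RtoC (sgnp c).
Proof.
  intros Hd; rewrite <- mult_IZR, <- opp_IZR.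
  replace (IZR (- (c * d)) / 2) with (IZR (2 * - (c * d)) / 4) by (rewrite mult_IZR; field).
  rewrite ex1_quarter; unfold sgnp.
  apply Z.odd_spec in Hd; destruct Hd as [e ->].
  destruct (Z.even c) eqn:Ev.
  - apply Z.even_spec in Ev; destruct Ev as [m ->].
    replace (2 * - (2 * m * (2 * e + 1)))%Z with (0 + (- (m * (2 * e + 1))) * 4)%Z by ring; rewrite Z.mod_add by lia; reflexivity.
  - rewrite <- Z.negb_odd in Ev; apply negb_false_iff, Z.odd_spec in Ev; destruct Ev as [m ->].
    replace (2 * - ((2 * m + 1) * (2 * e + 1)))%Z with (2 + (- (2 * m * e + m + e + 1)) * 4)%Z by ring; rewrite Z.mod_add by lia; reflexivity.
Qed.

Lemma det_odd a b c d : (a * d - b * c = 1)%Z -> (2 | c)%Z -> Z.odd d = true.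
Proof.
  intros D [e ->]; destruct (Z.odd d) eqn:O; auto; exfalso.
  rewrite <- Z.negb_even in O; apply negb_false_iff, Z.even_spec in O; destruct O as [f ->]; lia.
Qed.

Definition halflev (k : nat) : Z := (2 ^ (Z.of_nat (levexp k) - 1))%Z.

(** The lower left entry moves the first characteristic by a lattice vector, whose phase gives the
    sign (-1)^c, while d beta is beta or -beta modulo the lattice. For even c this is modularity;
    for odd c it is the antisymmetry used for newness. *)
Lemma fk_half_level k a b c d z : (k mod 4 <> 0)%nat -> (a * d - b * (halflev k * c) = 1)%Z -> inH z ->
  fk k (mob a b (halflev k * c) d z) = (chik k d * RtoC (sgnp c) * den (halflev k * c) d z ^ S k * fk k z)%C.
Proof.
  intros Hk D Hz.
  assert (E8 : (halflev k = 8 \/ halflev k = 16)%Z).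
  { unfold halflev, levexp; pose proof (mod4_lt k); destruct (k mod 4)%nat as [|[|[|[|?]]]]; [lia| | | |lia]; simpl; auto. }
  assert (D4 : (4 | halflev k * c)%Z) by (destruct E8 as [-> | ->]; [exists (2 * c)%Z|exists (4 * c)%Z]; ring).
  assert (Od : Z.odd d = true) by (eapply det_odd; [apply D|]; eapply Z.divide_trans; [|apply D4]; exists 2%Z; auto).
  unfold fk; rewrite Th_Gamma0_4 by auto.
  set (G := G2C _); set (dn := (den _ _ _ ^ S k)%C).
  pose proof (two_z_pos z Hz) as Hw.
  assert (Core : (chi_m4 d * Th k (IZR (halflev k * c) / 2 * beta1 k) (IZR (halflev k * c) / 2 * beta2 k) (IZR d * beta1 k) (IZR d * beta2 k) (2 * z)
     = chik k d * RtoC (sgnp c) * Th k 0 0 (beta1 k) (beta2 k) (2 * z))%C).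
  { rewrite chik_odd by auto; rewrite chi_m4_odd by auto.
    pose proof Od as Od'; apply Z.odd_spec in Od'; destruct Od' as [e He].
    unfold halflev, levexp, beta1, beta2 in *; pose proof (mod4_lt k).
    assert (Rodd : (k mod 4 = 1 \/ k mod 4 = 3)%nat ->
      (RtoC (IZR (sgn4 d)) * Th k (IZR (16 * c) / 2 * / 4) (IZR (16 * c) / 2 * / 4) (IZR d * / 4) (IZR d * / 4) (2 * z)
       = RtoC (sgnp c) * Th k 0 0 (/ 4) (/ 4) (2 * z))%C).
    { intros Hodd.
      replace (IZR (16 * c) / 2 * / 4) with (0 + IZR (2 * c)) by (rewrite !mult_IZR; field).
      rewrite Th_lattice_a by auto.
      replace (- (IZR (2 * c) * (IZR d * / 4) + IZR (2 * c) * (IZR d * / 4)) / 2) with (- (IZR c * IZR d) / 2) by (rewrite !mult_IZR; field).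
      rewrite ex1_half_odd by auto.
      destruct (Z.Even_or_Odd e) as [[q Hq]|[q Hq]].
      - replace (IZR d * / 4) with (/ 4 + IZR q) by (rewrite He, Hq, plus_IZR, !mult_IZR; field).
        rewrite Th_lattice_b by auto.
        replace (sgn4 d) with 1%Z; [ring|]; unfold sgn4; rewrite He, Hq; replace (2 * (2 * q) + 1)%Z with (1 + q * 4)%Z by ring; rewrite Z.mod_add by lia; auto.
      (* For d congruent to 3 modulo 4, d beta is -beta modulo the lattice, and the sign (-1)^k = -1
         of [Th_neg] cancels chi(d) = -1. *)
      - replace (IZR d * / 4) with (- / 4 + IZR (q + 1)) by (rewrite He, Hq, !plus_IZR, !mult_IZR, !plus_IZR, !mult_IZR; field).
        rewrite Th_lattice_b by auto.
        pose proof (Th_neg k 0 0 (/ 4) (/ 4) (2 * z) Hw) as N; rewrite Ropp_0 in N; rewrite N.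
        replace (sgn4 d) with (-1)%Z.
        2:{ unfold sgn4; rewrite He, Hq; replace (2 * (2 * q + 1) + 1)%Z with (3 + q * 4)%Z by ring; rewrite Z.mod_add by lia; auto. }
        assert (Sg : ((- (1)) ^ k = - (1))%C).
        { rewrite (Nat.div_mod_eq k 4), Cpow_add_r, Cpow_mult_r.
          replace ((- (1)) ^ 4)%C with (RtoC 1) by (simpl; ring); rewrite Cpow_1_l.
          destruct Hodd as [-> | ->]; simpl; ring. }
        rewrite Sg; replace (RtoC (IZR (-1))) with (- (1))%C by (apply C_eq; simpl; ring); ring. }
    destruct (k mod 4)%nat as [|[|[|[|?]]]] eqn:Ek; [lia| | | |lia].
    - change (2 ^ (Z.of_nat 5 - 1))%Z with 16%Z; rewrite Rodd by auto; ring.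
    - change (2 ^ (Z.of_nat 4 - 1))%Z with 8%Z.
      replace (IZR (8 * c) / 2 * 0) with (0 + IZR 0) by ring.
      replace (IZR (8 * c) / 2 * / 2) with (0 + IZR (2 * c)) by (rewrite !mult_IZR; field).
      rewrite Th_lattice_a by auto.
      replace (- (0 * (IZR d * 0) + IZR (2 * c) * (IZR d * / 2)) / 2) with (- (IZR c * IZR d) / 2) by (rewrite !mult_IZR; field).
      rewrite ex1_half_odd by auto.
      replace (IZR d * 0) with (0 + IZR 0) by ring.
      replace (IZR d * / 2) with (/ 2 + IZR e) by (rewrite He, plus_IZR, mult_IZR; field).
      rewrite Th_lattice_b by auto; ring.
    - change (2 ^ (Z.of_nat 5 - 1))%Z with 16%Z; rewrite Rodd by auto; ring. }
  transitivity (dn / G * (chi_m4 d * Th k (IZR (halflev k * c) / 2 * beta1 k) (IZR (halflev k * c) / 2 * beta2 k) (IZR d * beta1 k) (IZR d * beta2 k) (2 * z)))%C;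
    [unfold Cdiv; ring|].
  rewrite Core; unfold Cdiv; ring.
Qed.

Lemma lev_half k : lev k = (2 * halflev k)%Z.
Proof.
  unfold lev, halflev; rewrite <- Z.pow_succ_r; [f_equal; lia|].
  unfold levexp; pose proof (mod4_lt k); destruct (k mod 4)%nat as [|[|[|[|?]]]]; lia.
Qed.

Lemma fk_modular k a b c d z : (a * d - b * c = 1)%Z -> (lev k | c)%Z -> inH z ->
  fk k (mob a b c d z) = (chik k d * (den c d z ^ S k * fk k z))%C.
Proof.
  intros D [q Hq] Hz.
  destruct (Nat.eq_dec (k mod 4) 0) as [E|E].
  - assert (D4 : (4 | c)%Z) by (exists q; rewrite Hq; unfold lev, levexp; rewrite E; reflexivity).
    assert (Od : Z.odd d = true) by (eapply det_odd; [apply D|]; eapply Z.divide_trans; [|apply D4]; exists 2%Z; auto).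
    unfold fk; rewrite Th_Gamma0_4 by auto; rewrite chik_odd, chi_m4_odd by auto; unfold beta1, beta2; rewrite E.
    rewrite !Rmult_0_r; unfold Cdiv; ring.
  - assert (Ec : c = (halflev k * (2 * q))%Z) by (rewrite Hq, lev_half; ring).
    rewrite Ec in *; rewrite fk_half_level by auto.
    unfold sgnp; rewrite Z.even_mul; simpl; ring.
Qed.

(** * Coset representatives and cusps *)

Definition zlist (n : nat) : list Z := map Z.of_nat (seq 0 n).

Definition mat : Type := (Z * Z * Z * Z)%type.

Definition mobt (g : mat) (z : C) : C := let '(a, b, c, d) := g in mob a b c d z.
Definition det1 (g : mat) : Prop := let '(a, b, c, d) := g in (a * d - b * c = 1)%Z.
Definition dent (g : mat) (z : C) : C := let '(_, _, c, d) := g in den c d z.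

Definition listU (n : nat) : list mat := map (fun j => (1, 0, 2 * j, 1)%Z) (zlist n).
Definition listS (n : nat) : list mat := map (fun m => (0, -1, 1, m)%Z) (zlist n).
(** For N = 2n a power of 2, the bottom rows (2j : 1) and (1 : m) run through the projective line
    over Z/N, where one coordinate is always a unit. *)
Definition reps (n : nat) : list mat := listU n ++ listS (n + n).

Definition coset_idx (N r s : Z) (L : list mat) : list nat :=
  filter (fun j => let '(_, _, c, d) := nth j L (0, 0, 0, 0)%Z in Z.eqb ((r * d - s * c) mod N) 0) (seq 0 (length L)).

Definition coset_check (N : Z) (L : list mat) : bool :=
  forallb (fun g => let '(a, b, c, d) := g in Z.eqb (a * d - b * c) 1) L &&
  forallb (fun r => forallb (fun s => (Z.even r && Z.even s) || Nat.eqb (length (coset_idx N r s L)) 1)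
    (zlist (Z.to_nat N))) (zlist (Z.to_nat N)).

Lemma in_zlist n x : In x (zlist n) <-> (0 <= x < Z.of_nat n)%Z.
Proof.
  unfold zlist; rewrite in_map_iff; split.
  - intros [y [<- Hy]]; apply in_seq in Hy; lia.
  - intros H; exists (Z.to_nat x); split; [lia|apply in_seq; lia].
Qed.

(** Membership depends on the bottom row modulo N only; the check skips pairs of even residues,
    which determinant 1 excludes. *)
Lemma coset_check_sound N L : (0 < N)%Z -> (2 | N)%Z -> coset_check N L = true -> coset_reps N L.
Proof.
  intros HN [h Hh] H; apply andb_true_iff in H; destruct H as [H1 H2]; split.
  - intros g Hg; rewrite forallb_forall in H1; specialize (H1 g Hg); destruct g as [[[a b] c] d]; apply Z.eqb_eq, H1.
  - intros p q r s D.
    pose proof (Z.mod_pos_bound r N HN) as Br; pose proof (Z.mod_pos_bound s N HN) as Bs.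
    rewrite forallb_forall in H2; specialize (H2 (r mod N)%Z ltac:(apply in_zlist; lia)).
    rewrite forallb_forall in H2; specialize (H2 (s mod N)%Z ltac:(apply in_zlist; lia)).
    apply orb_true_iff in H2; destruct H2 as [H2|H2].
    { exfalso; apply andb_true_iff in H2; destruct H2 as [Er Es].
      apply Z.even_spec in Er; apply Z.even_spec in Es; destruct Er as [er Er], Es as [es Es].
      pose proof (Z.div_mod r N ltac:(lia)) as Dr; pose proof (Z.div_mod s N ltac:(lia)) as Ds.
      rewrite Er in Dr; rewrite Es in Ds; rewrite Hh in Dr at 1; rewrite Hh in Ds at 1.
      set (u := (r / N)%Z) in Dr; set (v := (s / N)%Z) in Ds; clearbody u v.
      assert (K : (2 * (p * (h * v + es) - q * (h * u + er)) = 1)%Z); [|lia].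
      transitivity (p * s - q * r)%Z; [rewrite Dr, Ds; ring|exact D]. }
    apply Nat.eqb_eq in H2.
    assert (M : forall c d, ((r mod N * d - s mod N * c) mod N = (r * d - s * c) mod N)%Z).
    { intros c d; rewrite Zminus_mod, Zmult_mod_idemp_l, Zmult_mod_idemp_l, <- Zminus_mod; auto. }
    remember (coset_idx N (r mod N) (s mod N) L) as idx eqn:Ei.
    destruct idx as [|i [|]]; try discriminate.
    assert (X : forall j, (j < length L)%nat -> (let '(_, _, c, d) := nth j L (0, 0, 0, 0)%Z in (N | r * d - s * c)%Z) <-> In j [i]).
    { intros j Hj; rewrite Ei; unfold coset_idx; rewrite filter_In.
      destruct (nth j L (0, 0, 0, 0)%Z) as [[[a b] c] d]; rewrite Z.eqb_eq, M, Z.mod_divide by lia.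
      split; [intros K; split; auto; apply in_seq; lia|tauto]. }
    exists i; split.
    + assert (K : In i (coset_idx N (r mod N) (s mod N) L)) by (rewrite <- Ei; now left).
      apply filter_In in K; destruct K as [K _]; apply in_seq in K; apply K.
    + intros j Hj; rewrite X by auto; simpl; split; [intros [E|[]]; auto|auto].
Qed.

Lemma reps_cosets k : coset_reps (lev k) (reps (Z.to_nat (halflev k))).
Proof.
  unfold lev, halflev, levexp; pose proof (mod4_lt k).
  destruct (k mod 4)%nat as [|[|[|[|?]]]]; [| | | |lia]; (apply coset_check_sound; [reflexivity|apply Z.mod_divide; [discriminate|reflexivity]|vm_compute; reflexivity]).
Qed.

Lemma mobt_inH g z : det1 g -> inH z -> inH (mobt g z).
Proof. destruct g as [[[a b] c] d]; apply mob_inH. Qed.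

Lemma dent_neq_0 g z : det1 g -> inH z -> dent g z <> 0.
Proof. destruct g as [[[a b] c] d]; intros D Hz; apply den_neq_0; auto; eapply det_neq_0; eauto. Qed.

(** The product of g with the inverse of g', for determinant 1. *)
Definition quot (g g' : mat) : mat :=
  let '(a, b, c, d) := g in let '(a', b', c', d') := g' in
  (a * d' - b * c', - a * b' + b * a', c * d' - d * c', - c * b' + d * a')%Z.

Lemma quot_det g g' : det1 g -> det1 g' -> det1 (quot g g').
Proof.
  destruct g as [[[a b] c] d], g' as [[[a' b'] c'] d']; simpl; intros D D'.
  transitivity ((a * d - b * c) * (a' * d' - b' * c'))%Z; [ring|rewrite D, D'; ring].
Qed.

Lemma quot_mobt g g' z : det1 g -> det1 g' -> inH z -> mobt g z = mobt (quot g g') (mobt g' z).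
Proof.
  intros D D' Hz; pose proof (quot_det g g' D D') as Q.
  destruct g as [[[a b] c] d], g' as [[[a' b'] c'] d']; simpl in *.
  rewrite mob_comp by auto; f_equal.
  - transitivity (a * (a' * d' - b' * c'))%Z; [rewrite D'; ring|ring].
  - transitivity (b * (a' * d' - b' * c'))%Z; [rewrite D'; ring|ring].
  - transitivity (c * (a' * d' - b' * c'))%Z; [rewrite D'; ring|ring].
  - transitivity (d * (a' * d' - b' * c'))%Z; [rewrite D'; ring|ring].
Qed.

Lemma quot_dent g g' z : det1 g -> det1 g' -> inH z -> dent g z = (dent (quot g g') (mobt g' z) * dent g' z)%C.
Proof.
  intros D D' Hz; destruct g as [[[a b] c] d], g' as [[[a' b'] c'] d']; simpl in *.
  rewrite den_comp by auto; f_equal.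
  - transitivity (c * (a' * d' - b' * c'))%Z; [rewrite D'; ring|ring].
  - transitivity (d * (a' * d' - b' * c'))%Z; [rewrite D'; ring|ring].
Qed.

Definition lower_left (g : mat) : Z := let '(_, _, c, _) := g in c.
Definition lower_right (g : mat) : Z := let '(_, _, _, d) := g in d.

Lemma reps_quot k g : det1 g -> exists g', In g' (reps (Z.to_nat (halflev k))) /\ det1 g' /\ (lev k | lower_left (quot g g'))%Z.
Proof.
  destruct (reps_cosets k) as [R1 R2]; destruct g as [[[a b] c] d]; intros D.
  destruct (R2 a b c d D) as [i [Hi K]]; specialize (K i Hi).
  set (g' := @nth (Z * Z * Z * Z) i (reps (Z.to_nat (halflev k))) (0, 0, 0, 0)%Z) in K.
  assert (In1 : In g' (reps (Z.to_nat (halflev k)))) by (apply nth_In, Hi).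
  exists g'; split; auto; split; [apply (R1 g' In1)|].
  destruct g' as [[[a' b'] c'] d']; simpl; apply K; auto.
Qed.

Lemma fk_modular_t k g z : det1 g -> (lev k | lower_left g)%Z -> inH z ->
  fk k (mobt g z) = (chik k (lower_right g) * (dent g z ^ S k * fk k z))%C.
Proof. destruct g as [[[a b] c] d]; apply fk_modular. Qed.

Lemma halflev_pos k : (0 < halflev k)%Z.
Proof. unfold halflev; apply Z.pow_pos_nonneg; [lia|]; unfold levexp; destruct (k mod 4)%nat as [|[|[|]]]; lia. Qed.

Lemma lev_even_odd k g : det1 g -> (halflev k | lower_left g)%Z -> (2 | halflev k)%Z -> Z.odd (lower_right g) = true.
Proof. destruct g as [[[a b] c] d]; simpl; intros D H H2; eapply det_odd; eauto; eapply Z.divide_trans; eauto. Qed.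

Lemma halflev_even k : (2 | halflev k)%Z.
Proof.
  unfold halflev, levexp; pose proof (mod4_lt k); destruct (k mod 4)%nat as [|[|[|[|?]]]]; [| | | |lia];
    [exists 1%Z|exists 8%Z|exists 4%Z|exists 8%Z]; reflexivity.
Qed.

Lemma Cmod_chik_odd k d : Z.odd d = true -> Cmod (chik k d) = 1.
Proof.
  intros H; rewrite chik_odd by auto; unfold sgn4.
  destruct (k mod 4)%nat as [|[|[|]]]; try apply Cmod_1; destruct (d mod 4 =? 1)%Z; rewrite Cmod_R; unfold Rabs; destruct (Rcase_abs _); lra.
Qed.

Lemma fk_cusp_reps k g : (1 <= k)%nat -> In g (reps (Z.to_nat (halflev k))) ->
  exists K mu, 0 <= K /\ 0 < mu /\ forall z, 2 <= Im z -> Cmod (fk k (mobt g z)) <= Cmod (dent g z) ^ S k * (K * exp (- mu * Im z)).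
Proof.
  intros Hk Hg.
  assert (E : exists K mu, 0 <= K /\ 0 < mu /\ forall z, 2 <= Im z ->
    Cmod (Th k 0 0 (beta1 k) (beta2 k) (2 * mobt g z)) <= Cmod (dent g z) ^ S k * (K * exp (- mu * Im z))).
  { apply in_app_iff in Hg; destruct Hg as [Hg|Hg]; apply in_map_iff in Hg; destruct Hg as [j [<- _]].
    - apply (Th_cusp_U k (beta1 k) (beta2 k) j Hk).
    - apply (Th_cusp_S k (beta1 k) (beta2 k) j Hk). }
  destruct E as [K [mu [HK [Hm B]]]].
  pose proof (gam_neq_0 (k mod 4)) as NG; pose proof (proj1 (Cmod_gt_0 _) NG) as PG.
  exists (K / Cmod (G2C (gam (k mod 4)))), mu; split; [apply Rdiv_le_0_compat; auto|]; split; auto; intros z Hz.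
  unfold fk; rewrite Cmod_div by auto; specialize (B z Hz).
  apply Rle_div_l; auto.
  eapply Rle_trans; [apply B|]; right; field; lra.
Qed.

(** Modularity reduces every cusp to a coset representative: automorphy factors multiply, and the
    character has modulus 1 on odd integers. *)
Lemma fk_cusp k g : (1 <= k)%nat -> det1 g -> exists K mu, 0 <= K /\ 0 < mu /\ forall z, 2 <= Im z ->
  Cmod (fk k (mobt g z)) <= Cmod (dent g z) ^ S k * (K * exp (- mu * Im z)).
Proof.
  intros Hk D; destruct (reps_quot k g D) as [g' [Hg' [D' Q]]].
  destruct (fk_cusp_reps k g' Hk Hg') as [K [mu [HK [Hm B]]]]; exists K, mu; split; auto; split; auto; intros z Hz.
  assert (HI : inH z) by (unfold inH; lra).
  rewrite (quot_mobt g g'), (quot_dent g g') by auto.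
  assert (DQ := quot_det g g' D D').
  rewrite fk_modular_t by (auto; apply mobt_inH; auto).
  assert (Od : Z.odd (lower_right (quot g g')) = true).
  { apply (lev_even_odd k); auto using halflev_even.
    eapply Z.divide_trans; [|apply Q]; rewrite lev_half; exists 2%Z; ring. }
  rewrite !Cmod_mult, (Cmod_chik_odd k _ Od), Rmult_1_l, Cmod_pow, Rpow_mult_distr, Rmult_assoc.
  apply Rmult_le_compat_l; [apply pow_le, Cmod_ge_0|auto].
Qed.

Lemma exp_null mu : 0 < mu -> forall eps, 0 < eps -> exists Y, forall y, Y < y -> exp (- mu * y) < eps.
Proof.
  intros Hm eps He; exists (/ (mu * eps)); intros y Hy.
  assert (P : 0 < / (mu * eps)) by (apply Rinv_0_lt_compat, Rmult_lt_0_compat; auto).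
  assert (X : / eps < mu * y).
  { apply Rle_lt_trans with (mu * / (mu * eps)); [right; field; lra|apply Rmult_lt_compat_l; auto]. }
  replace (- mu * y) with (- (mu * y)) by ring; rewrite exp_Ropp, <- (Rinv_inv eps).
  apply Rinv_lt_contravar; [apply Rmult_lt_0_compat; [apply Rinv_0_lt_compat; auto|apply exp_pos]|].
  pose proof (exp_ineq1_le (mu * y)); lra.
Qed.

Lemma pow_exp_null K mu : 0 < mu -> forall eps, 0 < eps -> exists Y, 0 < Y /\ forall y, Y < y -> y ^ K * exp (- mu * y) < eps.
Proof.
  intros Hm eps He; set (nu := mu / (INR K + 1)).
  pose proof (pos_INR K).
  assert (Hn : 0 < nu) by (apply Rdiv_lt_0_compat; lra).
  assert (P : 0 < nu ^ K) by (apply pow_lt; auto).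
  destruct (exp_null nu Hn (eps * nu ^ K)) as [Y HY]; [apply Rmult_lt_0_compat; auto|].
  exists (Rmax Y 1); split; [eapply Rlt_le_trans; [|apply Rmax_r]; lra|]; intros y Hy.
  assert (y1 : Y < y) by (eapply Rle_lt_trans; [apply Rmax_l|apply Hy]).
  assert (y2 : 1 < y) by (eapply Rle_lt_trans; [apply Rmax_r|apply Hy]).
  specialize (HY y y1).
  replace (- mu * y) with (INR K * (- nu * y) + - nu * y) by (unfold nu; field; lra).
  rewrite exp_plus, <- exp_pow_INR, <- Rmult_assoc, <- Rpow_mult_distr.
  apply (Rmult_lt_reg_l (nu ^ K)); auto; rewrite <- Rmult_assoc, <- Rpow_mult_distr, (Rmult_comm _ eps).
  eapply Rle_lt_trans; [|apply HY].
  apply Rle_trans with (1 * exp (- nu * y)); [|lra]; apply Rmult_le_compat_r; [apply Rlt_le, exp_pos|].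
  rewrite <- (pow1 K); apply pow_incr; split.
  - apply Rmult_le_pos; [lra|apply Rmult_le_pos; [lra|apply Rlt_le, exp_pos]].
  - replace (- nu * y) with (- (nu * y)) by ring; rewrite exp_Ropp, <- Rmult_assoc.
    pose proof (exp_ineq1_le (nu * y)); apply Rle_div_l; [apply exp_pos|lra].
Qed.

Lemma fk_cuspform k : (1 <= k)%nat -> cuspform (lev k) (S k) (chik k) (fk k) (coef k).
Proof.
  intros Hk; split; [apply dirichlet_chik|]; split; [apply fk_qexp|]; split.
  - intros a b c d D Hc z Hz; apply fk_modular; auto.
  - intros a b c d D eps He; destruct (fk_cusp k (a, b, c, d) Hk D) as [K [mu [HK [Hm B]]]].
    destruct (exp_null mu Hm (eps / (K + 1))) as [Y HY]; [apply Rdiv_lt_0_compat; lra|].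
    exists (Rmax 2 Y); intros x y Hy.
    assert (y2 : 2 < y) by (eapply Rle_lt_trans; [apply Rmax_l|apply Hy]).
    assert (y1 : Y < y) by (eapply Rle_lt_trans; [apply Rmax_r|apply Hy]).
    assert (HI : inH (x, y)) by (unfold inH; simpl; lra).
    pose proof (dent_neq_0 (a, b, c, d) (x, y) D HI) as N; simpl in N.
    change (Cplus (Cmult (ZtoC c) (x, y)) (ZtoC d)) with (den c d (x, y)).
    specialize (B (x, y) ltac:(simpl; lra)); simpl mobt in B; simpl dent in B; simpl Im in B.
    rewrite Cmod_mult, Cmod_inv, Cmod_pow by (apply Cpow_nz; auto).
    assert (PD : 0 < Cmod (den c d (x, y)) ^ S k) by (apply pow_lt; apply Cmod_gt_0; auto).
    apply Rle_lt_trans with (K * exp (- mu * y)).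
    + apply (Rmult_le_reg_l (Cmod (den c d (x, y)) ^ S k)); auto.
      rewrite <- Rmult_assoc, Rinv_r, Rmult_1_l by lra; auto.
    + specialize (HY y y1); apply Rle_lt_trans with (K * (eps / (K + 1))); [apply Rmult_le_compat_l; lra|].
      apply Rlt_le_trans with ((K + 1) * (eps / (K + 1))); [|right; field; lra].
      apply Rmult_lt_compat_r; [apply Rdiv_lt_0_compat|]; lra.
Qed.

(** * Products with oldforms *)

Lemma scale_inH d z : (0 < d)%Z -> inH z -> inH (ZtoC d * z).
Proof.
  intros Hd Hz; apply IZR_lt in Hd; unfold inH in *; destruct z as [x y]; simpl in *.
  replace (IZR d * y + 0 * x) with (IZR d * y) by ring; apply Rmult_lt_0_compat; auto.
Qed.

Lemma den_scale c e d z : den c e (ZtoC d * z) = den (d * c) e z.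
Proof. unfold den; rewrite ZtoC_mult; ring. Qed.

Lemma mob_scale a b c e d z : (ZtoC d * mob a b (d * c) e z)%C = mob a (d * b) c e (ZtoC d * z).
Proof.
  change (ZtoC d * ((ZtoC a * z + ZtoC b) / den (d * c) e z) = (ZtoC a * (ZtoC d * z) + ZtoC (d * b)) / den c e (ZtoC d * z))%C.
  rewrite den_scale, ZtoC_mult; unfold Cdiv; ring.
Qed.

Definition oldform_of (k : nat) (M d : Z) (chi' : Z -> C) (g : C -> C) (b : nat -> C) : Prop :=
  (0 < d)%Z /\ (forall n, Z.gcd n (lev k) = 1%Z -> chi' n = chik k n) /\ cuspform M (S k) chi' g b.

Lemma oldform_modular k M d chi' g b0 a b c e z : oldform_of k M d chi' g b0 ->
  (a * e - b * c = 1)%Z -> (d * M | c)%Z -> Z.odd e = true -> inH z ->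
  g (ZtoC d * mob a b c e z)%C = (chik k e * (den c e z ^ S k * g (ZtoC d * z)))%C.
Proof.
  intros [Hd [Hc [_ [_ [Hm _]]]]] D [q Hq] He Hz.
  assert (Ec : c = (d * (q * M))%Z) by (rewrite Hq; ring); rewrite Ec in *.
  rewrite mob_scale, Hm; [| |exists q; auto|apply scale_inH; auto].
  - rewrite Hc by (apply gcd_pow2_odd; auto).
    change (Cplus (Cmult (ZtoC (q * M)) (ZtoC d * z)) (ZtoC e)) with (den (q * M) e (ZtoC d * z)); rewrite den_scale; auto.
  - rewrite <- D; ring.
Qed.

(** Hermite decomposition diag(d, 1) gamma = gamma' (h, t; 0, s) with gamma' in SL_2(Z), h = gcd(da,
    c) and hs = d: it reduces the claim to the vanishing of g at the cusp of gamma'. A mere bound is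
    enough because f supplies the decay. *)
Lemma oldform_bound k M d chi' g b0 a b c e : oldform_of k M d chi' g b0 -> (a * e - b * c = 1)%Z ->
  exists Y, 0 < Y /\ forall z, Y < Im z -> Cmod (g (ZtoC d * mob a b c e z)%C) <= Cmod (den c e z) ^ S k.
Proof.
  intros [Hd [_ [_ [_ [_ Hg]]]]] D.
  set (h := Z.gcd (d * a) c).
  assert (Hh : (0 < h)%Z).
  { assert (h <> 0)%Z; [|pose proof (Z.gcd_nonneg (d * a) c); fold h in H0; lia].
    intros E; apply Z.gcd_eq_0 in E; destruct E as [E1 E2]; assert (a = 0)%Z by nia; subst; lia. }
  destruct (Z.gcd_divide_l (d * a) c) as [a' Ha]; destruct (Z.gcd_divide_r (d * a) c) as [c' Hc]; fold h in Ha, Hc.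
  destruct (Z.gcd_bezout (d * a) c h eq_refl) as [v [u Hb]].
  assert (B1 : (a' * v - (- u) * c' = 1)%Z) by
    (clearbody h; apply (Z.mul_reg_r _ _ h); [lia|]; transitivity (v * (a' * h) + u * (c' * h))%Z; [ring|rewrite <- Ha, <- Hc; lia]).
  clearbody h.
  set (s := (a' * e - c' * (d * b))%Z); set (t := (v * (d * b) + u * e)%Z).
  assert (Hs : (h * s = d)%Z).
  { unfold s; transitivity ((a' * h) * e - (c' * h) * d * b)%Z; [ring|]; rewrite <- Ha, <- Hc.
    transitivity (d * (a * e - b * c))%Z; [ring|rewrite D; ring]. }
  assert (Ps : (0 < s)%Z) by nia.
  destruct (Hg a' (- u)%Z c' v B1 1 Rlt_0_1) as [Y0 HY].
  pose proof (IZR_lt _ _ Ps) as Ps'; pose proof (IZR_le 1 h ltac:(lia)) as Ph.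
  pose proof (IZR_le 1 s ltac:(lia)) as Ps1.
  exists (Rmax 1 (Rabs Y0 * IZR s)); split; [eapply Rlt_le_trans; [apply Rlt_0_1|apply Rmax_l]|]; intros z Hz.
  assert (z1 : 1 < Im z) by (eapply Rle_lt_trans; [apply Rmax_l|apply Hz]).
  assert (z2 : Rabs Y0 * IZR s < Im z) by (eapply Rle_lt_trans; [apply Rmax_r|apply Hz]).
  assert (HI : inH z) by (unfold inH; lra).
  set (w := ((ZtoC h * z + ZtoC t) / ZtoC s)%C).
  assert (Ns : ZtoC s <> 0) by (unfold ZtoC; intros E; apply RtoC_inj in E; lra).
  assert (Nd : ZtoC d <> 0) by (unfold ZtoC; intros E; apply RtoC_inj, eq_IZR in E; lia).
  assert (Iw : Im w = IZR h * Im z / IZR s).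
  { unfold w, ZtoC; destruct z as [x y]; simpl; field; lra. }
  assert (Yw : Y0 < Im w).
  { rewrite Iw; apply Rlt_div_r; [lra|]; pose proof (Rle_abs Y0); apply Rle_lt_trans with (Rabs Y0 * IZR s); [apply Rmult_le_compat_r; lra|nra]. }
  assert (N := den_neq_0 c e z HI (det_neq_0 _ _ _ _ D)).
  assert (Ew : den c' v w = (den c e z / ZtoC s)%C).
  { unfold w, den; transitivity ((ZtoC (c' * h) * z + ZtoC (c' * t + v * s)) / ZtoC s)%C.
    - rewrite ZtoC_plus, !ZtoC_mult; field; auto.
    - rewrite <- Hc; replace (c' * t + v * s)%Z with e; auto.
      unfold t, s; transitivity (e * (a' * v - - u * c'))%Z; [rewrite B1; ring|ring]. }
  assert (Em : (ZtoC d * mob a b c e z)%C = mob a' (- u) c' v w).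
  { change (mob a' (- u) c' v w) with ((ZtoC a' * w + ZtoC (- u)) / den c' v w)%C; rewrite Ew; unfold w.
    transitivity ((ZtoC (a' * h) * z + ZtoC (a' * t + - u * s)) / den c e z)%C.
    - rewrite <- Ha; replace (a' * t + - u * s)%Z with (d * b)%Z.
      + change (mob a b c e z) with ((ZtoC a * z + ZtoC b) / den c e z)%C; rewrite !ZtoC_mult; field; auto.
      + unfold t, s; transitivity (d * b * (a' * v - - u * c'))%Z; [rewrite B1; ring|ring].
    - rewrite ZtoC_plus, !ZtoC_mult; field; auto. }
  rewrite Em.
  specialize (HY (Re w) (Im w) Yw).
  assert (Sw : (Re w, Im w) = w) by (destruct w; reflexivity); rewrite Sw in HY.
  change (Cplus (Cmult (ZtoC c') w) (ZtoC v)) with (den c' v w) in HY.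
  assert (Nw : den c' v w <> 0) by (rewrite Ew; intros E; apply N; transitivity (den c e z / ZtoC s * ZtoC s)%C; [field; auto|rewrite E; ring]).
  rewrite Cmod_mult, Cmod_inv, Cmod_pow in HY by (apply Cpow_nz; auto).
  assert (P : 0 < Cmod (den c' v w) ^ S k) by (apply pow_lt, Cmod_gt_0; auto).
  apply Rle_trans with (Cmod (den c' v w) ^ S k).
  - apply (Rmult_le_reg_l (/ Cmod (den c' v w) ^ S k)); [apply Rinv_0_lt_compat; auto|]; rewrite Rinv_l by lra; lra.
  - apply pow_incr; split; [apply Cmod_ge_0|]; rewrite Ew, Cmod_div by auto.
    unfold ZtoC; rewrite Cmod_R, Rabs_pos_eq by lra; apply Rle_div_l; [lra|]; pose proof (Cmod_ge_0 (den c e z)); nra.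
Qed.

Lemma chik_real_odd k d : Z.odd d = true -> exists s, chik k d = RtoC s /\ s * s = 1.
Proof.
  intros H; rewrite chik_odd by auto; unfold sgn4.
  destruct (k mod 4)%nat as [|[|[|]]]; try (exists 1; split; [reflexivity|ring]);
    (destruct (d mod 4 =? 1)%Z; [exists 1|exists (-1)]; split; [reflexivity|ring|reflexivity|ring]).
Qed.

Definition hprod (k : nat) (d : Z) (g : C -> C) (z : C) : C :=
  petersson_integrand (S k) (fk k) (fun z => g (ZtoC d * z)%C) z.

(** The powers of cz + d cancel against the height, and the real nebentypus against itself; only the
    half-level sign of f remains. *)
Lemma hprod_modular k M d chi' g b0 m z : (k mod 4 <> 0)%nat -> oldform_of k M d chi' g b0 ->
  det1 m -> (halflev k | lower_left m)%Z -> (d * M | lower_left m)%Z -> inH z ->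
  hprod k d g (mobt m z) = (RtoC (sgnp (lower_left m / halflev k)) * hprod k d g z)%C.
Proof.
  intros Hk Hg D [q Hq] HM Hz; destruct m as [[[a b] c] e]; simpl in D, Hq, HM |- *.
  assert (Hp := halflev_pos k).
  assert (Od : Z.odd e = true) by (apply (lev_even_odd k (a, b, c, e)); auto using halflev_even; exists q; auto).
  destruct (chik_real_odd k e Od) as [s [Es Hs]].
  assert (Ec : c = (halflev k * q)%Z) by (rewrite Hq; ring).
  assert (Eq : (c / halflev k = q)%Z) by (rewrite Ec, Z.mul_comm; apply Z.div_mul; lia).
  rewrite Eq; unfold hprod, petersson_integrand.
  rewrite (oldform_modular k M d chi' g b0 a b c e z) by auto.
  assert (F := fk_half_level k a b q e z Hk ltac:(rewrite <- Ec; auto) Hz); rewrite <- Ec in F; rewrite F, Es.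
  rewrite (Im_mob a b c e z D Hz).
  assert (N := den_neq_0 c e z Hz (det_neq_0 _ _ _ _ D)); set (w := den c e z) in *.
  assert (Nm : 0 < Cmod w) by (apply Cmod_gt_0; auto).
  unfold Rdiv; rewrite Rpow_mult_distr, RtoC_mult, !Cmult_conj, Cpow_conj.
  assert (R1 : Cconj (RtoC s) = RtoC s) by (apply C_eq; simpl; ring); rewrite R1.
  assert (R2 : (w ^ S k * Cconj w ^ S k * RtoC ((/ (Cmod w * Cmod w)) ^ S k))%C = 1).
  { rewrite <- Cpow_mult_l, <- Cmod2_conj, <- RtoC_pow, <- RtoC_mult, <- Rpow_mult_distr.
    replace (Cmod w ^ 2 * / (Cmod w * Cmod w)) with 1 by (field; lra); rewrite pow1; auto. }
  assert (R3 : (RtoC s * RtoC s)%C = 1) by (rewrite <- RtoC_mult, Hs; auto).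
  set (W := RtoC ((/ (Cmod w * Cmod w)) ^ S k)) in *.
  transitivity ((RtoC s * RtoC s) * (w ^ S k * Cconj w ^ S k * W) * (RtoC (sgnp q) * (fk k z * Cconj (g (ZtoC d * z)%C) * RtoC (Im z ^ S k))))%C;
    [ring|rewrite R2, R3; ring].
Qed.

(** The bounds for both factors carry a power of |cz + d| that the height cancels, leaving a power
    of y, which the exponential decay of f beats. *)
Lemma hprod_cusp k M d chi' g b0 m : (1 <= k)%nat -> oldform_of k M d chi' g b0 -> det1 m ->
  forall eps, 0 < eps -> exists Y, forall x y, Y < y -> Cmod (hprod k d g (mobt m (x, y))) < eps.
Proof.
  intros Hk Hg D eps He; destruct (fk_cusp k m Hk D) as [K [mu [HK [Hm B]]]].
  destruct m as [[[a b] c] e]; simpl in *.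
  destruct (oldform_bound k M d chi' g b0 a b c e Hg D) as [Y1 [_ HY1]].
  destruct (pow_exp_null (S k) mu Hm (eps / (K + 1))) as [Y2 [_ HY2]]; [apply Rdiv_lt_0_compat; lra|].
  exists (Rmax 2 (Rmax Y1 Y2)); intros x y Hy.
  assert (y0 : 2 < y) by (eapply Rle_lt_trans; [apply Rmax_l|apply Hy]).
  assert (y1 : Y1 < y) by (eapply Rle_lt_trans; [eapply Rle_trans; [apply Rmax_l|apply Rmax_r]|apply Hy]).
  assert (y2 : Y2 < y) by (eapply Rle_lt_trans; [eapply Rle_trans; [apply Rmax_r|apply Rmax_r]|apply Hy]).
  assert (HI : inH (x, y)) by (unfold inH; simpl; lra).
  specialize (B (x, y) ltac:(simpl; lra)); specialize (HY1 (x, y) y1); specialize (HY2 y y2).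
  unfold hprod, petersson_integrand; rewrite !Cmod_mult, Cmod_conj, Cmod_R, (Im_mob a b c e _ D HI).
  assert (N := den_neq_0 c e (x, y) HI (det_neq_0 _ _ _ _ D)); set (w := den c e (x, y)) in *.
  assert (Nm : 0 < Cmod w) by (apply Cmod_gt_0; auto).
  change (Im (x, y)) with y in *.
  assert (Pq : 0 < y / (Cmod w * Cmod w)) by (apply Rdiv_lt_0_compat; nra).
  rewrite Rabs_pos_eq by (apply pow_le; lra).
  apply Rle_lt_trans with (Cmod w ^ S k * (K * exp (- mu * y)) * Cmod w ^ S k * (y / (Cmod w * Cmod w)) ^ S k).
  - apply Rmult_le_compat_r; [apply pow_le; lra|]; apply Rmult_le_compat; auto using Cmod_ge_0.
  - replace (Cmod w ^ S k * (K * exp (- mu * y)) * Cmod w ^ S k * (y / (Cmod w * Cmod w)) ^ S k)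
      with (K * (exp (- mu * y) * (Cmod w * Cmod w * (y / (Cmod w * Cmod w))) ^ S k)) by (rewrite !Rpow_mult_distr; ring).
    replace (Cmod w * Cmod w * (y / (Cmod w * Cmod w))) with y by (field; lra).
    rewrite (Rmult_comm (exp _)); apply Rle_lt_trans with (K * (eps / (K + 1))); [apply Rmult_le_compat_l; lra|].
    apply Rlt_le_trans with ((K + 1) * (eps / (K + 1))); [|right; field; lra].
    apply Rmult_lt_compat_r; [apply Rdiv_lt_0_compat|]; lra.
Qed.

Definition ccont2 (F : C -> C) (x y : R) : Prop :=
  continuity_2d_pt (fun u v => Re (F (u, v))) x y /\ continuity_2d_pt (fun u v => Im (F (u, v))) x y.

Lemma ccont2_id x y : ccont2 (fun z => z) x y.
Proof. split; [apply continuity_2d_pt_id1|apply continuity_2d_pt_id2]. Qed.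

Lemma ccont2_const c x y : ccont2 (fun _ => c) x y.
Proof. split; apply continuity_2d_pt_const. Qed.

Lemma ccont2_plus F G x y : ccont2 F x y -> ccont2 G x y -> ccont2 (fun z => F z + G z)%C x y.
Proof. intros [F1 F2] [G1 G2]; split; apply continuity_2d_pt_plus; auto. Qed.

Lemma ccont2_mult F G x y : ccont2 F x y -> ccont2 G x y -> ccont2 (fun z => F z * G z)%C x y.
Proof.
  intros [F1 F2] [G1 G2]; split.
  - apply (continuity_2d_pt_minus (fun u v => Re (F (u, v)) * Re (G (u, v))) (fun u v => Im (F (u, v)) * Im (G (u, v))));
      apply continuity_2d_pt_mult; auto.
  - apply (continuity_2d_pt_plus (fun u v => Re (F (u, v)) * Im (G (u, v))) (fun u v => Im (F (u, v)) * Re (G (u, v))));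
      apply continuity_2d_pt_mult; auto.
Qed.

Lemma ccont2_conj F x y : ccont2 F x y -> ccont2 (fun z => Cconj (F z)) x y.
Proof. intros [F1 F2]; split; [exact F1|apply (continuity_2d_pt_opp (fun u v => Im (F (u, v)))); auto]. Qed.

Lemma ccont2_inv (F : C -> C) x y : F (x, y) <> 0 -> ccont2 F x y -> ccont2 (fun z => / F z)%C x y.
Proof.
  intros N [F1 F2].
  assert (Q : continuity_2d_pt (fun u v => / (Re (F (u, v)) * (Re (F (u, v)) * 1) + Im (F (u, v)) * (Im (F (u, v)) * 1))) x y).
  { apply continuity_2d_pt_inv.
    - apply continuity_2d_pt_plus; apply continuity_2d_pt_mult; auto; apply continuity_2d_pt_mult; auto; apply continuity_2d_pt_const.
    - rewrite !Rmult_1_r, <- Cmod_sqr_eq; apply Rgt_not_eq, Rmult_lt_0_compat; apply Cmod_gt_0, N. }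
  split.
  - apply (continuity_2d_pt_mult (fun u v => Re (F (u, v)))); auto.
  - apply (continuity_2d_pt_mult (fun u v => - Im (F (u, v)))); auto; apply continuity_2d_pt_opp; auto.
Qed.

Lemma ccont2_comp F G x y : ccont2 F (Re (G (x, y))) (Im (G (x, y))) -> ccont2 G x y -> ccont2 (fun z => F (G z)) x y.
Proof.
  intros [F1 F2] [G1 G2]; split.
  - eapply continuity_2d_pt_ext; [|apply (cont2_comp _ _ _ x y F1 G1 G2)]; intros u v; simpl; destruct (G (u, v)); reflexivity.
  - eapply continuity_2d_pt_ext; [|apply (cont2_comp _ _ _ x y F2 G1 G2)]; intros u v; simpl; destruct (G (u, v)); reflexivity.
Qed.

Lemma ccont2_Im_pow F n x y : ccont2 F x y -> ccont2 (fun z => RtoC (Im (F z) ^ n)) x y.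
Proof.
  intros [_ F2]; split; [|apply (continuity_2d_pt_const x y 0)]; simpl.
  induction n as [|n IH]; simpl; [apply continuity_2d_pt_const|apply continuity_2d_pt_mult; auto].
Qed.

Lemma ccont2_mobt m x y : det1 m -> 0 < y -> ccont2 (mobt m) x y.
Proof.
  destruct m as [[[a b] c] e]; intros D Hy.
  assert (HI : inH (x, y)) by (unfold inH; auto).
  apply (ccont2_mult (fun z => ZtoC a * z + ZtoC b)%C (fun z => / den c e z)%C).
  - apply ccont2_plus; [apply ccont2_mult|]; auto using ccont2_const, ccont2_id.
  - apply ccont2_inv; [apply (dent_neq_0 (a, b, c, e)); auto|].
    apply ccont2_plus; [apply ccont2_mult|]; auto using ccont2_const, ccont2_id.
Qed.

Lemma hprod_cont k M d chi' g b0 m x y : oldform_of k M d chi' g b0 -> det1 m -> 0 < y ->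
  ccont2 (fun z => hprod k d g (mobt m z)) x y.
Proof.
  intros [Hd [_ [_ [Hq _]]]] D Hy.
  assert (HI := mobt_inH m (x, y) D Hy).
  assert (Cm := ccont2_mobt m x y D Hy).
  unfold hprod, petersson_integrand; apply ccont2_mult; [apply ccont2_mult|apply ccont2_Im_pow; auto].
  - apply (ccont2_comp (fk k)); auto; apply (qexp_continuous _ _ _ _ (fk_qexp k)), HI.
  - apply ccont2_conj, (ccont2_comp g (fun z => ZtoC d * mobt m z)%C).
    + apply (qexp_continuous _ _ _ _ Hq), (scale_inH d _ Hd HI).
    + apply ccont2_mult; auto using ccont2_const.
Qed.

(** * Orthogonality to oldforms *)

(** Sums over cosets are compared as multisets by an executable search; the lemmas on [lsum]
    transfer a successful run to an identity of sums. *)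
Fixpoint extract (p : mat -> bool) (l : list mat) : option (list mat * mat) :=
  match l with
  | [] => None
  | m :: t => if p m then Some (t, m) else
      match extract p t with Some (t', y) => Some (m :: t', y) | None => None end
  end.

Fixpoint match_lists (r : mat -> mat -> bool) (l l' : list mat) : bool :=
  match l with
  | [] => match l' with [] => true | _ => false end
  | m :: t => match extract (r m) l' with Some (t', _) => match_lists r t t' | None => false end
  end.

(** [n] is fuel: each round removes an entry and a partner of opposite value. *)
Fixpoint cancels (n : nat) (r : mat -> mat -> bool) (l : list mat) : bool :=
  match n, l with
  | _, [] => true
  | S n', m :: t => match extract (r m) t with Some (t', _) => cancels n' r t' | None => false end
  | O, _ => false
  end.

Lemma extract_lsum p l l' y : extract p l = Some (l', y) ->
  p y = true /\ forall v : mat -> C, lsum v l = (v y + lsum v l')%C.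
Proof.
  revert l'; induction l as [|m t IH]; intros l' E; simpl in E; [discriminate|].
  destruct (p m) eqn:P; [injection E as <- <-; auto|].
  destruct (extract p t) as [[t' y']|]; [|discriminate]; injection E as <- <-.
  destruct (IH t' eq_refl) as [H1 H2]; split; auto; intros v; simpl; rewrite H2; ring.
Qed.

Lemma match_lists_lsum r l l' v : (forall m m', r m m' = true -> v m = v m') -> match_lists r l l' = true ->
  lsum v l = lsum v l'.
Proof.
  intros H; revert l'; induction l as [|m t IH]; intros l' E; simpl in E; [destruct l'; [auto|discriminate]|].
  destruct (extract (r m) l') as [[t' y]|] eqn:X; [|discriminate].
  destruct (extract_lsum _ _ _ _ X) as [H1 H2]; rewrite H2; simpl; rewrite (IH t' E), (H m y H1); auto.
Qed.

Lemma cancels_lsum n r l v : (forall m m', r m m' = true -> (v m + v m')%C = 0) -> cancels n r l = true -> lsum v l = 0.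
Proof.
  intros H; revert l; induction n as [|n IH]; intros l E; destruct l as [|m t]; simpl in E; try discriminate; auto.
  destruct (extract (r m) t) as [[t' y]|] eqn:X; [|discriminate].
  destruct (extract_lsum _ _ _ _ X) as [H1 H2]; simpl; rewrite H2, (IH t' E), Cplus_assoc, (H m y H1); ring.
Qed.

Definition mmul (m m' : mat) : mat :=
  let '(a, b, c, d) := m in let '(a', b', c', d') := m' in
  (a * a' + b * c', a * b' + b * d', c * a' + d * c', c * b' + d * d')%Z.

Lemma mobt_mmul m m' z : det1 m -> det1 m' -> inH z -> mobt m (mobt m' z) = mobt (mmul m m') z.
Proof. destruct m as [[[a b] c] d], m' as [[[a' b'] c'] d']; intros; apply mob_comp; auto. Qed.

Definition det1b (m : mat) : bool := let '(a, b, c, d) := m in (a * d - b * c =? 1)%Z.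

Lemma det1b_spec m : det1b m = true -> det1 m.
Proof. destruct m as [[[a b] c] d]; apply Z.eqb_eq. Qed.

Definition same_coset (N : Z) (m m' : mat) : bool :=
  det1b m && det1b m' && (lower_left (quot m m') mod N =? 0)%Z.

Definition opposite_coset (H : Z) (m m' : mat) : bool :=
  det1b m && det1b m' && (lower_left (quot m m') mod H =? 0)%Z && Z.odd (lower_left (quot m m') / H).

Definition odd_coset (H : Z) (m m' : mat) : bool :=
  det1b m && det1b m' && (let '(_, b, c, _) := quot m m' in (c mod H =? 0)%Z && Z.odd b).

Definition mS : mat := (0, -1, 1, 0)%Z.
Definition mT : mat := (1, 1, 0, 1)%Z.
Definition mT2 : mat := (1, 2, 0, 1)%Z.
Definition rmul (m' : mat) (l : list mat) : list mat := map (fun m => mmul m m') l.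
Definition listW (n : nat) : list mat := map (fun j => (1, 0, j, 1)%Z) (zlist n).

(** With U representing Gamma_0(2n) in Gamma_0(2): the sum over U is T-invariant, its transform by S
    is T^2-invariant, the translates of U by 1, S and ST match all coset representatives, and the
    terms of the sum rescaled by 1/2 cancel in pairs. *)
Definition fricke_check (n : nat) : bool :=
  let N := (2 * Z.of_nat n)%Z in let U := listU n in let W := listW n in
  match_lists (same_coset N) (rmul mT U) U &&
  match_lists (same_coset N) (rmul (mmul mS mT2) U) (rmul mS U) &&
  match_lists (same_coset N) (U ++ rmul mS U ++ rmul (mmul mS mT) U) (reps n) &&
  cancels (3 * n) (odd_coset (Z.of_nat n)) (W ++ rmul mT W ++ rmul mS W).

Lemma det1_listU n m : In m (listU n) -> det1 m.
Proof. intros H; apply in_map_iff in H; destruct H as [j [<- _]]; simpl; ring. Qed.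

Lemma det1_listW n m : In m (listW n) -> det1 m.
Proof. intros H; apply in_map_iff in H; destruct H as [j [<- _]]; simpl; ring. Qed.

Lemma det1_reps n m : In m (reps n) -> det1 m.
Proof.
  intros H; apply in_app_iff in H; destruct H as [H|H]; [eapply det1_listU; eauto|].
  apply in_map_iff in H; destruct H as [j [<- _]]; simpl; ring.
Qed.

Lemma lsum_rmul v m' l z : (forall m, In m l -> det1 m) -> det1 m' -> inH z ->
  lsum (fun m => v (mobt m (mobt m' z))) l = lsum (fun m => v (mobt m z)) (rmul m' l) :> C.
Proof.
  intros H D Hz; unfold rmul; rewrite lsum_map; apply lsum_ext_in; intros m Hm; rewrite mobt_mmul; auto.
Qed.

Lemma half_mob a b c e w : (mob a b (2 * c) e (w / 2) = mob a (2 * b) c e w / 2)%C.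
Proof.
  assert (N2 : RtoC 2 <> 0) by (intros X; apply RtoC_inj in X; lra).
  assert (E := mob_scale a b c e 2 (w / 2)%C); change (ZtoC 2) with (RtoC 2) in E.
  replace (2 * (w / 2))%C with w in E by (field; auto).
  rewrite <- E; field; auto.
Qed.

Lemma cont_H_ext F G : cont_H F -> (forall x y, 0 < y -> F x y = G x y) -> cont_H G.
Proof.
  intros HF E x y Hy; apply (continuity_2d_pt_ext_loc F); auto.
  exists (mkposreal y Hy); intros u v _ Hv; simpl in Hv; apply Rabs_def2 in Hv; apply E; lra.
Qed.

Lemma cusp_null_ext F G : cusp_null F -> (forall x y, 0 < y -> F x y = G x y) -> cusp_null G.
Proof.
  intros HF E eps He; destruct (HF eps He) as [Y HY]; exists (Rmax Y 0); intros x y Hy.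
  rewrite <- E; [apply HY|]; (eapply Rle_lt_trans; [|apply Hy]); [apply Rmax_l|apply Rmax_r].
Qed.

(** The comparison is made through [cext], which evaluates its argument at positive heights only. *)
Lemma intF_R_ext_pos F G : cont_H F -> cusp_null F -> (forall x y, 0 < y -> F x y = G x y) -> intF_R G = intF_R F.
Proof.
  intros C1 C2 E.
  rewrite !intF_R_cext by eauto using cont_H_ext, cusp_null_ext.
  unfold intM; apply RInt_ext_all; intros x; apply RInt_ext_all; intros t.
  unfold cext; destruct (Rlt_dec 0 t) as [P|]; auto; apply Rinv_0_lt_compat in P; rewrite !E; auto.
Qed.

Lemma intF_R_zero G : (forall x y, 0 < y -> G x y = 0) -> intF_R G = 0.
Proof.
  intros E.
  assert (C1 : cont_H (fun _ _ => 0)) by (intros x y _; apply continuity_2d_pt_const).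
  assert (C2 : cusp_null (fun _ _ => 0)) by (intros eps He; exists 0; intros; rewrite Rabs_R0; auto).
  rewrite (intF_R_ext_pos (fun _ _ => 0)) by (auto; intros; rewrite E; auto).
  rewrite intF_R_cext by auto; unfold intM.
  rewrite (RInt_ext_all _ (fun _ => 0)); [rewrite (RInt_const (V := R_CompleteNormedModule)); change scal with Rmult; simpl; lra|].
  intros x; rewrite (RInt_ext_all _ (fun _ => 0)); [rewrite (RInt_const (V := R_CompleteNormedModule)); change scal with Rmult; simpl; lra|].
  intros t; unfold cext; destruct (Rlt_dec 0 t); ring.
Qed.

(** * The Fricke argument for an abstract product h of level N = 2n *)

Section Fricke.
Context (n : nat) (h : C -> C) (pr : C -> R).
Context (chk : fricke_check n = true) (Hn : (0 < n)%nat) (n2 : Nat.even n = true) (prs : pr = Re \/ pr = Im).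
Context (inv : forall m z, det1 m -> (2 * Z.of_nat n | lower_left m)%Z -> inH z -> h (mobt m z) = h z).
Context (alt : forall z, inH z -> h (z + RtoC (/ 2))%C = (- h z)%C).
Context (cnt : forall m x y, det1 m -> 0 < y -> ccont2 (fun z => h (mobt m z)) x y).
Context (csp : forall m, det1 m -> forall eps, 0 < eps -> exists Y, forall x y, Y < y -> Cmod (h (mobt m (x, y))) < eps).

Let hsum (L : list mat) (z : C) : C := lsum (fun m => h (mobt m z)) L.

Lemma pr_plus a b : pr (a + b)%C = pr a + pr b.
Proof. destruct prs as [-> | ->]; reflexivity. Qed.

Lemma hsum_cont L : (forall m, In m L -> det1 m) -> cont_H (fun x y => pr (hsum L (x, y))).
Proof.
  intros HL x y Hy.
  assert (K : ccont2 (hsum L) x y).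
  { unfold hsum; induction L as [|m t IH]; [apply (ccont2_const 0)|].
    apply (ccont2_plus (fun z => h (mobt m z)) (fun z => lsum (fun m => h (mobt m z)) t)); [apply cnt; auto using in_eq|].
    apply IH; intros; apply HL; right; auto. }
  destruct prs as [-> | ->]; apply K.
Qed.

Lemma hsum_cusp L m' : (forall m, In m L -> det1 m) -> det1 m' -> cusp_null (fun x y => pr (hsum L (mobt m' (x, y)))).
Proof.
  intros HL D.
  assert (K : forall eps, 0 < eps -> exists Y, 0 < Y /\ forall x y, Y < y -> Cmod (hsum L (mobt m' (x, y))) < eps).
  { unfold hsum; induction L as [|m t IH]; intros eps He.
    - exists 1; split; [lra|]; intros; simpl; rewrite Cmod_0; auto.
    - destruct (IH ltac:(intros; apply HL; right; auto) (eps / 2) ltac:(lra)) as [Y1 [P1 H1]].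
      assert (Dm : det1 (mmul m m')).
      { assert (Dm : det1 m) by (apply HL, in_eq); clear - Dm D; destruct m as [[[a b] c] d], m' as [[[a' b'] c'] d']; simpl in *.
        transitivity ((a * d - b * c) * (a' * d' - b' * c'))%Z; [ring|rewrite Dm, D; ring]. }
      destruct (csp _ Dm (eps / 2) ltac:(lra)) as [Y2 H2].
      exists (Rmax Y1 Y2); split; [eapply Rlt_le_trans; [apply P1|apply Rmax_l]|]; intros x y Hy; simpl.
      assert (y1 : Y1 < y) by (eapply Rle_lt_trans; [apply Rmax_l|apply Hy]).
      assert (y2 : Y2 < y) by (eapply Rle_lt_trans; [apply Rmax_r|apply Hy]).
      eapply Rle_lt_trans; [apply Cmod_triangle|].
      rewrite mobt_mmul by (auto using in_eq; unfold inH; simpl; lra).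
      specialize (H1 x y y1); specialize (H2 x y y2); lra. }
  intros eps He; destruct (K eps He) as [Y [_ HY]]; exists Y; intros x y Hy.
  eapply Rle_lt_trans; [|apply (HY x y Hy)]; destruct prs as [-> | ->]; [apply re_le_Cmod|apply im_le_Cmod].
Qed.

Lemma hsum_match L L' z : inH z -> match_lists (same_coset (2 * Z.of_nat n)) L L' = true -> hsum L z = hsum L' z.
Proof.
  intros Hz; apply match_lists_lsum; intros m m' E; unfold same_coset in E.
  repeat (apply andb_true_iff in E; destruct E as [E ?]).
  apply Z.eqb_eq, Z.mod_divide in H; [|lia].
  rewrite (quot_mobt m m') by auto using det1b_spec.
  apply inv; auto using quot_det, det1b_spec, mobt_inH.
Qed.

(** The function h(z/2) changes sign under T. The quotient matrix is (a, b - a; c, e - c) T with b -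
    a even, and conjugation by diag(2, 1) carries the first factor to (a, (b - a)/2; 2c, e - c),
    which lies in Gamma_0(2n) because n divides c. *)
Lemma odd_coset_cancel m m' z : inH z -> odd_coset (Z.of_nat n) m m' = true -> (h (mobt m z / 2) + h (mobt m' z / 2))%C = 0.
Proof.
  intros Hz E; unfold odd_coset in E; repeat (apply andb_true_iff in E; destruct E as [E ?]).
  apply det1b_spec in E; apply det1b_spec in H0.
  rewrite (quot_mobt m m') by auto.
  pose proof (quot_det m m' E H0) as D; pose proof (mobt_inH m' z H0 Hz) as Hw.
  set (w := mobt m' z) in *; destruct (quot m m') as [[[a b] c] e]; simpl in D.
  apply andb_true_iff in H; destruct H as [Hc Hb].
  apply Z.eqb_eq, Z.mod_divide in Hc; [|lia].
  apply Nat.even_spec in n2; destruct n2 as [n' En].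
  destruct Hc as [c' Hc].
  apply Z.odd_spec in Hb; destruct Hb as [b' Hb].
  (* As n is even, so is c, and the determinant makes a odd; b is odd as well. *)
  assert (Oa : exists q, (b - a = 2 * q)%Z).
  { destruct (Z.Even_or_Odd a) as [[q Hq]|[q Hq]]; [|exists (b' - q)%Z; lia].
    exfalso; rewrite En, Nat2Z.inj_mul in Hc; rewrite Hq, Hc in D.
    assert (2 * (q * e - b * (c' * Z.of_nat n')) = 1)%Z by (rewrite <- D; ring); lia. }
  destruct Oa as [q Hq].
  assert (N2 : RtoC 2 <> 0) by (intros X; apply RtoC_inj in X; lra).
  assert (HT : inH (w + ZtoC 1)) by (apply Im_shift; auto).
  assert (E1 : mobt (a, b, c, e) w = mob a (2 * q) c (e - c) (w + ZtoC 1)%C).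
  { rewrite <- mob_T, mob_comp; auto; [unfold mobt; f_equal; lia|]; rewrite <- Hq; lia. }
  rewrite E1, <- half_mob.
  assert (E2 : h (mobt (a, q, 2 * c, e - c)%Z ((w + ZtoC 1) / 2)%C) = h ((w + ZtoC 1) / 2)%C).
  { apply inv.
    - unfold det1; transitivity (a * (e - c) - 2 * q * c)%Z; [ring|rewrite <- Hq; lia].
    - exists c'; unfold lower_left; rewrite Hc; ring.
    - unfold inH in *; destruct w as [x y]; simpl in *; field_simplify; lra. }
  unfold mobt in E2; rewrite E2.
  replace ((w + ZtoC 1) / 2)%C with (w / 2 + RtoC (/ 2))%C by (destruct w; apply C_eq; simpl; field).
  rewrite alt; [ring|]; unfold inH in *; destruct w as [x y]; simpl in *; field_simplify; lra.
Qed.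

Lemma hsum_half z : hsum (listU n) (z / 2)%C = lsum (fun m => h (mobt m z / 2)%C) (listW n).
Proof.
  unfold hsum, listU, listW; rewrite !lsum_map; apply lsum_ext_in; intros j _; unfold mobt; rewrite half_mob; reflexivity.
Qed.

Lemma hsum_vanishing z : inH z ->
  (hsum (listU n) (z / 2) + hsum (listU n) (mobt mT z / 2) + hsum (listU n) (mobt mS z / 2))%C = 0.
Proof.
  intros Hz; apply andb_true_iff in chk; destruct chk as [_ V].
  rewrite !hsum_half, <- (cancels_lsum _ _ _ (fun m => h (mobt m z / 2)%C) (fun m m' => odd_coset_cancel m m' z Hz) V).
  assert (DW := det1_listW n); assert (dS : det1 mS) by reflexivity; assert (dT : det1 mT) by reflexivity.
  rewrite !lsum_app, <- (lsum_rmul (fun w => h (w / 2)%C) mT), <- (lsum_rmul (fun w => h (w / 2)%C) mS) by auto; ring.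
Qed.

Lemma mobt_mS x y : mobt mS (x, y) = (- x / (x * x + y * y), y / (x * x + y * y)) \/ y <= 0.
Proof.
  destruct (Rle_or_lt y 0) as [|Hy]; auto; left; unfold mobt, mS, mob, ZtoC; apply C_eq; simpl; field; nra.
Qed.

Lemma petersson_fricke : intF_R (fun x y => pr (hsum (reps n) (x, y))) = 0.
Proof.
  set (F := fun x y => pr (hsum (listU n) (x, y))).
  pose proof chk as K; unfold fricke_check in K; repeat (apply andb_true_iff in K; destruct K as [K ?]).
  assert (DU := det1_listU n).
  assert (IV : forall x y, 0 < y -> inversion_of F x y = pr (hsum (listU n) (mobt mS (x, y)))).
  { intros x y Hy; unfold inversion_of, F; destruct (mobt_mS x y) as [-> |]; [reflexivity|lra]. }
  assert (Tx : forall x y, mobt mT (x, y) = (x + 1, y)).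
  { intros x y; unfold mobt, mT; rewrite mob_T; apply C_eq; simpl; ring. }
  assert (T2x : forall x y, mobt mT2 (x, y) = (x + 2, y)).
  { intros x y; unfold mobt, mT2; rewrite mob_T; apply C_eq; simpl; ring. }
  assert (HI : forall x y, 0 < y -> inH (x, y)) by (intros; unfold inH; auto).
  assert (dS : det1 mS) by reflexivity; assert (dT : det1 mT) by reflexivity; assert (dT2 : det1 mT2) by reflexivity.
  assert (RM : forall m' z, det1 m' -> inH z -> hsum (listU n) (mobt m' z) = hsum (rmul m' (listU n)) z).
  { intros m' z D Hz; apply (lsum_rmul h m'); auto. }
  assert (CI : forall L, (forall m, In m L -> det1 m) -> cusp_null (fun x y => pr (hsum L (x, y)))).
  { intros L HL; apply (cusp_null_ext (fun x y => pr (hsum L (mobt (1, 0, 0, 1)%Z (x, y))))); [apply hsum_cusp; auto; reflexivity|].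
    intros x y Hy; do 2 f_equal; unfold mobt; rewrite mob_T; apply C_eq; simpl; ring. }
  transitivity (intF_R (fun x y => F x y + inversion_of F x y + inversion_of F (x + 1) y)).
  2:{ apply fricke_integral.
    + apply hsum_cont; auto.
    + apply CI; auto.
    + apply (cusp_null_ext (fun x y => pr (hsum (listU n) (mobt mS (x, y))))); [apply hsum_cusp; auto|].
      intros x y Hy; rewrite IV; auto.
    + intros x y Hy; unfold F; rewrite <- Tx, RM by auto; f_equal; apply hsum_match; auto.
    + intros x y Hy; rewrite !IV by auto; rewrite <- T2x, mobt_mmul, !RM by auto; f_equal; apply hsum_match; auto.
    + intros x y Hy; rewrite IV by lra; unfold F.
      pose proof (hsum_vanishing (x, y) (HI x y Hy)) as Vn; apply (f_equal pr) in Vn; rewrite !pr_plus in Vn.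
      assert (pr 0 = 0) as P0 by (destruct prs as [-> | ->]; reflexivity); rewrite P0, Tx in Vn; rewrite <- Vn.
      assert (Hf : forall u v : R, ((u, v) / 2)%C = (u / 2, v / 2)) by (intros u v; apply C_eq; simpl; field).
      rewrite !Hf; do 3 f_equal.
      destruct (mobt_mS (2 * x) (2 * y)) as [-> |]; [|lra]; destruct (mobt_mS x y) as [-> |]; [|lra].
      rewrite Hf; f_equal; field; split; nra. }
  symmetry; apply (intF_R_ext_pos (fun x y => pr (hsum (reps n) (x, y)))); [apply hsum_cont|apply CI|]; try apply det1_reps.
  intros x y Hy; rewrite !IV by auto; unfold F; rewrite <- Tx, mobt_mmul, !RM by auto; rewrite <- !pr_plus; f_equal.
  rewrite <- (hsum_match _ _ (x, y) (HI x y Hy) H0); unfold hsum; rewrite !lsum_app; ring.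
Qed.

End Fricke.

(** * The newspace condition for the theta forms *)

Lemma psi_even_norm k p : (k mod 4 <> 0)%nat -> Z.even (Gnorm p) = true -> Phi k p = 0.
Proof.
  intros Hk He; unfold Phi; replace (psi (k mod 4) p) with (0, 0)%Z; [change (G2C (0, 0)%Z) with (RtoC 0); ring|].
  destruct p as [x y]; unfold Gnorm in He; cbn [fst snd] in He; rewrite Z.even_add, !Z.even_mul, <- !Z.negb_odd in He.
  unfold psi; pose proof (mod4_lt k); destruct (k mod 4)%nat as [|[|[|[|?]]]]; [lia| | | |lia];
    destruct (Z.odd x), (Z.odd y); simpl in He; auto; discriminate.
Qed.

(** For k not divisible by 4 the character vanishes on elements of even norm, so only odd powers of
    q occur. *)
Lemma fk_half_shift k z : (k mod 4 <> 0)%nat -> inH z -> fk k (z + RtoC (/ 2))%C = (- fk k z)%C.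
Proof.
  intros Hk Hz.
  assert (Hz' : inH (z + RtoC (/ 2))) by (unfold inH in *; destruct z; simpl in *; lra).
  replace (- fk k z)%C with (- (1) * fk k z)%C by ring.
  apply (usum_unique _ _ _ (fk_usum k _ Hz')).
  eapply usum_ext; [|apply (usum_scal (- (1))%C _ _ (fk_usum k z Hz))]; intros p; cbv beta.
  destruct (Z.even (Gnorm p)) eqn:E; [rewrite (psi_even_norm k p Hk E); ring|].
  rewrite <- Z.negb_odd in E; apply negb_false_iff in E.
  assert (Q : qN (z + RtoC (/ 2)) p = (- (1) * qN z p)%C).
  { assert (X := ex1_half_odd (-1) (Gnorm p) E); unfold sgnp in X; simpl Z.even in X; cbv iota in X.
    replace (- (1))%C with (RtoC (-1)) by (apply C_eq; simpl; ring); rewrite <- X.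
    unfold qN, ex1; rewrite <- Cexp_plus; f_equal; destruct z as [x y]; apply C_eq; simpl; field. }
  rewrite Q; ring.
Qed.

Lemma cuspform_period M k chi g b n z : cuspform M k chi g b -> inH z -> g (z + ZtoC n)%C = g z.
Proof.
  intros [[_ [_ [_ [C1 _]]]] [_ [Hm _]]] Hz; rewrite <- mob_T, Hm; [|ring|apply Z.divide_0_r|auto].
  rewrite C1; replace (ZtoC 0 * z + ZtoC 1)%C with (RtoC 1) by (unfold ZtoC; ring); rewrite Cpow_1_l; ring.
Qed.

Lemma hprod_half_shift k M d chi' g b z : (k mod 4 <> 0)%nat -> oldform_of k M d chi' g b -> (2 | d)%Z -> inH z ->
  hprod k d g (z + RtoC (/ 2))%C = (- hprod k d g z)%C.
Proof.
  intros Hk [Hd [_ Hg]] [e He] Hz; unfold hprod, petersson_integrand; rewrite fk_half_shift by auto.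
  replace (ZtoC d * (z + RtoC (/ 2)))%C with (ZtoC d * z + ZtoC e)%C.
  - rewrite (cuspform_period M (S k) chi' g b) by (auto; apply scale_inH; auto).
    replace (Im (z + RtoC (/ 2))) with (Im z) by (destruct z; simpl; ring); ring.
  - rewrite He, ZtoC_mult; unfold ZtoC; destruct z; apply C_eq; simpl; field.
Qed.

Lemma halflev_cases k : (k mod 4 <> 0)%nat -> halflev k = 8%Z \/ halflev k = 16%Z.
Proof.
  intros Hk; unfold halflev, levexp; pose proof (mod4_lt k); destruct (k mod 4)%nat as [|[|[|[|?]]]]; [lia| | | |lia]; simpl; auto.
Qed.

Lemma fricke_check_halflev k : (k mod 4 <> 0)%nat -> fricke_check (Z.to_nat (halflev k)) = true.
Proof. intros Hk; destruct (halflev_cases k Hk) as [-> | ->]; vm_compute; reflexivity. Qed.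

(** The fuel 48 is the number 3 * 16 of cosets at level 32, the larger of the two levels. *)
Lemma reps_cancel k : (k mod 4 <> 0)%nat ->
  cancels 48 (opposite_coset (halflev k)) (reps (Z.to_nat (halflev k))) = true.
Proof. intros Hk; destruct (halflev_cases k Hk) as [-> | ->]; vm_compute; reflexivity. Qed.

Lemma odd_divides_lev k q : (0 < q)%Z -> (q | lev k)%Z -> Z.odd q = true -> q = 1%Z.
Proof.
  intros Hq D O; apply Z.divide_gcd_iff in D; [|lia]; unfold lev in D; rewrite gcd_pow2_odd in D; auto.
Qed.

(** The distinction is on the parity of the cofactor q = N/(dM): an odd divisor of N is 1, so an odd
    q means dM = N, and then M < N rules out an odd d. *)
Lemma petersson_sum_zero k M d chi' g b pr : (1 <= k)%nat -> (k mod 4 <> 0)%nat -> (0 < M)%Z -> (M < lev k)%Z ->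
  (d * M | lev k)%Z -> oldform_of k M d chi' g b -> pr = Re \/ pr = Im ->
  intF_R (fun x y => pr (lsum (fun m => hprod k d g (mobt m (x, y))) (reps (Z.to_nat (halflev k))))) = 0.
Proof.
  intros Hk1 Hk HM HN [q Hq] Ho Hpr.
  assert (Hd : (0 < d)%Z) by apply Ho.
  pose proof (halflev_pos k) as Hp; pose proof (lev_half k) as HL.
  assert (Pq : (0 < q)%Z) by nia.
  destruct (Z.Even_or_Odd q) as [[q' Eq]|Oq].
  - assert (DH : (d * M | halflev k)%Z) by (exists q'; lia).
    apply intF_R_zero; intros x y Hy.
    rewrite (cancels_lsum 48 (opposite_coset (halflev k))); [destruct Hpr as [-> | ->]; reflexivity| |apply reps_cancel; auto].
    intros m m' E; unfold opposite_coset in E; repeat (apply andb_true_iff in E; destruct E as [E ?]).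
    apply det1b_spec in E; apply det1b_spec in H1; apply Z.eqb_eq, Z.mod_divide in H0; [|lia].
    assert (Hz : inH (x, y)) by (unfold inH; auto).
    rewrite (quot_mobt m m'), (hprod_modular k M d chi' g b); auto using quot_det, mobt_inH.
    + unfold sgnp; rewrite <- Z.negb_odd, H; simpl negb; cbv iota.
      replace (RtoC (-1)) with (- (1))%C by (apply C_eq; simpl; ring); ring.
    + eapply Z.divide_trans; eauto.
  - assert (Q1 : q = 1%Z) by (apply (odd_divides_lev k); auto; [exists (d * M)%Z; lia|apply Z.odd_spec; auto]).
    assert (D2 : (2 | d)%Z).
    { destruct (Z.Even_or_Odd d) as [[e He]|Od]; [exists e; lia|exfalso].
      assert (d = 1)%Z by (apply (odd_divides_lev k); auto; [exists M; lia|apply Z.odd_spec; auto]); nia. }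
    apply (petersson_fricke (Z.to_nat (halflev k)) (hprod k d g) pr); auto using fricke_check_halflev.
    + lia.
    + destruct (halflev_cases k Hk) as [-> | ->]; reflexivity.
    + intros m z D HD Hz; rewrite Z2Nat.id, <- HL in HD by lia.
      rewrite (hprod_modular k M d chi' g b); auto.
      * destruct HD as [r Hr]; replace (lower_left m / halflev k)%Z with (2 * r)%Z.
        -- unfold sgnp; rewrite Z.even_mul; simpl; ring.
        -- rewrite Hr, HL; replace (r * (2 * halflev k))%Z with ((2 * r) * halflev k)%Z by ring; rewrite Z.div_mul; lia.
      * eapply Z.divide_trans; [|apply HD]; exists 2%Z; lia.
      * eapply Z.divide_trans; [|apply HD]; exists 1%Z; lia.
    + intros z Hz; apply (hprod_half_shift k M d chi' g b); auto.
    + intros m x y D Hy; apply (hprod_cont k M d chi' g b); auto.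
    + intros m D; apply (hprod_cusp k M d chi' g b); auto.
Qed.

Lemma fk_newspace k : (1 <= k)%nat -> in_newspace (lev k) (S k) (chik k) (fk k).
Proof.
  intros Hk M d chi' g b HM HN Hd HD Dir Hc Hg.
  destruct (Nat.eq_dec (k mod 4) 0) as [E|E].
  - exfalso; destruct Dir as [_ [Per [_ [C1 _]]]].
    (* Here M is 1 or 2, and periodicity modulo M forces chi'(3) = chi'(1) = 1, while the nebentypus
       is -1 at 3. *)
    assert (L4 : lev k = 4%Z) by (unfold lev, levexp; rewrite E; reflexivity); rewrite L4 in *.
    assert (X : chi' 3%Z = RtoC (-1)) by (rewrite Hc by reflexivity; rewrite chik_odd, E by reflexivity; reflexivity).
    assert (M12 : (M = 1 \/ M = 2)%Z).
    { assert (M <> 3)%Z; [|lia]; intros ->; destruct HD as [q Hq]; lia. }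
    assert (Y : chi' 3%Z = RtoC 1).
    { destruct M12 as [-> | ->].
      - change 3%Z with (1 + 1 + 1)%Z; rewrite !Per; auto.
      - change 3%Z with (1 + 2)%Z; rewrite Per; auto. }
    rewrite Y in X; apply RtoC_inj in X; lra.
  - assert (Ho : oldform_of k M d chi' g b) by (split; auto).
    exists (reps (Z.to_nat (halflev k))); split; [apply reps_cosets|]; cbv zeta.
    assert (G : forall x y L, fold_right Cplus (RtoC 0) (map (fun m => let '(a, b, c, e) := m in
        petersson_integrand (S k) (fk k) (fun z => g (Cmult (ZtoC d) z)) (mob a b c e (x, y))) L)
      = lsum (fun m => hprod k d g (mobt m (x, y))) L).
    { intros x y L; induction L as [|[[[a b'] c] e] t IH]; simpl; [reflexivity|]; rewrite IH; reflexivity. }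
    split.
    + eapply eq_trans; [|apply (petersson_sum_zero k M d chi' g b Re); auto].
      f_equal; extensionality x; extensionality y; rewrite G; reflexivity.
    + eapply eq_trans; [|apply (petersson_sum_zero k M d chi' g b Im); auto].
      f_equal; extensionality x; extensionality y; rewrite G; reflexivity.
Qed.

Theorem theorem4p1 (k : nat) (hk : (2 <= k)%nat) :
  exists (f : C -> C) (g : nat -> C),
    newform (level_k k) k (char_k k) f g /\ has_CM g /\
    forall p : nat, prime (Z.of_nat p) -> p <> 2%nat ->
      ((p mod 4 = 1)%nat ->
         forall x y : Z, Z.of_nat p = (x * x + y * y)%Z -> Z.odd x = true ->
           g p = Cmult
                   (if Z.even (((x + y - 1) * (Z.of_nat k - 1)) / 2) then RtoC 1 else RtoC (-1))
                   (Cplus (Cpow (IZR x, IZR y) (k - 1)) (Cpow (IZR x, - IZR y) (k - 1)))) /\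
      ((p mod 4 = 3)%nat -> g p = RtoC 0).
Proof.
  destruct k as [|k]; [lia|]; assert (Hk : (1 <= k)%nat) by lia.
  exists (fk k), (coef k); split; [|split; [apply coef_has_CM|]].
  - rewrite level_lev; split; [apply fk_cuspform; auto|]; split; [apply coef_1|]; split; [apply coef_hecke|apply fk_newspace; auto].
  - intros p Hp H2; split.
    + intros H1 x y E O; rewrite (coef_formula k p x y) by auto.
      replace (S k - 1)%nat with k by lia; reflexivity.
    + intros H3; apply coef_p_3_mod_4; auto.
Qed.
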